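(* Let $X_i\sim\mu_i\in\mathcal P(\mathbb R^d)$, $i=1,\dots,n$, be centered, and let $\lambda_i>0$ with $\sum_{i=1}^n\lambda_i=1$. Then $$\frac12\inf_{\Pi(X_1,\dots,X_n)}\mathbb E\Big[\sum_{1\le i<j\le n}\lambda_i\lambda_j|X_i-X_j|^2\Big]\le\sum_{i=1}^n\lambda_i(1-\lambda_i)D(\mu_i\|\gamma),$$ where the infimum is over all couplings, i.e. joint laws of $(X_1,\dots,X_n)$ on $(\mathbb R^d)^n$ with $X_i\sim\mu_i$ for each $i$. Equality holds if and only if: (i) when $n=2$, $\mu_1=N(0,C)$ and $\mu_2=N(0,C^{-1})$ for some positive definite $C$; (ii) when $n\ge3$, $\mu_i=N(0,\mathrm{id})$ for every $i$.
   Context: $\mathcal P(\mathbb R^d)$ denotes Borel probability measures on $\mathbb R^d$ absolutely continuous w.r.t. Lebesgue measure with finite second moments. $\gamma=N(0,\mathrm{id})$ is the standard Gaussian on $\mathbb R^d$ and $D(\mu\|\gamma)$ is relative entropy. Centered means mean zero. *)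

(* Defs.v *)
From HB Require Import structures.
From mathcomp Require Import all_boot all_order all_algebra.
From mathcomp Require Import all_classical all_reals all_analysis.
Set Implicit Arguments. Unset Strict Implicit. Unset Printing Implicit Defensive.
Import Order.TTheory GRing.Theory Num.Theory.
Import numFieldNormedType.Exports.
Local Open Scope classical_set_scope.
Local Open Scope ring_scope.

(* R^d is modelled as d.-tuple R, with the product (= Borel) sigma-algebra
   generated by the coordinate projections (mathcomp-analysis instance). *)

Section Defs.
Variable R : realType.

(* Lebesgue integral on R^d, as the iterated integral of the Lebesgue measure
   on R (Tonelli); for nonnegative measurable integrands this is the integral
   against the d-dimensional Lebesgue measure. *)
Fixpoint leb_int (d : nat) : (d.-tuple R -> \bar R) -> \bar R :=
  if d is d'.+1 return (d.-tuple R -> \bar R) -> \bar R then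
    fun f => (\int[@lebesgue_measure R]_x leb_int (fun t => f (cons_tuple x t)))%E
  else fun f => f [tuple].

Definition leb_measure (d : nat) (A : set (d.-tuple R)) : \bar R :=
  leb_int (fun x => (\1_A x)%:E).

Definition sqnorm (d : nat) (x : d.-tuple R) : R := \sum_(k < d) (tnth x k) ^+ 2.
Definition sqdist (d : nat) (x y : d.-tuple R) : R :=
  \sum_(k < d) (tnth x k - tnth y k) ^+ 2.

Definition abs_cont_leb (d : nat) (mu : probability (d.-tuple R) R) : Prop :=
  forall A : set (d.-tuple R), measurable A -> leb_measure A = 0%E -> mu A = 0%E.

Definition finite_second_moment (d : nat) (mu : probability (d.-tuple R) R) :=
  (\int[mu]_x (sqnorm x)%:E < +oo)%E.

Definition centered (d : nat) (mu : probability (d.-tuple R) R) : Prop :=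
  forall k : 'I_d, (\int[mu]_x (tnth x k)%:E = 0)%E.

Definition in_P (d : nat) (mu : probability (d.-tuple R) R) : Prop :=
  abs_cont_leb mu /\ finite_second_moment mu.

Definition is_density (d : nat) (mu : probability (d.-tuple R) R)
  (f : d.-tuple R -> R) : Prop :=
  measurable_fun setT f /\ (forall x, 0 <= f x) /\
  forall A : set (d.-tuple R), measurable A ->
    mu A = leb_int (fun x => (\1_A x * f x)%:E).

Definition rv (d : nat) (x : d.-tuple R) : 'rV[R]_d := \row_k tnth x k.

Definition posdef (d : nat) (C : 'M[R]_d) : Prop :=
  C^T = C /\ forall v : 'rV[R]_d, v != 0 -> 0 < (v *m C *m v^T) ord0 ord0.

Definition gauss_density (d : nat) (C : 'M[R]_d) (x : d.-tuple R) : R :=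
  (Num.sqrt ((2 * pi) ^+ d * \det C))^-1 *
  expR (- (rv x *m invmx C *m (rv x)^T) ord0 ord0 / 2).

Definition is_gaussian (d : nat) (mu : probability (d.-tuple R) R)
  (C : 'M[R]_d) : Prop :=
  forall A : set (d.-tuple R), measurable A ->
    mu A = leb_int (fun x => (\1_A x * gauss_density C x)%:E).

Definition relent (d : nat) (mu : probability (d.-tuple R) R) : \bar R :=
  match pselect (exists f, is_density mu f) with
  | left H => let f := projT1 (cid H) in
      leb_int (fun x => (f x * ln (f x / gauss_density 1%:M x))%:E)
  | right _ => +oo%E
  end.

Definition is_coupling (n d : nat) (mu : 'I_n -> probability (d.-tuple R) R)
  (P : probability (n.-tuple (d.-tuple R)) R) : Prop :=
  forall (i : 'I_n) (A : set (d.-tuple R)), measurable A ->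
    P ((fun x => tnth x i) @^-1` A) = mu i A.

Definition mm_cost (n d : nat) (lam : 'I_n -> R) (x : n.-tuple (d.-tuple R)) : R :=
  \sum_(i < n) \sum_(j < n | (i < j)%N) lam i * lam j * sqdist (tnth x i) (tnth x j).

Definition opt_cost (n d : nat) (mu : 'I_n -> probability (d.-tuple R) R)
  (lam : 'I_n -> R) : \bar R :=
  ereal_inf [set c | exists P : probability (n.-tuple (d.-tuple R)) R,
    is_coupling mu P /\ c = (\int[P]_x (mm_cost lam x)%:E)%E].

End Defs.

(* Main.v *)
(* Given two densities f, g on R^d with f centered, let X have density f and let
   the unit vector e maximize E|<X,e>|. First-order optimality makes the
   component of X orthogonal to e centered conditionally on the sign of <X,e>.
   Cut the space of g by a hyperplane orthogonal to e into two pieces having the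
   masses of the two half-spaces of f; on each piece transport the orthogonal
   components by induction on d, then the e-components monotonically along the
   fibers. The resulting map T and the map Z whose e-component is the geometric
   mean of those of x and T x satisfy E|Z|^2 = E<X,TX>. With J = f/(g o T), the
   arithmetic-geometric inequality bounds the Jacobian of (1-w)x + wT(x) below by
   J^w and that of Z by J^(1/2). Jensen's inequality then yields, for B =
   (1-w)X + wTX,
     E|X-TX|^2/2 <= D(f) + D(g),
     D(B) <= (1-w)D(f) + wD(g) - w(1-w)E|X-TX|^2/2.
   For n marginals, add them one at a time, sending the barycenter of the
   previous ones to the next by such a map: the two inequalities propagate.
   For n >= 3, equality forces it in both inequalities for the first pair, hence
   J = 1 and |Z| = |x| almost everywhere, so that f is standard Gaussian. For
   n = 2, equality makes the coupling by T optimal; exchanging Tx and Ty whenever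
   <x-y,Tx-Ty> < 0 shows that T is monotone, which forces the slopes on the
   pieces to agree, so that T is linear and both laws are Gaussian. Conversely,
   for a Gaussian pair Fenchel-Young for the quadratic form of C bounds the cost
   of every coupling from below. *)

Require Import Defs.
From HB Require Import structures.
From mathcomp Require Import all_boot all_order all_algebra.
From mathcomp Require Import all_classical all_reals all_analysis.
From mathcomp Require Import measurable_realfun.
From mathcomp Require Import ring lra.
Import Order.TTheory GRing.Theory Num.Theory.
Import numFieldNormedType.Exports.
Local Open Scope classical_set_scope.
Local Open Scope ring_scope.
Set Implicit Arguments.
Unset Strict Implicit.
Unset Printing Implicit Defensive.

(** * Weighted push-forward measures *)

(** Working with an optimal map would call for almost-everywhere derivatives and an area formula.
    The map built here is assembled from one-dimensional rearrangements, for which every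
    change-of-variables bound can be tested on intervals; Jacobians survive only as weights [k] such
    that [k dx], pushed by the map, stays below Lebesgue measure. The map need not be optimal, which
    is harmless when bounding an infimum from above; only the equality case for two marginals has to
    recover optimality. The maximizing direction keeps the induction alive: both half-space pieces
    must again have centered tails. The identity E|Z|^2 = E<X,TX> lets the quadratic terms of the
    Gaussian logarithms combine into |X-TX|^2. It holds because the squared head of Z is the product
    of the two heads measured from their cutting hyperplanes, while the offset c of the second
    hyperplane is paired with E<X,e> = 0. A geometric mean is an arithmetic mean in logarithmic
    coordinates, which exist only on a half-line. Hence the cut, and hence the constant 1/2, the
    Gaussian mass of a half-space, in the bound for Z on each piece. *)

Section wpush.
Context d1 d2 (T : measurableType d1) (U : measurableType d2) (R : realType).
Variables (m : {measure set T -> \bar R}) (k : T -> R) (phi : T -> U).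
Hypothesis mk : measurable_fun setT k.
Hypothesis k0 : forall x, 0 <= k x.
Hypothesis mphi : measurable_fun setT phi.
Local Open Scope ereal_scope.

(** A bound of this measure by Lebesgue measure reads, without any derivative, as: [phi] is
    essentially injective where [k] is positive, with Jacobian at least [k]. *)
Definition wpush (A : set U) : \bar R := \int[m]_x (k x * \1_A (phi x))%:E.

Lemma wpush_measurable (A : set U) : measurable A ->
  measurable_fun setT (fun x => (k x * \1_A (phi x))%:E).
Proof.
move=> mA; apply/measurable_EFinP/measurable_funM => //.
exact: measurableT_comp mphi.
Qed.

Let wpush0 : wpush set0 = 0.
Proof. by rewrite /wpush; apply: integral0_eq => x _; rewrite indic0 mulr0. Qed.

Let wpush_ge0 A : 0 <= wpush A.
Proof. by apply: integral_ge0 => x _; rewrite lee_fin mulr_ge0. Qed.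

Let wpush_sigma_additive : semi_sigma_additive wpush.
Proof.
move=> F mF tF mUF; rewrite [X in _ --> X](_ : _ = \sum_(n <oo) wpush (F n)).
  by apply/cvg_closeP; split; [exact: is_cvg_nneseries|rewrite closeE].
rewrite /wpush -integral_nneseries//=; last 2 first.
- by move=> n; exact: wpush_measurable.
- by move=> n x _; rewrite lee_fin mulr_ge0.
apply: eq_integral => x _.
under eq_eseriesr do rewrite EFinM.
rewrite nneseriesZl//.
rewrite EFinM; congr (_ * _).
have := @measure_semi_sigma_additive _ _ _ (dirac (phi x) : {measure set U -> \bar R}) F mF tF mUF.
move=> /cvg_lim dE.
transitivity (\d_(phi x) (\bigcup_n F n) : \bar R); first by [].
by rewrite -dE.
Qed.

HB.instance Definition _ := isMeasure.Build _ _ _ wpush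
  wpush0 wpush_ge0 wpush_sigma_additive.

Definition wpush_m : {measure set U -> \bar R} := wpush.

Import HBNNSimple.

Lemma ge0_integral_wpush (F : U -> \bar R) : measurable_fun setT F ->
  (forall y, 0 <= F y) ->
  \int[wpush_m]_y F y = \int[m]_x ((k x)%:E * F (phi x)).
Proof.
move=> mF F0.
pose h := nnsfun_approx measurableT mF.
have mkE : measurable_fun setT (EFin \o k) by exact/measurable_EFinP.
have mh n : measurable_fun setT (EFin \o (h n \o phi)).
  by apply/measurable_EFinP; apply: measurableT_comp.
transitivity (limn (fun n => \int[wpush_m]_y (h n y)%:E)).
  rewrite -monotone_convergence//.
  - by apply: eq_integral => y _; apply/esym/cvg_lim => //;
      apply: cvg_nnsfun_approx.
  - by move=> n; exact/measurable_EFinP.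
  - by move=> n y _; rewrite lee_fin.
  - by move=> y _ a b ab; rewrite lee_fin; exact/lefP/nd_nnsfun_approx.
transitivity (limn (fun n => \int[m]_x ((k x)%:E * (h n (phi x))%:E))); last first.
  rewrite -monotone_convergence//.
  - apply: eq_integral => x _; apply/cvg_lim => //; apply: cvgeZl => //.
    exact: cvg_nnsfun_approx.
  - by move=> n; apply: emeasurable_funM => //; exact: mh.
  - by move=> n x _; rewrite mule_ge0 ?lee_fin.
  - move=> x _ a b ab; rewrite lee_wpmul2l ?lee_fin//.
    exact/lefP/nd_nnsfun_approx.
suff E n : \int[wpush_m]_y (h n y)%:E = \int[m]_x ((k x)%:E * (h n (phi x))%:E).
  by congr (limn _); apply/funext => n; exact: E.
rewrite integralT_nnsfun sintegralE.
transitivity (\int[m]_x (\sum_(r \in range (h n))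
   (r%:E * (k x * \1_(h n @^-1` [set r]) (phi x))%:E))); last first.
  apply: eq_integral => x _.
  rewrite [in RHS]fimfunE -fsumEFin// ge0_mule_fsumr; last first.
    by move=> r; exact: nnfun_muleindic_ge0.
  apply: eq_fsbigr => r _; rewrite -!EFinM; congr EFin.
  by rewrite mulrCA.
rewrite ge0_integral_fsum//; last 2 first.
- move=> r; apply: measurable_funeM; exact: wpush_measurable.
(* Outside the range of [h n] the level set is empty, which disposes of the negative values of
   [r]. *)
- move=> r x _; have [rh|rh] := boolP (r \in range (h n)).
    by move: rh; rewrite inE => -[t _ <-]; rewrite mule_ge0 ?lee_fin ?mulr_ge0.
  rewrite indicE memNset ?mulr0 ?mule0//= => rh'.
  by move/negP: rh; apply; rewrite inE; exists (phi x).
apply: eq_fsbigr => r; rewrite inE => -[t _ <-].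
rewrite ge0_integralZl ?lee_fin//; first exact: wpush_measurable.
by move=> x _; rewrite lee_fin mulr_ge0.
Qed.

Lemma ge0_le_integral_wpush (n : {measure set U -> \bar R}) (F : U -> \bar R) :
  (forall A, measurable A -> wpush A <= n A) ->
  measurable_fun setT F -> (forall y, 0 <= F y) ->
  \int[m]_x ((k x)%:E * F (phi x)) <= \int[n]_y F y.
Proof.
move=> H mF F0; rewrite -ge0_integral_wpush//.
exact: ge0_le_measure_integral.
Qed.

Lemma ge0_eq_integral_wpush (n : {measure set U -> \bar R}) (F : U -> \bar R) :
  (forall A, measurable A -> wpush A = n A) ->
  measurable_fun setT F -> (forall y, 0 <= F y) ->
  \int[m]_x ((k x)%:E * F (phi x)) = \int[n]_y F y.
Proof.
move=> H mF F0; rewrite -ge0_integral_wpush//.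
by apply: eq_measure_integral => A mA _; exact: H.
Qed.

End wpush.

(* The library's Lebesgue measure lives on [measurableTypeR R], whose display
   differs from the canonical one of [R] used by tuples. *)
Section lebR.
Context {R : realType}.
Local Open Scope ereal_scope.

Definition lebR (A : set R) : \bar R := @lebesgue_measure R A.

Let lebR0 : lebR set0 = 0. Proof. exact: (@measure0 _ _ _ (@lebesgue_measure R)). Qed.
Let lebR_ge0 A : 0 <= lebR A.
Proof. exact: (@measure_ge0 _ _ _ (@lebesgue_measure R)). Qed.
Let lebR_sigma_additive : semi_sigma_additive lebR.
Proof. exact: (@measure_semi_sigma_additive _ _ _ (@lebesgue_measure R)). Qed.

HB.instance Definition _ := isMeasure.Build _ _ _ lebR
  lebR0 lebR_ge0 lebR_sigma_additive.

Let lebR_sigma_finite : sigma_finite setT lebR.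
Proof. exact: (sigma_finiteT (@lebesgue_measure R)). Qed.

HB.instance Definition _ := @Measure_isSigmaFinite.Build _ _ _ lebR
  lebR_sigma_finite.

Lemma lebR_itv (i : interval R) : lebR [set` i] =
  (if i.1 < i.2 then (i.2 : \bar R) - i.1 else 0)%E.
Proof. exact: lebesgue_measure_itv. Qed.

Let idR : measurableTypeR R -> R := idfun.
Let midR : measurable_fun setT idR.
Proof. by move=> _ A mA; rewrite setTI. Qed.

Lemma ge0_integral_lebR (D : set R) (f : R -> \bar R) : measurable D ->
  measurable_fun D f -> (forall x, 0 <= f x) ->
  \int[lebR]_(x in D) f x = \int[@lebesgue_measure R]_(x in D) f x.
Proof.
move=> mD mf f0.
have := @ge0_integral_pushforward _ _ (measurableTypeR R) R R idR midR
   (@lebesgue_measure R) D f mD mf (fun x _ => f0 x).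
rewrite preimage_id /=.
by rewrite (@eq_measure_integral _ _ _ _ lebR).
Qed.

(** Lebesgue outer measure is an infimum over countable covers by half-open intervals, so a
    domination tested on these intervals passes to all Borel sets by countable subadditivity of
    [nu]. *)
Lemma le_lebR (nu : {measure set R -> \bar R}) :
  (forall a b : R, (a <= b)%R -> nu `]a, b]%classic <= (b - a)%:E) ->
  forall A, measurable A -> nu A <= lebR A.
Proof.
move=> H A mA.
rewrite /lebR /lebesgue_measure /lebesgue_stieltjes_measure.
rewrite /measure_extension /mu_ext.
apply: le_ereal_inf_tmp => _ [F [mF AF] <-].
have mF' k : measurable (F k : set R).
  by apply: sub_sigma_algebra; exact: mF.
apply: (@le_trans _ _ (\sum_(0 <= k <oo) nu (F k))).
  exact: measure_sigma_subadditive.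
apply: lee_nneseries => // k _.
have /ocitvP[->|[[a b] /= ab ->]] := mF k.
  rewrite measure0 le_eqVlt; apply/orP; left; apply/eqP/esym.
  exact: wlength0.
by rewrite wlength_itv_bnd ?(ltW ab)//; apply: H; exact: ltW.
Qed.

Lemma measure_eq_itvoc (m1 m2 : {measure set R -> \bar R}) :
  (forall a b : R, m1 `]a, b]%classic < +oo) ->
  (forall a b : R, (a <= b)%R -> m1 `]a, b]%classic = m2 `]a, b]%classic) ->
  forall A, measurable A -> m1 A = m2 A.
Proof.
move=> m1T H A mA.
pose g n : set R := `](- n%:R)%R, n%:R%R]%classic.
apply: (@measure_unique _ _ _ (@ocitv R : set (set R)) g) => //.
- exact: ocitvI.
- by move=> i; exact: is_ocitv.
- apply/seteqP; split => // x _; exists (Num.truncn `|x|%R).+1 => //=.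
  rewrite /g /= in_itv/=.
  by have := truncnS_gt `|x|%R; rewrite ltr_norml => /andP[-> /ltW ->].
- move=> _ /ocitvP[->|[[a b] /= ab ->]]; first by rewrite !measure0.
  by apply: H; exact: ltW.
- by move=> k; exact: m1T.
Qed.

End lebR.

(** * Sums of comonotone functions *)

Section comonotone.
Context {R : realType}.
Notation leb := (@lebR R).
Local Open Scope ereal_scope.

Lemma wpushD (p pi ka : R -> R) (w : R) (A : set R) : measurable A ->
  measurable_fun setT p -> measurable_fun setT pi -> measurable_fun setT ka ->
  (forall s, (0 <= pi s)%R) -> (forall s, (0 <= ka s)%R) -> (0 < w < 1)%R ->
  wpush leb (fun s => (1 - w) * pi s + w * ka s)%R p A =
  (1 - w)%:E * wpush leb pi p A + w%:E * wpush leb ka p A.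
Proof.
move=> mA mp mpi mka pi0 ka0 /andP[w0 w1].
have w1' : (0 <= 1 - w)%R by rewrite subr_ge0 ltW.
have w0' := ltW w0.
rewrite /wpush -!ge0_integralZl ?lee_fin//; try by
  [exact: wpush_measurable | move=> x _; rewrite lee_fin mulr_ge0].
rewrite -ge0_integralD//; try by
  [apply: measurable_funeM; exact: wpush_measurable |
   move=> x _; rewrite mule_ge0 ?lee_fin ?mulr_ge0// ltW].
by apply: eq_integral => x _; rewrite -!EFinM -EFinD; congr EFin; ring.
Qed.

(* No differentiation is involved: on a level interval of the combination both
   functions sweep intervals whose weighted lengths add up to at most the
   length of the level interval. *)
Lemma comonotone_wpush (E : set R) (p q pi ka : R -> R) (w : R) :
  measurable_fun setT p -> measurable_fun setT q ->
  measurable_fun setT pi -> measurable_fun setT ka ->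
  (forall s, 0 <= pi s)%R -> (forall s, 0 <= ka s)%R ->
  (forall s, ~ E s -> pi s = 0)%R -> (forall s, ~ E s -> ka s = 0)%R ->
  (forall s t, E s -> E t -> s <= t -> p s <= p t)%R ->
  (forall s t, E s -> E t -> s <= t -> q s <= q t)%R ->
  (0 < w < 1)%R ->
  (forall A, measurable A -> wpush leb pi p A <= leb A) ->
  (forall A, measurable A -> wpush leb ka q A <= leb A) ->
  forall A, measurable A ->
   wpush leb (fun s => (1 - w) * pi s + w * ka s)%R
     (fun s => (1 - w) * p s + w * q s)%R A <= leb A.
Proof.
move=> mp mq mpi mka pi0 ka0 piE kaE ndp ndq w01 Hp Hq A mA.
have /andP[w0 w1] := w01.
have w1' : (0 < 1 - w)%R by rewrite subr_gt0.
set k := (X in wpush leb X _ _); set b := (X in wpush leb _ X _).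
have mk : measurable_fun setT k.
  by apply: measurable_funD; apply: measurable_funM.
have mb : measurable_fun setT b.
  by apply: measurable_funD; apply: measurable_funM.
have k0 s : (0 <= k s)%R by rewrite addr_ge0// mulr_ge0// ltW.
suff H c d : (c <= d)%R -> wpush_m leb mk k0 mb `]c, d]%classic <= (d - c)%:E.
  exact: (le_lebR H).
move=> cd; rewrite /= /wpush_m.
rewrite wpushD//.
pose I := [set s | E s /\ (c < b s <= d)%R].
have [[s0 Is0]|I0] := pselect (exists s, I s); last first.
  have V (h : R -> R) : (forall s, ~ E s -> h s = 0)%R ->
      wpush leb h b `]c, d]%classic = 0.
    move=> hE; apply: integral0_eq => s _; rewrite indicE.
    have [Es|/hE ->] := pselect (E s); last by rewrite mul0r.
    rewrite memNset ?mulr0//= in_itv/= => bs; apply: I0; exists s; split => //.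
  by rewrite !V// !mule0 add0e lee_fin subr_ge0.
(* Both functions are nondecreasing on [E], so all four points can be enclosed between one smallest
   point [m] and one largest point [M] of [I], and [b M - b m] is at most [d - c]. *)
have key s1 s2 t1 t2 : I s1 -> I s2 -> I t1 -> I t2 ->
    ((1 - w) * (p s2 - p s1) + w * (q t2 - q t1) <= d - c)%R.
  move=> I1 I2 J1 J2.
  have [m [Im ms mt]] : exists m, [/\ I m, m <= s1 & m <= t1]%R.
    by have [st|ts] := leP s1 t1; [exists s1|exists t1; split => //; exact: ltW].
  have [M [IM Ms Mt]] : exists M, [/\ I M, s2 <= M & t2 <= M]%R.
    by have [st|ts] := leP s2 t2; [exists t2|exists s2; split => //; exact: ltW].
  have := ndp _ _ Im.1 I1.1 ms; have := ndp _ _ I2.1 IM.1 Ms.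
  have := ndq _ _ Im.1 J1.1 mt; have := ndq _ _ J2.1 IM.1 Mt.
  move: Im.2 IM.2; rewrite /b => /andP[h1 _] /andP[_ h2] h3 h4 h5 h6.
  have a1 : (w * (q t2 - q t1) <= w * (q M - q m))%R by rewrite ler_pM2l//; lra.
  have a2 : ((1 - w) * (p s2 - p s1) <= (1 - w) * (p M - p m))%R
    by rewrite ler_pM2l//; lra.
  lra.
pose pI := p @` I; pose qI := q @` I.
have bnd (r x y z : R) : (0 < r)%R -> (r * x + y <= z)%R -> (x <= (z - y) / r)%R.
  by move=> r0 h; rewrite ler_pdivlMr//; lra.
(* Since [key] lets the spreads of [p] and [q] use independent end points, the four extrema can be
   taken one at a time; boundedness of both images comes out first. *)
have ubp s1 t1 t2 : I s1 -> I t1 -> I t2 ->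
    ubound pI (p s1 + (d - c - w * (q t2 - q t1)) / (1 - w))%R.
  move=> i1 j1 j2 _ [s Is <-]; have := key _ _ _ _ i1 Is j1 j2.
  by move=> /(bnd _ _ _ _ w1'); lra.
have lbp s2 t1 t2 : I s2 -> I t1 -> I t2 ->
    lbound pI (p s2 - (d - c - w * (q t2 - q t1)) / (1 - w))%R.
  move=> i1 j1 j2 _ [s Is <-]; have := key _ _ _ _ Is i1 j1 j2.
  by move=> /(bnd _ _ _ _ w1'); lra.
have nep : pI !=set0 by exists (p s0); exists s0.
have neq : qI !=set0 by exists (q s0); exists s0.
have h1 t1 t2 : I t1 -> I t2 -> ((1 - w) * (sup pI - inf pI) + w * (q t2 - q t1) <= d - c)%R.
  move=> j1 j2; set e := ((d - c - w * (q t2 - q t1)) / (1 - w))%R.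
  have : (sup pI - inf pI <= e)%R.
    rewrite lerBlDl -lerBlDr; apply: lb_le_inf => // _ [s Is <-].
    rewrite lerBlDr; apply: ge_sup => //; exact: ubp.
  by rewrite /e ler_pdivlMr//; lra.
have lbq t2 : I t2 -> lbound qI (q t2 - (d - c - (1 - w) * (sup pI - inf pI)) / w)%R.
  move=> j2 _ [s Is <-]; have := h1 _ _ Is j2; rewrite addrC.
  by move=> /(bnd _ _ _ _ w0); lra.
have ubq t1 : I t1 -> ubound qI (q t1 + (d - c - (1 - w) * (sup pI - inf pI)) / w)%R.
  move=> j2 _ [s Is <-]; have := h1 _ _ j2 Is; rewrite addrC.
  by move=> /(bnd _ _ _ _ w0); lra.
have h2 : ((1 - w) * (sup pI - inf pI) + w * (sup qI - inf qI) <= d - c)%R.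
  set e := ((d - c - (1 - w) * (sup pI - inf pI)) / w)%R.
  have : (sup qI - inf qI <= e)%R.
    rewrite lerBlDl -lerBlDr; apply: lb_le_inf => // _ [s Is <-].
    rewrite lerBlDr; apply: ge_sup => //; exact: ubq.
  by rewrite /e ler_pdivlMr//; lra.
(* A point of [E] whose [b]-value lies in []c, d]] belongs to [I], so its [g]-value lies between the
   infimum and the supremum of [g] on [I]; the bound for [g] on that closed interval then
   applies. *)
have V (h g : R -> R) : measurable_fun setT h -> measurable_fun setT g ->
    (forall s, 0 <= h s)%R -> (forall s, ~ E s -> h s = 0)%R ->
    has_ubound (g @` I) -> has_lbound (g @` I) ->
    (forall A, measurable A -> wpush leb h g A <= leb A) ->
    wpush leb h b `]c, d]%classic <= (sup (g @` I) - inf (g @` I))%:E.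
  move=> mh mg h0 hE ub lb Hg.
  apply: (@le_trans _ _ (wpush leb h g `[inf (g @` I), sup (g @` I)]%classic)).
    apply: ge0_le_integral => //.
    - by move=> s _; rewrite lee_fin mulr_ge0.
    - by apply: wpush_measurable.
    - by apply: wpush_measurable.
    - move=> s _; rewrite lee_fin.
      have [Es|/hE ->] := pselect (E s); last by rewrite !mul0r.
      apply: ler_wpM2l => //; rewrite !indicE.
      case: (boolP (b s \in _)) => //; rewrite inE/= in_itv/= => bs.
      rewrite mem_set//= in_itv/=; apply/andP; split.
        by apply: ge_inf => //; exists s.
      by apply: ub_le_sup => //; exists s.
  apply: le_trans (Hg _ _) _ => //.
  rewrite lebR_itv/= lte_fin; case: ifPn => // _.
  rewrite lee_fin subr_ge0; apply: (@le_trans _ _ (g s0)).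
    by apply: ge_inf => //; exists s0.
  by apply: ub_le_sup => //; exists s0.
apply: (@le_trans _ _ ((1 - w)%:E * (sup pI - inf pI)%:E +
                       w%:E * (sup qI - inf qI)%:E)); last first.
  by rewrite -!EFinM -EFinD lee_fin.
apply: leeD; apply: lee_wpmul2l; rewrite ?lee_fin ?(ltW w0) ?(ltW w1')//.
- apply: (V pi p) => //.
  + by eexists; apply: (ubp s0 s0 s0).
  + by eexists; apply: (lbp s0 s0 s0).
- apply: (V ka q) => //.
  + by eexists; apply: (ubq s0).
  + by eexists; apply: (lbq s0).
Qed.

End comonotone.

(** * Lebesgue measure on tuples *)

Section Leb.
Context {R : realType}.
Local Open Scope ereal_scope.

Definition consp d (p : R * d.-tuple R) : d.+1.-tuple R := cons_tuple p.1 p.2.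

Lemma measurable_consp d : measurable_fun setT (@consp d).
Proof. exact: measurable_cons. Qed.

Definition tl d (x : d.+1.-tuple R) : d.-tuple R := [tuple of behead x].

Lemma measurable_tl d : measurable_fun setT (@tl d).
Proof. exact: measurable_behead. Qed.

Lemma consp_eta d (x : d.+1.-tuple R) : consp (thead x, tl x) = x.
Proof. by rewrite [RHS]tuple_eta; apply/val_inj. Qed.

Lemma thead_consp d (p : R * d.-tuple R) : thead (consp p) = p.1.
Proof. by rewrite theadE. Qed.

Lemma tl_consp d (p : R * d.-tuple R) : tl (consp p) = p.2.
Proof. exact/val_inj. Qed.

Lemma measurable_thead d : measurable_fun setT (@thead d R).
Proof. exact: measurable_tnth. Qed.

(** The recursion on the first coordinate copies that of [leb_int], so that the two agree by Tonelli
    on nonnegative measurable functions. *)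
Fixpoint Leb (d : nat) : set (d.-tuple R) -> \bar R :=
  if d is d'.+1 return set (d.-tuple R) -> \bar R then
    fun A => (lebR \x @Leb d') (@consp d' @^-1` A)
  else fun A => (\1_A [tuple])%:E.

Section step.
Variables (d : nat) (S : {sigma_finite_measure set (d.-tuple R) -> \bar R}).
Let P : set (d.+1.-tuple R) -> \bar R :=
  pushforward (lebR \x S) (@consp d).

Let mP (A : set (d.+1.-tuple R)) : measurable A -> measurable (@consp d @^-1` A).
Proof. by move=> mA; rewrite -[X in measurable X]setTI; exact: measurable_consp. Qed.

Lemma Leb_step : [/\ P set0 = 0, forall A, 0 <= P A, semi_sigma_additive P &
  sigma_finite setT P].
Proof.
split.
- by rewrite /P /pushforward preimage_set0 (measure0 (lebR \x S)).
- by move=> A; exact: (measure_ge0 (lebR \x S)).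
- move=> F mF tF mUF; rewrite /P /pushforward preimage_bigcup.
  apply: (@measure_semi_sigma_additive _ _ _ (lebR \x S)
    (fun n => @consp d @^-1` F n)).
  + by move=> n; exact: mP.
  + apply/trivIsetP => /= i j _ _ ij; rewrite -preimage_setI.
    by move/trivIsetP : tF => /(_ _ _ _ _ ij) ->//; rewrite preimage_set0.
  + by rewrite -preimage_bigcup; exact: mP.
- have /sigma_finiteP[F1 [TF1 ndF1 F1oo]] := sigma_finiteT S.
  have /sigma_finiteP[F2 [TF2 ndF2 F2oo]] := sigma_finiteT (@lebR R).
  pose F n := F2 n `*` F1 n.
  have FT : setT = \bigcup_n F n.
    rewrite -setXTT TF1 TF2 predeqE => -[x y]; split.
      move=> [/= [n _ Fnx] [k _ Gky]]; exists (maxn n k) => //; split.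
      - by move: x Fnx; exact/subsetPset/ndF2/leq_maxl.
      - by move: y Gky; exact/subsetPset/ndF1/leq_maxr.
    by move=> [n _ []/= ? ?]; split; exists n.
  have Ffin k : measurable (F k) /\ (lebR \x S) (F k) < +oo.
    have [? ?] := F2oo k; have [? ?] := F1oo k.
    split; first exact: measurableX.
    by rewrite product_measure1E// lte_mul_pinfty// ge0_fin_numE.
  pose g (x : d.+1.-tuple R) := (thead x, tl x).
  have mg : measurable_fun setT g.
    by apply/measurable_fun_pairP; split;
      [exact: measurable_thead|exact: measurable_tl].
  exists (fun n => g @^-1` F n).
    by rewrite -preimage_bigcup -FT preimage_setT.
  move=> n; have [mFn Fn] := Ffin n; split.
    by rewrite -[X in measurable X]setTI; exact: mg.
  rewrite /P /pushforward (_ : _ @^-1` _ = F n)//.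
  by apply/seteqP; split => [[s t]|[s t]]; rewrite /= /g thead_consp tl_consp.
Qed.
End step.

(** The measure axioms and sigma-finiteness go through one joint induction: the product in dimension
    [d.+1] behaves well only once dimension [d] is known to be sigma-finite. *)
Lemma Leb_props d : [/\ @Leb d set0 = 0, forall A, 0 <= @Leb d A,
  semi_sigma_additive (@Leb d) & sigma_finite setT (@Leb d)].
Proof.
elim: d => [|d [h1 h2 h3 h4]]; last first.
  pose mM := isMeasure.Build _ _ _ (@Leb d) h1 h2 h3.
  pose M : {measure set (d.-tuple R) -> \bar R} := HB.pack (@Leb d) mM.
  pose S : {sigma_finite_measure set (d.-tuple R) -> \bar R} :=
    HB.pack (@Leb d) mM (@Measure_isSigmaFinite.Build _ _ _ M h4).
  exact: (Leb_step S).
pose D : {measure set (0.-tuple R) -> \bar R} := dirac [tuple].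
have -> : @Leb 0 = D by apply/funext => A.
split => //; first exact: measure_semi_sigma_additive.
by apply: fin_num_fun_sigma_finite; [rewrite measure0|exact: fin_num_measure].
Qed.

HB.instance Definition _ d := isMeasure.Build _ _ _ (@Leb d)
  (let: And4 h _ _ _ := Leb_props d in h)
  (let: And4 _ h _ _ := Leb_props d in h)
  (let: And4 _ _ h _ := Leb_props d in h).
HB.instance Definition _ d := @Measure_isSigmaFinite.Build _ _ _ (@Leb d)
  (let: And4 _ _ _ h := Leb_props d in h).

Lemma ge0_integral_Leb0 (F : 0.-tuple R -> \bar R) : (forall x, 0 <= F x) ->
  \int[@Leb 0]_x F x = F [tuple].
Proof.
move=> F0; pose D : {measure set (0.-tuple R) -> \bar R} := dirac [tuple].
have mF : measurable_fun setT F.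
  rewrite (_ : F = cst (F [tuple])); first exact: measurable_cst.
  by apply/funext => x; rewrite tuple0.
transitivity (\int[D]_x F x); first exact: eq_measure_integral.
by rewrite integral_dirac// diracT mul1e.
Qed.

Lemma ge0_integral_LebS d (F : d.+1.-tuple R -> \bar R) :
  measurable_fun setT F -> (forall x, 0 <= F x) ->
  \int[@Leb d.+1]_x F x = \int[lebR]_s \int[@Leb d]_t F (consp (s, t)).
Proof.
move=> mF F0.
rewrite (_ : @Leb d.+1 = pushforward (lebR \x @Leb d) (@consp d))//.
rewrite ge0_integral_pushforward//; last exact: measurable_consp.
rewrite preimage_setT fubini_tonelli1//; last by move=> x; exact: F0.
exact: measurableT_comp (@measurable_consp d).
Qed.

Lemma ge0_integral_LebS' d (F : d.+1.-tuple R -> \bar R) :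
  measurable_fun setT F -> (forall x, 0 <= F x) ->
  \int[@Leb d.+1]_x F x = \int[@Leb d]_t \int[lebR]_s F (consp (s, t)).
Proof.
move=> mF F0; rewrite ge0_integral_LebS//.
rewrite (@fubini_tonelli _ _ _ _ _ lebR (@Leb d) (F \o @consp d))//;
  last by move=> x; exact: F0.
exact: measurableT_comp (@measurable_consp d).
Qed.

Lemma measurable_consp2 d (F : d.+1.-tuple R -> \bar R) :
  measurable_fun setT F ->
  (forall s, measurable_fun setT (fun t => F (consp (s, t)))) /\
  (forall t, measurable_fun setT (fun s => F (consp (s, t)))).
Proof.
move=> mF; have mFc : measurable_fun setT (F \o @consp d).
  exact: measurableT_comp (@measurable_consp d).
split => [s|t]; first exact: (@measurableT_comp _ _ _ _ _ _ (F \o @consp d)).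
exact: (@measurableT_comp _ _ _ _ _ _ (F \o @consp d) _ (fun s => (s, t))).
Qed.

Lemma leb_intE d (F : d.-tuple R -> \bar R) :
  measurable_fun setT F -> (forall x, 0 <= F x) ->
  leb_int F = \int[@Leb d]_x F x.
Proof.
elim: d F => [|d IH] F mF F0; first by rewrite ge0_integral_Leb0.
rewrite ge0_integral_LebS// ge0_integral_lebR//; last 2 first.
- apply: (measurable_fun_fubini_tonelli_F (m2 := @Leb d) (F \o @consp d)).
    exact: measurableT_comp (@measurable_consp d).
  by move=> x; exact: F0.
- by move=> x; exact: integral_ge0.
apply: eq_integral => s _ /=.
by apply: IH => //; exact: (measurable_consp2 mF).1.
Qed.

Lemma LebE d (A : set (d.-tuple R)) : measurable A -> leb_measure A = Leb A.
Proof.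
move=> mA; rewrite /leb_measure leb_intE ?integral_indic ?setIT//.
by apply/measurable_EFinP.
Qed.

End Leb.
Arguments consp {R d}.
Arguments tl {R d}.
Arguments Leb {R} d : simpl never.

Lemma measurable_inv_ge0 d (T : measurableType d) (R : realType) (f : T -> R) :
  measurable_fun setT f -> (forall x, 0 <= f x) ->
  measurable_fun setT (fun x => (f x)^-1).
Proof.
move=> mf f0; rewrite (_ : (fun x => _) = (fun x => f x `^ (-1))).
  exact: measurableT_comp (measurable_powR _) mf.
by apply/funext => x; rewrite powR_inv1.
Qed.

Lemma measurable_le_itv d (T : measurableType d) (R : realType) (f : T -> R) :
  (forall t, measurable [set x | f x <= t]) -> measurable_fun setT f.
Proof.
move=> H; apply: (@measurability _ _ _ _ setT f _ (@RGenOInfty.measurableE R)) => //.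
move=> _ [_ [x ->] <-]; rewrite setTI.
rewrite (_ : _ @^-1` _ = ~` [set y | f y <= x]); first exact: measurableC.
apply/seteqP; split => y /=; rewrite in_itv/= andbT; first by move=> h; apply/negP; rewrite -ltNge.
by move=> /negP; rewrite -ltNge.
Qed.

Lemma measurable_natr_bool d (T : measurableType d) (R : realType) (f : T -> bool) :
  measurable_fun setT f -> measurable_fun setT (fun x => (f x)%:R : R).
Proof.
move=> mf; rewrite (_ : (fun x => _) = (fun x => if f x then 1 else 0)).
  exact: measurable_fun_ifT.
by apply/funext => x; case: (f x).
Qed.

(** * Monotone transport of densities on the half-line *)

Section cdf.
Context {R : realType}.
Variable a : R -> R.
Hypothesis ma : measurable_fun setT a.
Hypothesis a0 : forall x, 0 <= a x.
Hypothesis a1 : (\int[lebR]_x (a x)%:E = 1)%E.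
Local Open Scope ereal_scope.

Let P : {measure set R -> \bar R} := wpush_m lebR ma a0 (@measurable_id _ _ setT).

Lemma mdensE (A : set R) : P A = \int[lebR]_(x in A) (a x)%:E.
Proof.
rewrite integral_mkcond; apply: eq_integral => x _.
by rewrite patchE; case: ifPn => [xA|xA];
  rewrite indicE ?xA ?(negbTE xA) ?mulr1 ?mulr0.
Qed.

Lemma mdensT : P setT = 1. Proof. by rewrite mdensE. Qed.

Lemma mdens_fin (A : set R) : measurable A -> P A \is a fin_num.
Proof.
move=> mA; rewrite ge0_fin_numE//; apply: (@le_lt_trans _ _ (P setT)).
  by apply: le_measure; rewrite ?inE.
by rewrite mdensT ltry.
Qed.

Definition cdfd (s : R) : R := fine (\int[lebR]_(x in `]-oo, s]) (a x)%:E).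

Lemma cdfdE s : (cdfd s)%:E = P `]-oo, s]%classic.
Proof. by rewrite /cdfd -mdensE fineK// mdens_fin. Qed.

Lemma cdfd_ge0 s : (0 <= cdfd s)%R.
Proof. by rewrite -lee_fin cdfdE. Qed.

Lemma cdfd_le1 s : (cdfd s <= 1)%R.
Proof. by rewrite -lee_fin cdfdE -mdensT; apply: le_measure; rewrite ?inE. Qed.

Lemma cdfd_nd s t : (s <= t)%R -> (cdfd s <= cdfd t)%R.
Proof.
move=> st; rewrite -lee_fin !cdfdE; apply: le_measure; rewrite ?inE//.
by apply: subset_itvl; rewrite bnd_simp.
Qed.

Lemma cdfdB s t : (s <= t)%R -> P `]s, t]%classic = (cdfd t - cdfd s)%:E.
Proof.
move=> st; rewrite EFinB !cdfdE.
have -> : `]s, t]%classic = `]-oo, t] `\` `]-oo, s].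
  by rewrite -[RHS]setCK setCD setCitvl setUC -[LHS]setCK setCitv.
rewrite measureD ?setIidr//; first by apply: subset_itvl; rewrite bnd_simp.
by rewrite -ge0_fin_numE// mdens_fin.
Qed.

(** Absolute continuity of the integral: the mass of an interval shorter than [dl] is below [e],
    uniformly in its position. *)
Lemma cdfd_continuous : continuous cdfd.
Proof.
move=> s; apply/cvgrPdist_lt => e e0.
have ia : lebR.-integrable setT (EFin \o a).
  apply/integrableP; split; first exact/measurable_EFinP.
  under eq_integral do rewrite /= ger0_norm//.
  by rewrite a1 ltry.
have [dl [dl0 H]] := integral_normr_continuous ia e0.
have key u v : (u <= v)%R -> (v - u < dl)%R -> (cdfd v - cdfd u < e)%R.
  move=> uv vu.
  have := H `]u, v]%classic (measurable_itv _).
  have -> : (lebR `]u, v]%classic < dl%:E) = true.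
    by rewrite lebR_itv/= lte_fin; case: ifPn => _; rewrite lte_fin.
  move=> /(_ isT).
  rewrite /Rintegral; apply: le_lt_trans.
  rewrite -lee_fin fineK.
    rewrite -cdfdB// mdensE; under [leRHS]eq_integral do rewrite ger0_norm//.
    exact: lexx.
  under eq_integral do rewrite ger0_norm//.
  by rewrite -mdensE mdens_fin.
near=> t.
have st : (`|s - t| < dl)%R by near: t; apply: cvgr_dist_lt.
have [ts|/ltW ts] := leP t s.
  rewrite ger0_norm ?subr_ge0 ?cdfd_nd//; apply: key => //.
  by rewrite -(ger0_norm (_ : 0 <= s - t)%R)// subr_ge0.
rewrite distrC ger0_norm ?subr_ge0 ?cdfd_nd//; apply: key => //.
by rewrite -(ger0_norm (_ : 0 <= t - s)%R) ?subr_ge0// distrC.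
Unshelve. all: by end_near. Qed.

Let exhaust (G : (set R)^nat) (u : R) : (forall n, measurable (G n)) ->
  {homo G : n m / (n <= m)%N >-> (n <= m)%O} -> \bigcup_n G n = setT ->
  (u < 1)%R -> exists n, u%:E < P (G n).
Proof.
move=> mG ndG GT u1; apply: contrapT => H.
have cG := @nondecreasing_cvg_mu _ _ _ P G mG.
have mT : measurable (\bigcup_n G n) by rewrite GT.
have {}cG := cG mT ndG.
have : lim ((P \o G) n @[n --> \oo]) <= u%:E.
  apply: lime_le; first by apply/cvg_ex; eexists; exact: cG.
  apply: nearW => n; rewrite leNgt; apply/negP => h; apply: H; by exists n.
rewrite (cvg_lim _ cG)// GT mdensT lee_fin.
by move=> /le_lt_trans => /(_ _ u1); rewrite ltxx.
Qed.

Lemma cdfd_gt u : (u < 1)%R -> exists t, (u < cdfd t)%R.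
Proof.
move=> u1; have [|||n] := @exhaust (fun n => `]-oo, n%:R%R]%classic) u _ _ _ u1.
- by [].
- move=> n m nm; apply/subsetPset; apply: subset_itvl.
  by rewrite bnd_simp ler_nat.
- apply/seteqP; split => // x _; exists (Num.truncn `|x|%R).+1 => //=.
  rewrite in_itv/= ltW//; apply: le_lt_trans (truncnS_gt `|x|%R).
  exact: ler_norm.
by move=> h; exists n%:R%R; rewrite -lte_fin cdfdE.
Qed.

Lemma cdfd_lt u : (0 < u)%R -> exists t, (cdfd t < u)%R.
Proof.
move=> u0; have u1 : (1 - u < 1)%R by lra.
have [|||n] := @exhaust (fun n => `](- n%:R)%R, +oo[%classic) (1 - u)%R _ _ _ u1.
- by [].
- move=> n m nm; apply/subsetPset; apply: subset_itvr.
  by rewrite bnd_simp lerN2 ler_nat.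
- apply/seteqP; split => // x _; exists (Num.truncn `|x|%R).+1 => //=.
  rewrite in_itv/= andbT.
  by have := truncnS_gt `|x|%R; rewrite ltr_norml => /andP[].
rewrite -[X in P X]setCitvl => h; exists (- n%:R)%R.
have PT : P setT = 1 by exact: mdensT.
have PTo : P setT < +oo by rewrite PT ltry.
have E A : measurable A -> P (~` A) = 1 - P A.
  move=> mA; rewrite -setTD measureD// setTI; congr (_ - _); exact: PT.
move: h; rewrite E//.
by rewrite -cdfdE -EFinB lte_fin => h; lra.
Qed.

Lemma cdfd_onto v : (0 < v < 1)%R -> exists s, cdfd s = v.
Proof.
move=> /andP[v0 v1]; have [t vt] := cdfd_gt v1; have [s sv] := cdfd_lt v0.
have st : (s <= t)%R.
  by rewrite leNgt; apply/negP => /ltW /cdfd_nd h; lra.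
have cw : {within `[s, t], continuous cdfd}.
  by apply: continuous_subspaceT => x; exact: cdfd_continuous.
have [|c _ <-] := @IVT R cdfd s t v st cw; last by exists c.
by rewrite ge_min le_max (ltW sv) (ltW vt) orbT.
Qed.

(** A continuous distribution function is uniformly distributed under its own law. The sublevel set
    is a closed half-line ending at its supremum [c], and continuity forces [cdfd c = v]. At [v = 1]
    the set would be unbounded, whence the strict bound. *)
Lemma mdens_cdfd_le v : (0 <= v < 1)%R -> P [set s | (cdfd s <= v)%R] = v%:E.
Proof.
move=> /andP[v0 v1]; have [t vt] := cdfd_gt v1.
pose S := [set s | (cdfd s <= v)%R].
have ubS : ubound S t.
  move=> s Ss; rewrite leNgt; apply/negP => /ltW /cdfd_nd h.
  by have : (cdfd s <= v)%R by []; lra.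
have [[s0 s0S]|S0] := pselect (exists s, S s); last first.
  (* The distribution function takes arbitrarily small values, so the sublevel set can be empty only
     for [v = 0]. *)
  have ve : v = 0%R.
    apply/eqP; rewrite eq_le v0 andbT leNgt; apply/negP => /cdfd_lt[s sv].
    by apply: S0; exists s; exact: ltW.
  rewrite (_ : [set s | _] = set0) ?measure0 ?ve//.
  by apply/seteqP; split => // s Ss; apply: S0; exists s; rewrite /S /= ve.
have hS : has_sup S by split; [exists s0|exists t].
pose c := sup S.
have cv : (cdfd c <= v)%R.
  rewrite leNgt; apply/negP => vc.
  have : \forall x \near c, (v < cdfd x)%R.
    by move: (@cdfd_continuous c) => /cvgr_gt; exact.
  move=> /nbhs_ballP[e /= e0 He].
  have [x Sx cx] := sup_adherent e0 hS.
  have : (v < cdfd x)%R.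
    apply: He; rewrite /ball/= ltr_distlC -/c in cx *.
    rewrite cx/=; apply: (@le_lt_trans _ _ c); first by apply: ub_le_sup Sx; exact: hS.2.
    by rewrite ltrDl.
  by rewrite ltNge Sx.
have vc : (v <= cdfd c)%R.
  rewrite leNgt; apply/negP => vc.
  have : \forall x \near c, (cdfd x < v)%R.
    by move: (@cdfd_continuous c) => /cvgr_lt; exact.
  move=> /nbhs_ballP[e /= e0 He].
  have : S (c + e / 2)%R.
    apply/ltW/He; rewrite /ball/= opprD addrA subrr add0r normrN.
    by rewrite gtr0_norm ?divr_gt0//; lra.
  by move=> /(ub_le_sup hS.2); rewrite -/c; lra.
have -> : [set s | (cdfd s <= v)%R] = `]-oo, c]%classic.
  apply/seteqP; split => s /=; rewrite in_itv/=; first by move=> h; apply: ub_le_sup => //; exact: hS.2.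
  by move=> /cdfd_nd h; exact: le_trans cv.
by rewrite -cdfdE; congr EFin; lra.
Qed.

Lemma measurable_cdfd : measurable_fun setT cdfd.
Proof. by apply: continuous_measurable_fun; exact: cdfd_continuous. Qed.

Lemma measurable_cdfd_le v : measurable [set s | (cdfd s <= v)%R].
Proof.
rewrite (_ : [set _ | _] = cdfd @^-1` `]-oo, v]%classic).
  by rewrite -[X in measurable X]setTI; exact: measurable_cdfd.
by apply/seteqP; split => s /=; rewrite in_itv.
Qed.

(** Were the mass [r] of this set below 1, the sublevel set at height [(r + 1) / 2] would be
    contained in it and yet have the larger mass [(r + 1) / 2]. *)
Lemma mdens_cdfd_lt1 : P [set s | (cdfd s < 1)%R] = 1.
Proof.
have mS : measurable [set s | (cdfd s < 1)%R].
  rewrite (_ : [set _ | _] = cdfd @^-1` `]-oo, 1%R[%classic).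
    by rewrite -[X in measurable X]setTI; exact: measurable_cdfd.
  by apply/seteqP; split => s /=; rewrite in_itv.
apply/eqP; rewrite eq_le; apply/andP; split.
  by rewrite -mdensT; apply: le_measure; rewrite ?inE.
have f := mdens_fin mS; rewrite -(fineK f) lee_fin.
rewrite leNgt; apply/negP => h.
set r := fine _ in h.
have r0 : (0 <= r)%R by rewrite fine_ge0.
have : ((r + 1) / 2)%:E <= r%:E.
  rewrite -mdens_cdfd_le; last lra.
  rewrite /r fineK//; apply: le_measure; rewrite ?inE//.
    exact: measurable_cdfd_le.
  move=> s /= h'; have : (fine (P [set s | (cdfd s < 1)%R]) < 1)%R by []; lra.
by rewrite lee_fin; lra.
Qed.

End cdf.

Section transport.
Context {R : realType}.
Variables a b : R -> R.
Hypotheses (ma : measurable_fun setT a) (mb : measurable_fun setT b).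
Hypotheses (a0 : forall x, 0 <= a x) (b0 : forall x, 0 <= b x).
Hypotheses (a1 : (\int[lebR]_x (a x)%:E = 1)%E)
           (b1 : (\int[lebR]_x (b x)%:E = 1)%E).
Local Open Scope ereal_scope.

Definition good (s : R) : bool := (0 < cdfd a s < 1)%R.

(** The monotone rearrangement, a generalized inverse of one distribution function composed with the
    other. Where the source value is 0 or 1 the set under the infimum may be unbounded below or
    empty; these points carry no mass and receive the default 0. *)
Definition tau (s : R) : R :=
  if good s then inf [set t | (cdfd a s <= cdfd b t)%R] else 0%R.

(** This Galois connection is the only fact about the infimum that is used later: monotonicity,
    measurability and the image law all follow from it. *)
Lemma tau_leP s t : good s -> (tau s <= t)%R = (cdfd a s <= cdfd b t)%R.
Proof.
move=> gs; rewrite /tau gs; move/andP: gs => [s0 s1].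
set S := [set t | _].
have [x sx] := cdfd_gt mb b0 b1 s1.
have [y ys] := cdfd_lt mb b0 b1 s0.
have lb : lbound S y.
  move=> u Su; rewrite leNgt; apply/negP => /ltW/(cdfd_nd mb b0 b1) h.
  by have : (cdfd a s <= cdfd b u)%R by []; lra.
have hS : has_inf S by split; [exists x; exact: ltW|exists y].
apply/idP/idP => [st|h]; last by apply: ge_inf => //; exists y.
apply: le_trans (cdfd_nd mb b0 b1 st).
rewrite leNgt; apply/negP => vc.
have : \forall x \near (inf S), (cdfd b x < cdfd a s)%R.
  by move: (@cdfd_continuous _ b mb b0 b1 (inf S)) => /cvgr_lt; exact.
move=> /nbhs_ballP[e /= e0 He].
have [z Sz zS] := inf_adherent e0 hS.
have : (cdfd b z < cdfd a s)%R.
  apply: He; rewrite /ball/= distrC ger0_norm; last first.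
    by rewrite subr_ge0; apply: ge_inf => //; exists y.
  by rewrite ltrBlDl.
by rewrite ltNge Sz.
Qed.

Lemma tau_nd s t : good s -> good t -> (s <= t)%R -> (tau s <= tau t)%R.
Proof.
move=> gs gt st; rewrite tau_leP//; apply: le_trans (cdfd_nd ma a0 a1 st) _.
by rewrite -tau_leP.
Qed.

Lemma measurable_good : measurable_fun setT good.
Proof.
apply: measurable_and; apply: measurable_fun_ltr => //; exact: measurable_cdfd.
Qed.

Lemma measurable_goodS : measurable [set s | good s].
Proof.
rewrite (_ : [set s | _] = good @^-1` [set true]).
  by rewrite -[X in measurable X]setTI; exact: measurable_good.
by apply/seteqP; split.
Qed.

Lemma measurable_tau : measurable_fun setT tau.
Proof.
apply: measurable_le_itv => t.
rewrite (_ : [set x | _] = ([set s | good s] `&` [set s | (cdfd a s <= cdfd b t)%R])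
   `|` (if (0 <= t)%R then ~` [set s | good s] else set0)).
  apply: measurableU; last first.
    by case: ifP => _ //; apply: measurableC; exact: measurable_goodS.
  apply: measurableI; first exact: measurable_goodS.
  exact: measurable_cdfd_le.
apply/seteqP; split => s /=.
- have [gs|/negP gs] := boolP (good s); first by rewrite tau_leP//; left.
  by rewrite {1}/tau; case: ifPn => // _ t0; right; rewrite t0.
- move=> [[gs h]|]; first by rewrite tau_leP.
  by case: ifP => //= t0 /negP gs; rewrite /tau (negbTE gs).
Qed.

Let Pa : {measure set R -> \bar R} := wpush_m lebR ma a0 (@measurable_id _ _ setT).
Let Pb : {measure set R -> \bar R} := wpush_m lebR mb b0 (@measurable_id _ _ setT).

(** Removing the bad points costs no mass and keeps the default value of [tau] out of all integrals,
    so that the transport identities hold without exceptional sets. *)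
Definition ag (s : R) : R := (a s * (good s)%:R)%R.

Lemma measurable_ag : measurable_fun setT ag.
Proof.
apply: measurable_funM => //; apply: measurable_natr_bool; exact: measurable_good.
Qed.

Lemma ag_ge0 s : (0 <= ag s)%R.
Proof. by rewrite mulr_ge0. Qed.

Lemma Pa_goodT : Pa [set s | good s] = 1.
Proof.
have -> : [set s | good s] = [set s | (cdfd a s < 1)%R] `\` [set s | (cdfd a s <= 0)%R].
  by apply/seteqP; split => s; rewrite /good /=; [move=> /andP[h ->]; split => //; apply/negP; rewrite -ltNge|move=> [-> /negP]; rewrite -ltNge => ->].
rewrite measureD.
- rewrite [X in _ - Pa X](_ : _ = [set s | (cdfd a s <= 0)%R]); last first.
    by apply/seteqP; split => s /=; [case|move=> h; split => //; lra].
  rewrite -[RHS]sube0; congr (_ - _); first exact: mdens_cdfd_lt1.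
  by apply: (mdens_cdfd_le ma a0 a1); rewrite lexx ltr01.
- rewrite (_ : [set s | _] = ~` [set s | (1 <= cdfd a s)%R]).
    apply: measurableC; rewrite (_ : [set _ | _] = cdfd a @^-1` `[1%R, +oo[%classic).
      by rewrite -[X in measurable X]setTI; exact: measurable_cdfd.
    by apply/seteqP; split => s /=; rewrite in_itv/= andbT.
  by apply/seteqP; split => s /=; [move=> h; apply/negP; rewrite -ltNge|move/negP; rewrite -ltNge].
- exact: measurable_cdfd_le.
- apply: (@le_lt_trans _ _ 1); last exact: ltry.
  by rewrite le_eqVlt; apply/orP; left; apply/eqP; exact: mdens_cdfd_lt1.
Qed.

(** On a half-line []-oo, t]], [tau_leP] turns the image mass into the mass of a sublevel set of
    [cdfd a], which is [cdfd b t] because [cdfd a] is uniform under [a]. Differences then give the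
    half-open intervals. *)
Lemma wpush_tau (A : set R) : measurable A -> wpush lebR ag tau A = Pb A.
Proof.
move=> mA.
pose Q := wpush_m lebR measurable_ag ag_ge0 measurable_tau.
have Qle t : Q `]-oo, t]%classic = Pb `]-oo, t]%classic.
  transitivity (Pa ([set s | good s] `&` [set s | (cdfd a s <= cdfd b t)%R])).
    apply: eq_integral => s _; rewrite /ag -mulrA; congr (_ * _)%:E.
    rewrite !indicE; have [gs|gs] := boolP (good s).
      rewrite mul1r; congr (_%:R); congr nat_of_bool.
      have e : (tau s \in `]-oo, t]%classic) = (cdfd a s <= cdfd b t)%R.
        by rewrite -tau_leP//; apply/idP/idP; rewrite inE/= in_itv.
      by rewrite e; apply/idP/idP; rewrite inE/=; [split|case].
    by rewrite mul0r memNset//= => -[gs' _]; move: gs; rewrite gs'.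
  rewrite -(cdfdE mb b0 b1).
  (* The uniform law of [cdfd a] is available below height 1 only; at height 1 the event is all of
     the good set. *)
  have [h|h] := ltP (cdfd b t) 1%R; last first.
    have -> : cdfd b t = 1%R by apply/eqP; rewrite eq_le h (cdfd_le1 mb b0 b1).
    rewrite -Pa_goodT; congr (Pa _); apply/seteqP; split => s /=; first by case.
    by move=> gs; split => //; move/andP: gs => [_ /ltW].
  have v01 : (0 <= cdfd b t < 1)%R by rewrite h (cdfd_ge0 mb b0 b1).
  have -> : [set s | good s] `&` [set s | (cdfd a s <= cdfd b t)%R] =
     [set s | (cdfd a s <= cdfd b t)%R] `\` [set s | (cdfd a s <= 0)%R].
    apply/seteqP; split => s; rewrite /good /=.
      by move=> [/andP[h0 h1] ->]; split => //; apply/negP; rewrite -ltNge.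
    move=> [h0 /negP]; rewrite -ltNge => ->; split => //.
    exact: le_lt_trans h0 h.
  rewrite measureD; last 3 first.
  - exact: measurable_cdfd_le.
  - exact: measurable_cdfd_le.
  - apply: (@le_lt_trans _ _ (cdfd b t)%:E); last exact: ltry.
    by rewrite le_eqVlt; apply/orP; left; apply/eqP; exact: mdens_cdfd_le.
  rewrite [X in _ - Pa X](_ : _ = [set s | (cdfd a s <= 0)%R]); last first.
    apply/seteqP; split => s /=; [by case|move=> h'; split => //].
    by apply: le_trans h' _; move/andP: v01 => [].
  rewrite -[RHS]sube0; congr (_ - _); first exact: mdens_cdfd_le.
  by apply: (mdens_cdfd_le ma a0 a1); rewrite lexx ltr01.
have QT : Q setT < +oo.
  apply: (@le_lt_trans _ _ (Pa setT)).
    apply: ge0_le_integral => //; try by move=> x _; rewrite lee_fin mulr_ge0// ag_ge0.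
    - by apply: wpush_measurable => //; [exact: measurable_ag|exact: measurable_tau].
    - exact: wpush_measurable.
    - move=> x _; rewrite lee_fin !indicT !mulr1 /ag ler_piMr//.
      by case: good.
  apply: (@le_lt_trans _ _ 1); last exact: ltry.
  by rewrite le_eqVlt; apply/orP; left; apply/eqP; exact: mdensT.
have Qoc c d : Q `]c, d]%classic < +oo.
  by apply: le_lt_trans QT; apply: le_measure; rewrite ?inE.
apply: (measure_eq_itvoc (m1 := Q) (m2 := Pb)) => // c d cd.
have -> : `]c, d]%classic = `]-oo, d] `\` `]-oo, c].
  by rewrite -[RHS]setCK setCD setCitvl setUC -[LHS]setCK setCitv.
have sub : `]-oo, d] `&` `]-oo, c]%classic = `]-oo, c]%classic.
  by rewrite setIidr//; apply: subset_itvl; rewrite bnd_simp.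
have fQ : Q `]-oo, d]%classic < +oo.
  by apply: le_lt_trans QT; apply: le_measure; rewrite ?inE.
have fPb : Pb `]-oo, d]%classic < +oo.
  by apply: le_lt_trans fQ; rewrite le_eqVlt; apply/orP; left; apply/eqP/esym; exact: Qle.
transitivity (Q `]-oo, d]%classic - Q `]-oo, c]%classic).
  by rewrite measureD// sub.
by rewrite measureD// sub; congr (_ - _); exact: Qle.
Qed.

(* The density ratio plays the role of the derivative of [tau]. *)
Definition dtau (s : R) : R := (ag s / b (tau s))%R.

Lemma dtau_ge0 s : (0 <= dtau s)%R.
Proof. by rewrite divr_ge0// ag_ge0. Qed.

Lemma measurable_dtau : measurable_fun setT dtau.
Proof.
apply: measurable_funM; first exact: measurable_ag.
apply: measurable_inv_ge0 => //; exact: measurableT_comp measurable_tau.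
Qed.

Lemma ge0_integral_tau (F : R -> \bar R) : measurable_fun setT F ->
  (forall y, 0 <= F y) ->
  \int[lebR]_s ((ag s)%:E * F (tau s)) = \int[lebR]_t ((b t)%:E * F t).
Proof.
move=> mF F0.
rewrite (ge0_eq_integral_wpush measurable_ag ag_ge0 measurable_tau (n := Pb))//.
  by rewrite ge0_integral_wpush.
exact: wpush_tau.
Qed.

(** Dividing the source weight by [b (tau s)] divides the target density by itself; as inverses of
    zero are zero, what remains of it is the indicator of its support. *)
Lemma ge0_integral_dtau (F : R -> \bar R) : measurable_fun setT F ->
  (forall y, 0 <= F y) ->
  \int[lebR]_s ((dtau s)%:E * F (tau s)) =
  \int[lebR]_t ((b t != 0%R)%:R%:E * F t).
Proof.
move=> mF F0.
have mib : measurable_fun setT (EFin \o (fun t => (b t)^-1)%R).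
  by apply/measurable_EFinP; exact: measurable_inv_ge0.
rewrite (eq_integral (fun s => (ag s)%:E * (((b (tau s))^-1)%:E * F (tau s)))); last first.
  by move=> s _; rewrite muleA.
rewrite (ge0_integral_tau (F := fun t => ((b t)^-1)%:E * F t)).
- apply: eq_integral => t _; rewrite muleA -EFinM.
  by have [->|bt] := eqVneq (b t) 0%R; rewrite ?mul0r// mulfV.
- exact: emeasurable_funM.
- by move=> y; rewrite mule_ge0// lee_fin invr_ge0.
Qed.

Lemma wpush_dtau (A : set R) : measurable A -> wpush lebR dtau tau A <= lebR A.
Proof.
move=> mA; rewrite /wpush.
under eq_integral do rewrite EFinM.
rewrite (ge0_integral_dtau (F := fun t => (\1_A t)%:E))//; last first.
  exact/measurable_EFinP.
have -> : lebR A = \int[lebR]_t (\1_A t)%:E by rewrite integral_indic// setIT.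
apply: ge0_le_integral => //.
- apply: emeasurable_funM; last exact/measurable_EFinP.
  apply/measurable_EFinP/measurable_natr_bool.
  apply: measurable_neg; exact: measurable_fun_eqr.
- exact/measurable_EFinP.
- by move=> t _; case: (b t != 0%R); rewrite ?mul1e// mul0e lee_fin.
Qed.

(** The part of the mass of [a] that is good and lands where [b] does not vanish is transported onto
    the whole mass of [b], so the complementary part integrates to 0. *)
Lemma ae_good : {ae lebR, forall s, (a s != 0 -> good s /\ b (tau s) != 0)%R}.
Proof.
have E : \int[lebR]_s (a s * (~~ (good s && (b (tau s) != 0%R)))%:R)%:E = 0.
  have mg : measurable_fun setT (fun s => good s && (b (tau s) != 0%R)).
    apply: measurable_and; first exact: measurable_good.
    apply: measurable_neg; apply: measurable_fun_eqr => //.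
    exact: measurableT_comp measurable_tau.
  have mh : measurable_fun setT (fun s => (~~ (good s && (b (tau s) != 0%R)))%:R : R).
    by apply: measurable_natr_bool; exact: measurable_neg.
  have mh' : measurable_fun setT (fun s => (good s && (b (tau s) != 0%R))%:R : R).
    exact: measurable_natr_bool.
  have e1 : \int[lebR]_s (a s * (good s && (b (tau s) != 0%R))%:R)%:E = 1.
    rewrite -b1 (eq_integral (fun s => (ag s)%:E * ((b (tau s) != 0%R)%:R)%:E)); last first.
      move=> s _; rewrite /ag -EFinM -mulrA; congr (_ * _)%:E.
      by case: good; rewrite ?mul1r ?mul0r.
    have mnb : measurable_fun setT (fun t => (b t != 0%R)%:R : R).
      apply: measurable_natr_bool.
      apply: measurable_neg; exact: measurable_fun_eqr.
    rewrite (ge0_integral_tau (F := fun t => ((b t != 0%R)%:R)%:E)) => [||y]; last 2 first.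
    - exact/measurable_EFinP.
    - by rewrite lee_fin.
    by apply: eq_integral => t _; rewrite -EFinM; case: eqVneq => [->|]; rewrite ?mulr1 ?mulr0.
  have : \int[lebR]_s (a s)%:E = \int[lebR]_s (a s * (good s && (b (tau s) != 0%R))%:R)%:E
       + \int[lebR]_s (a s * (~~ (good s && (b (tau s) != 0%R)))%:R)%:E.
    rewrite -ge0_integralD//; last 4 first.
    - by move=> s _; rewrite lee_fin mulr_ge0.
    - by apply/measurable_EFinP; apply: measurable_funM.
    - by move=> s _; rewrite lee_fin mulr_ge0.
    - by apply/measurable_EFinP; apply: measurable_funM.
    apply: eq_integral => s _; rewrite -EFinD -mulrDr; congr EFin.
    by case: (_ && _); rewrite ?(addr0, add0r) mulr1.
  rewrite a1 e1; set X := (X in _ + X); rewrite -/X.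
  have X0 : 0 <= X by apply: integral_ge0 => s _; rewrite lee_fin mulr_ge0.
  case: X X0 => // r _; rewrite -EFinD => -[] h.
  by congr EFin; lra.
have mg : measurable_fun setT (fun s => (a s * (~~ (good s && (b (tau s) != 0%R)))%:R)%:E).
  apply/measurable_EFinP; apply: measurable_funM => //.
  apply: measurable_natr_bool.
  apply: measurable_neg; apply: measurable_and; first exact: measurable_good.
  apply: measurable_neg; apply: measurable_fun_eqr => //.
  exact: measurableT_comp measurable_tau.
have := (ae_eq_integral_abs lebR measurableT mg).1.
move=> /(_ _)/wrap[].
  rewrite -[RHS]E; apply: eq_integral => s _.
  by rewrite gee0_abs// lee_fin mulr_ge0.
apply: filterS => s /(_ I) /= [] /eqP; rewrite mulf_eq0 => /orP[/eqP -> /eqP//|].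
by rewrite pnatr_eq0 eqb0 negbK => /andP[gs bs] _.
Qed.

End transport.

Lemma measurable_invr d (T : measurableType d) (R : realType) (f : T -> R) :
  measurable_fun setT f -> measurable_fun setT (fun x => (f x)^-1).
Proof.
move=> mf; rewrite (_ : (fun x => _) = (fun x => f x * (f x ^+ 2)^-1)).
  apply: measurable_funM => //; apply: measurable_inv_ge0.
    exact: measurable_funX.
  by move=> x; exact: sqr_ge0.
apply/funext => x; have [->|fx] := eqVneq (f x) 0; first by rewrite invr0 mul0r.
by rewrite expr2 invfM mulrA mulfV// mul1r.
Qed.

Section ae_integral.
Context d (T : measurableType d) (R : realType) (m : {measure set T -> \bar R}).
Implicit Types f g : T -> R.

Lemma ae0_integral g : measurable_fun setT g -> (forall x, 0 <= g x) ->
  (\int[m]_x (g x)%:E = 0)%E -> {ae m, forall x, g x = 0}.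
Proof.
move=> mg g0 h.
have mgE : measurable_fun setT (EFin \o g) by exact/measurable_EFinP.
have H := (ae_eq_integral_abs m measurableT mgE).1.
have : (\int[m]_x `|(EFin \o g) x| = 0)%E.
  by rewrite -[RHS]h; apply: eq_integral => x _ /=; rewrite ger0_norm.
by move=> /H; apply: filterS => x /(_ I) /= [].
Qed.

Lemma ge0_integral_ae0 g : measurable_fun setT g -> (forall x, 0 <= g x) ->
  {ae m, forall x, g x = 0} -> (\int[m]_x (g x)%:E = 0)%E.
Proof.
move=> mg g0 h; rewrite -(integral0 m setT).
apply: ge0_ae_eq_integral => //; first exact/measurable_EFinP.
  by move=> x _; rewrite lee_fin.
by apply: filterS h => x -> _.
Qed.

Lemma integral_saturated f g : measurable_fun setT f -> measurable_fun setT g ->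
  (forall x, 0 <= f x) -> (forall x, f x <= g x) ->
  (\int[m]_x (f x)%:E < +oo)%E -> (\int[m]_x (g x)%:E <= \int[m]_x (f x)%:E)%E ->
  {ae m, forall x, f x = g x}.
Proof.
move=> mf mg f0 fg foo gf.
have d0 x : 0 <= g x - f x by rewrite subr_ge0.
have mgf : measurable_fun setT (fun x => g x - f x) by exact: measurable_funB.
have E : (\int[m]_x (g x)%:E = \int[m]_x (f x)%:E + \int[m]_x (g x - f x)%:E)%E.
  rewrite -ge0_integralD//; try exact/measurable_EFinP; try by move=> x _; rewrite lee_fin.
  by apply: eq_integral => x _; rewrite -EFinD addrC subrK.
have /(ae0_integral mgf d0) : (\int[m]_x (g x - f x)%:E = 0)%E.
  move: gf; rewrite E.
  have : (0 <= \int[m]_x (f x)%:E)%E by apply: integral_ge0 => x _; rewrite lee_fin.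
  have : (0 <= \int[m]_x (g x - f x)%:E)%E by apply: integral_ge0 => x _; rewrite lee_fin.
  case: (\int[m]_x (g x - f x)%:E)%E => [r| |]//; case: (\int[m]_x (f x)%:E)%E foo => [q| |]// _.
  by rewrite !lee_fin => r0 _ h; congr EFin; lra.
by apply: filterS => x h; lra.
Qed.

End ae_integral.

(** * The one-dimensional Gaussian density and the logarithmic coordinate *)

Section gauss1.
Context {R : realType}.
Implicit Types s z : R.

Definition gam1 z : R := (Num.sqrt (2 * pi))^-1 * expR (- z ^+ 2 / 2).

Lemma sqrt2pi_gt0 : 0 < Num.sqrt (2 * pi) :> R.
Proof. by rewrite sqrtr_gt0 mulr_gt0// pi_gt0. Qed.

Lemma gam1_gt0 z : 0 < gam1 z.
Proof. by rewrite mulr_gt0 ?invr_gt0 ?sqrt2pi_gt0 ?expR_gt0. Qed.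

Lemma gam1N z : gam1 (- z) = gam1 z.
Proof. by rewrite /gam1 sqrrN. Qed.

Lemma measurable_gam1 : measurable_fun setT gam1.
Proof.
apply: measurable_funM => //; apply: measurableT_comp; first exact: measurable_expR.
by apply: measurable_funM => //; apply: measurable_funN; exact: measurable_funX.
Qed.

Lemma gam1_normal z : gam1 z = normal_pdf 0 1 z.
Proof.
rewrite /normal_pdf oner_eq0 /normal_peak /normal_fun /gam1 subr0 expr1n mul1r.
by rewrite -[pi *+ 2]mulr_natl.
Qed.

Lemma continuous_gam1 : continuous gam1.
Proof.
move=> x; apply: (@continuousM R R (cst _) (fun z => expR (- z ^+ 2 / 2))).
  exact: cst_continuous.
apply: continuous_comp; last exact: continuous_expR.
apply: (@continuousM R R (fun z => - z ^+ 2) (cst _)); last exact: cst_continuous.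
by apply: continuousN; exact: exprn_continuous.
Qed.

Lemma integral_gam1 : (\int[lebR]_z (gam1 z)%:E = 1)%E.
Proof.
rewrite ge0_integral_lebR//; last 2 first.
- by apply/measurable_EFinP; exact: measurable_gam1.
- by move=> z; rewrite lee_fin ltW// gam1_gt0.
by under eq_integral do rewrite gam1_normal; exact: integral_normal_pdf.
Qed.

Lemma integral_gam1_half :
  (\int[lebR]_z (gam1 z * (0 < z)%R%:R)%:E = (2^-1)%:E :> \bar R)%E.
Proof.
have mg : measurable_fun setT (EFin \o gam1).
  by apply/measurable_EFinP; exact: measurable_gam1.
have g0 z : (0 <= (gam1 z)%:E)%E by rewrite lee_fin ltW// gam1_gt0.
have := integral_gam1; rewrite ge0_integral_lebR//.
rewrite ge0_symfun_integralT; last 3 first.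
- by move=> x; exact: ltW (gam1_gt0 x).
- exact: continuous_gam1.
- by move=> x; rewrite /= gam1N.
rewrite (_ : [set x | _] = `[0%R, +oo[%classic); last first.
  by apply/seteqP; split => x /=; rewrite in_itv/= andbT.
rewrite -integral_itv_obnd_cbnd//; last first.
  by apply/measurable_EFinP; apply: measurable_funTS; exact: measurable_gam1.
rewrite -ge0_integral_lebR//; last exact: measurable_funTS.
rewrite (_ : (\int[lebR]_(x in _) _)%E = (\int[lebR]_z (gam1 z * (0 < z)%R%:R)%:E)%E).
  move=> h.
  set X := (X in (_ * X)%E) in h; rewrite -/X.
  have : (0 <= X)%E by apply: integral_ge0 => z _; rewrite lee_fin mulr_ge0// ltW// gam1_gt0.
  case: X h => [r| |]//.
    by rewrite -EFinM => -[] h _; congr EFin; lra.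
  by rewrite gt0_muley// lte_fin.
rewrite integral_mkcond; apply: eq_integral => z _; rewrite patchE.
have -> : (z \in `]0%R, +oo[%classic) = (0 < z).
  by apply/idP/idP; rewrite inE/= in_itv/= andbT.
by case: ifPn => _; rewrite ?mulr1 ?mulr0.
Qed.

Lemma lebR_ocitv (c d : R) : c <= d -> lebR `]c, d]%classic = (d - c)%:E.
Proof.
rewrite lebR_itv/= lte_fin; case: ltP => // dc cd; congr EFin.
by have -> : d = c; [apply/eqP; rewrite eq_le dc|rewrite subrr].
Qed.

Lemma lebR_ccitv (c d : R) : c <= d -> lebR `[c, d]%classic = (d - c)%:E.
Proof.
rewrite lebR_itv/= lte_fin; case: ltP => // dc cd; congr EFin.
by have -> : d = c; [apply/eqP; rewrite eq_le dc|rewrite subrr].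
Qed.

(** Change of variables by the logarithm, tested on half-open intervals, where it is the fundamental
    theorem of calculus for [1 / s]. *)
Lemma wpush_ln (A : set R) : measurable A ->
  wpush lebR (fun s => (0 < s)%R%:R / s) (@ln R) A = lebR A.
Proof.
move=> mA; set k := (fun s : R => _).
have mk : measurable_fun setT k.
  apply: measurable_funM; last exact: measurable_invr.
  by apply: measurable_natr_bool; exact: measurable_fun_ltr.
have k0 s : 0 <= k s.
  by rewrite /k; case: (ltP 0 s) => [s0|_]; rewrite ?mul0r// mul1r invr_ge0 ltW.
have mln := @measurable_ln R.
pose Q := wpush_m lebR mk k0 mln.
have QE c d : c <= d -> Q `]c, d]%classic = (d - c)%:E.
  rewrite le_eqVlt => /orP[/eqP ->|cd].
    by rewrite set_itvoc0 measure0 subrr.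
  have ecd : expR c < expR d by rewrite ltr_expR.
  transitivity (\int[lebR]_(s in `]expR c, expR d]) (k s)%:E)%E.
    rewrite integral_mkcond; apply: eq_integral => s _; rewrite patchE indicE.
    have -> : (s \in `]expR c, expR d]%classic) = (0 < s) && (ln s \in `]c, d]%classic).
      apply/idP/idP; rewrite !inE/= !in_itv/=.
        move=> /andP[cs sd]; have s0 : 0 < s by apply: lt_trans cs; rewrite expR_gt0.
        rewrite s0 mem_set//= in_itv/= -ltr_expR -ler_expR lnK//.
        by rewrite cs sd.
      move=> /andP[s0]; rewrite inE/= in_itv/=.
      by rewrite -ltr_expR -ler_expR lnK.
    rewrite /k; case: (ltP 0 s) => s0 /=; last by rewrite !mul0r.
    by case: ifPn; rewrite ?mulr1 ?mulr0.
  rewrite ge0_integral_lebR//; last first.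
    by apply: measurable_funTS; exact/measurable_EFinP.
  transitivity (\int[lebesgue_measure]_(s in `]expR c, expR d]) (s^-1)%:E)%E.
    apply: eq_integral => s; rewrite inE/= in_itv/= => /andP[cs _].
    by rewrite /k (lt_trans _ cs) ?expR_gt0// mul1r.
  have s0 x : x \in `[expR c, expR d] -> 0 < x.
    by rewrite in_itv/= => /andP[/(lt_le_trans (expR_gt0 c))].
  have cV : {within `[expR c, expR d], continuous (fun s : R => s^-1)}.
    apply: continuous_in_subspaceT => x; rewrite inE => /s0 x0.
    by apply: inv_continuous; rewrite gt_eqF.
  rewrite integral_itv_obnd_cbnd; last first.
    apply/measurable_EFinP/(@measurable_funS _ _ _ _ setT) => //.
    exact: (@measurable_invr _ _ R (fun x : measurableTypeR R => x)).
  rewrite (continuous_FTC2 (F := @ln R))//.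
  - by rewrite !expRK EFinB.
  - split=> [x xi| |].
    + have x0 : 0 < x by apply: s0; exact: subset_itv_oo_cc xi.
      by have [] := is_derive1_ln x0.
    + by apply: cvg_at_right_filter; apply: continuous_ln; exact: expR_gt0.
    + by apply: cvg_at_left_filter; apply: continuous_ln; exact: expR_gt0.
  - move=> x xi; have x0 : 0 < x by apply: s0; exact: subset_itv_oo_cc xi.
    by rewrite derive1E; have h := is_derive1_ln x0; rewrite derive_val.
have -> : wpush lebR k (@ln R) A = Q A by [].
apply: (measure_eq_itvoc (m1 := Q) (m2 := lebR)) => // c d.
  have [cd|dc] := leP c d.
    by apply: (@le_lt_trans _ _ (d - c)%:E); rewrite ?ltry// le_eqVlt; apply/orP; left; apply/eqP; exact: QE.
  rewrite set_itv_ge ?measure0 ?ltry// bnd_simp -leNgt; exact: ltW.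
move=> cd; transitivity (d - c)%:E; first exact: QE.
by apply/esym; exact: lebR_ocitv.
Qed.

(** The positive half of the Gaussian density written in the variable [z = ln s]; hence its total
    mass 1/2. *)
Definition phi1 (z : R) : R := gam1 (expR z) * expR z.

Lemma phi1_gt0 z : 0 < phi1 z.
Proof. by rewrite mulr_gt0 ?gam1_gt0 ?expR_gt0. Qed.

Lemma measurable_phi1 : measurable_fun setT phi1.
Proof.
apply: measurable_funM; last exact: measurable_expR.
by apply: measurableT_comp; [exact: measurable_gam1|exact: measurable_expR].
Qed.

Lemma integral_phi1 : (\int[lebR]_z (phi1 z)%:E = (2^-1)%:E :> \bar R)%E.
Proof.
rewrite -integral_gam1_half.
have mk : measurable_fun setT (fun s : R => (0 < s)%R%:R / s : R).
  apply: measurable_funM; last exact: measurable_invr.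
  by apply: measurable_natr_bool; exact: measurable_fun_ltr.
have k0 (s : R) : 0 <= (0 < s)%R%:R / s.
  by case: (ltP 0 s) => [s0|_]; rewrite ?mul0r// mul1r invr_ge0 ltW.
rewrite -(ge0_eq_integral_wpush mk k0 (@measurable_ln R) (n := lebR) wpush_ln); last 2 first.
- by apply/measurable_EFinP; exact: measurable_phi1.
- by move=> y; rewrite lee_fin ltW// phi1_gt0.
apply: eq_integral => s _; rewrite -EFinM; congr EFin; rewrite /phi1.
case: (ltP 0 s) => s0; rewrite ?mulr0 ?mul0r//.
by rewrite lnK// mul1r mulr1 mulrCA mulVf ?mulr1// gt_eqF.
Qed.

End gauss1.

Lemma weighted_AGM (R : realType) (w t : R) : 0 < w < 1 -> 0 < t ->
  t `^ w <= (1 - w) + w * t ?= iff (t == 1).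
Proof.
move=> /andP[w0 w1] t0; pose L := ln t; pose m := t `^ w.
have m0 : 0 < m by exact: powR_gt0.
have mE : m = expR (w * L) by rewrite /m /powR gt_eqF.
have e1 : 1 = m * expR (- (w * L)) by rewrite mE -expRD subrr expR0.
have e2 : t = m * expR ((1 - w) * L).
  by rewrite mE -expRD mulrBl mul1r addrC subrK lnK.
have E : (1 - w) + w * t - m =
    m * ((1 - w) * (expR (- (w * L)) - (1 - w * L)) +
         w * (expR ((1 - w) * L) - (1 + (1 - w) * L))).
  transitivity ((1 - w) * (m * expR (- (w * L))) + w * (m * expR ((1 - w) * L)) - m).
    by rewrite -e1 -e2 mulr1.
  by ring.
have h1 := expR_ge1Dx (- (w * L)); have h2 := expR_ge1Dx ((1 - w) * L).
have h3 : 0 <= (1 - w) * (expR (- (w * L)) - (1 - w * L)) by rewrite mulr_ge0//; lra.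
have h4 : 0 <= w * (expR ((1 - w) * L) - (1 + (1 - w) * L)) by rewrite mulr_ge0//; lra.
split; first by rewrite -subr_ge0 E mulr_ge0 ?addr_ge0// ltW.
apply/eqP/eqP => [h|->]; last by rewrite powR1; lra.
have [L0|Ln0] := eqVneq L 0; first by rewrite -(lnK t0) -/L L0 expR0.
have wL : - (w * L) != 0 by rewrite oppr_eq0 mulf_neq0// gt_eqF.
have := expR_gt1Dx wL.
have : m * ((1 - w) * (expR (- (w * L)) - (1 - w * L)) +
         w * (expR ((1 - w) * L) - (1 + (1 - w) * L))) = 0 by rewrite -E -h -/m subrr.
move=> /eqP; rewrite mulf_eq0 gt_eqF//= paddr_eq0// mulf_eq0 => /andP[/orP[|] /eqP + _]; lra.
Qed.

Section half.
Context {R : realFieldType}.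
Lemma half_gt0 : 0 < 2^-1 :> R. Proof. by rewrite invr_gt0 ltr0n. Qed.
Lemma onem_half : 1 - 2^-1 = 2^-1 :> R. Proof. lra. Qed.
Lemma half_lt1 : (0 < 2^-1 :> R) && (2^-1 < 1 :> R). Proof. by rewrite half_gt0/=; lra. Qed.
End half.

(** * The arithmetic and geometric interpolations of a monotone map of the half-line *)

(* [E] is the good set of a transport [tau] with formal derivative [dtau]. [hDB]
   and [hDZ] are the resulting formal derivatives of [hB s = (1 - w) s + w tau s]
   and of [hZ s = sqrt (s tau s) = exp (hzeta s)]. *)
Section head.
Context {R : realType}.
Variables (E : R -> bool) (tau dtau : R -> R) (w : R).
Hypotheses (mE : measurable_fun setT E) (mtau : measurable_fun setT tau)
  (mdtau : measurable_fun setT dtau).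
Hypothesis E_gt0 : forall s, E s -> [/\ 0 < s, 0 < tau s & 0 < dtau s].
Hypothesis tau_nd : forall s t, E s -> E t -> s <= t -> tau s <= tau t.
Hypothesis tau_le : forall A, measurable A ->
  (wpush lebR (fun s => (E s)%:R * dtau s)%R tau A <= lebR A)%E.
Hypothesis w01 : 0 < w < 1.

Definition hpi s : R := (E s)%:R.
Definition hka s : R := (E s)%:R * dtau s.
Definition hB s : R := (1 - w) * s + w * tau s.
Definition hDB s : R := (1 - w) * hpi s + w * hka s.
Definition hZ s : R := Num.sqrt (s * tau s).
Definition hpil s : R := (E s)%:R / s.
Definition hkal s : R := hka s / tau s.
Definition hk s : R := (1 - 2^-1) * hpil s + 2^-1 * hkal s.
Definition hzeta s : R := (1 - 2^-1) * ln s + 2^-1 * ln (tau s).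
Definition hDZ s : R := hZ s * hk s.

Let mhpi : measurable_fun setT hpi.
Proof. by apply: measurable_natr_bool; exact: mE. Qed.
Let mhka : measurable_fun setT hka.
Proof. by apply: measurable_funM. Qed.
Let mhpil : measurable_fun setT hpil.
Proof. by apply: measurable_funM => //; exact: measurable_invr. Qed.
Let mhkal : measurable_fun setT hkal.
Proof. by apply: measurable_funM => //; exact: measurable_invr. Qed.
Let mhk : measurable_fun setT hk.
Proof. by apply: measurable_funD; apply: measurable_funM. Qed.
Let mhzeta : measurable_fun setT hzeta.
Proof.
apply: measurable_funD; apply: measurable_funM => //.
by apply: measurableT_comp mtau; exact: measurable_ln.
Qed.

Let hpi_ge0 s : 0 <= hpi s. Proof. exact: ler0n. Qed.
Let hka_ge0 s : 0 <= hka s. Proof. rewrite /hka; have [/E_gt0[_ _ d0]|_] := boolP (E s); last by rewrite mul0r.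
by rewrite mul1r ltW.
Qed.
Let hpil_ge0 s : 0 <= hpil s.
Proof.
rewrite /hpil; have [/E_gt0[s0 _ _]|_] := boolP (E s); last by rewrite mul0r.
by rewrite mul1r invr_ge0 ltW.
Qed.
Let hkal_ge0 s : 0 <= hkal s.
Proof.
rewrite /hkal/hka; have [/E_gt0[s0 t0 d0]|_] := boolP (E s); last by rewrite !mul0r.
by rewrite mul1r divr_ge0// ltW.
Qed.
Let hk_ge0 s : 0 <= hk s.
Proof.
by rewrite /hk onem_half -mulrDr mulr_ge0 ?addr_ge0 ?hpil_ge0 ?hkal_ge0// ltW// half_gt0.
Qed.

Lemma hE_wpush_id (A : set R) : measurable A -> (wpush lebR hpi id A <= lebR A)%E.
Proof.
move=> mA; have -> : lebR A = (\int[lebR]_t (\1_A t)%:E)%E by rewrite integral_indic// setIT.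
apply: ge0_le_integral => //.
- by move=> s _; rewrite lee_fin mulr_ge0.
- exact: wpush_measurable.
- exact/measurable_EFinP.
- by move=> s _; rewrite lee_fin ler_piMl// /hpi; case: (E s).
Qed.

(** The comonotone functions are the identity and [tau]. The weight vanishes outside [E], where
    moreover [hB] is positive, so inserting the indicator of the half-line changes nothing on the
    left. *)
Lemma ge0_integral_hDB (phi : R -> \bar R) : measurable_fun setT phi ->
  (forall t, 0 <= phi t)%E ->
  (\int[lebR]_s ((hDB s)%:E * phi (hB s)) <=
   \int[lebR]_t ((0 < t)%R%:R%:E * phi t))%E.
Proof.
move=> mphi phi0; have /andP[w0 w1] := w01.
have mDB : measurable_fun setT hDB by apply: measurable_funD; apply: measurable_funM.
have mB : measurable_fun setT hB by apply: measurable_funD; apply: measurable_funM.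
have w1' : 0 <= 1 - w by rewrite subr_ge0 ltW.
have DB0 s : 0 <= hDB s by rewrite addr_ge0// mulr_ge0// ltW.
pose F t := ((0 < t)%R%:R%:E * phi t)%E.
apply: (@le_trans _ _ (\int[lebR]_s ((hDB s)%:E * F (hB s)))%E).
  rewrite le_eqVlt; apply/orP; left; apply/eqP; apply: eq_integral => s _.
  rewrite /hDB /hpi /hka /F; have [hs|_] := boolP (E s); last first.
    by rewrite mul0r !mulr0 addr0 !mul0e.
  have [s0 t0 _] := E_gt0 hs.
  have -> : 0 < hB s by rewrite addr_gt0// mulr_gt0// subr_gt0.
  by rewrite mul1e.
apply: (ge0_le_integral_wpush mDB DB0 mB); last 2 first.
- apply: emeasurable_funM => //; apply/measurable_EFinP; apply: measurable_natr_bool.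
  exact: measurable_fun_ltr.
- by move=> t; rewrite mule_ge0// lee_fin ler0n.
apply: (comonotone_wpush (E := [set s | E s])) => //.
- by move=> s /negP; rewrite /hpi => /negbTE ->.
- by move=> s /negP; rewrite /hka => /negbTE ->; rewrite mul0r.
- exact: hE_wpush_id.
Qed.

Lemma hE_wpush_ln (A : set R) : measurable A -> (wpush lebR hpil (@ln R) A <= lebR A)%E.
Proof.
move=> mA; rewrite -(wpush_ln mA); apply: ge0_le_integral => //.
- by move=> s _; rewrite lee_fin mulr_ge0.
- exact: wpush_measurable.
- apply: wpush_measurable => //.
  apply: measurable_funM; last exact: measurable_invr.
  by apply: measurable_natr_bool; exact: measurable_fun_ltr.
- move=> s _; rewrite lee_fin ler_wpM2r// /hpil.
  have [/E_gt0[s0 _ _]|_] := boolP (E s); first by rewrite s0.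
  by rewrite mul0r; case: (ltP 0 s) => [s0|_]; rewrite ?mul0r// mul1r invr_ge0 ltW.
Qed.

(** A chain rule for push-forward bounds: the inequality for [tau] is composed with the exact change
    of variables by the logarithm. *)
Lemma hE_wpush_lntau (A : set R) : measurable A ->
  (wpush lebR hkal (fun s => ln (tau s)) A <= lebR A)%E.
Proof.
move=> mA; rewrite -(wpush_ln mA).
have mk : measurable_fun setT (fun s : R => (0 < s)%R%:R / s : R).
  apply: measurable_funM; last exact: measurable_invr.
  by apply: measurable_natr_bool; exact: measurable_fun_ltr.
have k0 (s : R) : 0 <= (0 < s)%R%:R / s.
  by case: (ltP 0 s) => [s0|_]; rewrite ?mul0r// mul1r invr_ge0 ltW.
have mF : measurable_fun setT (fun t : R => ((0 < t)%R%:R / t * \1_A (ln t))%:E).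
  exact: wpush_measurable.
have := @ge0_le_integral_wpush _ _ _ _ _ lebR hka tau mhka hka_ge0 mtau lebR
  (fun t => ((0 < t)%R%:R / t * \1_A (ln t))%:E)
  tau_le mF.
have F0 t : (0 <= ((0 < t)%R%:R / t * \1_A (ln t))%:E)%E by rewrite lee_fin mulr_ge0.
move=> /(_ F0); apply: le_trans.
apply: ge0_le_integral => //.
- by move=> s _; rewrite lee_fin mulr_ge0.
- apply: wpush_measurable => //; exact: measurableT_comp mtau.
- apply: emeasurable_funM; first exact/measurable_EFinP.
  exact: measurableT_comp mF mtau.
- move=> s _; rewrite -EFinM lee_fin mulrA ler_wpM2r//= /hkal /hka.
  have [/E_gt0[_ t0 _]|_] := boolP (E s); first by rewrite t0 !mul1r.
  by rewrite !mul0r.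
Qed.

Lemma hzeta_nd s t : E s -> E t -> s <= t -> hzeta s <= hzeta t.
Proof.
move=> hs ht st; have [s0 ts0 _] := E_gt0 hs; have [t0 tt0 _] := E_gt0 ht.
have h1 : ln s <= ln t by rewrite ler_ln.
have h2 : ln (tau s) <= ln (tau t) by rewrite ler_ln ?tau_nd.
by rewrite /hzeta onem_half lerD// ler_wpM2l// ltW// half_gt0.
Qed.

(** In logarithmic coordinates the geometric mean of [s] and [tau s] is the half-sum of [ln s] and
    [ln (tau s)], so the lemma on comonotone functions applies again with weight 1/2. *)
Lemma hE_wpush_hzeta (A : set R) : measurable A ->
  (wpush lebR hk hzeta A <= lebR A)%E.
Proof.
move=> mA; apply: (comonotone_wpush (E := [set s | E s])) => //.
- exact: measurableT_comp mtau.
- by move=> s /negP; rewrite /hpil => /negbTE ->; rewrite mul0r.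
- by move=> s /negP; rewrite /hkal /hka => /negbTE ->; rewrite !mul0r.
- by move=> s t /E_gt0[s0 _ _] /E_gt0[t0 _ _] st; rewrite ler_ln.
- by move=> s t hs ht st; have [_ s0 _] := E_gt0 hs; have [_ t0 _] := E_gt0 ht;
    rewrite ler_ln ?tau_nd.
- exact: half_lt1.
- exact: hE_wpush_ln.
- exact: hE_wpush_lntau.
Qed.

Lemma hDZ_gam1 s : hDZ s * gam1 (hZ s) = hk s * phi1 (hzeta s).
Proof.
rewrite /hDZ /hk /hpil /hkal /hka; have [hs|_] := boolP (E s); last first.
  by rewrite !mul0r !mulr0 addr0 mulr0 !mul0r.
have [s0 t0 _] := E_gt0 hs.
suff -> : hZ s = expR (hzeta s) by rewrite /phi1; ring.
rewrite /hZ -(@lnK _ (Num.sqrt _)) ?posrE ?sqrtr_gt0 ?mulr_gt0//; congr expR.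
rewrite -powR12_sqrt ?mulr_ge0 ?ltW// ln_powR lnM ?posrE// /hzeta onem_half mulrDr; ring.
Qed.

(** The values of [hZ] fill at most the positive half-line, which has Gaussian mass 1/2. *)
Lemma ge0_integral_hDZ : (\int[lebR]_s (hDZ s * gam1 (hZ s))%:E <= (2^-1)%:E)%E.
Proof.
under eq_integral do rewrite hDZ_gam1 EFinM.
rewrite -integral_phi1.
apply: (ge0_le_integral_wpush mhk hk_ge0 mhzeta (n := lebR) (F := EFin \o phi1)).
- exact: hE_wpush_hzeta.
- by apply/measurable_EFinP; exact: measurable_phi1.
- by move=> y; rewrite lee_fin ltW// phi1_gt0.
Qed.

Lemma hDB_leif s : E s -> dtau s `^ w <= hDB s ?= iff (dtau s == 1).
Proof.
move=> hs; have [_ _ d0] := E_gt0 hs.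
by rewrite /hDB /hpi /hka hs mulr1 mul1r; exact: weighted_AGM.
Qed.

Lemma hDB_ge s : E s -> 1 - w <= hDB s.
Proof.
move=> hs; have [_ _ d0] := E_gt0 hs; have /andP[w0 _] := w01.
rewrite /hDB /hpi /hka hs mulr1 mul1r.
by rewrite lerDl mulr_ge0// ltW.
Qed.

Lemma hZ_sqr s : E s -> hZ s ^+ 2 = s * tau s.
Proof. by move=> /E_gt0[s0 t0 _]; rewrite sqr_sqrtr// mulr_ge0// ltW. Qed.

(** The square of [hDZ s] exceeds [dtau s] by exactly [(s * tau s / 4) * (s^-1 - dtau s / tau s) ^+
    2], so equality means that [s] and [tau s] have the same logarithmic derivative. *)
Lemma hDZ_leif s : E s -> Num.sqrt (dtau s) <= hDZ s ?= iff (dtau s == tau s / s).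
Proof.
move=> hs; have [s0 t0 d0] := E_gt0 hs.
have Z0 : 0 < hZ s by rewrite sqrtr_gt0 mulr_gt0.
have D0 : 0 < hDZ s.
  have h2 := @half_gt0 R.
  have d1 := divr_gt0 d0 t0; have s1 : 0 < s^-1 by rewrite invr_gt0.
  rewrite /hDZ/hk/hpil/hkal/hka hs !mul1r onem_half.
  by apply: mulr_gt0 => //; apply: addr_gt0; exact: mulr_gt0.
have EE : hDZ s ^+ 2 = dtau s + (s * tau s / 4) * (s^-1 - dtau s / tau s) ^+ 2.
  rewrite /hDZ exprMn hZ_sqr// /hk /hpil /hkal /hka hs !mul1r.
  by field; rewrite !gt_eqF.
have q0 : 0 < s * tau s / 4 by rewrite divr_gt0 ?mulr_gt0.
have e : (dtau s == tau s / s) = (s^-1 - dtau s / tau s == 0).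
  apply/eqP/eqP => [->|]; first by field; rewrite !gt_eqF.
  by move=> h; have -> : dtau s = tau s * (s^-1 - (s^-1 - dtau s / tau s)) by [field; rewrite !gt_eqF]; rewrite h subr0.
have D : hDZ s = Num.sqrt (hDZ s ^+ 2) by rewrite sqrtr_sqr gtr0_norm.
have X0 := mulr_ge0 (ltW q0) (sqr_ge0 (s^-1 - dtau s / tau s)).
split.
  by rewrite D ler_sqrt ?sqr_ge0// EE lerDl.
rewrite e; apply/eqP/eqP => [h|h].
  have : dtau s = hDZ s ^+ 2 by rewrite -h sqr_sqrtr// ltW.
  rewrite EE => /eqP; rewrite eq_sym -subr_eq0 addrAC subrr add0r mulf_eq0 gt_eqF//=.
  by rewrite sqrf_eq0 => /eqP.
by rewrite [RHS]D EE h expr0n/= mulr0 addr0.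
Qed.

Section head_equality.
Hypothesis sat : {ae lebR, forall s, E s -> hDZ s = Num.sqrt (dtau s)}.
Hypothesis half : (\int[lebR]_s (hDZ s * gam1 (hZ s))%:E = (2^-1)%:E)%E.

Let hkE : {ae lebR, forall s, hkal s = hpil s /\ hk s = hpil s}.
Proof.
apply: filterS sat => s sats.
suff e : hkal s = hpil s by split => //; rewrite /hk e -mulrDl subrK mul1r.
rewrite /hkal /hka /hpil; have [hs|_] := boolP (E s); last by rewrite !mul0r.
have [_ /esym] := hDZ_leif hs; rewrite -(sats hs) eqxx => /eqP ->.
have [s0 t0 _] := E_gt0 hs; by field; rewrite !gt_eqF.
Qed.

Let hk_phi1 : (\int[lebR]_s (hk s * phi1 (hzeta s))%:E = (2^-1)%:E)%E.
Proof. by rewrite -half; apply: eq_integral => s _; rewrite hDZ_gam1. Qed.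

(** The push-forward of [hk] is at most Lebesgue measure, yet integrates the positive function
    [phi1] to its full integral 1/2; no interval can then lose mass. *)
Let hk_itv c d : c <= d -> wpush lebR hk hzeta `]c, d]%classic = (d - c)%:E.
Proof.
move=> cd.
pose I : set R := `]c, d]%classic.
have mI : measurable I by exact: measurable_itv.
pose e := expR c * gam1 (expR d).
have e0 : 0 < e by rewrite mulr_gt0 ?expR_gt0 ?gam1_gt0.
have phie t : I t -> e <= phi1 t.
  rewrite /I/= in_itv/= => /andP[ct td]; rewrite /phi1 mulrC ler_pM ?expR_ge0//.
  - by rewrite ltW// gam1_gt0.
  - by rewrite ler_expR ltW.
  - rewrite /gam1 ler_pM2l ?invr_gt0 ?sqrt2pi_gt0// ler_expR ler_pM2r ?half_gt0// lerN2.
    by rewrite ler_pXn2r ?nnegrE ?expR_ge0// ler_expR.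
pose psi t := phi1 t - e * \1_I t.
have psi0 t : 0 <= psi t.
  rewrite /psi indicE; have [|_] := boolP (t \in I).
    by rewrite inE mulr1 subr_ge0 => /phie.
  by rewrite mulr0 subr0 ltW// phi1_gt0.
have mpsi : measurable_fun setT psi.
  by apply: measurable_funB; [exact: measurable_phi1|apply: measurable_funM].
have mphi : measurable_fun setT (EFin \o @phi1 R) by apply/measurable_EFinP; exact: measurable_phi1.
pose N := wpush_m lebR mhk hk_ge0 mhzeta.
have NI : (N I <= lebR I)%E by exact: hE_wpush_hzeta.
have split (m : {measure set R -> \bar R}) :
    (\int[m]_t (phi1 t)%:E = e%:E * m I + \int[m]_t (psi t)%:E)%E.
  rewrite -integral_cst// integral_mkcond -ge0_integralD//.
  - apply: eq_integral => t _; rewrite patchE /psi indicE; case: (t \in I) => /=.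
      by rewrite mulr1 -EFinD addrC subrK.
    by rewrite mulr0 subr0 add0e.
  - by move=> t _; rewrite patchE; case: ifP => // _; rewrite lee_fin ltW.
  - by apply/(measurable_restrictT _ _).1 => //; exact: measurable_cst.
  - by move=> t _; rewrite lee_fin.
  - exact/measurable_EFinP.
have hN : (\int[N]_t (phi1 t)%:E = (2^-1)%:E)%E.
  rewrite -hk_phi1 (ge0_integral_wpush lebR mhk hk_ge0 mhzeta) => [||y]//.
  by rewrite lee_fin ltW// phi1_gt0.
have pN : (\int[N]_t (psi t)%:E <= \int[lebR]_t (psi t)%:E)%E.
  apply: ge0_le_measure_integral => //.
  - by move=> B mB; exact: hE_wpush_hzeta.
  - exact/measurable_EFinP.
have lI : lebR I = (d - c)%:E by exact: lebR_ocitv.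
have sl : (\int[lebR]_t (phi1 t)%:E = e%:E * (d - c)%:E + \int[lebR]_t (psi t)%:E)%E.
  by apply: etrans (split lebR) _; congr (_ * _ + _)%E; exact: lI.
have := integral_phi1 (R := R); rewrite -[RHS]hN sl split => h.
have NE : wpush lebR hk hzeta I = N I by [].
rewrite -/I NE; apply/eqP; rewrite eq_le; apply/andP; split; first by rewrite -lI.
move: h NI pN; rewrite lI.
have : (0 <= \int[N]_t (psi t)%:E)%E by apply: integral_ge0 => t _; rewrite lee_fin.
have : (0 <= N I)%E by exact: measure_ge0.
have : (\int[lebR]_t (psi t)%:E < +oo)%E.
  apply: (@le_lt_trans _ _ (\int[lebR]_t (phi1 t)%:E)%E); last by rewrite integral_phi1 ltry.
  apply: ge0_le_integral => //; first by move=> t _; rewrite lee_fin.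
    exact/measurable_EFinP.
  by move=> t _; rewrite lee_fin /psi lerBlDr lerDl mulr_ge0// ltW.
case: (N I) => [r| |]//; case: (\int[N]_t (psi t)%:E)%E => [q| |]//;
  case: (\int[lebR]_t (psi t)%:E)%E => [z| |]//.
rewrite -!EFinM -!EFinD !lee_fin => _ r0 q0 [] h rd qz.
have h' : e * (d - c) <= e * r by lra.
by move: h'; rewrite ler_pM2l.
Qed.

(** The increment of [hzeta] is at most that of [ln s] and at most that of [ln (tau s)]; being their
    average, it equals both. *)
Lemma head_ratio s1 s2 : E s1 -> E s2 -> s1 <= s2 ->
  ln (tau s2) - ln (tau s1) = ln s2 - ln s1.
Proof.
move=> h1 h2 s12.
have [s10 t10 _] := E_gt0 h1; have [s20 t20 _] := E_gt0 h2.
have lns : ln s1 <= ln s2 by rewrite ler_ln.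
have lnt : ln (tau s1) <= ln (tau s2) by rewrite ler_ln// tau_nd.
have I := hk_itv (hzeta_nd h1 h2 s12).
have sub s : E s -> hzeta s \in `]hzeta s1, hzeta s2] -> s1 <= s <= s2.
  rewrite in_itv/= => hs /andP[zs sz]; apply/andP; split.
    rewrite leNgt; apply/negP => ss; have := hzeta_nd hs h1 (ltW ss).
    by rewrite leNgt zs.
  rewrite leNgt; apply/negP => ss; have [s0 t0 _] := E_gt0 hs.
  have l1 : ln s2 < ln s by rewrite ltr_ln.
  have l2 : ln (tau s2) <= ln (tau s) by rewrite ler_ln// tau_nd// ltW.
  by move: sz; rewrite /hzeta onem_half; have := @half_gt0 R; nra.
(* Points of [E] whose [hzeta]-value lies between those of [s1] and [s2] lie between [s1] and [s2]
   themselves. The [hk]-mass of that level interval is thus at most the length swept by [p]. *)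
have bound (k p : R -> R) (mk : measurable_fun setT k) (mp : measurable_fun setT p) :
    (forall s, 0 <= k s) -> {ae lebR, forall s, hk s = k s} ->
    (forall s, E s -> s1 <= s <= s2 -> p s1 <= p s <= p s2) -> p s1 <= p s2 ->
    (forall A, measurable A -> wpush lebR k p A <= lebR A)%E ->
    (forall s, ~~ E s -> k s = 0) ->
    hzeta s2 - hzeta s1 <= p s2 - p s1.
  move=> k0 hkk ps pp kle kE.
  rewrite -lee_fin -I -(lebR_ccitv pp); apply: le_trans (kle _ (measurable_itv _)).
  apply: ae_ge0_le_integral => //.
  - by move=> s _; rewrite lee_fin mulr_ge0.
  - exact: wpush_measurable.
  - by move=> s _; rewrite lee_fin mulr_ge0.
  - exact: wpush_measurable.
  - apply: filterS hkk => s -> _; rewrite lee_fin.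
    have [hs|/kE ->] := boolP (E s); last by rewrite !mul0r.
    apply: ler_wpM2l => //; rewrite !indicE.
    case: (boolP (hzeta s \in _)) => //; rewrite inE/= => /(sub _ hs)/(ps _ hs) pi.
    by rewrite mem_set//= in_itv.
have b1 : hzeta s2 - hzeta s1 <= ln s2 - ln s1.
  apply: (bound hpil (@ln R)) => //.
  - by apply: filterS hkE => s [].
  - move=> s hs /andP[ss1 ss2]; have [s0 _ _] := E_gt0 hs.
    by rewrite !ler_ln// ss1.
  - exact: hE_wpush_ln.
  - by move=> s /negbTE; rewrite /hpil => ->; rewrite mul0r.
have b2 : hzeta s2 - hzeta s1 <= ln (tau s2) - ln (tau s1).
  apply: (bound hkal (fun s => ln (tau s))) => //.
  - exact: measurableT_comp mtau.
  - by apply: filterS hkE => s [-> ->].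
  - move=> s hs /andP[ss1 ss2]; have [_ s0 _] := E_gt0 hs.
    by rewrite !ler_ln ?posrE// !tau_nd.
  - exact: hE_wpush_lntau.
  - by move=> s /negbTE; rewrite /hkal /hka => ->; rewrite !mul0r.
by move: b1 b2; rewrite /hzeta onem_half; lra.
Qed.

(** Constant ratio on [E] comes from [head_ratio]. That [E] is almost the whole half-line follows
    because its logarithmic weight already pushes forward to full Lebesgue measure. *)
Lemma head_linear : exists th, 0 < th /\
  {ae lebR, forall s, 0 < s -> E s /\ tau s = th * s}.
Proof.
have [s0 hs0] : exists s0, E s0.
  apply: contrapT => nE.
  suff : (\int[lebR]_s (hk s * phi1 (hzeta s))%:E = 0)%E.
    by rewrite hk_phi1 => -[] h; have := @half_gt0 R; rewrite h ltxx.
  apply: integral0_eq => s _; have [hs|/negbTE hs] := boolP (E s).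
    by exfalso; apply: nE; exists s.
  by rewrite /hk /hpil /hkal /hka hs !mul0r !mulr0 addr0 mul0r.
have [s00 t00 _] := E_gt0 hs0.
pose th := tau s0 / s0.
have th0 : 0 < th by exact: divr_gt0.
have lnE s : E s -> ln (tau s) = ln s + ln th.
  move=> hs; have [s1 t1 _] := E_gt0 hs.
  rewrite /th lnM ?posrE ?invr_gt0// lnV ?posrE//.
  have [ss|/ltW ss] := leP s s0.
    by have := head_ratio hs hs0 ss; lra.
  by have := head_ratio hs0 hs ss; lra.
have tE s : E s -> tau s = th * s.
  move=> hs; have [s1 t1 _] := E_gt0 hs.
  apply: ln_inj; rewrite ?posrE ?mulr_gt0 ?invr_gt0//.
  by rewrite (lnE _ hs) lnM ?posrE// addrC.
exists th; split => //.
pose N := wpush_m lebR mhpil hpil_ge0 (@measurable_ln R).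
have hN c d : c <= d -> N `]c, d]%classic = (d - c)%:E.
  (* On [E] the exponent [hzeta s] is [ln s + ln th / 2], so intervals for [ln] are translates by
     [dl] of intervals for [hzeta]. *)
  move=> cd; set dl := ln th / 2.
  have -> : (d - c)%:E = (wpush lebR hk hzeta `]c + dl, d + dl]%classic).
    by rewrite hk_itv; [congr EFin; lra|rewrite lerD2r].
  apply: ae_eq_integral => //; first exact: wpush_measurable.
    exact: wpush_measurable.
  apply: filterS hkE => s [_ ->] _; congr EFin.
  have [hs|/negbTE hs] := boolP (E s); last by rewrite /hpil hs !mul0r.
  congr (_ * _); rewrite !indicE; congr (_%:R); congr nat_of_bool.
  have z : hzeta s = ln s + dl by rewrite /hzeta lnE// /dl onem_half; lra.
  by apply/idP/idP; rewrite !inE/= !in_itv/= z ltrD2r lerD2r.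
have NE A : measurable A -> N A = lebR A.
  apply: (measure_eq_itvoc (m1 := N) (m2 := lebR)) => c d.
    have [cd|dc] := leP c d.
      apply: (@le_lt_trans _ _ (d - c)%:E); rewrite ?ltry// le_eqVlt.
      by apply/orP; left; apply/eqP; exact: hN.
    by rewrite set_itv_ge ?measure0 ?ltry// bnd_simp -leNgt; exact: ltW.
  move=> cd; transitivity (d - c)%:E; first exact: hN.
  by apply/esym; exact: lebR_ocitv.
have mk : measurable_fun setT (fun s : R => (0 < s)%R%:R / s : R).
  apply: measurable_funM; last exact: measurable_invr.
  by apply: measurable_natr_bool; exact: measurable_fun_ltr.
have k0 (s : R) : 0 <= (0 < s)%R%:R / s.
  by case: (ltP 0 s) => [s1|_]; rewrite ?mul0r// mul1r invr_ge0 ltW.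
have mphi : measurable_fun setT (EFin \o @phi1 R) by apply/measurable_EFinP; exact: measurable_phi1.
have phi0 (y : R) : (0 <= (EFin \o phi1) y)%E by rewrite lee_fin ltW// phi1_gt0.
have mpl : measurable_fun setT (fun s : R => phi1 (ln s)).
  by apply: measurableT_comp; [exact: measurable_phi1|exact: measurable_ln].
have e1 : (\int[lebR]_s (hpil s * phi1 (ln s))%:E = \int[lebR]_z (@phi1 R z)%:E)%E.
  exact: (ge0_eq_integral_wpush mhpil hpil_ge0 (@measurable_ln R) NE mphi phi0).
have e2 : (\int[lebR]_s ((0 < s)%R%:R / s * phi1 (ln s))%:E = \int[lebR]_z (@phi1 R z)%:E)%E.
  exact: (ge0_eq_integral_wpush mk k0 (@measurable_ln R) (@wpush_ln R) mphi phi0).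
(* The weight restricted to [E] and the unrestricted one have the same finite integral against
   [phi1], so they agree almost everywhere. *)
have : {ae lebR, forall s, hpil s * phi1 (ln s) = (0 < s)%R%:R / s * phi1 (ln s)}.
  apply: integral_saturated.
  - exact: measurable_funM.
  - exact: measurable_funM.
  - by move=> s; rewrite mulr_ge0// ltW// phi1_gt0.
  - move=> s; rewrite ler_wpM2r ?(ltW (phi1_gt0 _))// /hpil.
    have [/E_gt0[s1 _ _]|_] := boolP (E s); first by rewrite s1.
    by rewrite mul0r.
  - by rewrite e1 integral_phi1 ltry.
  - by rewrite e1 e2.
apply: filterS => s h s1; rewrite s1 in h.
have hs : E s.
  apply: contraT => /negbTE hs; move: h; rewrite /hpil hs mul0r mul0r mul1r => /esym/eqP.
  by rewrite mulf_eq0 invr_eq0 !gt_eqF ?phi1_gt0.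
by split => //; exact: tE.
Qed.

End head_equality.

End head.

(** * Almost-everywhere statements along sections of a product *)

Section ae.
Context d (T : measurableType d) (R : realType) (m : {measure set T -> \bar R}).

Lemma ae_integral0E (g : T -> \bar R) : measurable_fun setT g ->
  (forall x, 0 <= g x)%E ->
  ({ae m, forall x, g x = 0%E} <-> (\int[m]_x g x = 0)%E).
Proof.
move=> mg g0; have [H1 H2] := ae_eq_integral_abs m measurableT mg.
have E : (\int[m]_x `|g x| = \int[m]_x g x)%E.
  by apply: eq_integral => x _; rewrite gee0_abs.
split=> [h|h].
  by rewrite -E; apply: H2; apply: filterS h => x -> _.
by move: h; rewrite -E => /H1; apply: filterS => x /(_ I).
Qed.

Lemma ae_boolE (P : T -> bool) : measurable_fun setT P ->
  ({ae m, forall x, P x} <-> (\int[m]_x ((~~ P x)%:R)%:E = 0 :> \bar R)%E).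
Proof.
move=> mP; rewrite -ae_integral0E; last 2 first.
- by apply/measurable_EFinP/measurable_natr_bool; exact: measurable_neg.
- by move=> x; rewrite lee_fin ler0n.
split; apply: filterS => x; first by move=> ->.
by case: (P x) => //= -[] /eqP; rewrite oner_eq0.
Qed.

End ae.

Section ae_iter.
Context d1 d2 (T1 : measurableType d1) (T2 : measurableType d2) (R : realType).
Variables (m1 : {sigma_finite_measure set T1 -> \bar R})
          (m2 : {sigma_finite_measure set T2 -> \bar R}).

Let mind (P : T1 * T2 -> bool) : measurable_fun setT P ->
  measurable_fun setT (fun x => ((~~ P x)%:R)%:E : \bar R).
Proof. by move=> mP; apply/measurable_EFinP/measurable_natr_bool; exact: measurable_neg. Qed.

Lemma ae_iterE (P : T1 * T2 -> bool) : measurable_fun setT P ->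
  ({ae m1, forall x, {ae m2, forall y, P (x, y)}} <->
   (\int[m1]_x \int[m2]_y ((~~ P (x, y))%:R)%:E = 0 :> \bar R)%E).
Proof.
move=> mP; rewrite -ae_integral0E; last 2 first.
- apply: (measurable_fun_fubini_tonelli_F (m2 := m2) (fun z => ((~~ P z)%:R)%:E)); first exact: mind.
  by move=> x; rewrite lee_fin ler0n.
- by move=> x; apply: integral_ge0 => y _; rewrite lee_fin ler0n.
have mPx x : measurable_fun setT (fun y => P (x, y)).
  by apply: measurableT_comp mP _.
by split; apply: filterS => x /(ae_boolE m2 (mPx x)).
Qed.

(** Both orders express that the iterated integral of the indicator of failure vanishes; Tonelli
    exchanges them. Boolean predicates supply the measurability this requires. *)
Lemma ae_swap (P : T1 * T2 -> bool) : measurable_fun setT P ->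
  {ae m1, forall x, {ae m2, forall y, P (x, y)}} ->
  {ae m2, forall y, {ae m1, forall x, P (x, y)}}.
Proof.
move=> mP /(ae_iterE mP) h.
have mPy y : measurable_fun setT (fun x => P (x, y)).
  by apply: measurableT_comp mP _.
suff : {ae m2, forall y, (\int[m1]_x ((~~ P (x, y))%:R)%:E = 0 :> \bar R)%E}.
  by apply: filterS => y /(ae_boolE m1 (mPy y)).
rewrite ae_integral0E; last 2 first.
- apply: (measurable_fun_fubini_tonelli_G (m1 := m1) (fun z => ((~~ P z)%:R)%:E)); first exact: mind.
  by move=> x; rewrite lee_fin ler0n.
- by move=> y; apply: integral_ge0 => x _; rewrite lee_fin ler0n.
rewrite -(@fubini_tonelli _ _ _ _ _ m1 m2 (fun z => ((~~ P z)%:R)%:E))//; exact: mind.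
Qed.

End ae_iter.

(** * Euclidean operations and the Gaussian density on tuples *)

Section euclid.
Context {R : realType}.

Definition dot d (x y : d.-tuple R) : R := \sum_(k < d) tnth x k * tnth y k.
Definition tsub d (x y : d.-tuple R) : d.-tuple R := [tuple tnth x k - tnth y k | k < d].
Definition comb d (w : R) (x y : d.-tuple R) : d.-tuple R :=
  [tuple (1 - w) * tnth x k + w * tnth y k | k < d].
Definition gam d (x : d.-tuple R) : R :=
  (Num.sqrt (2 * pi))^-1 ^+ d * expR (- sqnorm x / 2).

Lemma tnth_consp0 d (p : R * d.-tuple R) : tnth (consp p) ord0 = p.1.
Proof. by []. Qed.

Lemma tnth_conspS d (p : R * d.-tuple R) k : tnth (consp p) (lift ord0 k) = tnth p.2 k.
Proof. by rewrite /consp tnthS. Qed.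

Lemma tnth_tl d (x : d.+1.-tuple R) k : tnth (tl x) k = tnth x (lift ord0 k).
Proof. by rewrite -[in RHS](consp_eta x) tnth_conspS. Qed.

Lemma dot_consp d (p q : R * d.-tuple R) :
  dot (consp p) (consp q) = p.1 * q.1 + dot p.2 q.2.
Proof.
rewrite /dot big_ord_recl !tnth_consp0; congr (_ + _).
by apply: eq_bigr => k _; rewrite !tnth_conspS.
Qed.

Lemma sqnormE d (x : d.-tuple R) : sqnorm x = dot x x.
Proof. by apply: eq_bigr => k _; rewrite expr2. Qed.

Lemma sqnorm_consp d (p : R * d.-tuple R) :
  sqnorm (consp p) = p.1 ^+ 2 + sqnorm p.2.
Proof. by rewrite !sqnormE dot_consp expr2. Qed.

Lemma sqnorm_ge0 d (x : d.-tuple R) : 0 <= sqnorm x.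
Proof. by apply: sumr_ge0 => k _; exact: sqr_ge0. Qed.

Lemma tsub_consp d (p q : R * d.-tuple R) :
  tsub (consp p) (consp q) = consp (p.1 - q.1, tsub p.2 q.2).
Proof.
apply: eq_from_tnth => k; rewrite tnth_mktuple.
case: (unliftP ord0 k) => [j|] ->; last by rewrite !tnth_consp0.
by rewrite !tnth_conspS tnth_mktuple.
Qed.

Lemma comb_consp d w (p q : R * d.-tuple R) :
  comb w (consp p) (consp q) = consp ((1 - w) * p.1 + w * q.1, comb w p.2 q.2).
Proof.
apply: eq_from_tnth => k; rewrite tnth_mktuple.
case: (unliftP ord0 k) => [j|] ->; last by rewrite !tnth_consp0.
by rewrite !tnth_conspS tnth_mktuple.
Qed.

Lemma gam_gt0 d (x : d.-tuple R) : 0 < gam x.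
Proof. by rewrite mulr_gt0 ?expR_gt0// exprn_gt0// invr_gt0 sqrt2pi_gt0. Qed.

Lemma gam_consp d (p : R * d.-tuple R) : gam (consp p) = gam1 p.1 * gam p.2.
Proof.
rewrite /gam /gam1 sqnorm_consp exprS.
have -> : - (p.1 ^+ 2 + sqnorm p.2) / 2 = - p.1 ^+ 2 / 2 + - sqnorm p.2 / 2 by ring.
by rewrite expRD; ring.
Qed.

Lemma measurable_dot d dT (T : measurableType dT) (f g : T -> d.-tuple R) :
  measurable_fun setT f -> measurable_fun setT g ->
  measurable_fun setT (fun x => dot (f x) (g x)).
Proof.
move=> mf mg; apply: measurable_sum => k; apply: measurable_funM.
  exact: measurableT_comp (measurable_tnth _) mf.
exact: measurableT_comp (measurable_tnth _) mg.
Qed.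

Lemma measurable_sqnorm d dT (T : measurableType dT) (f : T -> d.-tuple R) :
  measurable_fun setT f -> measurable_fun setT (fun x => sqnorm (f x)).
Proof.
move=> mf; rewrite (_ : (fun x => _) = (fun x => dot (f x) (f x))).
  exact: measurable_dot.
by apply/funext => x; rewrite sqnormE.
Qed.

Lemma measurable_gam d dT (T : measurableType dT) (f : T -> d.-tuple R) :
  measurable_fun setT f -> measurable_fun setT (fun x => gam (f x)).
Proof.
move=> mf; apply: measurable_funM => //; apply: measurableT_comp; first exact: measurable_expR.
by apply: measurable_funM => //; apply: measurable_funN; exact: measurable_sqnorm.
Qed.

Lemma measurable_mktuple d dT (T : measurableType dT) (f : 'I_d -> T -> R) :
  (forall k, measurable_fun setT (f k)) ->
  measurable_fun setT (fun x => [tuple f k x | k < d]).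
Proof.
move=> mf; apply/measurable_fun_tnthP => k.
rewrite (_ : _ \o _ = f k); first exact: mf.
by apply/funext => x /=; rewrite tnth_mktuple.
Qed.

Lemma measurable_comb d w dT (T : measurableType dT) (f g : T -> d.-tuple R) :
  measurable_fun setT f -> measurable_fun setT g ->
  measurable_fun setT (fun x => comb w (f x) (g x)).
Proof.
move=> mf mg; apply: measurable_mktuple => k.
apply: measurable_funD; apply: measurable_funM => //.
  exact: measurableT_comp (measurable_tnth _) mf.
exact: measurableT_comp (measurable_tnth _) mg.
Qed.

Lemma measurable_tsub d dT (T : measurableType dT) (f g : T -> d.-tuple R) :
  measurable_fun setT f -> measurable_fun setT g ->
  measurable_fun setT (fun x => tsub (f x) (g x)).
Proof.
move=> mf mg; apply: measurable_mktuple => k; apply: measurable_funB.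
  exact: measurableT_comp (measurable_tnth _) mf.
exact: measurableT_comp (measurable_tnth _) mg.
Qed.

Lemma measurable_consp' d dT (T : measurableType dT) (f : T -> R) (g : T -> d.-tuple R) :
  measurable_fun setT f -> measurable_fun setT g ->
  measurable_fun setT (fun x => consp (f x, g x)).
Proof.
move=> mf mg; apply: (measurableT_comp (@measurable_consp R d)).
exact: measurable_fun_pair.
Qed.

Lemma integral_gam d : (\int[@Leb R d]_x (gam x)%:E = 1)%E.
Proof.
have m d' : measurable_fun setT (fun x : d'.-tuple R => (gam x)%:E).
  by apply/measurable_EFinP; apply: measurable_gam.
have g0 d' (x : d'.-tuple R) : (0 <= (gam x)%:E)%E by rewrite lee_fin ltW// gam_gt0.
elim: d => [|d IH].
  rewrite ge0_integral_Leb0// /gam expr0 mul1r /sqnorm big_ord0 oppr0 mul0r expR0//.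
rewrite ge0_integral_LebS// -(@integral_gam1 R); apply: eq_integral => s _.
under eq_integral do rewrite gam_consp EFinM /=.
have g1 : (0 <= (gam1 s)%:E)%E by rewrite lee_fin ltW// gam1_gt0.
transitivity ((gam1 s)%:E * \int[Leb d]_x (gam x)%:E)%E; last by rewrite IH mule1.
by apply: ge0_integralZl => //; exact: m.
Qed.

End euclid.

Section ae_Leb.
Context {R : realType} (d : nat).
Local Notation Leb := (@Leb R).

(** The tail is quantified first because the later arguments fix a tail and work along the line of
    heads above it. *)
Lemma ae_LebS (P : d.+1.-tuple R -> bool) : measurable_fun setT P ->
  {ae Leb d.+1, forall x, P x} <->
  {ae Leb d, forall t, {ae lebR, forall s, P (consp (s, t))}}.
Proof.
move=> mP; rewrite ae_boolE// ge0_integral_LebS'; last 2 first.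
- by apply/measurable_EFinP/measurable_natr_bool; exact: measurable_neg.
- by move=> x; rewrite lee_fin ler0n.
have mQ : measurable_fun setT (fun z : d.-tuple R * R => P (consp (z.2, z.1))).
  by apply: measurableT_comp mP _; apply: measurable_consp'.
by rewrite -(ae_iterE (Leb d) lebR mQ).
Qed.

Lemma ae_tl (Q : d.-tuple R -> Prop) : {ae Leb d, forall t, Q t} ->
  {ae Leb d.+1, forall x, Q (tl x)}.
Proof.
move=> [N [mN N0 QN]]; exists (@tl R d @^-1` N); split.
- by rewrite -[X in measurable X]setTI; exact: measurable_tl.
- have mtN : measurable (@tl R d @^-1` N).
    by rewrite -[X in measurable X]setTI; exact: measurable_tl.
  transitivity (\int[Leb d.+1]_x (\1_(@tl R d @^-1` N) x)%:E)%E.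
    by rewrite integral_indic// setIT.
  rewrite ge0_integral_LebS//; last exact/measurable_EFinP.
  apply: integral0_eq => s _.
  rewrite (_ : (\int[_]_t _)%E = (\int[Leb d]_t (\1_N t)%:E)%E).
    by rewrite integral_indic// setIT.
  by apply: eq_integral => t _; rewrite !indicE; congr (_%:R%:E); congr nat_of_bool;
    apply/idP/idP; rewrite !inE /= tl_consp.
- by move=> x /= h; apply: QN => /= q; apply: h.
Qed.

End ae_Leb.

(** * Transport pairs *)

Section defs.
Context {R : realType}.
Local Notation Leb := (@Leb R).

Definition density d (f : d.-tuple R -> R) : Prop :=
  [/\ measurable_fun setT f, forall x, 0 <= f x &
      (\int[Leb d]_x (f x)%:E = 1)%E].

Definition centered_density d (f : d.-tuple R -> R) : Prop :=
  forall k : 'I_d, (Leb d).-integrable setT (fun x => (tnth x k * f x)%:E) /\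
    (\int[Leb d]_x (tnth x k * f x)%:E = 0)%E.

Definition qform d (M : 'M[R]_d) (x : d.-tuple R) : R :=
  (rv x *m M *m (rv x)^T) ord0 ord0.

(* [f x / g (T x)] plays the role of the Jacobian of the transport [T], while [DB]
   and [DZ] play those of the Jacobians of [(1-w)x + wT(x)] and of the "geometric
   mean" [Z] of [x] and [T x]. The changes of variables are only inequalities,
   so no derivative is needed. *)
Record transport_pair d (w : R) (f g : d.-tuple R -> R)
    (T Z : d.-tuple R -> d.-tuple R) (DB DZ : d.-tuple R -> R) : Prop := TransportPair {
  tp_mT : measurable_fun setT T;
  tp_mZ : measurable_fun setT Z;
  tp_mDB : measurable_fun setT DB;
  tp_mDZ : measurable_fun setT DZ;
  tp_DB_ge0 : forall x, 0 <= DB x;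
  tp_DZ_ge0 : forall x, 0 <= DZ x;
  tp_push : forall phi : d.-tuple R -> \bar R, measurable_fun setT phi ->
    (forall x, 0 <= phi x)%E ->
    (\int[Leb d]_x ((f x)%:E * phi (T x)) = \int[Leb d]_x ((g x)%:E * phi x))%E;
  tp_gpos : {ae Leb d, forall x, 0 < f x -> 0 < g (T x)};
  tp_DB_powR : {ae Leb d, forall x, 0 < f x -> (f x / g (T x)) `^ w <= DB x};
  tp_DB_lb : {ae Leb d, forall x, 0 < f x -> (1 - w) ^+ d <= DB x};
  tp_DZ_sqrt : {ae Leb d, forall x, 0 < f x -> Num.sqrt (f x / g (T x)) <= DZ x};
  tp_DB_le : forall phi : d.-tuple R -> \bar R, measurable_fun setT phi ->
    (forall x, 0 <= phi x)%E ->
    (\int[Leb d]_x ((DB x)%:E * phi (comb w x (T x))) <= \int[Leb d]_x phi x)%E;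
  tp_DZ_le : (\int[Leb d]_x (DZ x * gam (Z x))%:E <= 1)%E;
  tp_dot_integrable : (Leb d).-integrable setT
    (fun x => ((sqnorm (Z x) - dot x (T x)) * f x)%:E);
  tp_dot0 : (\int[Leb d]_x ((sqnorm (Z x) - dot x (T x)) * f x)%:E = 0)%E;
  tp_rigid : {ae Leb d, forall x, 0 < f x -> (f x / g (T x)) `^ w = DB x ->
    Num.sqrt (f x / g (T x)) = DZ x -> f x / g (T x) = 1 /\ sqnorm (Z x) = sqnorm x};
  tp_linear :
    {ae Leb d, forall x, 0 < f x -> f x = gam (Z x) * Num.sqrt (f x / g (T x))} ->
    {ae Leb d, forall x, 0 < f x -> Num.sqrt (f x / g (T x)) = DZ x} ->
    {ae Leb d, forall x, {ae Leb d, forall y, 0 < f x -> 0 < f y ->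
      0 <= dot (tsub x y) (tsub (T x) (T y))}} ->
    exists (M : 'M[R]_d) (b : d.-tuple R), posdef M /\
      {ae Leb d, forall x, [/\ 0 < f x, rv (T x) = rv x *m M + rv b,
        sqnorm (Z x) = qform M x & f x / g (T x) = \det M]} }.

(** The base of the induction: in dimension 0 both densities are the constant 1, so every ratio
    equals 1. *)
Lemma transport_pair0 (w : R) (f g : 0.-tuple R -> R) : 0 < w < 1 ->
  density f -> density g ->
  transport_pair w f g id id (cst 1) (cst 1).
Proof.
move=> w01 [mf f0 f1] [mg g0 g1].
have fE x : f x = 1.
  have : (f [tuple])%:E = 1%:E by rewrite -f1 ge0_integral_Leb0// => y; rewrite lee_fin.
  by move=> [] <-; rewrite tuple0.
have gE x : g x = 1.
  have : (g [tuple])%:E = 1%:E by rewrite -g1 ge0_integral_Leb0// => y; rewrite lee_fin.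
  by move=> [] <-; rewrite tuple0.
have sq x : sqnorm (x : 0.-tuple R) = 0 by rewrite /sqnorm big_ord0.
have dt x y : dot (x : 0.-tuple R) y = 0 by rewrite /dot big_ord0.
have E0 : (fun x : 0.-tuple R => ((sqnorm x - dot x x) * f x)%:E) = cst 0%E.
  by apply/funext => x; rewrite sq dt subrr mul0r.
split => //=.
- by move=> phi mphi phi0; apply: eq_integral => x _; rewrite fE gE.
- by apply: aeW => x; rewrite gE.
- by apply: aeW => x _; rewrite fE gE divr1 powR1.
- by apply: aeW => x _; rewrite expr0.
- by apply: aeW => x _; rewrite fE gE divr1 sqrtr1.
- move=> phi mphi phi0; rewrite le_eqVlt; apply/orP; left; apply/eqP.
  by apply: eq_integral => x _; rewrite mul1e; congr phi; rewrite tuple0 [RHS]tuple0.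
- rewrite le_eqVlt; apply/orP; left; apply/eqP; rewrite -[RHS](@integral_gam R 0).
  by apply: eq_integral => x _; rewrite mul1r.
- by rewrite E0; exact: integrable0.
- by rewrite E0 integral0.
- by apply: aeW => x _ _ _; rewrite fE gE divr1.
move=> _ _ _; exists 1%:M, [tuple]; split.
  split; first by rewrite trmx1.
  by move=> v /eqP []; apply/rowP => -[].
apply: aeW => x; split; rewrite ?fE//.
- by apply/rowP => -[].
- by rewrite sq /qform mxE big_ord0.
- by rewrite gE divr1 det1.
Qed.

End defs.

Section transport_more.
Context {R : realType}.
Variables a b : R -> R.
Hypotheses (ma : measurable_fun setT a) (mb : measurable_fun setT b).
Hypotheses (a0 : forall x, 0 <= a x) (b0 : forall x, 0 <= b x).
Hypotheses (a1 : (\int[lebR]_x (a x)%:E = 1)%E)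
           (b1 : (\int[lebR]_x (b x)%:E = 1)%E).
Local Open Scope ereal_scope.

Lemma ge0_integral_density_tau (H : R -> \bar R) : measurable_fun setT H ->
  (forall y, 0 <= H y) ->
  \int[lebR]_s ((a s)%:E * H (tau a b s)) = \int[lebR]_t ((b t)%:E * H t).
Proof.
move=> mH H0; rewrite -(ge0_integral_tau ma mb a0 b0 a1 b1 mH H0).
have mHt : measurable_fun setT (fun s => H (tau a b s)).
  exact: measurableT_comp mH (measurable_tau ma mb a0 b0 a1 b1).
apply: ge0_ae_eq_integral => //.
- by apply: emeasurable_funM => //; exact/measurable_EFinP.
- by apply: emeasurable_funM => //; apply/measurable_EFinP; exact: measurable_ag.
- by move=> s _; rewrite mule_ge0// lee_fin.
- by move=> s _; rewrite mule_ge0// lee_fin ag_ge0.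
apply: filterS (ae_good ma mb a0 b0 a1 b1) => s h _; rewrite /ag.
have [->|/h [-> _]] := eqVneq (a s) 0%R; first by rewrite mul0r.
by rewrite mulr1.
Qed.

Hypotheses (an : forall x, (x <= 0)%R -> a x = 0%R) (bn : forall x, (x <= 0)%R -> b x = 0%R).

(** Positivity of both densities is added to [good] so that the ratio [dtau] is positive; [ae_hE]
    shows that only a null part of the source is lost. *)
Definition hE s : bool := [&& good a s, 0 < a s & 0 < b (tau a b s)]%R.

Lemma hE_gt0 s : hE s -> [/\ 0 < s, 0 < tau a b s & 0 < dtau a b s]%R.
Proof.
move=> /and3P[gs as0 bs0]; split.
- by rewrite ltNge; apply/negP => /an h; rewrite h ltxx in as0.
- by rewrite ltNge; apply/negP => /bn h; rewrite h ltxx in bs0.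
- by rewrite /dtau /ag gs mulr1 divr_gt0.
Qed.

Lemma ae_hE : {ae lebR, forall s, (0 < a s)%R -> hE s}.
Proof.
have := ae_good ma mb a0 b0 a1 b1; apply: filterS => s h as0.
have [gs bs] := h (lt0r_neq0 as0).
by rewrite /hE gs as0 /= lt_neqAle eq_sym bs b0.
Qed.

End transport_more.

(** Conditional densities depend on the tail, and the fiberwise rearrangements must assemble into
    one measurable map; this is the joint measurability that makes it possible. *)
Lemma measurable_cdfd_joint {R : realType} d (T : measurableType d) (c : T -> R -> R) (s : T -> R) :
  measurable_fun setT (fun z : T * R => c z.1 z.2) -> (forall x r, 0 <= c x r)%R ->
  measurable_fun setT s -> measurable_fun setT (fun x => cdfd (c x) (s x)).
Proof.
move=> mc c0 ms.
have mf : measurable_fun setT (fun z : T * R => (c z.1 z.2 * (z.2 <= s z.1)%R%:R)%:E).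
  apply/measurable_EFinP/measurable_funM => //; apply: measurable_natr_bool.
  by apply: measurable_fun_ler => //; exact: measurableT_comp ms _.
have f0 (z : T * R) : (0 <= (c z.1 z.2 * (z.2 <= s z.1)%R%:R)%:E)%E.
  by rewrite lee_fin mulr_ge0.
rewrite (_ : (fun x => _) =
  fine \o (fun x => \int[lebR]_r (c x r * (r <= s x)%R%:R)%:E)%E).
  apply: measurableT_comp; first exact: fine_measurable.
  exact: (measurable_fun_fubini_tonelli_F (m2 := @lebR R) _ mf f0).
apply/funext => x; rewrite /cdfd /=; congr fine; rewrite integral_mkcond.
apply: eq_integral => r _; rewrite patchE.
have -> : (r \in `]-oo, s x]%classic) = (r <= s x)%R by apply/idP/idP; rewrite inE/= in_itv.
by case: (r <= s x)%R; rewrite ?mulr1 ?mulr0.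
Qed.

Section marginal.
Context {R : realType} (d : nat).
Local Notation Leb := (@Leb R).
Local Open Scope ereal_scope.

Lemma measurable_fiber (H : d.+1.-tuple R -> \bar R) : measurable_fun setT H ->
  (forall x, 0 <= H x) ->
  measurable_fun setT (fun t => \int[lebR]_s H (consp (s, t))).
Proof.
move=> mH H0.
apply: (measurable_fun_fubini_tonelli_F (m2 := @lebR R) (fun z : d.-tuple R * R => H (consp (z.2, z.1)))).
  by apply: measurableT_comp mH _; exact: measurable_consp'.
by move=> z; exact: H0.
Qed.

Lemma measurable_sec dT (U : measurableType dT) (H : d.+1.-tuple R -> U) t : measurable_fun setT H ->
  measurable_fun setT (fun s => H (consp (s, t))).
Proof. by move=> mH; apply: measurableT_comp mH _; exact: measurable_consp'. Qed.

Variable F : d.+1.-tuple R -> R.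
Hypothesis dF : density F.
Let mF : measurable_fun setT F. Proof. by have [] := dF. Qed.
Let F0 x : (0 <= F x)%R. Proof. by have [] := dF. Qed.
Let F1 : \int[Leb d.+1]_x (F x)%:E = 1. Proof. by have [] := dF. Qed.
Let mFE : measurable_fun setT (EFin \o F). Proof. exact/measurable_EFinP. Qed.
Let F0E x : 0 <= (F x)%:E. Proof. by rewrite lee_fin. Qed.

(** Infinite fiber integrals are sent to 0 by [fine], so a positive value is always the true one,
    and only a null set of tails is affected. *)
Definition marg (t : d.-tuple R) : R := fine (\int[lebR]_s (F (consp (s, t)))%:E).

Lemma measurable_marg : measurable_fun setT marg.
Proof.
apply: measurableT_comp; first exact: fine_measurable.
exact: (measurable_fiber mFE F0E).
Qed.

Lemma marg_ge0 t : (0 <= marg t)%R.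
Proof. by apply: fine_ge0; apply: integral_ge0. Qed.

Lemma marg_gt0 t : (0 < marg t)%R -> \int[lebR]_s (F (consp (s, t)))%:E = (marg t)%:E.
Proof.
rewrite /marg; have : 0 <= \int[lebR]_s (F (consp (s, t)))%:E by apply: integral_ge0.
by case: (\int[lebR]_s _) => [r| |] //=; rewrite ltxx.
Qed.

Lemma marg_ae : {ae Leb d, forall t, \int[lebR]_s (F (consp (s, t)))%:E = (marg t)%:E}.
Proof.
have mf := measurable_fiber mFE F0E.
have i : (Leb d).-integrable setT (fun t => \int[lebR]_s (F (consp (s, t)))%:E).
  apply/integrableP; split => //.
  under eq_integral do rewrite gee0_abs ?integral_ge0//.
  by rewrite -(ge0_integral_LebS' mFE F0E) F1 ltry.
have := integrable_ae measurableT i.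
by apply: filterS => t /(_ I) h; rewrite /marg fineK.
Qed.

Lemma marg_integral (h : d.-tuple R -> \bar R) : measurable_fun setT h ->
  (forall t, 0 <= h t) ->
  \int[Leb d.+1]_x ((F x)%:E * h (tl x)) = \int[Leb d]_t ((marg t)%:E * h t).
Proof.
move=> mh h0.
rewrite ge0_integral_LebS'; last 2 first.
- by apply: emeasurable_funM => //; exact: measurableT_comp mh (@measurable_tl _ _).
- by move=> x; rewrite mule_ge0.
apply: ge0_ae_eq_integral => //.
- apply: (measurable_fiber (H := fun x => ((F x)%:E * h (tl x)))).
    by apply: emeasurable_funM => //; exact: measurableT_comp mh (@measurable_tl _ _).
  by move=> x; rewrite mule_ge0.
- by apply: emeasurable_funM => //; apply/measurable_EFinP; exact: measurable_marg.
- by move=> t _; apply: integral_ge0 => s _; rewrite mule_ge0.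
- by move=> t _; rewrite mule_ge0// lee_fin marg_ge0.
apply: filterS marg_ae => t ht _; rewrite -ht.
under eq_integral do rewrite tl_consp /=.
rewrite ge0_integralZr//; exact: (measurable_sec t mFE).
Qed.

Lemma density_marg : density marg.
Proof.
split; [exact: measurable_marg|exact: marg_ge0|].
transitivity (\int[Leb d]_t ((marg t)%:E * cst 1 t)).
  by apply: eq_integral => t _; rewrite mule1.
rewrite -marg_integral//; apply: etrans F1.
by apply: eq_integral => x _; rewrite /= mule1.
Qed.

Section signed.
Variable h : d.-tuple R -> R.
Hypothesis mh : measurable_fun setT h.

Let mht : measurable_fun setT (fun x : d.+1.-tuple R => h (tl x)).
Proof. exact: measurableT_comp mh (@measurable_tl _ _). Qed.

Lemma marg_integrableE :
  (Leb d.+1).-integrable setT (fun x => (h (tl x) * F x)%:E) <->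
  (Leb d).-integrable setT (fun t => (h t * marg t)%:E).
Proof.
have E : \int[Leb d.+1]_x `|(h (tl x) * F x)%:E| = \int[Leb d]_t `|(h t * marg t)%:E|.
  transitivity (\int[Leb d.+1]_x ((F x)%:E * `|h (tl x)|%:E)).
    by apply: eq_integral => x _; rewrite /= normrM (ger0_norm (F0 x)) mulrC.
  rewrite (marg_integral (h := fun t => `|h t|%:E)) => [||t].
  - by apply: eq_integral => t _; rewrite /= normrM (ger0_norm (marg_ge0 t)) mulrC.
  - by apply/measurable_EFinP; exact: measurableT_comp.
  - by rewrite lee_fin.
split => /integrableP[_ i]; apply/integrableP; split.
- by apply/measurable_EFinP; apply: measurable_funM => //; exact: measurable_marg.
- by rewrite -E.
- by apply/measurable_EFinP; apply: measurable_funM.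
- by rewrite E.
Qed.

Lemma marg_integral_signed :
  \int[Leb d.+1]_x (h (tl x) * F x)%:E = \int[Leb d]_t (h t * marg t)%:E.
Proof.
have posE n (m : n.-tuple R -> R) (u : n.-tuple R -> R) : (forall x, 0 <= m x)%R ->
   ((fun x => (u x * m x)%:E)^\+ = (fun x => (m x)%:E * (Num.max (u x) 0)%:E) /\
   (fun x => (u x * m x)%:E)^\- = (fun x => (m x)%:E * (Num.max (- u x) 0)%:E)).
  move=> m0; split; apply/funext => x; rewrite ?funeposE ?funenegE -EFinM.
    by rewrite -EFin_max maxr_pMr// mulr0 mulrC.
  by rewrite -EFinN -EFin_max maxr_pMr// mulr0 -mulNr mulrC.
have [p1 n1] := posE _ F (fun x => h (tl x)) F0.
have [p2 n2] := posE _ marg h marg_ge0.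
rewrite [LHS]integralE [RHS]integralE p1 n1 p2 n2.
congr (_ - _).
  rewrite (marg_integral (h := fun t => (Num.max (h t) 0)%:E))// => [|t].
    by apply/measurable_EFinP; apply: measurable_maxr.
  by rewrite lee_fin le_max lexx orbT.
rewrite (marg_integral (h := fun t => (Num.max (- h t) 0)%:E))// => [|t].
  by apply/measurable_EFinP; apply: measurable_maxr => //; exact: measurable_funN.
by rewrite lee_fin le_max lexx orbT.
Qed.

End signed.

End marginal.

(** Equality between products of Jacobian bounds is split by this into equality for the tail factor
    and for the head factor. *)
Lemma mulr_le_eq (R : realFieldType) (a1 b1 a2 b2 : R) : 0 < a1 -> 0 < a2 ->
  a1 <= b1 -> a2 <= b2 -> a1 * a2 = b1 * b2 -> a1 = b1 /\ a2 = b2.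
Proof.
move=> a10 a20 h1 h2 e.
have b10 : 0 < b1 by exact: lt_le_trans h1.
have b20 : 0 < b2 by exact: lt_le_trans h2.
split; apply/eqP; rewrite eq_le ?h1 ?h2/=; rewrite leNgt; apply/negP => h.
  have : a1 * a2 < b1 * a2 by rewrite ltr_pM2r.
  have : b1 * a2 <= b1 * b2 by rewrite ler_pM2l.
  lra.
have : a1 * a2 < a1 * b2 by rewrite ltr_pM2l.
have : a1 * b2 <= b1 * b2 by rewrite ler_pM2r.
lra.
Qed.

Lemma ge0_integral_mul0 d (T : measurableType d) (R : realType)
    (m : {measure set T -> \bar R}) (g : T -> R) (phi : T -> \bar R) :
  measurable_fun setT g -> (forall x, 0 <= g x) -> measurable_fun setT phi ->
  (forall x, 0 <= phi x)%E -> (\int[m]_x (g x)%:E = 0)%E ->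
  (\int[m]_x ((g x)%:E * phi x) = 0)%E.
Proof.
move=> mg g0 mphi phi0 h; have mgE : measurable_fun setT (EFin \o g) by exact/measurable_EFinP.
apply/(ae_integral0E m).
- exact: emeasurable_funM.
- by move=> x; rewrite mule_ge0// lee_fin.
- have := (ae_integral0E m mgE (fun s => (g0 _ : (0 <= _%:E)%E))).2 h.
  by apply: filterS => x /= ->; rewrite mul0e.
Qed.

Lemma integral_saturated_ae d (T : measurableType d) (R : realType)
    (m : {measure set T -> \bar R}) (f g : T -> R) :
  measurable_fun setT f -> measurable_fun setT g ->
  (forall x, 0 <= f x) -> (forall x, 0 <= g x) -> {ae m, forall x, f x <= g x} ->
  (\int[m]_x (f x)%:E < +oo)%E -> (\int[m]_x (g x)%:E <= \int[m]_x (f x)%:E)%E ->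
  {ae m, forall x, f x = g x}.
Proof.
move=> mf mg f0 g0 fg foo gf.
have mM : measurable_fun setT (fun x => Num.max (f x) (g x)) by exact: measurable_maxr.
have ME : {ae m, forall x, Num.max (f x) (g x) = g x}.
  by apply: filterS fg => x; rewrite maxEle => ->.
have M0 x : 0 <= Num.max (f x) (g x) by rewrite le_max f0.
have := integral_saturated (m := m) mf mM f0 (fun x => _ : f x <= Num.max (f x) (g x)).
have -> : (\int[m]_x (Num.max (f x) (g x))%:E = \int[m]_x (g x)%:E)%E.
  apply: ge0_ae_eq_integral => //; try exact/measurable_EFinP.
  - by move=> x _; rewrite lee_fin.
  - by move=> x _; rewrite lee_fin.
  - by apply: filterS ME => x -> _.
move=> /(_ _ foo gf) h.
have {h} : {ae m, forall x, f x = Num.max (f x) (g x)}.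
  by apply: h => x; rewrite le_max lexx.
by apply: filterS2 ME => x ->.
Qed.

(** A measurable null cover of the exceptional set reduces an arbitrary predicate to the Boolean
    case. *)
Lemma ae_fiber (R : realType) d (S : d.+1.-tuple R -> Prop) :
  {ae @Leb R d.+1, forall x, S x} ->
  {ae @Leb R d, forall t, {ae lebR, forall s, S (consp (s, t))}}.
Proof.
move=> [N [mN N0 SN]].
have mP : measurable_fun setT (fun x : d.+1.-tuple R => x \notin N).
  apply: measurable_neg; apply: (measurable_fun_bool true).
  rewrite setTI (_ : _ @^-1` _ = N)//.
  by apply/seteqP; split => x /=; [move/set_mem|move/mem_set].
have : {ae @Leb R d.+1, forall x, x \notin N}.
  by exists N; split => // x /= /negP; rewrite negbK inE.
move=> /(ae_LebS mP); apply: filterS => t; apply: filterS => s /negP h.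
by apply: contrapT => nS; apply: h; rewrite inE; exact: SN.
Qed.

(** After [x] is split into head and tail, its head is moved behind [y] by [ae_swap]. Both tails
    then come first, and the two heads vary freely over almost every pair of values. *)
Lemma ae_fiber2 (R : realType) d (Q : d.+1.-tuple R * d.+1.-tuple R -> bool) :
  measurable_fun setT Q ->
  {ae @Leb R d.+1, forall x, {ae @Leb R d.+1, forall y, Q (x, y)}} ->
  {ae @Leb R d, forall t, {ae @Leb R d, forall u,
    {ae lebR, forall r, {ae lebR, forall s, Q (consp (s, t), consp (r, u))}}}}.
Proof.
move=> mQ /ae_fiber; apply: filterS => t h.
apply: (@ae_fiber R d (fun y => {ae lebR, forall s, Q (consp (s, t), y)})).
apply: (ae_swap (m1 := lebR) (m2 := @Leb R d.+1) (P := fun z => Q (consp (z.1, t), z.2))) => //.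
apply: measurableT_comp mQ _; apply: measurable_fun_pair => //.
exact: measurable_consp'.
Qed.

Lemma ae_exists d (T : measurableType d) (R : realType) (m : {measure set T -> \bar R})
    (A : set T) (S : T -> Prop) : measurable A -> (0 < m A)%E ->
  {ae m, forall x, S x} -> exists2 x, A x & S x.
Proof.
move=> mA A0 [N [mN N0 SN]]; apply: contrapT => h.
have : (m A <= m N)%E.
  apply: le_measure; rewrite ?inE// => x Ax; apply: SN => /= Sx; apply: h.
  by exists x.
by rewrite N0 leNgt A0.
Qed.

Lemma ae_itv (R : realType) (a b : R) (S : R -> Prop) : a < b ->
  {ae lebR, forall x, S x} -> exists x, a < x < b /\ S x.
Proof.
move=> ab aeS.
have [||x] := @ae_exists _ _ _ lebR `]a, b[%classic S _ _ aeS.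
- exact: measurable_itv.
- have e : lebR `]a, b[%classic = (b - a)%:E by rewrite lebR_itv/= lte_fin ab.
  apply: (@lt_le_trans _ _ (b - a)%:E); first by rewrite lte_fin subr_gt0.
  by rewrite le_eqVlt; apply/orP; left; apply/eqP/esym; exact: e.
by rewrite /= in_itv/= => xab Sx; exists x.
Qed.

(** Near the origin the quadratic term vanishes, which leaves [0 <= c]. If the slopes differed, the
    quadratic form would be negative on an open cone of pairs [(s, r)], and far out in this cone it
    would outweigh [c]. *)
Lemma ray_slopes (R : realType) (th1 th2 c : R) : 0 < th1 -> 0 < th2 ->
  {ae lebR, forall r : R, {ae lebR, forall s : R, 0 < s -> 0 < r ->
    0 <= (s - r) * (th1 * s - th2 * r) + c}} -> 0 <= c /\ th1 = th2.
Proof.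
move=> t10 t20 H; split.
  rewrite leNgt; apply/negP => c0.
  (* Chosen so that for [s] and [r] below [dl] the quadratic term is smaller than [- c]. *)
  pose dl := Num.min 1 (- c / (2 * (th1 + th2))).
  have tt : 0 < th1 + th2 by rewrite addr_gt0.
  have dl0 : 0 < dl by rewrite lt_min ltr01 divr_gt0 ?oppr_gt0// mulr_gt0.
  have dl1 : dl <= 1 by rewrite ge_min lexx.
  have dl2 : dl * (2 * (th1 + th2)) <= - c.
    by rewrite -ler_pdivlMr ?mulr_gt0// ge_min lexx orbT.
  have [r [/andP[r0 r1] Hr]] := ae_itv dl0 H.
  have [s [/andP[s0 s1] Hs]] := ae_itv dl0 Hr.
  have := Hs s0 r0.
  have A1 : (s - r) * (th1 * s - th2 * r) <= s * (th1 * s) + r * (th2 * r).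
    have : 0 <= s * (th2 * r) by rewrite !mulr_ge0// ltW.
    have : 0 <= r * (th1 * s) by rewrite !mulr_ge0// ltW.
    by rewrite mulrBl !mulrBr; lra.
  have A2 : s * (th1 * s) <= dl * th1.
    by rewrite mulrCA mulrC ler_pM2r// -[leRHS]mulr1 ler_pM// ?ltW// (lt_le_trans s1).
  have A3 : r * (th2 * r) <= dl * th2.
    by rewrite mulrCA mulrC ler_pM2r// -[leRHS]mulr1 ler_pM// ?ltW// (lt_le_trans r1).
  have A4 : dl * (2 * (th1 + th2)) = 2 * (dl * th1 + dl * th2) by ring.
  have A5 : 0 < dl * th1 by rewrite mulr_gt0.
  have A6 : 0 < dl * th2 by rewrite mulr_gt0.
  lra.
apply: contrapT => nt.
(* The form is [th1 * (s - r) * (s - q * r)], with roots 1 and [q] in the ratio [s / r]; [a] and [b]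
   list these roots in increasing order. *)
pose q := th2 / th1.
have q0 : 0 < q by exact: divr_gt0.
have tq : th2 = th1 * q by rewrite /q mulrC divfK// gt_eqF.
have [a [b [a0 ab abE]]] : exists a b, [/\ 0 < a, a < b &
    forall s r, (s - r) * (s - q * r) = (s - a * r) * (s - b * r)].
  have [q1|q1|q1] := ltgtP q 1.
  - by exists q, 1; split => // s r; rewrite mul1r mulrC.
  - by exists 1, q; split => // s r; rewrite mul1r.
  - by case: nt; rewrite tq q1 mulr1.
pose h := (b - a) / 3.
have h0 : 0 < h by rewrite divr_gt0// subr_gt0.
(* With [s / r] in the middle third between the roots, the form is at most [- k * r ^+ 2]; taking
   [r] above [K] makes this smaller than [- |c|]. *)
pose k := th1 * h ^+ 2.
have k0 : 0 < k by rewrite mulr_gt0// exprn_gt0.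
pose K := 1 + `|c| / k.
have ck : 0 <= `|c| / k by rewrite divr_ge0// ltW.
have K0 : 1 <= K by rewrite /K lerDl.
have KK : K < K + 1 by rewrite ltrDl.
have [r [/andP[r0 _] Hr]] := ae_itv KK H.
have r1 : 1 < r by exact: le_lt_trans K0 r0.
have rp : 0 < r by lra.
have ar : (a + h) * r < (a + 2 * h) * r by rewrite ltr_pM2r// ltrD2l; lra.
have [s [/andP[s1 s2] Hs]] := ae_itv ar Hr.
have sp : 0 < s by apply: lt_trans s1; rewrite mulr_gt0// addr_gt0.
have := Hs sp rp.
have bE : b = a + 3 * h by rewrite /h; field.
have E : (s - r) * (th1 * s - th2 * r) = - (th1 * ((s - a * r) * (b * r - s))).
  transitivity (th1 * ((s - r) * (s - q * r))); first by rewrite tq; ring.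
  by rewrite abE; ring.
have hr0 : 0 < h * r by rewrite mulr_gt0.
have f1 : h * r <= s - a * r by rewrite lerBrDl -mulrDl ltW.
have f2 : h * r <= b * r - s by rewrite bE; lra.
have f3 : (h * r) * (h * r) <= (s - a * r) * (b * r - s) by apply: ler_pM => //; exact: ltW.
have f4 : th1 * ((h * r) * (h * r)) <= th1 * ((s - a * r) * (b * r - s)) by rewrite ler_pM2l.
have f5 : th1 * ((h * r) * (h * r)) = k * r * r by rewrite /k; ring.
have f6 : k * r <= k * r * r by rewrite ler_peMr ?(ltW r1)// mulr_ge0// ltW.
have f7 : k * K < k * r by rewrite ltr_pM2l.
have f8 : k * K = k + `|c| by rewrite /K mulrDr mulr1 mulrC divfK// gt_eqF.
have f9 := ler_norm c.
rewrite E; lra.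
Qed.

(** * One transport step on a half-space *)

(* [F] and [G] are carried by [thead x > 0]. Tails are transported by the map
   given for the marginals, heads by the monotone transport between conditional
   densities. *)
Section half.
Context {R : realType} (d : nat).
Local Notation Leb := (@Leb R).
Variables (w : R) (F G : d.+1.-tuple R -> R).
Hypothesis w01 : 0 < w < 1.
Hypotheses (dF : density F) (dG : density G).
Hypotheses (Fn : forall x, thead x <= 0 -> F x = 0)
           (Gn : forall x, thead x <= 0 -> G x = 0).
Variables (T' Z' : d.-tuple R -> d.-tuple R) (DB' DZ' : d.-tuple R -> R).
Local Notation fm := (marg F).
Local Notation gm := (marg G).
Hypothesis TP : transport_pair w fm gm T' Z' DB' DZ'.

Let mF : measurable_fun setT F. Proof. by have [] := dF. Qed.
Let F0 x : 0 <= F x. Proof. by have [] := dF. Qed.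
Let mG : measurable_fun setT G. Proof. by have [] := dG. Qed.
Let G0 x : 0 <= G x. Proof. by have [] := dG. Qed.
Let mT' : measurable_fun setT T'. Proof. exact: tp_mT TP. Qed.
Let mZ' : measurable_fun setT Z'. Proof. exact: tp_mZ TP. Qed.
Let mDB' : measurable_fun setT DB'. Proof. exact: tp_mDB TP. Qed.
Let mDZ' : measurable_fun setT DZ'. Proof. exact: tp_mDZ TP. Qed.
Let DB'0 : forall x, 0 <= DB' x. Proof. exact: tp_DB_ge0 TP. Qed.
Let DZ'0 : forall x, 0 <= DZ' x. Proof. exact: tp_DZ_ge0 TP. Qed.
Let mtl := @measurable_tl R d.
Let mth := @measurable_thead R d.
Let mfm := measurable_marg dF.
Let mgm := measurable_marg dG.

Definition hav t s := F (consp (s, t)) / fm t.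
Definition hbv t u := G (consp (u, T' t)) / gm (T' t).
Definition hok t := (0 < fm t) && (0 < gm (T' t)).
Definition hta (x : d.+1.-tuple R) : R :=
  if hok (tl x) then tau (hav (tl x)) (hbv (tl x)) (thead x) else 0.
Definition hTh x : d.+1.-tuple R := consp (hta x, T' (tl x)).
Definition hgd (x : d.+1.-tuple R) : bool := hok (tl x) && good (hav (tl x)) (thead x).
Definition hdta x : R := hav (tl x) (thead x) * (hgd x)%:R / hbv (tl x) (hta x).
Definition hEh x : bool := [&& hgd x, 0 < F x & 0 < G (hTh x)].
Definition hZh x : d.+1.-tuple R := consp (Num.sqrt (thead x * hta x), Z' (tl x)).
(** The step is triangular: the transported tail does not depend on the head. Both formal Jacobians
    are therefore products of the tail Jacobian and the one-dimensional one on the fiber. *)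
Definition hDBh x : R :=
  DB' (tl x) * hDB (fun s => hEh (consp (s, tl x))) (fun s => hdta (consp (s, tl x))) w (thead x).
Definition hDZh x : R :=
  DZ' (tl x) * hDZ (fun s => hEh (consp (s, tl x))) (fun s => hta (consp (s, tl x)))
    (fun s => hdta (consp (s, tl x))) (thead x).

Lemma hok_fm t : hok t -> 0 < fm t. Proof. by case/andP. Qed.
Lemma hok_gm t : hok t -> 0 < gm (T' t). Proof. by case/andP. Qed.

Lemma hav_density t : hok t -> [/\ measurable_fun setT (hav t), forall s, 0 <= hav t s &
  (\int[lebR]_s (hav t s)%:E = 1)%E].
Proof.
move=> /hok_fm t0; split.
- by apply: measurable_funM => //; exact: measurable_sec.
- by move=> s; rewrite divr_ge0// ltW.
- under eq_integral do rewrite /hav EFinM.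
  rewrite ge0_integralZr//.
  + by rewrite marg_gt0// -EFinM mulfV// gt_eqF.
  + by apply/measurable_EFinP; exact: (measurable_sec t mF).
  + by move=> s _; rewrite lee_fin.
  + by rewrite lee_fin invr_ge0 ltW.
Qed.

Lemma hbv_density t : hok t -> [/\ measurable_fun setT (hbv t), forall s, 0 <= hbv t s &
  (\int[lebR]_s (hbv t s)%:E = 1)%E].
Proof.
move=> /hok_gm t0; split.
- by apply: measurable_funM => //; exact: measurable_sec.
- by move=> s; rewrite divr_ge0// ltW.
- under eq_integral do rewrite /hbv EFinM.
  rewrite ge0_integralZr//.
  + by rewrite marg_gt0// -EFinM mulfV// gt_eqF.
  + by apply/measurable_EFinP; exact: (measurable_sec (T' t) mG).
  + by move=> s _; rewrite lee_fin.
  + by rewrite lee_fin invr_ge0 ltW.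
Qed.

Let measurable_bvj dX (X : measurableType dX) (t : X -> d.-tuple R) (u : X -> R) :
  measurable_fun setT t -> measurable_fun setT u ->
  measurable_fun setT (fun x => hbv (t x) (u x)).
Proof.
move=> mt mu; have mTt : measurable_fun setT (fun x => T' (t x)).
  exact: measurableT_comp mT' mt.
apply: measurable_funM.
  by apply: measurableT_comp mG _; exact: measurable_consp'.
by apply: measurable_invr; exact: measurableT_comp mgm mTt.
Qed.

Let measurable_avj dX (X : measurableType dX) (t : X -> d.-tuple R) (u : X -> R) :
  measurable_fun setT t -> measurable_fun setT u ->
  measurable_fun setT (fun x => hav (t x) (u x)).
Proof.
move=> mt mu; apply: measurable_funM.
  by apply: measurableT_comp mF _; exact: measurable_consp'.
by apply: measurable_invr; exact: measurableT_comp mfm mt.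
Qed.

Let av0 t s : 0 <= hav t s. Proof. by rewrite divr_ge0// marg_ge0. Qed.
Let bv0 t s : 0 <= hbv t s. Proof. by rewrite divr_ge0// marg_ge0. Qed.

Lemma measurable_hok : measurable_fun setT hok.
Proof.
apply: measurable_and; apply: measurable_fun_ltr => //.
exact: measurableT_comp mgm mT'.
Qed.

Let mcda : measurable_fun setT (fun x : d.+1.-tuple R => cdfd (hav (tl x)) (thead x)).
Proof.
apply: (measurable_cdfd_joint (c := fun x => hav (tl x))) => //.
by apply: measurable_avj => //; exact: measurableT_comp mtl _.
Qed.

Let mcdb u : measurable_fun setT (fun x : d.+1.-tuple R => cdfd (hbv (tl x)) u).
Proof.
apply: (measurable_cdfd_joint (c := fun x => hbv (tl x)) (s := cst u)) => //.
by apply: measurable_bvj => //; exact: measurableT_comp mtl _.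
Qed.

Lemma measurable_hgd : measurable_fun setT hgd.
Proof.
apply: measurable_and; first exact: measurableT_comp measurable_hok mtl.
by apply: measurable_and; apply: measurable_fun_ltr.
Qed.

Let mset dX (Y : measurableType dX) (P : Y -> bool) :
  measurable_fun setT P -> measurable [set x | P x].
Proof.
move=> mP; rewrite (_ : [set x | P x] = P @^-1` [set true]).
  by rewrite -[X in measurable X]setTI; exact: mP.
by apply/seteqP; split.
Qed.

(** Through [tau_leP] a sublevel set of [hta] is described by the two conditional distribution
    functions, which are jointly measurable. *)
Lemma measurable_hta : measurable_fun setT hta.
Proof.
apply: measurable_le_itv => u.
have mP : measurable_fun setT (fun x => if hgd x then cdfd (hav (tl x)) (thead x) <= cdfd (hbv (tl x)) u
    else 0 <= u).
  apply: measurable_fun_ifT; first exact: measurable_hgd.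
    by apply: measurable_fun_ler; [exact: mcda|exact: mcdb].
  exact: measurable_cst.
rewrite (_ : [set x | _] = [set x | if hgd x then cdfd (hav (tl x)) (thead x) <= cdfd (hbv (tl x)) u
    else 0 <= u]); first exact: mset.
suff e x : (hta x <= u) = (if hgd x then cdfd (hav (tl x)) (thead x) <= cdfd (hbv (tl x)) u
    else 0 <= u) by apply/seteqP; split => x /=; rewrite e.
rewrite /hta /hgd; case: (boolP (hok (tl x))) => //= okx.
have [m1 p1 i1] := hav_density okx; have [m2 p2 i2] := hbv_density okx.
have [gx|gx] := boolP (good _ _); first by rewrite tau_leP.
by rewrite /tau (negbTE gx).
Qed.

Lemma measurable_hTh : measurable_fun setT hTh.
Proof.
apply: measurable_consp'; first exact: measurable_hta.
exact: measurableT_comp mT' mtl.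
Qed.

Lemma measurable_hEh : measurable_fun setT hEh.
Proof.
apply: measurable_and; first exact: measurable_hgd.
apply: measurable_and; apply: measurable_fun_ltr => //.
exact: measurableT_comp mG measurable_hTh.
Qed.

Lemma measurable_hdta : measurable_fun setT hdta.
Proof.
apply: measurable_funM.
  apply: measurable_funM; first exact: measurable_avj.
  by apply: measurable_natr_bool; exact: measurable_hgd.
by apply: measurable_invr; apply: measurable_bvj => //; exact: measurable_hta.
Qed.

Lemma measurable_hZh : measurable_fun setT hZh.
Proof.
apply: measurable_consp'; last exact: measurableT_comp mZ' mtl.
apply: measurableT_comp.
  by apply: continuous_measurable_fun; exact: sqrt_continuous.
by apply: measurable_funM => //; exact: measurable_hta.
Qed.

Lemma hDBhE x : hDBh x = DB' (tl x) *
  ((1 - w) * (hEh x)%:R + w * ((hEh x)%:R * hdta x)).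
Proof. by rewrite /hDBh /hDB /hpi /hka consp_eta. Qed.

Lemma hDZhE x : hDZh x = DZ' (tl x) * (Num.sqrt (thead x * hta x) *
  ((1 - 2^-1) * ((hEh x)%:R / thead x) + 2^-1 * ((hEh x)%:R * hdta x / hta x))).
Proof. by rewrite /hDZh /hDZ /hZ /hk /hpil /hkal /hka consp_eta. Qed.

Lemma measurable_hDBh : measurable_fun setT hDBh.
Proof.
rewrite (funext hDBhE); apply: measurable_funM; first exact: measurableT_comp mDB' mtl.
have mE : measurable_fun setT (fun x => (hEh x)%:R : R).
  by apply: measurable_natr_bool; exact: measurable_hEh.
apply: measurable_funD; apply: measurable_funM => //.
by apply: measurable_funM => //; exact: measurable_hdta.
Qed.

Lemma measurable_hDZh : measurable_fun setT hDZh.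
Proof.
rewrite (funext hDZhE); apply: measurable_funM; first exact: measurableT_comp mDZ' mtl.
have mE : measurable_fun setT (fun x => (hEh x)%:R : R).
  by apply: measurable_natr_bool; exact: measurable_hEh.
apply: measurable_funM.
  apply: measurableT_comp.
    by apply: continuous_measurable_fun; exact: sqrt_continuous.
  by apply: measurable_funM => //; exact: measurable_hta.
apply: measurable_funD; apply: measurable_funM => //; apply: measurable_funM => //.
- exact: measurable_invr.
- by apply: measurable_funM => //; exact: measurable_hdta.
- by apply: measurable_invr; exact: measurable_hta.
Qed.

Section fiber.
Variable t : d.-tuple R.
Local Notation E_ := (fun s => hEh (consp (s, t))).
Local Notation tau_ := (fun s => hta (consp (s, t))).
Local Notation dtau_ := (fun s => hdta (consp (s, t))).

Lemma fib_tauE s : hok t -> hta (consp (s, t)) = tau (hav t) (hbv t) s.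
Proof. by move=> okt; rewrite /hta tl_consp okt thead_consp. Qed.

Lemma fib_dtauE s : hok t -> hdta (consp (s, t)) = dtau (hav t) (hbv t) s.
Proof.
by move=> okt; rewrite /hdta /dtau /ag /hgd fib_tauE// tl_consp thead_consp okt.
Qed.

Lemma fib_Th s : hTh (consp (s, t)) = consp (tau_ s, T' t).
Proof. by rewrite /hTh tl_consp. Qed.

Lemma fib_E s : hok t -> E_ s = hE (hav t) (hbv t) s.
Proof.
move=> okt; have f0 := hok_fm okt; have g0 := hok_gm okt.
rewrite /hEh /hE /hgd tl_consp thead_consp okt/=.
rewrite -(fib_tauE _ okt).
by rewrite fib_Th /hav /hbv !pmulr_lgt0// invr_gt0.
Qed.

Lemma hEh_ok s : E_ s -> hok t.
Proof. by rewrite /hEh /hgd tl_consp => /andP[/andP[]]. Qed.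

Let avn s : s <= 0 -> hav t s = 0.
Proof. by move=> s0; rewrite /hav Fn ?mul0r// thead_consp. Qed.
Let bvn s : s <= 0 -> hbv t s = 0.
Proof. by move=> s0; rewrite /hbv Gn ?mul0r// thead_consp. Qed.

Lemma fib_mE : measurable_fun setT E_.
Proof. exact: measurable_sec measurable_hEh. Qed.
Lemma fib_mtau : measurable_fun setT tau_.
Proof. exact: measurable_sec measurable_hta. Qed.
Lemma fib_mdtau : measurable_fun setT dtau_.
Proof. exact: measurable_sec measurable_hdta. Qed.

Lemma fib_gt0 s : E_ s -> [/\ 0 < s, 0 < tau_ s & 0 < dtau_ s].
Proof.
move=> Es; have okt := hEh_ok Es; move: Es; rewrite (fib_E _ okt) (fib_tauE _ okt) (fib_dtauE _ okt).
exact: hE_gt0.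
Qed.

Lemma fib_nd s u : E_ s -> E_ u -> s <= u -> tau_ s <= tau_ u.
Proof.
move=> Es Eu; have okt := hEh_ok Es; move: Es Eu; rewrite !(fib_E _ okt) !(fib_tauE _ okt).
have [m1 p1 i1] := hav_density okt; have [m2 p2 i2] := hbv_density okt.
by move=> /and3P[gs _ _] /and3P[gu _ _]; exact: tau_nd.
Qed.

Lemma fib_le A : measurable A ->
  (wpush lebR (fun s => (E_ s)%:R * dtau_ s)%R tau_ A <= lebR A)%E.
Proof.
move=> mA; have mk : measurable_fun setT (fun s => (E_ s)%:R * dtau_ s).
  apply: measurable_funM; last exact: fib_mdtau.
  by apply: measurable_natr_bool; exact: fib_mE.
have [okt|okt] := boolP (hok t); last first.
  rewrite /wpush integral0_eq// => s _.
  by have [/hEh_ok|_] := boolP (E_ s); rewrite ?mul0r// (negbTE okt).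
have [m1 p1 i1] := hav_density okt; have [m2 p2 i2] := hbv_density okt.
apply: le_trans (wpush_dtau m1 m2 p1 p2 i1 i2 mA).
have d0 s : 0 <= dtau_ s by rewrite (fib_dtauE _ okt); exact: dtau_ge0.
apply: ge0_le_integral => //.
- by move=> s _; rewrite lee_fin; apply: mulr_ge0 => //; exact: mulr_ge0.
- by apply: wpush_measurable => //; exact: fib_mtau.
- exact: (wpush_measurable (measurable_dtau m1 m2 p1 p2 i1 i2) (measurable_tau m1 m2 p1 p2 i1 i2) mA).
- move=> s _; rewrite lee_fin -(fib_tauE _ okt) -(fib_dtauE _ okt); apply: ler_wpM2r => //.
  by case: (E_ s); rewrite ?mul1r// mul0r.
Qed.

Lemma fib_ae : hok t -> {ae lebR, forall s, 0 < F (consp (s, t)) -> E_ s}.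
Proof.
move=> okt; have [m1 p1 i1] := hav_density okt; have [m2 p2 i2] := hbv_density okt.
apply: filterS (ae_hE m1 m2 p1 p2 i1 i2) => s h Fs; rewrite (fib_E _ okt); apply: h.
by rewrite /hav divr_gt0// hok_fm.
Qed.

End fiber.

Lemma ae_hok : {ae Leb d, forall t, 0 < fm t -> hok t}.
Proof. by apply: filterS (tp_gpos TP) => t h f0; rewrite /hok f0 h. Qed.

Lemma ae_hEh : {ae Leb d.+1, forall x, 0 < F x -> hEh x}.
Proof.
have mP : measurable_fun setT (fun x => (0 < F x) ==> hEh x).
  rewrite (_ : (fun x => _) = (fun x => ~~ (0 < F x) || hEh x)).
    apply: measurable_or; last exact: measurable_hEh.
    by apply: measurable_neg; exact: measurable_fun_ltr.
  by apply/funext => x; rewrite implybE.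
suff : {ae Leb d.+1, forall x, (0 < F x) ==> hEh x}.
  by apply: filterS => x /implyP.
apply/(ae_LebS mP).
apply: filterS2 (marg_ae dF) ae_hok => t ht okt.
have := marg_ge0 dF t; rewrite le_eqVlt => /orP[/eqP f0|/okt {}okt]; last first.
  by apply: filterS (fib_ae okt) => s h; apply/implyP.
have mFt : measurable_fun setT (fun s => (F (consp (s, t)))%:E).
  by apply/measurable_EFinP; exact: measurable_sec.
rewrite -f0 in ht.
have := (ae_integral0E lebR mFt (fun s => (F0 _ : (0 <= _%:E)%E))).2 ht.
by apply: filterS => s [] ->; rewrite ltxx.
Qed.

(** Disintegration over tails: the heads are rearranged inside each fiber, after which the
    push-forward property of the tail map applies to the fiber averages. *)
Lemma half_push (phi : d.+1.-tuple R -> \bar R) : measurable_fun setT phi ->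
  (forall x, 0 <= phi x)%E ->
  (\int[Leb d.+1]_x ((F x)%:E * phi (hTh x)) = \int[Leb d.+1]_x ((G x)%:E * phi x))%E.
Proof.
move=> mphi phi0.
have mFE : measurable_fun setT (EFin \o F) by exact/measurable_EFinP.
have mGE : measurable_fun setT (EFin \o G) by exact/measurable_EFinP.
have mH : measurable_fun setT (fun x => (F x)%:E * phi (hTh x))%E.
  by apply: emeasurable_funM => //; exact: measurableT_comp mphi measurable_hTh.
have H0 x : (0 <= (F x)%:E * phi (hTh x))%E by rewrite mule_ge0// lee_fin.
have mK : measurable_fun setT (fun x => (G x)%:E * phi x)%E by exact: emeasurable_funM.
have K0 x : (0 <= (G x)%:E * phi x)%E by rewrite mule_ge0// lee_fin.
have mphis y : measurable_fun setT (fun u => phi (consp (u, y))).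
  exact: (measurable_sec y mphi).
pose I y := (\int[lebR]_u ((G (consp (u, y)))%:E * phi (consp (u, y))))%E.
have mI : measurable_fun setT I by exact: (measurable_fiber mK K0).
have I0 y : (0 <= I y)%E by apply: integral_ge0.
(* The conditional mean of [phi] under [G] given the tail [y]. *)
pose Psi y := (((gm y)^-1)%:E * I y)%E.
have mPsi : measurable_fun setT Psi.
  by apply: emeasurable_funM => //; apply/measurable_EFinP; exact: measurable_invr.
have Psi0 y : (0 <= Psi y)%E by rewrite mule_ge0// lee_fin invr_ge0 marg_ge0.
transitivity (\int[Leb d]_t ((fm t)%:E * Psi (T' t)))%E.
  rewrite ge0_integral_LebS'//; apply: ge0_ae_eq_integral => //.
  - exact: measurable_fiber mH H0.
  - apply: emeasurable_funM; first exact/measurable_EFinP.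
    exact: measurableT_comp mPsi mT'.
  - by move=> t _; apply: integral_ge0.
  - by move=> t _; rewrite mule_ge0// lee_fin marg_ge0.
  apply: filterS2 (marg_ae dF) ae_hok => t ht okt _.
  have := marg_ge0 dF t; rewrite le_eqVlt => /orP[/eqP f0|/okt {}okt].
    rewrite -f0 mul0e; apply: (ge0_integral_mul0 (g := fun s => F (consp (s, t)))) => //.
    - exact: (measurable_sec t mF).
    - apply: (measurable_sec t (H := fun x => phi (hTh x))).
      exact: measurableT_comp mphi measurable_hTh.
    - by rewrite ht -f0.
  have [m1 p1 i1] := hav_density okt; have [m2 p2 i2] := hbv_density okt.
  have f0 := hok_fm okt; have g0 := hok_gm okt.
  transitivity (\int[lebR]_s ((fm t)%:E * ((hav t s)%:E *
     phi (consp (tau (hav t) (hbv t) s, T' t)))))%E.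
    apply: eq_integral => s _; rewrite fib_Th (fib_tauE _ okt) muleA -EFinM.
    by congr (_%:E * _)%E; rewrite /hav mulrC divfK// gt_eqF.
  rewrite ge0_integralZl//; last 3 first.
  - apply: emeasurable_funM; first exact/measurable_EFinP.
    apply: measurableT_comp (mphis _) _.
    exact: (measurable_tau m1 m2 p1 p2 i1 i2).
  - by move=> s _; rewrite mule_ge0// lee_fin.
  - by rewrite lee_fin ltW.
  congr (_ * _)%E.
  rewrite (ge0_integral_density_tau m1 m2 p1 p2 i1 i2 (H := fun u => phi (consp (u, T' t))))//.
  rewrite /Psi /I -ge0_integralZl//; last 2 first.
  - exact: (measurable_sec (T' t) mK).
  - by rewrite lee_fin invr_ge0 ltW.
  by apply: eq_integral => u _; rewrite muleA -EFinM; congr (_%:E * _)%E; rewrite mulrC.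
rewrite (tp_push TP mPsi Psi0) ge0_integral_LebS'//; apply: ge0_ae_eq_integral => //.
- by apply: emeasurable_funM => //; exact/measurable_EFinP.
- by move=> t _; rewrite mule_ge0// lee_fin marg_ge0.
- by move=> t _; apply: integral_ge0 => s _.
apply: filterS (marg_ae dG) => t ht _.
have := marg_ge0 dG t; rewrite le_eqVlt => /orP[/eqP f0|f0].
  rewrite -f0 mul0e; apply/esym; apply: (ge0_integral_mul0 (g := fun s => G (consp (s, t)))) => //.
  - exact: (measurable_sec t mG).
  - by rewrite ht -f0.
by rewrite /Psi muleA -EFinM mulfV ?gt_eqF// mul1e.
Qed.

(** Each joint density is its marginal times a conditional density, so the ratio factorizes in the
    same way as [hDBh] and [hDZh]. *)
Lemma half_J x : hEh x ->
  F x / G (hTh x) = (fm (tl x) / gm (T' (tl x))) * hdta x.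
Proof.
move=> /and3P[gx Fx Gx]; have /andP[/andP[f0 g0] _] := gx.
rewrite /hdta gx mulr1 /hav /hbv consp_eta -/(hTh x).
by field; rewrite !gt_eqF.
Qed.

Lemma hEh_dta x : hEh x -> 0 < hdta x.
Proof. by move=> Ex; have [] := @fib_gt0 (tl x) (thead x); rewrite consp_eta. Qed.

Lemma hEh_J' x : hEh x -> 0 < fm (tl x) / gm (T' (tl x)).
Proof. by move=> /and3P[/andP[/andP[f0 g0] _] _ _]; exact: divr_gt0. Qed.

Let w0 : 0 < w. Proof. by case/andP: w01. Qed.
Let w1 : 0 < 1 - w. Proof. by rewrite subr_gt0; case/andP: w01. Qed.

Let E_ x := fun s => hEh (consp (s, tl x)).
Let D_ x := fun s => hdta (consp (s, tl x)).
Let T_ x := fun s => hta (consp (s, tl x)).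

Lemma half_gpos : {ae Leb d.+1, forall x, 0 < F x -> 0 < G (hTh x)}.
Proof. by apply: filterS ae_hEh => x h /h /and3P[]. Qed.

Let E_x x : hEh x -> E_ x (thead x). Proof. by rewrite /E_ consp_eta. Qed.
Let D_x x : D_ x (thead x) = hdta x. Proof. by rewrite /D_ consp_eta. Qed.
Let T_x x : T_ x (thead x) = hta x. Proof. by rewrite /T_ consp_eta. Qed.

Let leB x : hEh x ->
  hdta x `^ w <= hDB (E_ x) (D_ x) w (thead x) ?= iff (hdta x == 1).
Proof.
move=> Ex; rewrite -D_x.
by apply: (@hDB_leif _ _ (T_ x)) => //; [exact: fib_gt0|exact: E_x].
Qed.

Let leZ x : hEh x ->
  Num.sqrt (hdta x) <= hDZ (E_ x) (T_ x) (D_ x) (thead x) ?= iff (hdta x == hta x / thead x).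
Proof.
move=> Ex; rewrite -D_x -T_x.
by apply: hDZ_leif => //; [exact: fib_gt0|exact: E_x].
Qed.

Let ae_x : {ae Leb d.+1, forall x, 0 < F x -> [/\ hEh x,
  (fm (tl x) / gm (T' (tl x))) `^ w <= DB' (tl x),
  (1 - w) ^+ d <= DB' (tl x) &
  Num.sqrt (fm (tl x) / gm (T' (tl x))) <= DZ' (tl x)]}.
Proof.
have h : {ae Leb d, forall t, 0 < fm t -> [/\ (fm t / gm (T' t)) `^ w <= DB' t,
    (1 - w) ^+ d <= DB' t & Num.sqrt (fm t / gm (T' t)) <= DZ' t]}.
  apply: filterS3 (tp_DB_powR TP) (tp_DB_lb TP) (tp_DZ_sqrt TP) => t h1 h2 h3 ft.
  by split; [exact: h1|exact: h2|exact: h3].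
apply: filterS2 ae_hEh (ae_tl h) => x Ex h3 /Ex {}Ex.
have f0 : 0 < fm (tl x) by case/and3P: Ex => /andP[/andP[]].
by have [] := h3 f0.
Qed.

Lemma half_DB_powR : {ae Leb d.+1, forall x, 0 < F x -> (F x / G (hTh x)) `^ w <= hDBh x}.
Proof.
apply: filterS ae_x => x h /h [Ex h1 _ _].
rewrite half_J// powRM ?(ltW (hEh_J' Ex)) ?(ltW (hEh_dta Ex))//.
by rewrite /hDBh ler_pM ?powR_ge0//; have [] := leB Ex.
Qed.

Lemma half_DB_lb : {ae Leb d.+1, forall x, 0 < F x -> (1 - w) ^+ d.+1 <= hDBh x}.
Proof.
apply: filterS ae_x => x h /h [Ex _ h1 _].
rewrite exprSr /hDBh ler_pM ?exprn_ge0 ?(ltW w1)//.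
apply: (@hDB_ge _ _ (T_ x)) => //; [exact: fib_gt0|exact: E_x].
Qed.

Lemma half_DZ_sqrt : {ae Leb d.+1, forall x, 0 < F x ->
  Num.sqrt (F x / G (hTh x)) <= hDZh x}.
Proof.
apply: filterS ae_x => x h /h [Ex _ _ h1].
rewrite half_J// sqrtrM ?(ltW (hEh_J' Ex))//.
by rewrite /hDZh ler_pM ?sqrtr_ge0//; have [] := leZ Ex.
Qed.

(** Equality for the products gives it for tails and heads separately. On heads, equality in the
    arithmetic bound yields [hdta x = 1] and in the geometric bound [hdta x = hta x / thead x];
    together they fix the head. *)
Lemma half_rigid : {ae Leb d.+1, forall x, 0 < F x -> (F x / G (hTh x)) `^ w = hDBh x ->
    Num.sqrt (F x / G (hTh x)) = hDZh x ->
    F x / G (hTh x) = 1 /\ sqnorm (hZh x) = sqnorm x}.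
Proof.
apply: filterS2 ae_x (ae_tl (tp_rigid TP)) => x h hr /h [Ex h1 _ h2].
have J0 := hEh_J' Ex; have d0 := hEh_dta Ex.
rewrite half_J// powRM ?(ltW J0) ?(ltW d0)// sqrtrM ?(ltW J0)// => e1 e2.
have [l1 l1e] := leB Ex; have [l2 l2e] := leZ Ex.
have [j1 i1] := mulr_le_eq (powR_gt0 _ J0) (powR_gt0 _ d0) h1 l1 e1.
have sJ : 0 < Num.sqrt (fm (tl x) / gm (T' (tl x))) by rewrite sqrtr_gt0.
have sd : 0 < Num.sqrt (hdta x) by rewrite sqrtr_gt0.
have [j2 i2] := mulr_le_eq sJ sd h2 l2 e2.
have f0 : 0 < fm (tl x) by case/and3P: Ex => /andP[/andP[]].
have [-> sz] := hr f0 j1 j2.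
have /eqP -> : hdta x == 1 by rewrite -l1e i1 eqxx.
split; first by rewrite mulr1.
have d1 : hdta x = 1 by apply/eqP; rewrite -l1e i1 eqxx.
have /eqP : hdta x == hta x / thead x by rewrite -l2e i2 eqxx.
have [s0 t0 _] : [/\ 0 < thead x, 0 < hta x & 0 < hdta x].
  by have := @fib_gt0 (tl x) (thead x); rewrite consp_eta => /(_ Ex).
rewrite d1 => e3.
have ts : hta x = thead x by rewrite -[RHS]mul1r e3 divfK// gt_eqF.
rewrite -[in RHS](consp_eta x) !sqnorm_consp /= sz; congr (_ + _).
by rewrite ts sqr_sqrtr// mulr_ge0// ltW.
Qed.

Lemma half_DB_ge0 x : 0 <= hDBh x.
Proof.
rewrite hDBhE mulr_ge0// addr_ge0// mulr_ge0 ?(ltW w0) ?(ltW w1)//.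
by have [/hEh_dta/ltW|_] := boolP (hEh x); rewrite ?mul0r// mul1r.
Qed.

Lemma half_DZ_ge0 x : 0 <= hDZh x.
Proof.
rewrite /hDZh mulr_ge0//; have [Ex|/negbTE Ex] := boolP (hEh x).
  by apply: le_trans (sqrtr_ge0 (hdta x)) _; have [] := leZ Ex.
by rewrite /hDZ /hk /hpil /hkal /hka consp_eta Ex !mul0r !mulr0 addr0 mulr0.
Qed.

(** On each fiber [ge0_integral_hDB] removes the head and leaves the function [I] of the
    interpolated tail, to which the tail inequality applies. *)
Lemma half_DB_le (phi : d.+1.-tuple R -> \bar R) : measurable_fun setT phi ->
  (forall x, 0 <= phi x)%E ->
  (\int[Leb d.+1]_x ((hDBh x)%:E * phi (comb w x (hTh x))) <=
   \int[Leb d.+1]_x ((0 < thead x)%R%:R%:E * phi x))%E.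
Proof.
move=> mphi phi0.
have mB : measurable_fun setT (fun x => comb w x (hTh x)).
  by apply: measurable_comb => //; exact: measurable_hTh.
have mH : measurable_fun setT (fun x => (hDBh x)%:E * phi (comb w x (hTh x)))%E.
  apply: emeasurable_funM; first by apply/measurable_EFinP; exact: measurable_hDBh.
  exact: measurableT_comp mphi mB.
have H0 x : (0 <= (hDBh x)%:E * phi (comb w x (hTh x)))%E.
  by rewrite mule_ge0// lee_fin half_DB_ge0.
have mp : measurable_fun setT (fun x : d.+1.-tuple R => ((0 < thead x)%R%:R)%:E : \bar R).
  by apply/measurable_EFinP/measurable_natr_bool; exact: measurable_fun_ltr.
have mK : measurable_fun setT (fun x : d.+1.-tuple R => (0 < thead x)%R%:R%:E * phi x)%E.
  exact: emeasurable_funM.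
have K0 (x : d.+1.-tuple R) : (0 <= (0 < thead x)%R%:R%:E * phi x)%E by rewrite mule_ge0// lee_fin.
pose I y := (\int[lebR]_s ((0 < s)%R%:R%:E * phi (consp (s, y))))%E.
have IE y : I y = (\int[lebR]_s ((0 < thead (consp (s, y)))%R%:R%:E * phi (consp (s, y))))%E.
  by apply: eq_integral => s _; rewrite thead_consp.
have mI : measurable_fun setT I.
  by rewrite (funext IE); exact: measurable_fiber mK K0.
have I0 y : (0 <= I y)%E by apply: integral_ge0 => s _; rewrite mule_ge0// lee_fin.
apply: (@le_trans _ _ (\int[Leb d]_t ((DB' t)%:E * I (comb w t (T' t))))%E).
  rewrite ge0_integral_LebS'//; apply: ge0_le_integral => //.
  - by move=> t _; apply: integral_ge0.
  - exact: measurable_fiber mH H0.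
  - apply: emeasurable_funM; first exact/measurable_EFinP.
    by apply: measurableT_comp mI _; exact: measurable_comb.
  move=> t _.
  have mphit : measurable_fun setT (fun s => phi (consp (s, comb w t (T' t)))).
    exact: (measurable_sec _ mphi).
  have K1 := ge0_integral_hDB (fib_mE t) (fib_mtau t) (fib_mdtau t) (@fib_gt0 t)
    (@fib_nd t) (@fib_le t) w01 mphit (fun s => phi0 _).
  have DBt : (0 <= (DB' t)%:E)%E by rewrite lee_fin.
  apply: le_trans (lee_wpmul2l DBt K1).
  rewrite -ge0_integralZl//; last 2 first.
  - apply: emeasurable_funM.
      apply/measurable_EFinP.
      have mE : measurable_fun setT (fun s => (hEh (consp (s, t)))%:R : R).
        by apply: measurable_natr_bool; exact: fib_mE.
      apply: measurable_funD; apply: measurable_funM => //.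
      by apply: measurable_funM => //; exact: fib_mdtau.
    apply: measurableT_comp mphit _; apply: measurable_funD; apply: measurable_funM => //.
    exact: fib_mtau.
  - move=> s _; rewrite mule_ge0// lee_fin /hDB /hpi /hka.
    rewrite addr_ge0// mulr_ge0 ?(ltW w0) ?(ltW w1)//.
    by have [/hEh_dta/ltW|_] := boolP (hEh _); rewrite ?mul0r// mul1r.
  rewrite le_eqVlt; apply/orP; left; apply/eqP; apply: eq_integral => s _.
  by rewrite /hDBh tl_consp thead_consp EFinM muleA fib_Th comb_consp.
apply: le_trans (tp_DB_le TP mI I0) _.
by rewrite ge0_integral_LebS'// le_eqVlt; apply/orP; left; apply/eqP.
Qed.

Lemma half_DZ_fiber t : (\int[lebR]_s (hDZh (consp (s, t)) * gam (hZh (consp (s, t))))%:E =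
  (DZ' t * gam (Z' t))%:E *
  \int[lebR]_s (hDZ (fun s => hEh (consp (s, t))) (fun s => hta (consp (s, t)))
    (fun s => hdta (consp (s, t))) s * gam1 (hZ (fun s => hta (consp (s, t))) s))%:E)%E.
Proof.
rewrite -ge0_integralZl//.
- apply: eq_integral => s _; rewrite -EFinM; congr EFin.
  by rewrite /hDZh /hZh !tl_consp !thead_consp gam_consp /hZ /=; ring.
- have mE : measurable_fun setT (fun s => (hEh (consp (s, t)))%:R : R).
    by apply: measurable_natr_bool; exact: fib_mE.
  have mZ : measurable_fun setT (hZ (fun s => hta (consp (s, t)))).
    apply: measurableT_comp.
      by apply: continuous_measurable_fun; exact: sqrt_continuous.
    by apply: measurable_funM => //; exact: fib_mtau.
  apply/measurable_EFinP; apply: measurable_funM; last first.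
    by apply: measurableT_comp mZ; exact: measurable_gam1.
  apply: measurable_funM => //.
  apply: measurable_funD; apply: measurable_funM => //; apply: measurable_funM => //.
  + exact: measurable_invr.
  + by apply: measurable_funM => //; exact: fib_mdtau.
  + by apply: measurable_invr; exact: fib_mtau.
- move=> s _; rewrite lee_fin hDZ_gam1; last exact: fib_gt0.
  rewrite mulr_ge0 ?(ltW (phi1_gt0 _))// /hk /hpil /hkal /hka onem_half -mulrDr.
  rewrite mulr_ge0 ?(ltW half_gt0)//.
  have [/fib_gt0[s0 t0 d0]|_] := boolP (hEh _); last by rewrite !mul0r addr0.
  by rewrite !mul1r; apply: addr_ge0; [rewrite invr_ge0|apply: divr_ge0]; exact: ltW.
- by rewrite lee_fin mulr_ge0// ltW// gam_gt0.
Qed.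

Lemma half_DZ_fiber_le t :
  (\int[lebR]_s (hDZh (consp (s, t)) * gam (hZh (consp (s, t))))%:E <=
   (DZ' t * gam (Z' t))%:E * (2^-1)%:E)%E.
Proof.
rewrite half_DZ_fiber; apply: lee_wpmul2l; first by rewrite lee_fin mulr_ge0// ltW// gam_gt0.
exact: (ge0_integral_hDZ (fib_mE t) (fib_mtau t) (fib_mdtau t) (@fib_gt0 t)
    (@fib_nd t) (@fib_le t)).
Qed.

Lemma half_DZ_le : (\int[Leb d.+1]_x (hDZh x * gam (hZh x))%:E <= (2^-1)%:E)%E.
Proof.
have mH : measurable_fun setT (fun x => (hDZh x * gam (hZh x))%:E).
  apply/measurable_EFinP; apply: measurable_funM; first exact: measurable_hDZh.
  by apply: measurable_gam; exact: measurable_hZh.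
have H0 x : (0 <= (hDZh x * gam (hZh x))%:E)%E.
  by rewrite lee_fin mulr_ge0 ?half_DZ_ge0// ltW// gam_gt0.
have mK : measurable_fun setT (fun t => (DZ' t * gam (Z' t))%:E).
  by apply/measurable_EFinP; apply: measurable_funM => //; exact: measurable_gam.
have K0 t : (0 <= (DZ' t * gam (Z' t))%:E)%E.
  by rewrite lee_fin mulr_ge0// ltW// gam_gt0.
have h0 : (0 <= (2^-1 : R)%:E)%E by rewrite lee_fin ltW// half_gt0.
rewrite ge0_integral_LebS'//.
apply: (@le_trans _ _ (\int[Leb d]_t ((DZ' t * gam (Z' t))%:E * (2^-1)%:E))%E).
  apply: ge0_le_integral => //.
  - by move=> t _; apply: integral_ge0.
  - exact: measurable_fiber mH H0.
  - exact: emeasurable_funM.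
  - by move=> t _; exact: half_DZ_fiber_le.
rewrite ge0_integralZr//.
by rewrite -[leRHS]mul1e; apply: lee_wpmul2r => //; exact: tp_DZ_le TP.
Qed.

Let R' t := sqnorm (Z' t) - dot t (T' t).

(** The squared head of [hZh] is exactly the product of the heads of [x] and [hTh x], so only the
    tails contribute to this difference. *)
Let ae_R : {ae Leb d.+1, forall x,
  ((sqnorm (hZh x) - dot x (hTh x)) * F x)%:E = (R' (tl x) * F x)%:E}.
Proof.
apply: filterS ae_hEh => x h.
have := F0 x; rewrite le_eqVlt => /orP[/eqP <-|/h Ex]; first by rewrite !mulr0.
have [s0 t0 _] : [/\ 0 < thead x, 0 < hta x & 0 < hdta x].
  by have := @fib_gt0 (tl x) (thead x); rewrite consp_eta => /(_ Ex).
rewrite -[x in dot x](consp_eta x) /hZh /hTh sqnorm_consp dot_consp /=.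
by rewrite sqr_sqrtr ?mulr_ge0 ?(ltW s0) ?(ltW t0)// /R'; congr (_ * _)%:E; ring.
Qed.

Let mR' : measurable_fun setT R'.
Proof. by apply: measurable_funB; [exact: measurable_sqnorm|exact: measurable_dot]. Qed.

Let mRh : measurable_fun setT (fun x => ((sqnorm (hZh x) - dot x (hTh x)) * F x)%:E).
Proof.
apply/measurable_EFinP; apply: measurable_funM => //; apply: measurable_funB.
  by apply: measurable_sqnorm; exact: measurable_hZh.
by apply: measurable_dot => //; exact: measurable_hTh.
Qed.

Let iR : (Leb d.+1).-integrable setT (fun x => (R' (tl x) * F x)%:E).
Proof. by apply/(marg_integrableE dF mR'); exact: tp_dot_integrable TP. Qed.

Lemma half_dot_integrable : (Leb d.+1).-integrable setT
    (fun x => ((sqnorm (hZh x) - dot x (hTh x)) * F x)%:E).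
Proof.
apply/integrableP; split => //.
have /integrableP[mi] := iR; apply: le_lt_trans.
rewrite le_eqVlt; apply/orP; left; apply/eqP; apply: ge0_ae_eq_integral => //.
- exact: measurableT_comp.
- exact: measurableT_comp.
by apply: filterS ae_R => x -> _.
Qed.

Lemma half_dot0 : (\int[Leb d.+1]_x ((sqnorm (hZh x) - dot x (hTh x)) * F x)%:E = 0)%E.
Proof.
rewrite (@ae_eq_integral _ _ _ (Leb d.+1) setT (fun x => (R' (tl x) * F x)%:E))//.
- by rewrite (marg_integral_signed dF mR'); exact: tp_dot0 TP.
- by have /integrableP[] := iR.
- by apply: filterS ae_R => x -> _.
Qed.

Section linear.
Variable p : R.
Hypothesis p0 : 0 < p.
Hypothesis H1 : {ae Leb d.+1, forall x, 0 < F x ->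
  p * F x = gam (hZh x) * Num.sqrt (F x / G (hTh x))}.
Hypothesis H2 : {ae Leb d.+1, forall x, 0 < F x ->
  Num.sqrt (F x / G (hTh x)) = hDZh x}.

Let J' t := fm t / gm (T' t).
Let fDZ x := hDZ (E_ x) (T_ x) (D_ x) (thead x).

Let ae_fac : {ae Leb d.+1, forall x, 0 < F x -> [/\ hEh x,
  Num.sqrt (J' (tl x)) = DZ' (tl x), Num.sqrt (hdta x) = fDZ x &
  p * F x = hDZh x * gam (hZh x)]}.
Proof.
apply: filterS3 ae_x H1 H2 => x h h1 h2 F0x; have [Ex _ _ l1] := h F0x.
have J0 := hEh_J' Ex; have d0 := hEh_dta Ex.
have [l2 _] := leZ Ex.
have := h2 F0x; rewrite {1}(half_J Ex) sqrtrM ?(ltW J0)// => e2.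
have sJ : 0 < Num.sqrt (fm (tl x) / gm (T' (tl x))) by rewrite sqrtr_gt0.
have sd : 0 < Num.sqrt (hdta x) by rewrite sqrtr_gt0.
have [j2 i2] := mulr_le_eq sJ sd l1 l2 e2.
by split => //; rewrite (h1 F0x) (h2 F0x) mulrC.
Qed.

Let mDg : measurable_fun setT (fun x => hDZh x * gam (hZh x)).
Proof.
apply: measurable_funM; first exact: measurable_hDZh.
by apply: measurable_gam; exact: measurable_hZh.
Qed.

Let Dg0 x : 0 <= hDZh x * gam (hZh x).
Proof. by rewrite mulr_ge0 ?half_DZ_ge0// ltW// gam_gt0. Qed.

Let g' t := DZ' t * gam (Z' t).
Let g'0 t : 0 <= g' t. Proof. by rewrite mulr_ge0// ltW// gam_gt0. Qed.
Let mg' : measurable_fun setT g'.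
Proof. by apply: measurable_funM => //; exact: measurable_gam. Qed.

(** In the equality case [p * F x] is the Gaussian weight [hDZh x * gam (hZh x)] wherever [F] is
    positive, and it is trivially below that weight elsewhere. *)
Let fib_fm : {ae Leb d, forall t, ((p * fm t)%:E <=
  \int[lebR]_s (hDZh (consp (s, t)) * gam (hZh (consp (s, t))))%:E)%E}.
Proof.
apply: filterS2 (marg_ae dF) (ae_fiber ae_fac) => t ht hf.
have mFt := measurable_sec t mF.
rewrite EFinM -ht -ge0_integralZl//; last 3 first.
- exact/measurable_EFinP.
- by move=> s _; rewrite lee_fin.
- by rewrite lee_fin ltW.
apply: ae_ge0_le_integral => //.
- by move=> s _; rewrite -EFinM lee_fin mulr_ge0// ltW.
- by apply: measurable_funeM; exact/measurable_EFinP.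
- by move=> s _; rewrite lee_fin.
- by apply/measurable_EFinP; exact: (measurable_sec t mDg).
apply: filterS hf => s hs _; rewrite -EFinM lee_fin.
have := F0 (consp (s, t)); rewrite le_eqVlt => /orP[/eqP <-|/hs [_ _ _ ->]//].
by rewrite mulr0.
Qed.

Let fm_le : {ae Leb d, forall t, p * fm t <= 2^-1 * g' t}.
Proof.
apply: filterS fib_fm => t ht; rewrite -lee_fin; apply: le_trans ht _.
by apply: le_trans (half_DZ_fiber_le t) _; rewrite -EFinM mulrC.
Qed.

Let int_g' : (\int[Leb d]_t (g' t)%:E <= 1)%E.
Proof. exact: tp_DZ_le TP. Qed.

Let fm1 : (\int[Leb d]_t (fm t)%:E = 1)%E.
Proof. by have [] := density_marg dF. Qed.

(** Here [p] stands for the mass of the original density on this side of the cut. Equality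
    identifies that mass with part of the Gaussian mass of a half-space; applied to both sides,
    whose masses add up to 1, it will force 1/2 on each. *)
Lemma half_mass_le : p <= 2^-1.
Proof.
rewrite -lee_fin -[leLHS]mule1 -fm1 -ge0_integralZl//; last 3 first.
- exact/measurable_EFinP.
- by move=> t _; rewrite lee_fin marg_ge0.
- by rewrite lee_fin ltW.
apply: (@le_trans _ _ ((2^-1)%:E * \int[Leb d]_t (g' t)%:E)%E); last first.
  by rewrite -[leRHS]mule1; apply: lee_wpmul2l.
rewrite -ge0_integralZl//; last 2 first.
- exact/measurable_EFinP.
- by move=> t _; rewrite lee_fin.
apply: ae_ge0_le_integral => //.
- by move=> s _; rewrite -EFinM lee_fin mulr_ge0 ?marg_ge0// ltW.
- by apply: measurable_funeM; exact/measurable_EFinP.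
- by move=> s _; rewrite -EFinM lee_fin mulr_ge0// ltW// half_gt0.
- by apply: measurable_funeM; exact/measurable_EFinP.
by apply: filterS fm_le => t ht _; rewrite -!EFinM lee_fin.
Qed.

Hypothesis ph : p = 2^-1.

(** For [p = 2^-1] the two ends of the estimate in [half_mass_le] coincide, so the pointwise bound
    [fm_le] is saturated. *)
Let fm_g' : {ae Leb d, forall t, fm t = g' t}.
Proof.
apply: integral_saturated_ae => //.
- by move=> t; exact: marg_ge0.
- apply: filterS fm_le => t; rewrite ph ler_pM2l//; exact: half_gt0.
- by rewrite fm1 ltry.
- by rewrite fm1.
Qed.

Let lin t th := 0 < th /\ {ae lebR, forall s, 0 < s ->
  hEh (consp (s, t)) /\ hta (consp (s, t)) = th * s}.

(** Saturation of the fiber integral is what [head_linear] asks for. At this stage the slope [th]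
    may still depend on the tail. *)
Let ae_lin : {ae Leb d, forall t, 0 < fm t ->
  Num.sqrt (J' t) = DZ' t /\ exists th, lin t th}.
Proof.
apply: filterS3 (filterI fib_fm fm_g') (filterI (marg_ae dF) ae_hok) (ae_fiber ae_fac).
move=> t [h1 h2] [h3 h4] h5 f0; have okt := h4 f0.
have sE : Num.sqrt (J' t) = DZ' t.
  apply: contrapT => ns; move: f0; have := h3.
  have -> : (\int[lebR]_s (F (consp (s, t)))%:E = 0)%E.
    apply: ge0_integral_ae0 => //; first exact: (measurable_sec t mF).
    apply: filterS h5 => s hs; apply/eqP; rewrite eq_le F0 andbT leNgt.
    by apply/negP => /hs [_]; rewrite tl_consp.
  by move=> [] <-; rewrite ltxx.
split => //.
have sat : {ae lebR, forall s, hEh (consp (s, t)) ->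
   hDZ (fun s => hEh (consp (s, t))) (fun s => hta (consp (s, t)))
    (fun s => hdta (consp (s, t))) s = Num.sqrt (hdta (consp (s, t)))}.
  apply: filterS h5 => s hs Es; have /hs[_ _] : 0 < F (consp (s, t)) by case/and3P: Es.
  by rewrite /fDZ /E_ /T_ /D_ tl_consp thead_consp => ->.
have hh : (\int[lebR]_s (hDZ (fun s => hEh (consp (s, t))) (fun s => hta (consp (s, t)))
    (fun s => hdta (consp (s, t))) s * gam1 (hZ (fun s => hta (consp (s, t))) s))%:E = (2^-1)%:E)%E.
  apply/eqP; rewrite eq_le; apply/andP; split.
    exact: (ge0_integral_hDZ (fib_mE t) (fib_mtau t) (fib_mdtau t) (@fib_gt0 t)
      (@fib_nd t) (@fib_le t)).
  move: h1; rewrite half_DZ_fiber -/(g' t) -h2 ph EFinM muleC.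
  by rewrite lee_pmul2l// lte_fin.
have [th [th0 hth]] := head_linear (fib_mE t) (fib_mtau t) (fib_mdtau t) (@fib_gt0 t)
      (@fib_nd t) (@fib_le t) sat hh.
by exists th.
Qed.

Hypothesis H3 : {ae Leb d.+1, forall x, {ae Leb d.+1, forall y, 0 < F x -> 0 < F y ->
  0 <= dot (tsub x y) (tsub (hTh x) (hTh y))}}.

(** On a pair of fibers the heads range over almost all of two half-lines, so [ray_slopes] applies
    with the tail pairing as constant: it yields monotonicity of the tail map and equality of the
    slopes at once. *)
Let ae_mono : {ae Leb d, forall t, {ae Leb d, forall u, forall th1 th2,
  lin t th1 -> lin u th2 -> 0 <= dot (tsub t u) (tsub (T' t) (T' u)) /\ th1 = th2}}.
Proof.
pose Q (z : d.+1.-tuple R * d.+1.-tuple R) := (0 < F z.1) ==> ((0 < F z.2) ==>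
  (0 <= dot (tsub z.1 z.2) (tsub (hTh z.1) (hTh z.2)))).
have mQ : measurable_fun setT Q.
  rewrite (_ : Q = (fun z => ~~ (0 < F z.1) || (~~ (0 < F z.2) ||
     (0 <= dot (tsub z.1 z.2) (tsub (hTh z.1) (hTh z.2)))))); last first.
    by apply/funext => z; rewrite /Q !implybE.
  have mF1 : measurable_fun setT (fun z : d.+1.-tuple R * d.+1.-tuple R => F z.1).
    exact: measurableT_comp mF _.
  have mF2 : measurable_fun setT (fun z : d.+1.-tuple R * d.+1.-tuple R => F z.2).
    exact: measurableT_comp mF _.
  apply: measurable_or; first by apply: measurable_neg; exact: measurable_fun_ltr.
  apply: measurable_or; first by apply: measurable_neg; exact: measurable_fun_ltr.
  apply: measurable_fun_ler => //; apply: measurable_dot; apply: measurable_tsub => //.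
    exact: measurableT_comp measurable_hTh _.
  exact: measurableT_comp measurable_hTh _.
have H3Q : {ae Leb d.+1, forall x, {ae Leb d.+1, forall y, Q (x, y)}}.
  by apply: filterS H3 => x; apply: filterS => y h; apply/implyP => Fx; apply/implyP => Fy; exact: h.
apply: filterS (ae_fiber2 mQ H3Q) => t; apply: filterS => u H th1 th2 [t10 l1] [t20 l2].
apply: (ray_slopes t10 t20).
apply: filterS2 H l2 => r Hr hr; apply: filterS2 Hr l1 => s Q1 hs s0 r0.
have [E1 e1] := hs s0; have [E2 e2] := hr r0.
have F1 : 0 < F (consp (s, t)) by case/and3P: E1.
have F2 : 0 < F (consp (r, u)) by case/and3P: E2.
have /implyP/(_ F1)/implyP/(_ F2) /= := Q1.
by rewrite !fib_Th !tsub_consp dot_consp /= e1 e2.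
Qed.

Lemma half_linear : exists (th : R) (M : 'M[R]_d) (b : d.-tuple R),
  [/\ 0 < th, posdef M & {ae Leb d.+1, forall x, 0 < thead x -> [/\ 0 < F x,
    thead (hTh x) = th * thead x /\ rv (tl (hTh x)) = rv (tl x) *m M + rv b,
    sqnorm (hZh x) = th * thead x ^+ 2 + qform M (tl x) &
    F x / G (hTh x) = th * \det M]}].
Proof.
have [|||M [b [pM hM]]] := tp_linear TP.
- apply: filterS2 ae_lin fm_g' => t h e f0.
  by have [s _] := h f0; rewrite s {1}e mulrC.
- by apply: filterS ae_lin => t h /h[].
- apply: filterS2 ae_mono ae_lin => t h ht; apply: filterS2 h ae_lin => u h hu ft fu.
  have [_ [th1 l1]] := ht ft; have [_ [th2 l2]] := hu fu.
  by have [] := h _ _ l1 l2.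
have [t0 _ [[f0 h0] ae0]] : exists2 t, setT t & (0 < fm t /\ (0 < fm t ->
   Num.sqrt (J' t) = DZ' t /\ exists th, lin t th)) /\
   {ae Leb d, forall u, forall th1 th2,
  lin t th1 -> lin u th2 -> 0 <= dot (tsub t u) (tsub (T' t) (T' u)) /\ th1 = th2}.
  apply: (@ae_exists _ _ _ (Leb d)) => //.
    rewrite lt_neqAle eq_sym measure_ge0 andbT; apply/eqP => L0.
    have := fm1; rewrite (_ : (\int[Leb d]_t (fm t)%:E)%E = 0%E).
      by move=> -[] /eqP; rewrite eq_sym oner_eq0.
    by apply: null_set_integral => //; apply/measurable_EFinP.
  by apply: filterS3 hM ae_lin ae_mono => t [h _ _ _] h1 h2.
have [_ [th l0]] := h0 f0.
have ae_th : {ae Leb d, forall u, lin u th}.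
  apply: filterS3 hM ae_lin ae0 => u [h _ _ _] h1 h2.
  have [_ [th' l']] := h1 h; have [_ e] := h2 _ _ l0 l'.
  by rewrite e.
have th0 : 0 < th by case: l0.
exists th, M, b; split => //.
pose P x := (0 < thead x) ==> (hEh x && (hta x == th * thead x)).
have mP : measurable_fun setT P.
  rewrite (_ : P = (fun x => ~~ (0 < thead x) || (hEh x && (hta x == th * thead x)))).
    apply: measurable_or; first by apply: measurable_neg; exact: measurable_fun_ltr.
    apply: measurable_and; first exact: measurable_hEh.
    by apply: measurable_fun_eqr; [exact: measurable_hta|exact: measurable_funM].
  by apply/funext => x; rewrite /P implybE.
have aeP : {ae Leb d.+1, forall x, P x}.
  apply/(ae_LebS mP); apply: filterS ae_th => t [_]; apply: filterS => s h.
  by apply/implyP; rewrite thead_consp => /h[-> /eqP].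
apply: filterS3 aeP ae_fac (ae_tl hM) => x /implyP Px hx [h1 h2 h3 h4] x0.
have /andP[Ex /eqP tx] := Px x0.
have Fx : 0 < F x by case/and3P: Ex.
have [_ _ sx _] := hx Fx.
have [l2 l2e] := leZ Ex.
have dx : hdta x = th.
  have /eqP -> : hdta x == hta x / thead x by rewrite -l2e sx.
  by rewrite tx mulfK// gt_eqF.
split => //.
- by rewrite /hTh thead_consp tl_consp.
- by rewrite /hZh sqnorm_consp /= h3 sqr_sqrtr tx ?mulrA ?mulr_ge0 ?(ltW th0) ?(ltW x0)//; congr (_ + _); ring.
- by rewrite half_J// h4 dx mulrC.
Qed.

End linear.

End half.

Section affine1.
Context {R : realType}.
Local Open Scope ereal_scope.

Lemma lebR_occo (a b : R) : (a <= b)%R -> lebR `[a, b[%classic = (b - a)%:E.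
Proof.
rewrite lebR_itv/= lte_fin; case: ltP => // dc cd; congr EFin.
by have -> : b = a; [apply/eqP; rewrite eq_le dc|rewrite subrr].
Qed.

Lemma lebR_image_eq (p : R -> R) (mp : measurable_fun setT p) (A : set R) :
  (forall a b : R, (a <= b)%R -> lebR (p @^-1` `]a, b]%classic) = (b - a)%:E) ->
  measurable A -> wpush lebR (cst 1%R) p A = lebR A.
Proof.
move=> H mA.
have m1 : measurable_fun setT (cst 1%R : R -> R) by exact: measurable_cst.
have p1 : forall x : R, (0 <= (cst 1%R : R -> R) x)%R by move=> x; exact: ler01.
have mpB (B : set R) : measurable B -> measurable (p @^-1` B).
  by move=> mB; rewrite -[X in measurable X]setTI; exact: mp.
pose N := wpush_m lebR m1 p1 mp.
have NE (B : set R) : measurable B -> N B = lebR (p @^-1` B).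
  move=> /mpB mB; transitivity (\int[lebR]_x (\1_(p @^-1` B) x)%:E); last by rewrite integral_indic// setIT.
  by apply: eq_integral => x _; rewrite mul1r.
have Nitv a b : (a <= b)%R -> N `]a, b]%classic = (b - a)%:E.
  by move=> ab; apply: etrans (NE _ (measurable_itv _)) _; exact: H.
apply: (measure_eq_itvoc (m1 := N) (m2 := lebR)) => // [a b|a b ab].
  have [ab|ba] := leP a b.
    apply: (@le_lt_trans _ _ (b - a)%:E); rewrite ?ltry// le_eqVlt.
    by apply/orP; left; apply/eqP; exact: Nitv.
  by rewrite set_itv_ge ?measure0 ?ltry// bnd_simp -leNgt; exact: ltW.
by transitivity (b - a)%:E; [exact: Nitv|apply/esym; exact: lebR_ocitv].
Qed.

Lemma ge0_integral_shift (c : R) (h : R -> \bar R) : measurable_fun setT h ->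
  (forall r, 0 <= h r) -> \int[lebR]_r h (c + r)%R = \int[lebR]_r h r.
Proof.
move=> mh h0.
have mp : measurable_fun setT (fun r : R => c + r)%R by exact: measurable_funD.
have m1 : measurable_fun setT (cst 1%R : R -> R) by exact: measurable_cst.
have p1 : forall x : R, (0 <= (cst 1%R : R -> R) x)%R by move=> x; exact: ler01.
transitivity (\int[lebR]_r (((cst 1%R : R -> R) r)%:E * h (c + r)%R)).
  by apply: eq_integral => r _; rewrite mul1e.
apply: (ge0_eq_integral_wpush (m := lebR) m1 p1 mp (n := lebR)) => // A mA; apply: (lebR_image_eq mp) => // a b ab.
rewrite (_ : _ @^-1` _ = `](a - c)%R, (b - c)%R]%classic).
  by rewrite lebR_ocitv ?lerD2r//; congr EFin; ring.
by apply/seteqP; split => r /=; rewrite !in_itv/= ltrBlDl lerBrDl.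
Qed.

Lemma ge0_integral_opp (h : R -> \bar R) : measurable_fun setT h ->
  (forall r, 0 <= h r) -> \int[lebR]_r h (- r)%R = \int[lebR]_r h r.
Proof.
move=> mh h0.
have mp : measurable_fun setT (fun r : R => - r)%R by exact: measurable_funN.
have m1 : measurable_fun setT (cst 1%R : R -> R) by exact: measurable_cst.
have p1 : forall x : R, (0 <= (cst 1%R : R -> R) x)%R by move=> x; exact: ler01.
transitivity (\int[lebR]_r (((cst 1%R : R -> R) r)%:E * h (- r)%R)).
  by apply: eq_integral => r _; rewrite mul1e.
apply: (ge0_eq_integral_wpush (m := lebR) m1 p1 mp (n := lebR)) => // A mA; apply: (lebR_image_eq mp) => // a b ab.
rewrite (_ : _ @^-1` _ = `[(- b)%R, (- a)%R[%classic).
  by rewrite lebR_occo ?lerN2//; congr EFin; ring.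
by apply/seteqP; split => r /=; rewrite !in_itv/= ltrNr lerNl andbC.
Qed.

(** Both half-lines are parametrized by a positive [r], so that each side of a cut becomes the same
    positive half-line; the cut point itself is null. *)
Lemma ge0_integral_split (c : R) (h : R -> \bar R) : measurable_fun setT h ->
  (forall r, 0 <= h r) -> \int[lebR]_r h r =
  \int[lebR]_r ((0 < r)%R%:R%:E * h (c + 1 * r)%R) +
  \int[lebR]_r ((0 < r)%R%:R%:E * h (c + (-1) * r)%R).
Proof.
move=> mh h0; rewrite -(ge0_integral_shift c mh h0).
have mp : measurable_fun setT (fun r : R => ((0 < r)%R%:R)%:E : \bar R).
  by apply/measurable_EFinP/measurable_natr_bool; exact: measurable_fun_ltr.
have mc : measurable_fun setT (fun r : R => h (c + r)%R).
  by apply: measurableT_comp mh _; exact: measurable_funD.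
have mn : measurable_fun setT (fun r : R => ((r < 0)%R%:R)%:E : \bar R).
  by apply/measurable_EFinP/measurable_natr_bool; exact: measurable_fun_ltr.
have -> : \int[lebR]_r ((0 < r)%R%:R%:E * h (c + (-1) * r)%R) =
  \int[lebR]_r ((r < 0)%R%:R%:E * h (c + r)%R).
  rewrite -[RHS]ge0_integral_opp; last 2 first.
  - exact: emeasurable_funM.
  - by move=> r; rewrite mule_ge0// lee_fin.
  by apply: eq_integral => r _; rewrite oppr_lt0 mulN1r.
rewrite -ge0_integralD//; last 4 first.
- by move=> r _; rewrite mule_ge0// lee_fin.
- by apply: emeasurable_funM => //; under eq_fun do rewrite mul1r.
- by move=> r _; rewrite mule_ge0// lee_fin.
- exact: emeasurable_funM.
apply: ge0_ae_eq_integral => //.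
- apply: emeasurable_funD; apply: emeasurable_funM => //.
  by under eq_fun do rewrite mul1r.
- by move=> r _; rewrite adde_ge0// mule_ge0// lee_fin.
exists [set 0%R]; split => //.
  by apply: etrans (lebesgue_measure_set1 _).
move=> r /= nr; apply: contrapT => r0; apply: nr => _.
have [rp|rn|/esym//] := ltgtP r 0%R; rewrite ?mul1r ?mul1e ?mul0e ?add0e ?adde0//.
Qed.

End affine1.

(** * Splitting into two half-spaces and gluing *)

Section split.
Context {R : realType} (d : nat).
Local Notation Leb := (@Leb R).

(** For [sg = 1] it moves the positive half-space to the part above height [c], for [sg = -1] to the
    part below. Both sides of a cut thus become instances of the positive half-space; for [c = 0] it
    is its own inverse. *)
Definition mv (sg c : R) (x : d.+1.-tuple R) : d.+1.-tuple R :=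
  consp (c + sg * thead x, tl x).

Lemma measurable_mv sg c : measurable_fun setT (mv sg c).
Proof.
apply: measurable_consp'; last exact: measurable_tl.
apply: measurable_funD => //; apply: measurable_funM => //; exact: measurable_thead.
Qed.

Lemma mvK sg x : sg * sg = 1 -> mv sg 0 (mv sg 0 x) = x.
Proof. by move=> s2; rewrite /mv thead_consp tl_consp/= !add0r mulrA s2 mul1r consp_eta. Qed.

Lemma ge0_integral_mv c (H : d.+1.-tuple R -> \bar R) : measurable_fun setT H ->
  (forall x, 0 <= H x)%E -> (\int[Leb d.+1]_x H x =
    \int[Leb d.+1]_x ((0 < thead x)%R%:R%:E * H (mv 1 c x)) +
    \int[Leb d.+1]_x ((0 < thead x)%R%:R%:E * H (mv (-1) c x)))%E.
Proof.
move=> mH H0.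
have mP : measurable_fun setT (fun x : d.+1.-tuple R => ((0 < thead x)%R%:R)%:E : \bar R).
  apply/measurable_EFinP/measurable_natr_bool; apply: measurable_fun_ltr => //.
  exact: measurable_thead.
have mK sg : measurable_fun setT (fun x : d.+1.-tuple R => (0 < thead x)%R%:R%:E * H (mv sg c x))%E.
  by apply: emeasurable_funM => //; exact: measurableT_comp mH (measurable_mv _ _).
have K0 sg (x : d.+1.-tuple R) : (0 <= (0 < thead x)%R%:R%:E * H (mv sg c x))%E.
  by rewrite mule_ge0// lee_fin.
rewrite !ge0_integral_LebS'// -ge0_integralD//; last 4 first.
- by move=> t _; apply: integral_ge0.
- exact: (measurable_fiber (mK 1) (K0 1)).
- by move=> t _; apply: integral_ge0.
- exact: (measurable_fiber (mK (-1)) (K0 (-1))).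
apply: eq_integral => t _.
have := ge0_integral_split c (measurable_sec t mH) (fun s => H0 _) => ->.
by congr (_ + _)%E; apply: eq_integral => s _; rewrite /mv thead_consp tl_consp.
Qed.

Let mpos : measurable [set x : d.+1.-tuple R | 0 < thead x].
Proof.
rewrite (_ : [set x | _] = (fun x : d.+1.-tuple R => 0 < thead x) @^-1` [set true]).
  rewrite -[X in measurable X]setTI.
  have := @measurable_fun_ltr _ (d.+1.-tuple R) R setT (cst 0) (fun x => thead x) (measurable_cst _) (@measurable_thead _ _).
  exact.
by apply/seteqP; split.
Qed.

Lemma Leb_mv c (A : set (d.+1.-tuple R)) : measurable A ->
  (Leb d.+1 A = Leb d.+1 ([set x | 0 < thead x]%R `&` mv 1 c @^-1` A) +
               Leb d.+1 ([set x | 0 < thead x]%R `&` mv (-1) c @^-1` A))%E.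
Proof.
move=> mA.
have mB sg : measurable ([set x | 0 < thead x]%R `&` mv sg c @^-1` A).
  by apply: measurableI => //; rewrite -[X in measurable X]setTI; exact: measurable_mv.
have E (B : set (d.+1.-tuple R)) : measurable B -> Leb d.+1 B = (\int[Leb d.+1]_x (\1_B x)%:E)%E.
  by move=> mB'; rewrite integral_indic// setIT.
rewrite !E// (ge0_integral_mv c); last 2 first.
- exact/measurable_EFinP.
- by move=> x; rewrite lee_fin.
by congr (_ + _)%E; apply: eq_integral => x _; rewrite -EFinM !indicE in_setI -natrM mulnb;
  congr (_%:R%:E); congr nat_of_bool; congr andb; apply/idP/idP; rewrite !inE.
Qed.

Lemma ae_mv sg c (P : d.+1.-tuple R -> Prop) : (sg == 1) || (sg == -1) ->
  {ae Leb d.+1, forall x, P x} -> {ae Leb d.+1, forall x, 0 < thead x -> P (mv sg c x)}.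
Proof.
move=> sg1 [N [mN N0 PN]].
have := Leb_mv c mN; rewrite N0 => /esym/eqP.
rewrite padde_eq0 ?measure_ge0// => /andP[/eqP e1 /eqP e2].
exists ([set x | 0 < thead x] `&` mv sg c @^-1` N); split.
- by apply: measurableI => //; rewrite -[X in measurable X]setTI; exact: measurable_mv.
- by case/orP: sg1 => /eqP ->.
- by move=> x /= h; split; apply: contrapT => h'; apply: h => // x0;
    apply: contrapT => nP; apply: h'; exact: PN.
Qed.

Lemma ae_mv_glue (P : d.+1.-tuple R -> Prop) :
  {ae Leb d.+1, forall x, 0 < thead x -> P x} ->
  {ae Leb d.+1, forall x, 0 < thead x -> P (mv (-1) 0 x)} ->
  {ae Leb d.+1, forall x, P x}.
Proof.
move=> [N1 [mN1 N10 PN1]] [N2 [mN2 N20 PN2]].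
have mth0 : measurable [set x : d.+1.-tuple R | thead x = 0].
  rewrite (_ : [set x | _] = (@thead d R) @^-1` [set 0]); last by apply/seteqP; split.
  by rewrite -[X in measurable X]setTI; exact: measurable_thead.
have mneg : measurable [set x : d.+1.-tuple R | thead x < 0].
  rewrite (_ : [set x | _] = mv (-1) 0 @^-1` [set x | 0 < thead x]).
    by rewrite -[X in measurable X]setTI; exact: measurable_mv.
  by apply/seteqP; split => x /=; rewrite /mv thead_consp/= add0r mulN1r oppr_gt0.
pose A := ([set x | 0 < thead x] `&` N1) `|` (([set x | thead x < 0] `&` mv (-1) 0 @^-1` N2) `|`
  [set x | thead x = 0]).
have mA : measurable A.
  apply: measurableU; first exact: measurableI.
  apply: measurableU => //; apply: measurableI => //.
  by rewrite -[X in measurable X]setTI; exact: measurable_mv.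
exists A; split => //.
  rewrite (Leb_mv 0 mA); apply/eqP; rewrite padde_eq0 ?measure_ge0//; apply/andP; split.
    apply/eqP; apply: (subset_measure0 (B := N1)) => //.
      by apply: measurableI => //; rewrite -[X in measurable X]setTI; exact: measurable_mv.
    move=> x /= [x0]; rewrite /A /= /mv mul1r add0r consp_eta => -[[]//|[[]|x00]].
      by move=> xn; have := lt_trans x0 xn; rewrite ltxx.
    by move: x0; rewrite x00 ltxx.
  apply/eqP; apply: (subset_measure0 (B := N2)) => //.
    by apply: measurableI => //; rewrite -[X in measurable X]setTI; exact: measurable_mv.
  move=> x /= [x0]; rewrite /A /=.
  have th : thead (mv (-1) 0 x) = - thead x by rewrite /mv thead_consp/= add0r mulN1r.
  rewrite mvK ?mulrNN ?mul1r// th => -[[]|[[_]//|]].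
    by rewrite oppr_gt0 => xn; have := lt_trans x0 xn; rewrite ltxx.
  by move=> /eqP; rewrite oppr_eq0 gt_eqF.
move=> x /= nP; have [x0|x0|x0] := ltgtP (thead x) 0.
- right; left; split => //=; apply: PN2 => /= h; apply: nP.
  have := h _; rewrite mvK ?mulrNN ?mul1r//; apply.
  by rewrite /mv thead_consp/= add0r mulN1r oppr_gt0.
- by left; split => //; apply: PN1 => /= h; exact/nP/h.
- by right; right.
Qed.

End split.

Section half_record.
Context {R : realType}.
Local Notation Leb := (@Leb R).

Definition pair_exists d (w : R) : Prop := forall f g : d.-tuple R -> R,
  density f -> density g -> centered_density f ->
  exists T Z DB DZ, transport_pair w f g T Z DB DZ.

(** It parallels [transport_pair], with images confined to the half-space and Gaussian mass at most
    1/2. The equality clause is parametrized by the mass [p] of the piece, because linearity is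
    available only after both masses are known to be 1/2. *)
Record half_transport d (w : R) (F G : d.+1.-tuple R -> R)
    (T Z : d.+1.-tuple R -> d.+1.-tuple R) (DB DZ : d.+1.-tuple R -> R) : Prop := HalfTransport {
  ht_mT : measurable_fun setT T;
  ht_mZ : measurable_fun setT Z;
  ht_mDB : measurable_fun setT DB;
  ht_mDZ : measurable_fun setT DZ;
  ht_DB_ge0 : forall x, 0 <= DB x;
  ht_DZ_ge0 : forall x, 0 <= DZ x;
  ht_push : forall phi : d.+1.-tuple R -> \bar R, measurable_fun setT phi ->
    (forall x, 0 <= phi x)%E ->
    (\int[Leb d.+1]_x ((F x)%:E * phi (T x)) = \int[Leb d.+1]_x ((G x)%:E * phi x))%E;
  ht_gpos : {ae Leb d.+1, forall x, 0 < F x -> 0 < G (T x)};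
  ht_DB_powR : {ae Leb d.+1, forall x, 0 < F x -> (F x / G (T x)) `^ w <= DB x};
  ht_DB_lb : {ae Leb d.+1, forall x, 0 < F x -> (1 - w) ^+ d.+1 <= DB x};
  ht_DZ_sqrt : {ae Leb d.+1, forall x, 0 < F x -> Num.sqrt (F x / G (T x)) <= DZ x};
  ht_DB_le : forall phi : d.+1.-tuple R -> \bar R, measurable_fun setT phi ->
    (forall x, 0 <= phi x)%E ->
    (\int[Leb d.+1]_x ((DB x)%:E * phi (comb w x (T x))) <=
     \int[Leb d.+1]_x ((0 < thead x)%R%:R%:E * phi x))%E;
  ht_DZ_le : (\int[Leb d.+1]_x (DZ x * gam (Z x))%:E <= (2^-1)%:E)%E;
  ht_dot_integrable : (Leb d.+1).-integrable setT
    (fun x => ((sqnorm (Z x) - dot x (T x)) * F x)%:E);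
  ht_dot0 : (\int[Leb d.+1]_x ((sqnorm (Z x) - dot x (T x)) * F x)%:E = 0)%E;
  ht_rigid : {ae Leb d.+1, forall x, 0 < F x -> (F x / G (T x)) `^ w = DB x ->
    Num.sqrt (F x / G (T x)) = DZ x -> F x / G (T x) = 1 /\ sqnorm (Z x) = sqnorm x};
  ht_linear : forall p, 0 < p ->
    {ae Leb d.+1, forall x, 0 < F x -> p * F x = gam (Z x) * Num.sqrt (F x / G (T x))} ->
    {ae Leb d.+1, forall x, 0 < F x -> Num.sqrt (F x / G (T x)) = DZ x} ->
    p <= 2^-1 /\ (p = 2^-1 ->
    {ae Leb d.+1, forall x, {ae Leb d.+1, forall y, 0 < F x -> 0 < F y ->
      0 <= dot (tsub x y) (tsub (T x) (T y))}} ->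
    exists (th : R) (M : 'M[R]_d) (b : d.-tuple R),
    [/\ 0 < th, posdef M & {ae Leb d.+1, forall x, 0 < thead x -> [/\ 0 < F x,
      thead (T x) = th * thead x /\ rv (tl (T x)) = rv (tl x) *m M + rv b,
      sqnorm (Z x) = th * thead x ^+ 2 + qform M (tl x) &
      F x / G (T x) = th * \det M]}]) }.

Lemma half_exists d (w : R) (F G : d.+1.-tuple R -> R) : 0 < w < 1 -> pair_exists d w ->
  density F -> density G ->
  (forall x, thead x <= 0 -> F x = 0) -> (forall x, thead x <= 0 -> G x = 0) ->
  (forall k : 'I_d, (Leb d.+1).-integrable setT (fun x => (tnth (tl x) k * F x)%:E) /\
    (\int[Leb d.+1]_x (tnth (tl x) k * F x)%:E = 0)%E) ->
  exists T Z DB DZ, half_transport w F G T Z DB DZ.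
Proof.
move=> w01 IH dF dG Fn Gn cF.
have cfm : centered_density (marg F).
  move=> k; have [i e] := cF k; have mk : measurable_fun setT (fun t : d.-tuple R => tnth t k).
    exact: measurable_tnth.
  split; first exact/(marg_integrableE dF mk).
  by rewrite -(marg_integral_signed dF mk).
have [T' [Z' [DB' [DZ' TP]]]] := IH _ _ (density_marg dF) (density_marg dG) cfm.
exists (hTh F G T'), (hZh F G T' Z'), (hDBh w F G T' DB'), (hDZh F G T' DZ').
split.
- exact: (measurable_hTh dF dG TP).
- exact: (measurable_hZh dF dG TP).
- exact: (measurable_hDBh dF dG TP).
- exact: (measurable_hDZh dF dG TP).
- exact: (half_DB_ge0 w01 Fn Gn TP).
- exact: (half_DZ_ge0 Fn Gn TP).
- exact: (half_push dF dG TP).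
- exact: (half_gpos dF dG TP).
- exact: (half_DB_powR w01 dF dG Fn Gn TP).
- exact: (half_DB_lb w01 dF dG Fn Gn TP).
- exact: (half_DZ_sqrt dF dG Fn Gn TP).
- exact: (half_DB_le w01 dF dG Fn Gn TP).
- exact: (half_DZ_le dF dG Fn Gn TP).
- exact: (half_dot_integrable dF dG Fn Gn TP).
- exact: (half_dot0 dF dG Fn Gn TP).
- exact: (half_rigid w01 dF dG Fn Gn TP).
- move=> p p0 H1 H2; split; first exact: (half_mass_le dF dG Fn Gn TP p0 H1 H2).
  by move=> ph H3; exact: (half_linear dF dG Fn Gn TP p0 H1 H2 ph H3).
Qed.

End half_record.

Section signed_mv.
Context {R : realType} (d : nat).
Local Notation Leb := (@Leb R).
Variables (c : R) (H : d.+1.-tuple R -> R).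
Hypothesis mH : measurable_fun setT H.

Definition pos (x : d.+1.-tuple R) : R := (0 < thead x)%R%:R.

Lemma measurable_pos : measurable_fun setT pos.
Proof. by apply: measurable_natr_bool; apply: measurable_fun_ltr => //; exact: measurable_thead. Qed.

Lemma pos_ge0 x : 0 <= pos x. Proof. exact: ler0n. Qed.

Let mK sg : measurable_fun setT (fun x => pos x * H (mv sg c x)).
Proof.
apply: measurable_funM; first exact: measurable_pos.
exact: measurableT_comp mH (measurable_mv _ _).
Qed.

Lemma integrable_mv : (Leb d.+1).-integrable setT (EFin \o H) ->
  forall sg, (sg == 1) || (sg == -1) ->
  (Leb d.+1).-integrable setT (fun x => (pos x * H (mv sg c x))%:E).
Proof.
move=> /integrableP[mHE iH] sg sg1; apply/integrableP; split; first exact/measurable_EFinP.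
have := iH; rewrite (ge0_integral_mv c); last 2 first.
- exact: measurableT_comp.
- by move=> x.
have E s : (\int[Leb d.+1]_x `|(pos x * H (mv s c x))%:E| =
   \int[Leb d.+1]_x ((0 < thead x)%R%:R%:E * `|(EFin \o H) (mv s c x)|))%E.
  by apply: eq_integral => x _; rewrite EFinM abseM gee0_abs// lee_fin pos_ge0.
rewrite -!E => h.
have N s : (0 <= \int[Leb d.+1]_x `|(pos x * H (mv s c x))%:E|)%E by exact: integral_ge0.
case/orP: sg1 => /eqP ->; apply: le_lt_trans h.
  by rewrite leeDl.
by rewrite leeDr.
Qed.

Lemma integrable_mv_glue :
  (Leb d.+1).-integrable setT (fun x => (pos x * H (mv 1 c x))%:E) ->
  (Leb d.+1).-integrable setT (fun x => (pos x * H (mv (-1) c x))%:E) ->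
  (Leb d.+1).-integrable setT (EFin \o H).
Proof.
move=> /integrableP[m1 i1] /integrableP[m2 i2].
apply/integrableP; split; first exact/measurable_EFinP.
rewrite (ge0_integral_mv c); last 2 first.
- by apply: measurableT_comp => //; exact/measurable_EFinP.
- by move=> x.
have E s : (\int[Leb d.+1]_x `|(pos x * H (mv s c x))%:E| =
   \int[Leb d.+1]_x ((0 < thead x)%R%:R%:E * `|(EFin \o H) (mv s c x)|))%E.
  by apply: eq_integral => x _; rewrite EFinM abseM gee0_abs// lee_fin pos_ge0.
by rewrite -!E; exact: lte_add_pinfty.
Qed.

Lemma integral_mv_signed : (Leb d.+1).-integrable setT (EFin \o H) ->
  (\int[Leb d.+1]_x (H x)%:E = \int[Leb d.+1]_x (pos x * H (mv 1 c x))%:E +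
    \int[Leb d.+1]_x (pos x * H (mv (-1) c x))%:E)%E.
Proof.
move=> iH.
have i1 : (Leb d.+1).-integrable setT (fun x => (pos x * H (mv 1 c x))%:E).
  by apply: integrable_mv => //; rewrite eqxx.
have i2 : (Leb d.+1).-integrable setT (fun x => (pos x * H (mv (-1) c x))%:E).
  by apply: integrable_mv => //; rewrite eqxx orbT.
have mp : measurable_fun setT (EFin \o H)^\+%E by apply: measurable_funepos; case/integrableP: iH.
have mn : measurable_fun setT (EFin \o H)^\-%E by apply: measurable_funeneg; case/integrableP: iH.
have P s : (fun x => (pos x * H (mv s c x))%:E)^\+%E =
    (fun x => (0 < thead x)%R%:R%:E * (EFin \o H)^\+ (mv s c x))%E.
  apply/funext => x; rewrite !funeposE /= /pos; case: (0 < thead x).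
    by rewrite mul1r mul1e.
  by rewrite mul0r mul0e maxxx.
have Nn s : (fun x => (pos x * H (mv s c x))%:E)^\-%E =
    (fun x => (0 < thead x)%R%:R%:E * (EFin \o H)^\- (mv s c x))%E.
  apply/funext => x; rewrite !funenegE /= /pos; case: (0 < thead x).
    by rewrite mul1r mul1e.
  by rewrite mul0r mul0e oppr0 maxxx.
rewrite [LHS]integralE (ge0_integral_mv c mp)// (ge0_integral_mv c mn)//.
rewrite [X in _ = (X + _)%E]integralE [X in _ = (_ + X)%E]integralE !P !Nn.
have := integrable_neg_fin_num measurableT i2; rewrite Nn => f2.
have := integrable_neg_fin_num measurableT i1; rewrite Nn => f1.
by rewrite fin_num_oppeD// addeACA.
Qed.

End signed_mv.

Section halves.
Context {R : realType} (d : nat).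
Local Notation Leb := (@Leb R).
Variables (w c : R) (f g : d.+1.-tuple R -> R).
Hypothesis w01 : 0 < w < 1.
Hypotheses (df : density f) (dg : density g).

Definition halfd sg c p (f : d.+1.-tuple R -> R) x := pos x * f (mv sg c x) / p.

Lemma halfd_density sg c' p h : density h -> 0 < p ->
  (\int[Leb d.+1]_x (pos x * h (mv sg c' x))%:E = p%:E)%E -> density (halfd sg c' p h).
Proof.
move=> [mh h0 h1] p0 hp; have mk : measurable_fun setT (fun x => pos x * h (mv sg c' x)).
  apply: measurable_funM; first exact: measurable_pos.
  exact: measurableT_comp mh (measurable_mv _ _).
split.
- exact: measurable_funM.
- by move=> x; rewrite divr_ge0 ?mulr_ge0 ?pos_ge0// ltW.
under eq_integral do rewrite EFinM.
rewrite ge0_integralZr//.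
- by rewrite hp -EFinM mulfV// gt_eqF.
- exact/measurable_EFinP.
- by move=> x _; rewrite lee_fin mulr_ge0// pos_ge0.
- by rewrite lee_fin invr_ge0 ltW.
Qed.

Lemma halfd_le0 sg c' p h x : thead x <= 0 -> halfd sg c' p h x = 0.
Proof. by rewrite /halfd /pos ltNge => ->; rewrite !mul0r. Qed.

Variables (sg p : R).
Hypothesis sg1 : (sg == 1) || (sg == -1).
Hypothesis p0 : 0 < p.
Let F := halfd sg 0 p f.
Let G := halfd sg c p g.
Variables (T Z : d.+1.-tuple R -> d.+1.-tuple R) (DB DZ : d.+1.-tuple R -> R).
Hypothesis HT : half_transport w F G T Z DB DZ.
Let mf : measurable_fun setT f. Proof. by have [] := df. Qed.
Let f0 x : 0 <= f x. Proof. by have [] := df. Qed.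
Let mg : measurable_fun setT g. Proof. by have [] := dg. Qed.
Let g0 x : 0 <= g x. Proof. by have [] := dg. Qed.
Let mT : measurable_fun setT T. Proof. exact: ht_mT HT. Qed.
Let mZ : measurable_fun setT Z. Proof. exact: ht_mZ HT. Qed.
Let mpos := @measurable_pos R d.

Let pF x : pos x * f (mv sg 0 x) = p * F x.
Proof. by rewrite /F /halfd; field; rewrite gt_eqF. Qed.
Let pG x : pos x * g (mv sg c x) = p * G x.
Proof. by rewrite /G /halfd; field; rewrite gt_eqF. Qed.

Lemma sg_sq : sg * sg = 1.
Proof. by case/orP: sg1 => /eqP ->; rewrite ?mulr1// mulrNN mulr1. Qed.

Lemma halves_push (phi : d.+1.-tuple R -> \bar R) : measurable_fun setT phi ->
  (forall x, 0 <= phi x)%E ->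
  (\int[Leb d.+1]_x ((pos x)%:E * ((f (mv sg 0 x))%:E * phi (mv sg c (T x)))) =
   \int[Leb d.+1]_x ((pos x)%:E * ((g (mv sg c x))%:E * phi (mv sg c x))))%E.
Proof.
move=> mphi phi0.
have mF : measurable_fun setT F.
  apply: measurable_funM => //; apply: measurable_funM => //.
  exact: measurableT_comp mf (measurable_mv _ _).
have mG : measurable_fun setT G.
  apply: measurable_funM => //; apply: measurable_funM => //.
  exact: measurableT_comp mg (measurable_mv _ _).
have F0 x : 0 <= F x by rewrite divr_ge0 ?mulr_ge0 ?pos_ge0// ltW.
have G0 x : 0 <= G x by rewrite divr_ge0 ?mulr_ge0 ?pos_ge0// ltW.
have mphic : measurable_fun setT (fun x => phi (mv sg c x)).
  exact: measurableT_comp mphi (measurable_mv _ _).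
transitivity (p%:E * \int[Leb d.+1]_x ((F x)%:E * phi (mv sg c (T x))))%E.
  rewrite -ge0_integralZl//.
  - by apply: eq_integral => x _; rewrite !muleA -!EFinM pF.
  - apply: emeasurable_funM; first exact/measurable_EFinP.
    exact: measurableT_comp mphic mT.
  - by move=> x _; rewrite mule_ge0// lee_fin.
  - by rewrite lee_fin ltW.
rewrite (ht_push HT mphic)// -ge0_integralZl//.
- by apply: eq_integral => x _; rewrite !muleA -!EFinM pG.
- by apply: emeasurable_funM => //; exact/measurable_EFinP.
- by move=> x _; rewrite mule_ge0// lee_fin.
- by rewrite lee_fin ltW.
Qed.

Let F_gt0 x : 0 < thead x -> 0 < f (mv sg 0 x) -> 0 < F x.
Proof. by move=> x0 fx; rewrite /F /halfd /pos x0 mul1r divr_gt0. Qed.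

Let G_gt0 x : 0 < G x -> g (mv sg c x) = p * G x.
Proof.
rewrite /G /halfd /pos; case: (0 < thead x); last by rewrite !mul0r ltxx.
by rewrite mul1r => _; field; rewrite gt_eqF.
Qed.

(** The predicate is abstract in the density ratio and in the density, so a single transfer serves
    all pointwise fields; the normalizing mass [p] cancels in the ratio. *)
Lemma halves_ae (P : d.+1.-tuple R -> R -> R -> Prop) :
  {ae Leb d.+1, forall x, 0 < F x -> P x (F x / G (T x)) (F x)} ->
  {ae Leb d.+1, forall x, 0 < thead x -> 0 < f (mv sg 0 x) -> 0 < g (mv sg c (T x)) /\
     P x (f (mv sg 0 x) / g (mv sg c (T x))) (f (mv sg 0 x) / p)}.
Proof.
move=> h; apply: filterS2 h (ht_gpos HT) => x h h' x0 fx.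
have Fx := F_gt0 x0 fx; have Gx := h' Fx.
have fE : f (mv sg 0 x) = p * F x by rewrite -pF /pos x0 mul1r.
rewrite (G_gt0 Gx) fE; split; first by rewrite mulr_gt0.
have -> : p * F x / (p * G (T x)) = F x / G (T x) by field; rewrite !gt_eqF.
by have -> : p * F x / p = F x by [field; rewrite gt_eqF]; exact: h.
Qed.

Lemma halves_ae_rev (P : d.+1.-tuple R -> R -> R -> Prop) :
  {ae Leb d.+1, forall x, 0 < thead x -> 0 < f (mv sg 0 x) ->
     P x (f (mv sg 0 x) / g (mv sg c (T x))) (f (mv sg 0 x))} ->
  {ae Leb d.+1, forall x, 0 < F x -> P x (F x / G (T x)) (p * F x)}.
Proof.
move=> h; apply: filterS2 h (ht_gpos HT) => x h h' Fx.
have x0 : 0 < thead x.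
  rewrite ltNge; apply/negP => xn; move: Fx.
  by rewrite /F halfd_le0// ltxx.
have Gx := h' Fx.
have fE : f (mv sg 0 x) = p * F x by rewrite -pF /pos x0 mul1r.
have := h x0; rewrite (G_gt0 Gx) fE.
have -> : p * F x / (p * G (T x)) = F x / G (T x) by field; rewrite !gt_eqF.
by apply; rewrite mulr_gt0.
Qed.

Lemma comb_mv (x y : d.+1.-tuple R) : comb w (mv sg 0 x) (mv sg c y) = mv sg (w * c) (comb w x y).
Proof.
rewrite /mv -[in comb w x y](consp_eta x) -[in comb w _ y](consp_eta y).
by rewrite !comb_consp !thead_consp !tl_consp /=; congr (consp (_, _)); ring.
Qed.

Lemma halves_DB_le (phi : d.+1.-tuple R -> \bar R) : measurable_fun setT phi ->
  (forall x, 0 <= phi x)%E ->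
  (\int[Leb d.+1]_x ((pos x)%:E * ((DB x)%:E * phi (comb w (mv sg 0 x) (mv sg c (T x))))) <=
   \int[Leb d.+1]_x ((pos x)%:E * phi (mv sg (w * c) x)))%E.
Proof.
move=> mphi phi0.
have mphic : measurable_fun setT (fun x => phi (mv sg (w * c) x)).
  exact: measurableT_comp mphi (measurable_mv _ _).
apply: le_trans (ht_DB_le HT mphic (fun x => phi0 _)).
have mc : measurable_fun setT (fun x => comb w x (T x)) by exact: measurable_comb.
apply: ge0_le_integral => //.
- by move=> x _; rewrite !mule_ge0 ?lee_fin ?pos_ge0 ?(ht_DB_ge0 HT).
- apply: emeasurable_funM; first exact/measurable_EFinP.
  apply: emeasurable_funM; first by apply/measurable_EFinP; exact: ht_mDB HT.
  under eq_fun do rewrite comb_mv.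
  exact: measurableT_comp mphic mc.
- apply: emeasurable_funM; first by apply/measurable_EFinP; exact: ht_mDB HT.
  exact: measurableT_comp mphic mc.
move=> x _; rewrite comb_mv /pos; case: (0 < thead x); first by rewrite mul1e.
by rewrite mul0e mule_ge0// lee_fin; exact: ht_DB_ge0 HT _.
Qed.

Lemma dot_mv (x y : d.+1.-tuple R) : dot (mv sg 0 x) (mv sg c y) = dot x y + c * (sg * thead x).
Proof.
rewrite /mv -[in dot x y](consp_eta x) -[in dot _ y](consp_eta y) !dot_consp /=.
rewrite add0r mulrDr mulrACA sg_sq; ring.
Qed.

Lemma dot_tsub_mv a b (x y u v : d.+1.-tuple R) :
  dot (tsub (mv sg a x) (mv sg a y)) (tsub (mv sg b u) (mv sg b v)) =
  dot (tsub x y) (tsub u v).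
Proof.
rewrite /mv -[in RHS](consp_eta x) -[in RHS](consp_eta y) -[in RHS](consp_eta u)
  -[in RHS](consp_eta v) !tsub_consp !dot_consp /=; congr (_ + _).
have := sg_sq; move: (thead x) (thead y) (thead u) (thead v) => x0 y0 u0 v0 s2.
transitivity ((sg * sg) * ((x0 - y0) * (u0 - v0))); first by ring.
by rewrite s2 mul1r.
Qed.

Let K x := (sqnorm (Z x) - dot (mv sg 0 x) (mv sg c (T x))) * (pos x * f (mv sg 0 x)).

Let KE x : K x = p * ((sqnorm (Z x) - dot x (T x)) * F x) -
  c * (pos x * (thead (mv sg 0 x) * f (mv sg 0 x))).
Proof.
have th : thead (mv sg 0 x) = sg * thead x by rewrite /mv thead_consp/= add0r.
rewrite /K dot_mv th [LHS](_ : _ = (sqnorm (Z x) - dot x (T x)) * (pos x * f (mv sg 0 x)) -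
  c * (pos x * (sg * thead x * f (mv sg 0 x)))); last by ring.
by rewrite pF; ring.
Qed.

Hypothesis cf : (Leb d.+1).-integrable setT (fun x => (thead x * f x)%:E).

Let mtf : measurable_fun setT (fun x : d.+1.-tuple R => thead x * f x).
Proof. by apply: measurable_funM => //; exact: measurable_thead. Qed.

Let i2 : (Leb d.+1).-integrable setT (fun x => (pos x * (thead (mv sg 0 x) * f (mv sg 0 x)))%:E).
Proof. exact: (integrable_mv 0 mtf cf sg1). Qed.

Lemma halves_dot_integrable : (Leb d.+1).-integrable setT
  (fun x => ((sqnorm (Z x) - dot (mv sg 0 x) (mv sg c (T x))) * (pos x * f (mv sg 0 x)))%:E).
Proof.
rewrite (_ : (fun x => _) = (fun x => (p%:E * ((sqnorm (Z x) - dot x (T x)) * F x)%:E -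
   c%:E * (pos x * (thead (mv sg 0 x) * f (mv sg 0 x)))%:E)%E)); last first.
  by apply/funext => x; rewrite -[in LHS]/(K x) KE EFinB !EFinM.
apply: integrableB => //; apply: integrableZl => //; exact: ht_dot_integrable HT.
Qed.

(** The offset [c] of the target hyperplane leaves a multiple of the first moment of this half; only
    the sum over both halves will vanish. *)
Lemma halves_dot :
  (\int[Leb d.+1]_x ((sqnorm (Z x) - dot (mv sg 0 x) (mv sg c (T x))) * (pos x * f (mv sg 0 x)))%:E
   = - (c%:E * \int[Leb d.+1]_x (pos x * (thead (mv sg 0 x) * f (mv sg 0 x)))%:E))%E.
Proof.
transitivity (\int[Leb d.+1]_x (p%:E * ((sqnorm (Z x) - dot x (T x)) * F x)%:E -
   c%:E * (pos x * (thead (mv sg 0 x) * f (mv sg 0 x)))%:E)%E)%E.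
  by apply: eq_integral => x _; rewrite -[in LHS]/(K x) KE EFinB !EFinM.
rewrite integralB//; last 2 first.
- by apply: integrableZl => //; exact: ht_dot_integrable HT.
- exact: integrableZl.
rewrite integralZl//; last exact: ht_dot_integrable HT.
by rewrite (ht_dot0 HT) mule0 add0e integralZl.
Qed.

End halves.

(* The lower half-space is handled through the reflection [mv (-1)]. *)
Section gl.
Context {R : realType} (d : nat).
Local Notation Leb := (@Leb R).
Local Notation X := (d.+1.-tuple R).

Definition gl {V : Type} (A1 A2 : X -> V) (y : X) : V :=
  if 0 < thead y then A1 y else A2 (mv (-1) 0 y).

Lemma mv10 (x : X) : mv 1 0 x = x.
Proof. by rewrite /mv mul1r add0r consp_eta. Qed.

Lemma thead_mv sg c (x : X) : thead (mv sg c x) = c + sg * thead x.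
Proof. by rewrite /mv thead_consp. Qed.

Lemma gl_pos V (A1 A2 : X -> V) x : 0 < thead x -> gl A1 A2 (mv 1 0 x) = A1 x.
Proof. by rewrite mv10 /gl => ->. Qed.

Lemma gl_neg V (A1 A2 : X -> V) x : 0 < thead x -> gl A1 A2 (mv (-1) 0 x) = A2 x.
Proof.
move=> x0; rewrite /gl thead_mv add0r mulN1r oppr_gt0 ltNge ltW//= mvK//.
by rewrite mulrNN mul1r.
Qed.

Lemma measurable_gl dV (V : measurableType dV) (A1 A2 : X -> V) :
  measurable_fun setT A1 -> measurable_fun setT A2 -> measurable_fun setT (gl A1 A2).
Proof.
move=> m1 m2; apply: measurable_fun_ifT => //.
  by apply: measurable_fun_ltr => //; exact: measurable_thead.
exact: measurableT_comp m2 (measurable_mv _ _).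
Qed.

Lemma ge0_integral_glue c (H : X -> \bar R) (K1 K2 : X -> \bar R) : measurable_fun setT H ->
  (forall x, 0 <= H x)%E ->
  (forall x, 0 < thead x -> H (mv 1 c x) = K1 x) ->
  (forall x, 0 < thead x -> H (mv (-1) c x) = K2 x) ->
  (\int[Leb d.+1]_x H x = \int[Leb d.+1]_x ((pos x)%:E * K1 x) +
    \int[Leb d.+1]_x ((pos x)%:E * K2 x))%E.
Proof.
move=> mH H0 h1 h2; rewrite (ge0_integral_mv c mH H0); congr (_ + _)%E;
  apply: eq_integral => x _; rewrite /pos; case: ltP => x0; rewrite ?mul0e//.
- by rewrite h1.
- by rewrite h2.
Qed.

Lemma sqnorm_mv sg (x : X) : sg * sg = 1 -> sqnorm (mv sg 0 x) = sqnorm x.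
Proof.
move=> s2; rewrite /mv sqnorm_consp/= -[in RHS](consp_eta x) sqnorm_consp/= add0r exprMn.
by rewrite [sg ^+ 2]expr2 s2 mul1r.
Qed.

End gl.

Section glued.
Context {R : realType} (d : nat).
Local Notation Leb := (@Leb R).
Local Notation X := (d.+1.-tuple R).
Variables (w c : R) (f g : X -> R).
Hypothesis w01 : 0 < w < 1.
Hypotheses (df : density f) (dg : density g) (cf : centered_density f).
Variables (p1 p2 : R).
Hypotheses (p10 : 0 < p1) (p20 : 0 < p2) (p12 : p1 + p2 = 1).
Variables (T1 Z1 T2 Z2 : X -> X) (D1 E1 D2 E2 : X -> R).
Hypothesis HT1 : half_transport w (halfd 1 0 p1 f) (halfd 1 c p1 g) T1 Z1 D1 E1.
Hypothesis HT2 : half_transport w (halfd (-1) 0 p2 f) (halfd (-1) c p2 g) T2 Z2 D2 E2.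

Definition glT := gl (fun x => mv 1 c (T1 x)) (fun x => mv (-1) c (T2 x)).
Let Z := gl Z1 Z2.
Let DB := gl D1 D2.
Let DZ := gl E1 E2.
Let s1 : ((1 : R) == 1) || ((1 : R) == -1). Proof. by rewrite eqxx. Qed.
Let s2 : ((-1 : R) == 1) || ((-1 : R) == -1). Proof. by rewrite eqxx orbT. Qed.
Let mf : measurable_fun setT f. Proof. by have [] := df. Qed.
Let f0 x : 0 <= f x. Proof. by have [] := df. Qed.
Let mg : measurable_fun setT g. Proof. by have [] := dg. Qed.
Let g0 x : 0 <= g x. Proof. by have [] := dg. Qed.

Let mT : measurable_fun setT glT.
Proof.
apply: measurable_gl.
  exact: measurableT_comp (measurable_mv _ _) (ht_mT HT1).
exact: measurableT_comp (measurable_mv _ _) (ht_mT HT2).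
Qed.

Lemma glued_push (phi : X -> \bar R) : measurable_fun setT phi ->
  (forall x, 0 <= phi x)%E ->
  (\int[Leb d.+1]_x ((f x)%:E * phi (glT x)) = \int[Leb d.+1]_x ((g x)%:E * phi x))%E.
Proof.
move=> mphi phi0.
rewrite (@ge0_integral_glue _ _ 0 _ (fun x => (f (mv 1 0 x))%:E * phi (mv 1 c (T1 x)))%E
  (fun x => (f (mv (-1) 0 x))%:E * phi (mv (-1) c (T2 x)))%E); last 4 first.
- apply: emeasurable_funM; first exact/measurable_EFinP.
  exact: measurableT_comp.
- by move=> x; rewrite mule_ge0// lee_fin.
- by move=> x x0; rewrite /glT gl_pos.
- by move=> x x0; rewrite /glT gl_neg.
rewrite (halves_push df dg p10 HT1 mphi phi0) (halves_push df dg p20 HT2 mphi phi0).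
rewrite -(@ge0_integral_glue _ _ c (fun x => (g x)%:E * phi x)%E)//.
- by apply: emeasurable_funM => //; exact/measurable_EFinP.
- by move=> x; rewrite mule_ge0// lee_fin.
Qed.

Lemma glued_ae (P : X -> X -> R -> R -> R -> R -> Prop) :
  {ae Leb d.+1, forall x, 0 < thead x -> 0 < f (mv 1 0 x) -> 0 < g (mv 1 c (T1 x)) /\
     P (mv 1 0 x) (Z1 x) (D1 x) (E1 x) (f (mv 1 0 x)) (f (mv 1 0 x) / g (mv 1 c (T1 x)))} ->
  {ae Leb d.+1, forall x, 0 < thead x -> 0 < f (mv (-1) 0 x) -> 0 < g (mv (-1) c (T2 x)) /\
     P (mv (-1) 0 x) (Z2 x) (D2 x) (E2 x) (f (mv (-1) 0 x)) (f (mv (-1) 0 x) / g (mv (-1) c (T2 x)))} ->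
  {ae Leb d.+1, forall x, 0 < f x -> 0 < g (glT x) /\
     P x (Z x) (DB x) (DZ x) (f x) (f x / g (glT x))}.
Proof.
move=> h1 h2; apply: ae_mv_glue.
  apply: filterS h1 => x h x0; have := h x0.
  rewrite -[in glT x](mv10 x) -[in Z x](mv10 x) -[in DB x](mv10 x) -[in DZ x](mv10 x).
  by rewrite /glT /Z /DB /DZ !gl_pos// !mv10.
by apply: filterS h2 => x h x0; have := h x0; rewrite /glT /Z /DB /DZ !gl_neg.
Qed.

Lemma glued_gpos : {ae Leb d.+1, forall x, 0 < f x -> 0 < g (glT x)}.
Proof.
have h1 := halves_ae p10 HT1 (P := fun x J u => True) (aeW _ (fun _ _ => I)).
have h2 := halves_ae p20 HT2 (P := fun x J u => True) (aeW _ (fun _ _ => I)).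
by apply: filterS (glued_ae (P := fun _ _ _ _ _ _ => True) h1 h2) => x h /h [].
Qed.

Let mk (P : R -> R -> R -> Prop) :
  {ae Leb d.+1, forall x, 0 < halfd 1 0 p1 f x -> P (D1 x) (E1 x) (halfd 1 0 p1 f x / halfd 1 c p1 g (T1 x))} ->
  {ae Leb d.+1, forall x, 0 < halfd (-1) 0 p2 f x -> P (D2 x) (E2 x) (halfd (-1) 0 p2 f x / halfd (-1) c p2 g (T2 x))} ->
  {ae Leb d.+1, forall x, 0 < f x -> P (DB x) (DZ x) (f x / g (glT x))}.
Proof.
move=> h1 h2.
have k1 := halves_ae p10 HT1 (P := fun x J u => P (D1 x) (E1 x) J) h1.
have k2 := halves_ae p20 HT2 (P := fun x J u => P (D2 x) (E2 x) J) h2.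
by apply: filterS (glued_ae (P := fun _ _ D E _ J => P D E J) k1 k2) => x h /h [].
Qed.

(** Interpolation sends the two sides of the cut at height 0 to the two sides of height [w * c], so
    the images do not overlap and the two bounds add up. *)
Lemma glued_DB_le (phi : X -> \bar R) : measurable_fun setT phi -> (forall x, 0 <= phi x)%E ->
  (\int[Leb d.+1]_x ((DB x)%:E * phi (comb w x (glT x))) <= \int[Leb d.+1]_x phi x)%E.
Proof.
move=> mphi phi0.
have mDB : measurable_fun setT DB by apply: measurable_gl; [exact: ht_mDB HT1|exact: ht_mDB HT2].
have DB0 x : 0 <= DB x.
  by rewrite /DB /gl; case: ifP => _; [exact: ht_DB_ge0 HT1 _|exact: ht_DB_ge0 HT2 _].
rewrite (@ge0_integral_glue _ _ 0 _ (fun x => (D1 x)%:E * phi (comb w (mv 1 0 x) (mv 1 c (T1 x))))%E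
  (fun x => (D2 x)%:E * phi (comb w (mv (-1) 0 x) (mv (-1) c (T2 x))))%E); last 4 first.
- apply: emeasurable_funM; first exact/measurable_EFinP.
  by apply: measurableT_comp => //; exact: measurable_comb.
- by move=> x; rewrite mule_ge0// lee_fin.
- by move=> x x0; rewrite /DB /glT !gl_pos.
- by move=> x x0; rewrite /DB /glT !gl_neg.
rewrite [leRHS](@ge0_integral_glue _ _ (w * c) _ (fun x => phi (mv 1 (w * c) x))
  (fun x => phi (mv (-1) (w * c) x)))//.
apply: leeD.
- exact: (halves_DB_le HT1).
- exact: (halves_DB_le HT2).
Qed.

Lemma glued_DZ_le : (\int[Leb d.+1]_x (DZ x * gam (Z x))%:E <= 1)%E.
Proof.
have mZ : measurable_fun setT Z by apply: measurable_gl; [exact: ht_mZ HT1|exact: ht_mZ HT2].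
have mDZ : measurable_fun setT DZ by apply: measurable_gl; [exact: ht_mDZ HT1|exact: ht_mDZ HT2].
have DZ0 x : 0 <= DZ x.
  by rewrite /DZ /gl; case: ifP => _; [exact: ht_DZ_ge0 HT1 _|exact: ht_DZ_ge0 HT2 _].
rewrite (@ge0_integral_glue _ _ 0 _ (fun x => (E1 x * gam (Z1 x))%:E)
  (fun x => (E2 x * gam (Z2 x))%:E)); last 4 first.
- by apply/measurable_EFinP; apply: measurable_funM => //; exact: measurable_gam.
- by move=> x; rewrite lee_fin mulr_ge0// ltW// gam_gt0.
- by move=> x x0; rewrite /DZ /Z !gl_pos.
- by move=> x x0; rewrite /DZ /Z !gl_neg.
have -> : (1 = (2^-1)%:E + (2^-1)%:E :> \bar R)%E by rewrite -EFinD; congr EFin; lra.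
have P0 sg p (hp : 0 < p) TT ZZ DD EE : half_transport w (halfd sg 0 p f) (halfd sg c p g) TT ZZ DD EE ->
    (\int[Leb d.+1]_x ((pos x)%:E * (EE x * gam (ZZ x))%:E) <= (2^-1)%:E)%E.
  move=> HT; apply: le_trans (ht_DZ_le HT).
  have m : measurable_fun setT (fun x => (EE x * gam (ZZ x))%:E).
    by apply/measurable_EFinP; apply: measurable_funM; [exact: ht_mDZ HT|apply: measurable_gam; exact: ht_mZ HT].
  have h0 x : 0 <= EE x * gam (ZZ x) by rewrite mulr_ge0 ?(ht_DZ_ge0 HT)// ltW// gam_gt0.
  apply: ge0_le_integral => //.
  - by move=> x _; rewrite mule_ge0 ?lee_fin// pos_ge0.
  - by apply: emeasurable_funM => //; apply/measurable_EFinP; exact: measurable_pos.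
  - by move=> x _; rewrite -EFinM lee_fin /pos; case: (0 < thead x); rewrite ?mul1r ?mul0r.
by apply: leeD; [exact: P0 HT1|exact: P0 HT2].
Qed.

Let ch : (Leb d.+1).-integrable setT (fun x => (thead x * f x)%:E).
Proof. exact: (cf ord0).1. Qed.

Let H x := (sqnorm (Z x) - dot x (glT x)) * f x.

Let mH : measurable_fun setT H.
Proof.
apply: measurable_funM => //; apply: measurable_funB.
  by apply: measurable_sqnorm; apply: measurable_gl; [exact: ht_mZ HT1|exact: ht_mZ HT2].
exact: measurable_dot.
Qed.

Let H1E : (fun x => (pos x * H (mv 1 0 x))%:E) =
  (fun x => ((sqnorm (Z1 x) - dot (mv 1 0 x) (mv 1 c (T1 x))) * (pos x * f (mv 1 0 x)))%:E).
Proof.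
apply/funext => x; congr EFin; rewrite /H /pos; case: ltP => x0; rewrite ?mul0r ?mulr0//.
by rewrite !mul1r /Z /glT !gl_pos.
Qed.

Let H2E : (fun x => (pos x * H (mv (-1) 0 x))%:E) =
  (fun x => ((sqnorm (Z2 x) - dot (mv (-1) 0 x) (mv (-1) c (T2 x))) * (pos x * f (mv (-1) 0 x)))%:E).
Proof.
apply/funext => x; congr EFin; rewrite /H /pos; case: ltP => x0; rewrite ?mul0r ?mulr0//.
by rewrite !mul1r /Z /glT !gl_neg.
Qed.

Lemma glued_dot_integrable : (Leb d.+1).-integrable setT (fun x => (H x)%:E).
Proof.
apply: (integrable_mv_glue (c := 0) mH).
  by rewrite H1E; exact: (halves_dot_integrable df s1 p10 HT1 ch).
by rewrite H2E; exact: (halves_dot_integrable df s2 p20 HT2 ch).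
Qed.

(** The leftovers of the two halves are [- c] times the two parts of the first moment of [f], whose
    sum is zero by centering. *)
Lemma glued_dot0 : (\int[Leb d.+1]_x (H x)%:E = 0)%E.
Proof.
rewrite (integral_mv_signed 0 mH glued_dot_integrable) H1E H2E.
rewrite (halves_dot df s1 p10 HT1 ch) (halves_dot df s2 p20 HT2 ch).
have mth : measurable_fun setT (fun x : X => thead x * f x).
  by apply: measurable_funM => //; exact: measurable_thead.
have i1 := integrable_mv 0 mth ch s1; have i2 := integrable_mv 0 mth ch s2.
have := (cf ord0).2; rewrite (integral_mv_signed 0 mth ch).
have := integrable_fin_num measurableT i1; have := integrable_fin_num measurableT i2.
case: (\int[_]_x _)%E => // a _; case: (\int[_]_x _)%E => // b _ [] ab.
by rewrite -!EFinM -!EFinN -EFinD; congr EFin; rewrite -[RHS](mulr0 (-c)) -ab; ring.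
Qed.

(** The equality clause enters as a hypothesis because its proof draws on the masses and moments of
    the pieces; [glued_linear] supplies it. *)
Lemma glued_transport :
  ({ae Leb d.+1, forall x, 0 < f x -> f x = gam (Z x) * Num.sqrt (f x / g (glT x))} ->
    {ae Leb d.+1, forall x, 0 < f x -> Num.sqrt (f x / g (glT x)) = DZ x} ->
    {ae Leb d.+1, forall x, {ae Leb d.+1, forall y, 0 < f x -> 0 < f y ->
      0 <= dot (tsub x y) (tsub (glT x) (glT y))}} ->
    exists (M : 'M[R]_d.+1) (b : X), posdef M /\
      {ae Leb d.+1, forall x, [/\ 0 < f x, rv (glT x) = rv x *m M + rv b,
        sqnorm (Z x) = qform M x & f x / g (glT x) = \det M]}) ->
  transport_pair w f g glT Z DB DZ.
Proof.
move=> lin; split => //.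
- by apply: measurable_gl; [exact: ht_mZ HT1|exact: ht_mZ HT2].
- by apply: measurable_gl; [exact: ht_mDB HT1|exact: ht_mDB HT2].
- by apply: measurable_gl; [exact: ht_mDZ HT1|exact: ht_mDZ HT2].
- by move=> x; rewrite /DB /gl; case: ifP => _; [exact: ht_DB_ge0 HT1 _|exact: ht_DB_ge0 HT2 _].
- by move=> x; rewrite /DZ /gl; case: ifP => _; [exact: ht_DZ_ge0 HT1 _|exact: ht_DZ_ge0 HT2 _].
- exact: glued_push.
- exact: glued_gpos.
- exact: (mk (P := fun D E J => J `^ w <= D) (ht_DB_powR HT1) (ht_DB_powR HT2)).
- exact: (mk (P := fun D E J => (1 - w) ^+ d.+1 <= D) (ht_DB_lb HT1) (ht_DB_lb HT2)).
- exact: (mk (P := fun D E J => Num.sqrt J <= E) (ht_DZ_sqrt HT1) (ht_DZ_sqrt HT2)).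
- exact: glued_DB_le.
- exact: glued_DZ_le.
- exact: glued_dot_integrable.
- exact: glued_dot0.
have k1 := halves_ae p10 HT1 (P := fun x J u => J `^ w = D1 x -> Num.sqrt J = E1 x ->
  J = 1 /\ sqnorm (Z1 x) = sqnorm x) (ht_rigid HT1).
have k2 := halves_ae p20 HT2 (P := fun x J u => J `^ w = D2 x -> Num.sqrt J = E2 x ->
  J = 1 /\ sqnorm (Z2 x) = sqnorm x) (ht_rigid HT2).
apply: filterS (glued_ae (P := fun x z D E _ J => J `^ w = D -> Num.sqrt J = E ->
  J = 1 /\ sqnorm z = sqnorm x) _ _) => [x h /h []//||].
- by apply: filterS k1 => x h x0 fx; have := h x0 fx; rewrite sqnorm_mv ?mul1r.
- by apply: filterS k2 => x h x0 fx; have := h x0 fx; rewrite sqnorm_mv ?mulrNN ?mul1r.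
Qed.

End glued.

(** * From almost every point to every point *)

Lemma ae_dense (R : realType) d (S : d.-tuple R -> Prop) (x : d.-tuple R) (e : R) : 0 < e ->
  {ae @Leb R d, forall y, S y} -> exists y, S y /\ forall k, `|tnth y k - tnth x k| < e.
Proof.
move=> e0; elim: d S x => [|d IH] S x.
  move=> aeS; have [y _ Sy] : exists2 y, setT y & S y.
    apply: (@ae_exists _ _ _ (@Leb R 0)) => //.
    apply: (lt_le_trans lte01); rewrite le_eqVlt; apply/orP; left; apply/eqP.
    transitivity (\int[@Leb R 0]_x (1%:E))%E; first by rewrite ge0_integral_Leb0.
    by rewrite integral_cst// mul1e.
  by exists y; split=> // -[].
move=> /ae_fiber /(IH _ (tl x)) [t [ht tx]].
have [|s [/andP[s1 s2] Ss]] := @ae_itv R (thead x - e) (thead x + e) _ _ ht; first lra.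
exists (consp (s, t)); split => // k; case: (unliftP ord0 k) => [j|] ->.
  by rewrite tnth_conspS/= -tnth_tl.
by rewrite tnth_consp0/= ltr_norml -/(thead x); apply/andP; split; lra.
Qed.

Section seqcont.
Context {R : realType}.

Lemma cvg_sum_ord (T : Type) (F : set_system T) {FF : Filter F} n
    (u : 'I_n -> T -> R) (l : 'I_n -> R) :
  (forall k, u k m @[m --> F] --> l k) ->
  (\sum_(k < n) u k m) @[m --> F] --> \sum_(k < n) l k.
Proof.
move=> h; elim: n u l h => [|n IH] u l h.
  by under eq_fun do rewrite big_ord0; rewrite big_ord0; exact: cvg_cst.
under eq_fun do rewrite big_ord_recl; rewrite big_ord_recl.
by apply: cvgD; [exact: h|apply: IH => k; exact: h].
Qed.

(** Coordinatewise sequential continuity suffices to extend an inequality from a dense set, and for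
    polynomial expressions it follows from the limit rules in [R]. *)
Definition seqcont d (h : d.-tuple R -> R) := forall (x_ : nat -> d.-tuple R) x,
  (forall k, tnth (x_ n) k @[n --> \oo] --> tnth x k) -> h (x_ n) @[n --> \oo] --> h x.

Lemma ae_closure d (h : d.-tuple R -> R) : seqcont h ->
  {ae @Leb R d, forall x, 0 <= h x} -> forall x, 0 <= h x.
Proof.
move=> ch aeh x.
have H n : exists y, (0 <= h y) /\ forall k, `|tnth y k - tnth x k| < n.+1%:R^-1.
  by apply: ae_dense.
have [x_ Hx] := choice H.
have cv : h (x_ n) @[n --> \oo] --> h x.
  apply: ch => k; apply/cvgrPdist_lt => e e0.
  have : n.+1%:R^-1 @[n --> \oo] --> (0 : R) by exact: cvg_harmonic.
  move=> /cvgrPdist_lt /(_ e e0); apply: filterS => n.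
  rewrite sub0r normrN ger0_norm// => hn.
  by rewrite distrC; exact: lt_trans ((Hx n).2 k) hn.
by apply: (cvgr_to_ge cv); apply: nearW => n; exact: (Hx n).1.
Qed.

Definition aff d (M : 'M[R]_d) (b t : d.-tuple R) : d.-tuple R :=
  [tuple (rv t *m M + rv b) ord0 k | k < d].

Lemma rv_inj d : injective (@rv R d).
Proof.
move=> x y /rowP h; apply: eq_from_tnth => k.
by have := h k; rewrite !mxE.
Qed.

Lemma rv_aff d (M : 'M[R]_d) b t : rv (aff M b t) = rv t *m M + rv b.
Proof. by apply/rowP => k; rewrite mxE tnth_mktuple. Qed.

Lemma tnth_aff d (M : 'M[R]_d) b t k :
  tnth (aff M b t) k = (\sum_j tnth t j * M j k) + tnth b k.
Proof.
rewrite tnth_mktuple !mxE; congr (_ + _).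
by apply: eq_bigr => j _; rewrite mxE.
Qed.

Lemma measurable_aff d (M : 'M[R]_d) b dT (T : measurableType dT) (h : T -> d.-tuple R) :
  measurable_fun setT h -> measurable_fun setT (fun x => aff M b (h x)).
Proof.
move=> mh; rewrite (_ : (fun x => _) = (fun x => [tuple (\sum_j tnth (h x) j * M j k) + tnth b k | k < d])).
  apply: measurable_mktuple => k; apply: measurable_funD => //; apply: measurable_sum => j.
  by apply: measurable_funM => //; exact: measurableT_comp (measurable_tnth _) mh.
by apply/funext => x; apply: eq_from_tnth => k; rewrite tnth_aff tnth_mktuple.
Qed.

(** The monotonicity pairing between two possibly different affine maps: above the cut the tail map
    is the first, below it the second. *)
Definition cross d (M1 M2 : 'M[R]_d) (b1 b2 t u : d.-tuple R) : R :=
  dot (tsub t u) (tsub (aff M1 b1 t) (aff M2 b2 u)).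

Lemma crossE d (M1 M2 : 'M[R]_d) (b1 b2 t u : d.-tuple R) : cross M1 M2 b1 b2 t u =
  \sum_k (tnth t k - tnth u k) * (((\sum_j tnth t j * M1 j k) + tnth b1 k) -
    ((\sum_j tnth u j * M2 j k) + tnth b2 k)).
Proof. by apply: eq_bigr => k _; rewrite !tnth_mktuple -!tnth_aff !tnth_mktuple. Qed.

Lemma seqcont_crossr d (M1 M2 : 'M[R]_d) (b1 b2 t : d.-tuple R) :
  seqcont (cross M1 M2 b1 b2 t).
Proof.
move=> x_ x cx; rewrite crossE; under eq_fun do rewrite crossE.
apply: cvg_sum_ord => k; apply: cvgM; first by apply: cvgB => //; exact: cvg_cst.
apply: cvgB; first exact: cvg_cst.
apply: cvgD; last exact: cvg_cst.
by apply: cvg_sum_ord => j; apply: cvgM => //; exact: cvg_cst.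
Qed.

Lemma seqcont_crossl d (M1 M2 : 'M[R]_d) (b1 b2 u : d.-tuple R) :
  seqcont (fun t => cross M1 M2 b1 b2 t u).
Proof.
move=> x_ x cx; rewrite crossE; under eq_fun do rewrite crossE.
apply: cvg_sum_ord => k; apply: cvgM; first by apply: cvgB => //; exact: cvg_cst.
apply: cvgB; last exact: cvg_cst.
apply: cvgD; last exact: cvg_cst.
by apply: cvg_sum_ord => j; apply: cvgM => //; exact: cvg_cst.
Qed.

Lemma cross_ge0_ae d (M1 M2 : 'M[R]_d) (b1 b2 : d.-tuple R) :
  {ae @Leb R d, forall t, {ae @Leb R d, forall u, 0 <= cross M1 M2 b1 b2 t u}} ->
  forall t u, 0 <= cross M1 M2 b1 b2 t u.
Proof.
move=> h t u; apply: (ae_closure (@seqcont_crossl _ M1 M2 b1 b2 u)).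
apply: filterS h => x hx; exact: (ae_closure (@seqcont_crossr _ M1 M2 b1 b2 x) hx).
Qed.

Lemma sqnorm_eq0 d (x : d.-tuple R) : sqnorm x = 0 -> forall k, tnth x k = 0.
Proof.
move=> /eqP; rewrite psumr_eq0 => [/allP h k|k _]; last exact: sqr_ge0.
have := h k (mem_index_enum _) => /implyP /(_ isT).
by rewrite sqrf_eq0 => /eqP.
Qed.

Lemma small_le0 (a K : R) : 0 <= a -> (forall e, 0 < e -> a <= e * K) -> a = 0.
Proof.
move=> a0 h; apply/eqP; rewrite eq_le a0 andbT leNgt; apply/negP => ap.
have K1 : 0 < 2 * (`|K| + 1) by rewrite mulr_gt0// ltr_wpDl.
have := h (a / (2 * (`|K| + 1))) (divr_gt0 ap K1).
have : a / (2 * (`|K| + 1)) * K <= a / 2.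
  rewrite -mulrA ler_pM2l// mulrC ler_pdivrMr//.
  have := ler_norm K; lra.
by lra.
Qed.

(* Testing with [u = t + e (A t - B t)] and letting [e] go to 0. *)
Lemma cross_ge0_eq d (M1 M2 : 'M[R]_d) (b1 b2 : d.-tuple R) :
  (forall t u, 0 <= cross M1 M2 b1 b2 t u) -> M1 = M2 /\ b1 = b2.
Proof.
move=> h.
have A t : aff M1 b1 t = aff M2 b2 t.
  pose dl := tsub (aff M1 b1 t) (aff M2 b2 t).
  suff s0 : sqnorm dl = 0.
    apply: eq_from_tnth => k; have := sqnorm_eq0 s0 k; rewrite tnth_mktuple.
    by move=> /eqP; rewrite subr_eq0 => /eqP.
  apply: (@small_le0 _ (dot dl [tuple \sum_j tnth dl j * M2 j k | k < d])).
    exact: sqnorm_ge0.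
  move=> e e0; pose u := [tuple tnth t k + e * tnth dl k | k < d].
  have := h t u.
  suff -> : cross M1 M2 b1 b2 t u = e * (e * dot dl [tuple \sum_j tnth dl j * M2 j k | k < d] - sqnorm dl).
    by rewrite pmulr_rge0// subr_ge0.
  rewrite sqnormE /cross /dot mulrBr !mulr_sumr -sumrB; apply: eq_bigr => k _.
  have E1 : tnth (tsub t u) k = - (e * tnth dl k) by rewrite !tnth_mktuple; ring.
  have E2 : tnth (aff M2 b2 u) k = tnth (aff M2 b2 t) k + e * \sum_j tnth dl j * M2 j k.
    rewrite !tnth_aff addrAC; congr (_ + _); rewrite mulr_sumr -big_split/=.
    by apply: eq_bigr => j _; rewrite [tnth u _]tnth_mktuple mulrDl mulrA.
  have E3 : tnth dl k = tnth (aff M1 b1 t) k - tnth (aff M2 b2 t) k by rewrite tnth_mktuple.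
  rewrite E1 [X in _ * X = _]tnth_mktuple E2 [X in _ = e * (e * (_ * X)) - _]tnth_mktuple.
  have -> : tnth (aff M1 b1 t) k = tnth dl k + tnth (aff M2 b2 t) k by rewrite E3; ring.
  by ring.
have B : b1 = b2.
  have := A [tuple 0 | k < d] => /(congr1 (@rv R d)); rewrite !rv_aff.
  have -> : rv [tuple (0 : R) | k < d] = 0 by apply/rowP => k; rewrite !mxE tnth_mktuple.
  by rewrite !mul0mx !add0r => /rv_inj.
split => //; apply/row_matrixP => i; rewrite !rowE.
have := A [tuple ((i == k)%:R : R) | k < d] => /(congr1 (@rv R d)); rewrite !rv_aff B => /addIr.
suff -> : rv [tuple ((i == k)%:R : R) | k < d] = delta_mx 0 i by [].
by apply/rowP => k; rewrite !mxE tnth_mktuple eq_sym.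
Qed.

End seqcont.

(** * Scaling, block matrices and first moments of half-spaces *)

Section scale.
Context {R : realType}.
Local Open Scope ereal_scope.

Lemma ge0_integral_scale (k : R) (h : R -> \bar R) : (0 < k)%R -> measurable_fun setT h ->
  (forall r, 0 <= h r) -> k%:E * \int[lebR]_r h (k * r)%R = \int[lebR]_r h r.
Proof.
move=> k0 mh h0.
have mp : measurable_fun setT (fun r : R => k * r)%R by exact: measurable_funM.
have mhk : measurable_fun setT (fun r : R => h (k * r)%R) by exact: measurableT_comp mh mp.
have mk : measurable_fun setT (cst k : R -> R) by exact: measurable_cst.
have kk : forall x : R, (0 <= (cst k : R -> R) x)%R by move=> x; exact: ltW.
pose N := wpush_m lebR mk kk mp.
have E a b : (a <= b)%R -> N `]a, b]%classic = (b - a)%:E.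
  move=> ab; transitivity (\int[lebR]_x (k%:E * (\1_(`](a / k)%R, (b / k)%R]) x)%:E)).
    apply: eq_integral => x _; rewrite EFinM !indicE; congr (_ * _%:R%:E); congr nat_of_bool.
    by apply/idP/idP; rewrite !inE /= !in_itv/= ltr_pdivrMr// ler_pdivlMr// [(x * k)%R]mulrC.
  rewrite ge0_integralZl//; last 2 first.
  - by apply/measurable_EFinP; exact: measurable_indic.
  - by rewrite lee_fin ltW.
  rewrite integral_indic// setIT.
  transitivity (k%:E * (b / k - a / k)%:E); last by rewrite -EFinM; congr EFin; field; rewrite gt_eqF.
  by congr (_ * _); apply: lebR_ocitv; rewrite ler_pM2r// invr_gt0.
transitivity (\int[lebR]_r (((cst k : R -> R) r)%:E * h (k * r)%R)).
  by rewrite -ge0_integralZl// lee_fin ltW.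
apply: (ge0_eq_integral_wpush (m := lebR) mk kk mp (n := lebR)) => // A mA.
apply: (measure_eq_itvoc (m1 := N) (m2 := lebR)) => // [a b|a b ab].
  have [ab|ba] := leP a b; first by rewrite E// ltry.
  by rewrite set_itv_ge ?measure0 ?ltry// bnd_simp -leNgt; exact: ltW.
by transitivity (b - a)%:E; [exact: E|apply/esym; exact: lebR_ocitv].
Qed.

End scale.

Section block.
Context {R : realType} (d : nat).

Lemma rv_consp (p : R * d.-tuple R) : rv (consp p) = row_mx p.1%:M (rv p.2) :> 'rV_(1 + d).
Proof.
apply/rowP => k; case: (splitP k) => j e.
  have -> : k = lshift d j by exact: val_inj.
  by rewrite row_mxEl ord1 !mxE eqxx mulr1n -[in RHS](tnth_consp0 p); congr tnth; apply: val_inj.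
have -> : k = rshift 1 j by exact: val_inj.
rewrite row_mxEr !mxE -[in RHS](tnth_conspS p); congr tnth; exact: val_inj.
Qed.

Definition blk (th : R) (M : 'M[R]_d) : 'M[R]_d.+1 :=
  (block_mx th%:M 0 0 M : 'M[R]_(1 + d)).

Lemma rv_mul_blk th M (p : R * d.-tuple R) :
  rv (consp p) *m blk th M = row_mx (th * p.1)%:M (rv p.2 *m M) :> 'rV_(1 + d).
Proof.
rewrite rv_consp /blk (@mul_row_block _ 1 1 d 1 d) !mulmx0 addr0 add0r.
by rewrite mul_scalar_mx scale_scalar_mx mulrC.
Qed.

Lemma qform_blk th M (x : d.+1.-tuple R) :
  qform (blk th M) x = th * thead x ^+ 2 + qform M (tl x).
Proof.
rewrite /qform -{1 2}(consp_eta x) rv_mul_blk rv_consp (@tr_row_mx _ 1 1 d) (@mul_row_col _ 1 1 d 1).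
rewrite mxE tr_scalar_mx -scalar_mxM [X in X + _]mxE eqxx mulr1n /=; congr (_ + _).
by rewrite -mulrA -expr2.
Qed.

Lemma det_blk th M : \det (blk th M) = th * \det M.
Proof. by rewrite /blk (@det_ublock _ 1 d) det_scalar1. Qed.

Lemma posdef_blk th M : 0 < th -> posdef M -> posdef (blk th M).
Proof.
move=> th0 [MT Mp]; split.
  by rewrite /blk (@tr_block_mx _ 1 d 1 d) tr_scalar_mx !trmx0 MT.
move=> v v0; pose x := [tuple v ord0 k | k < d.+1].
have vE : v = rv x by apply/rowP => k; rewrite mxE tnth_mktuple.
rewrite vE -/(qform _ _) qform_blk.
have [t0|t0] := eqVneq (rv (tl x)) 0.
  rewrite /qform t0 !mul0mx mxE addr0 mulr_gt0// exprn_even_gt0//=.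
  apply: contra_neq v0 => s0; rewrite vE -(consp_eta x) rv_consp s0 t0 /=.
  by rewrite raddf0 row_mx0.
by rewrite ltr_wpDl ?Mp// mulr_ge0 ?sqr_ge0// ltW.
Qed.

End block.

Section half_moment.
Context {R : realType} (d : nat).
Local Notation Leb := (@Leb R).
Local Notation X := (d.+1.-tuple R).

Lemma qformE n (M : 'M[R]_n) (x : n.-tuple R) : qform M x = dot (aff M [tuple 0 | k < n] x) x.
Proof.
rewrite /qform mxE; apply: eq_bigr => k _; rewrite tnth_mktuple !mxE tnth_mktuple addr0.
by [].
Qed.

Lemma measurable_qform n (M : 'M[R]_n) dT (T : measurableType dT) (h : T -> n.-tuple R) :
  measurable_fun setT h -> measurable_fun setT (fun x => qform M (h x)).
Proof.
move=> mh; under eq_fun do rewrite qformE.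
by apply: measurable_dot => //; exact: measurable_aff.
Qed.

(** The head times the half-space density that equality imposes, with slope [th] and tail matrix
    [M]. *)
Definition hm (K th : R) (M : 'M[R]_d) (x : X) : R :=
  pos x * thead x * (K * Num.sqrt th * expR (- (th * thead x ^+ 2 + qform M (tl x)) / 2)).

Let mhm K th M : measurable_fun setT (hm K th M).
Proof.
have mth : measurable_fun setT (fun x : X => thead x) by exact: measurable_thead.
apply: measurable_funM; first by apply: measurable_funM => //; exact: measurable_pos.
apply: measurable_funM => //; apply: measurableT_comp; first exact: measurable_expR.
apply: measurable_funM => //; apply: measurable_funN; apply: measurable_funD.
  by apply: measurable_funM => //; exact: measurable_funX.
by apply: measurable_qform; exact: measurable_tl.
Qed.

Let hm0 K th M x : 0 <= K -> 0 <= hm K th M x.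
Proof.
move=> K0; rewrite /hm /pos; case: ltP => h; rewrite ?mul0r// mul1r.
by rewrite !mulr_ge0 ?sqrtr_ge0 ?expR_ge0// ltW.
Qed.

(** Rescaling the head by [sqrt th] shows that [sqrt th] times the first moment does not depend on
    [th]. Equal moments on the two sides will therefore give equal slopes. *)
Lemma hm_scale K th M : 0 <= K -> 0 < th ->
  ((Num.sqrt th)%:E * \int[Leb d.+1]_x (hm K th M x)%:E = \int[Leb d.+1]_x (hm K 1 M x)%:E)%E.
Proof.
move=> K0 th0; have s0 : 0 < Num.sqrt th by rewrite sqrtr_gt0.
have mE th' : measurable_fun setT (fun x => (hm K th' M x)%:E) by exact/measurable_EFinP.
have E0 th' x : (0 <= (hm K th' M x)%:E)%E by rewrite lee_fin hm0.
rewrite !ge0_integral_LebS'// -ge0_integralZl//; last 2 first.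
- exact: (measurable_fiber (mE th) (E0 th)).
- by move=> t _; apply: integral_ge0.
apply: eq_integral => t _.
pose h (s : R) := (hm K 1 M (consp (s, t)))%:E.
have mh : measurable_fun setT h by exact: (measurable_sec t (mE 1)).
have h0 s : (0 <= h s)%E by exact: E0.
transitivity ((Num.sqrt th)%:E * \int[lebR]_r h (Num.sqrt th * r)%R)%E; last first.
  exact: (ge0_integral_scale s0 mh h0).
apply: (congr1 (fun z => (Num.sqrt th)%:E * z)%E).
apply: eq_integral => s _; rewrite /h /=; congr EFin; rewrite /hm /pos !thead_consp !tl_consp /=.
rewrite pmulr_rgt0// mul1r sqrtr1 mulr1 exprMn sqr_sqrtr; last exact: ltW.
by ring.
Qed.

Lemma half_moment K th M (F : X -> R) : 0 <= K -> 0 < th -> measurable_fun setT F ->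
  (forall x, 0 <= F x) -> (forall x, thead x <= 0 -> F x = 0) ->
  {ae Leb d.+1, forall x, 0 < thead x ->
    F x = K * Num.sqrt th * expR (- (th * thead x ^+ 2 + qform M (tl x)) / 2)} ->
  ((Num.sqrt th)%:E * \int[Leb d.+1]_x (thead x * F x)%:E = \int[Leb d.+1]_x (hm K 1 M x)%:E)%E.
Proof.
move=> K0 th0 mF F0 Fn h; rewrite -(hm_scale M K0 th0); congr (_ * _)%E.
apply: ge0_ae_eq_integral => //.
- apply/measurable_EFinP; apply: measurable_funM => //; exact: measurable_thead.
- exact/measurable_EFinP.
- move=> x _; rewrite lee_fin; case: (leP (thead x) 0) => x0; first by rewrite Fn// mulr0.
  by rewrite mulr_ge0// ltW.
- by move=> x _; rewrite lee_fin hm0.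
apply: filterS h => x h _; rewrite /hm /pos; case: ltP => x0; last by rewrite Fn// mulr0 !mul0r.
by rewrite mul1r h.
Qed.

End half_moment.

(** * Equality on both halves produces one linear map *)

Section glued_linear.
Context {R : realType} (d : nat).
Local Notation Leb := (@Leb R).
Local Notation X := (d.+1.-tuple R).
Variables (w c : R) (f g : X -> R).
Hypothesis w01 : 0 < w < 1.
Hypotheses (df : density f) (dg : density g) (cf : centered_density f).
Variables (p1 p2 : R).
Hypotheses (p10 : 0 < p1) (p20 : 0 < p2) (p12 : p1 + p2 = 1).
Hypothesis p1E : (\int[Leb d.+1]_x (pos x * f (mv 1 0 x))%:E = p1%:E)%E.
Hypothesis p2E : (\int[Leb d.+1]_x (pos x * f (mv (-1) 0 x))%:E = p2%:E)%E.
Variables (T1 Z1 T2 Z2 : X -> X) (D1 E1 D2 E2 : X -> R).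
Local Notation F1 := (halfd 1 0 p1 f).
Local Notation F2 := (halfd (-1) 0 p2 f).
Local Notation G1 := (halfd 1 c p1 g).
Local Notation G2 := (halfd (-1) c p2 g).
Hypothesis HT1 : half_transport w F1 G1 T1 Z1 D1 E1.
Hypothesis HT2 : half_transport w F2 G2 T2 Z2 D2 E2.
Local Notation T := (glT c T1 T2).
Local Notation Z := (gl Z1 Z2).
Local Notation DZ := (gl E1 E2).
Hypothesis H1 : {ae Leb d.+1, forall x, 0 < f x -> f x = gam (Z x) * Num.sqrt (f x / g (T x))}.
Hypothesis H2 : {ae Leb d.+1, forall x, 0 < f x -> Num.sqrt (f x / g (T x)) = DZ x}.
Hypothesis H3 : {ae Leb d.+1, forall x, {ae Leb d.+1, forall y, 0 < f x -> 0 < f y ->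
      0 <= dot (tsub x y) (tsub (T x) (T y))}}.

Let s1 : ((1 : R) == 1) || ((1 : R) == -1). Proof. by rewrite eqxx. Qed.
Let s2 : ((-1 : R) == 1) || ((-1 : R) == -1). Proof. by rewrite eqxx orbT. Qed.

Let half_pos sg p x : 0 < halfd sg 0 p f x -> 0 < p -> 0 < thead x /\ 0 < f (mv sg 0 x).
Proof.
rewrite /halfd /pos; case: (0 < thead x) => /=; rewrite ?mul1r ?mul0r ?ltxx// => h p0.
by split => //; move: h; rewrite pmulr_lgt0// invr_gt0.
Qed.

Let mono12 (sg sg' : R) (Ta Tb : X -> X) : (sg == 1) || (sg == -1) -> (sg' == 1) || (sg' == -1) ->
  (forall x, 0 < thead x -> T (mv sg 0 x) = Ta x) ->
  (forall x, 0 < thead x -> T (mv sg' 0 x) = Tb x) ->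
  {ae Leb d.+1, forall x, {ae Leb d.+1, forall y, 0 < thead x -> 0 < thead y ->
    0 < f (mv sg 0 x) -> 0 < f (mv sg' 0 y) ->
      0 <= dot (tsub (mv sg 0 x) (mv sg' 0 y)) (tsub (Ta x) (Tb y))}}.
Proof.
move=> hs hs' ha hb; apply: filterS (ae_mv 0 hs H3) => x h.
case: (ltP 0 (thead x)) => x0; last by apply: aeW => y.
apply: filterS (ae_mv 0 hs' (h x0)) => y hy _ y0 fx fy.
by rewrite -ha// -hb//; exact: hy.
Qed.

Let lin1 : p1 <= 2^-1 /\ (p1 = 2^-1 ->
    exists (th : R) (M : 'M[R]_d) (b : d.-tuple R),
    [/\ 0 < th, posdef M & {ae Leb d.+1, forall x, 0 < thead x -> [/\ 0 < F1 x,
      thead (T1 x) = th * thead x /\ rv (tl (T1 x)) = rv (tl x) *m M + rv b,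
      sqnorm (Z1 x) = th * thead x ^+ 2 + qform M (tl x) &
      F1 x / G1 (T1 x) = th * \det M]}]).
Proof.
have h1 := halves_ae_rev p10 HT1 (P := fun x J u => u = gam (Z1 x) * Num.sqrt J).
have h2 := halves_ae_rev p10 HT1 (P := fun x J u => Num.sqrt J = E1 x).
have [||? h] := ht_linear HT1 p10.
- apply: h1; apply: filterS (ae_mv 0 s1 H1) => x h x0 fx.
  by have := h x0 fx; rewrite /glT !gl_pos.
- apply: h2; apply: filterS (ae_mv 0 s1 H2) => x h x0 fx.
  by have := h x0 fx; rewrite /glT !gl_pos.
split => // e; apply: (h e).
have m := mono12 s1 s1 (fun x x0 => gl_pos _ _ x0) (fun x x0 => gl_pos _ _ x0).
apply: filterS m => x; apply: filterS => y hxy Fx Fy.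
have [x0 fx] := half_pos Fx p10; have [y0 fy] := half_pos Fy p10.
by have := hxy x0 y0 fx fy; rewrite dot_tsub_mv.
Qed.

Let lin2 : p2 <= 2^-1 /\ (p2 = 2^-1 ->
    exists (th : R) (M : 'M[R]_d) (b : d.-tuple R),
    [/\ 0 < th, posdef M & {ae Leb d.+1, forall x, 0 < thead x -> [/\ 0 < F2 x,
      thead (T2 x) = th * thead x /\ rv (tl (T2 x)) = rv (tl x) *m M + rv b,
      sqnorm (Z2 x) = th * thead x ^+ 2 + qform M (tl x) &
      F2 x / G2 (T2 x) = th * \det M]}]).
Proof.
have h1 := halves_ae_rev p20 HT2 (P := fun x J u => u = gam (Z2 x) * Num.sqrt J).
have h2 := halves_ae_rev p20 HT2 (P := fun x J u => Num.sqrt J = E2 x).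
have [||? h] := ht_linear HT2 p20.
- apply: h1; apply: filterS (ae_mv 0 s2 H1) => x h x0 fx.
  by have := h x0 fx; rewrite /glT !gl_neg.
- apply: h2; apply: filterS (ae_mv 0 s2 H2) => x h x0 fx.
  by have := h x0 fx; rewrite /glT !gl_neg.
split => // e; apply: (h e).
have m := mono12 s2 s2 (fun x x0 => gl_neg _ _ x0) (fun x x0 => gl_neg _ _ x0).
apply: filterS m => x; apply: filterS => y hxy Fx Fy.
have [x0 fx] := half_pos Fx p20; have [y0 fy] := half_pos Fy p20.
by have := hxy x0 y0 fx fy; rewrite dot_tsub_mv.
Qed.

(** Neither half can carry more than 1/2, and the two masses add up to 1. *)
Let p1h : p1 = 2^-1. Proof. have := lin1.1; have := lin2.1; have := p12; lra. Qed.
Let p2h : p2 = 2^-1. Proof. have := lin1.1; have := lin2.1; have := p12; lra. Qed.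

Let affine_part (th : R) (M : 'M[R]_d) (b : d.-tuple R) (x y : X) :
  thead y = th * thead x /\ rv (tl y) = rv (tl x) *m M + rv b ->
  y = consp (th * thead x, aff M b (tl x)).
Proof.
case=> h1 h2; rewrite -[LHS]consp_eta h1; congr (consp (_, _)).
by apply: rv_inj; rewrite rv_aff h2.
Qed.

(** In the monotonicity inequality for a pair on opposite sides of the cut, let both heads tend to
    0: only the tail pairing remains, and its nonnegativity for two affine maps makes them equal. *)
Let glue_tails th1 M1 b1 th2 M2 b2 : 0 < th1 -> 0 < th2 ->
  {ae Leb d.+1, forall x, 0 < thead x -> 0 < F1 x /\
      (thead (T1 x) = th1 * thead x /\ rv (tl (T1 x)) = rv (tl x) *m M1 + rv b1)} ->
  {ae Leb d.+1, forall x, 0 < thead x -> 0 < F2 x /\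
      (thead (T2 x) = th2 * thead x /\ rv (tl (T2 x)) = rv (tl x) *m M2 + rv b2)} ->
  M1 = M2 /\ b1 = b2.
Proof.
move=> t10 t20 L1 L2; apply: cross_ge0_eq; apply: cross_ge0_ae.
pose C (z : X * X) := (thead z.1 + thead z.2) * (th1 * thead z.1 + th2 * thead z.2) +
  cross M1 M2 b1 b2 (tl z.1) (tl z.2).
pose Q z := (0 < thead z.1) ==> ((0 < thead z.2) ==> (0 <= C z)).
have mth1 : measurable_fun setT (fun z : X * X => thead z.1).
  exact: measurableT_comp (@measurable_thead R d) _.
have mth2 : measurable_fun setT (fun z : X * X => thead z.2).
  exact: measurableT_comp (@measurable_thead R d) _.
have mtl1 : measurable_fun setT (fun z : X * X => tl z.1).
  exact: measurableT_comp (@measurable_tl R d) _.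
have mtl2 : measurable_fun setT (fun z : X * X => tl z.2).
  exact: measurableT_comp (@measurable_tl R d) _.
have mC : measurable_fun setT C.
  apply: measurable_funD.
    by apply: measurable_funM; apply: measurable_funD => //; exact: measurable_funM.
  by apply: measurable_dot; apply: measurable_tsub => //; exact: measurable_aff.
have mQ : measurable_fun setT Q.
  rewrite (_ : Q = (fun z => ~~ (0 < thead z.1) || (~~ (0 < thead z.2) || (0 <= C z)))); last first.
    by apply/funext => z; rewrite /Q !implybE.
  apply: measurable_or; first by apply: measurable_neg; exact: measurable_fun_ltr.
  apply: measurable_or; first by apply: measurable_neg; exact: measurable_fun_ltr.
  exact: measurable_fun_ler.
have HQ : {ae Leb d.+1, forall x, {ae Leb d.+1, forall y, Q (x, y)}}.
  have m := mono12 s1 s2 (fun x x0 => gl_pos _ _ x0) (fun x x0 => gl_neg _ _ x0).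
  apply: filterS2 m L1 => x m Lx; apply: filterS2 m L2 => y m Ly.
  apply/implyP => /= x0; apply/implyP => /= y0.
  have [/half_pos/(_ p10)[_ fx] ex] := Lx x0; have [/half_pos/(_ p20)[_ fy] ey] := Ly y0.
  have := m x0 y0 fx fy; rewrite (affine_part ex) (affine_part ey) /mv !tsub_consp dot_consp/=.
  rewrite !thead_consp !tl_consp /= /C /=.
  suff -> : (0 + 1 * thead x - (0 + -1 * thead y)) * (c + 1 * (th1 * thead x) - (c + -1 * (th2 * thead y))) =
    (thead x + thead y) * (th1 * thead x + th2 * thead y) by [].
  by ring.
apply: filterS (ae_fiber2 mQ HQ) => t; apply: filterS => u H.
pose K := th1 + th2.
have K0 : 0 < K by rewrite addr_gt0.
rewrite leNgt; apply/negP => c0; set a := cross _ _ _ _ _ _ in c0.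
(* Heads below [dl] make the head term smaller than [- a], contradicting monotonicity if [a] were
   negative. *)
pose dl := Num.min 1 (- a / (2 * K)).
have dl0 : 0 < dl by rewrite lt_min ltr01 divr_gt0 ?oppr_gt0// mulr_gt0.
have [r [/andP[r0 r1] Hr]] := ae_itv dl0 H.
have [s [/andP[s0 s1'] Hs]] := ae_itv dl0 Hr.
have := Hs; rewrite /Q /= !thead_consp/= s0 r0 /= /C /= !thead_consp !tl_consp/= -/a.
have dl1 : dl <= 1 by rewrite ge_min lexx.
have dl2 : dl * (2 * K) <= - a.
  by rewrite -ler_pdivlMr ?mulr_gt0// ge_min lexx orbT.
have A1 : (s + r) * (th1 * s + th2 * r) < 2 * (dl * K).
  have B1 : s + r < 2 * dl by lra.
  have B2 : th1 * s + th2 * r < K.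
    by rewrite /K; apply: ltrD; rewrite gtr_pMr//; lra.
  have -> : 2 * (dl * K) = (2 * dl) * K by ring.
  by apply: ltr_pM => //; rewrite ?addr_ge0 ?mulr_ge0// ltW.
have : dl * (2 * K) = 2 * (dl * K) by ring.
lra.
Qed.

Let mf : measurable_fun setT f. Proof. by have [] := df. Qed.
Let f0 x : 0 <= f x. Proof. by have [] := df. Qed.
Let dF1 : density F1. Proof. exact: (halfd_density df p10 p1E). Qed.
Let dF2 : density F2. Proof. exact: (halfd_density df p20 p2E). Qed.

(** Centering balances the first moments of the two sides and the masses are both 1/2, so the
    normalized moments agree. They are positive, since otherwise [F1] would vanish almost
    everywhere. *)
Let moments_eq : exists2 m : R, 0 < m & (\int[Leb d.+1]_x (thead x * F1 x)%:E = m%:E)%E /\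
  (\int[Leb d.+1]_x (thead x * F2 x)%:E = m%:E)%E.
Proof.
have [ch ch0] := cf ord0.
have mth : measurable_fun setT (fun x : X => thead x * f x).
  by apply: measurable_funM => //; exact: measurable_thead.
have i1 := integrable_mv 0 mth ch s1; have i2 := integrable_mv 0 mth ch s2.
have e1 : (fun x => (thead x * F1 x)%:E) =
    (fun x => (2%:E * (pos x * (thead (mv 1 0 x) * f (mv 1 0 x)))%:E)%E).
  apply/funext => x; rewrite /halfd p1h thead_mv add0r mul1r -EFinM; congr EFin.
  by rewrite invrK; ring.
have e2 : (fun x => (thead x * F2 x)%:E) =
    (fun x => ((-2)%:E * (pos x * (thead (mv (-1) 0 x) * f (mv (-1) 0 x)))%:E)%E).
  apply/funext => x; rewrite /halfd p2h thead_mv add0r mulN1r -EFinM; congr EFin.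
  by rewrite invrK; ring.
have I1 : (\int[Leb d.+1]_x (thead x * F1 x)%:E =
    2%:E * \int[Leb d.+1]_x (pos x * (thead (mv 1 0 x) * f (mv 1 0 x)))%:E)%E.
  by rewrite e1 integralZl.
have I2 : (\int[Leb d.+1]_x (thead x * F2 x)%:E =
    (-2)%:E * \int[Leb d.+1]_x (pos x * (thead (mv (-1) 0 x) * f (mv (-1) 0 x)))%:E)%E.
  by rewrite e2 integralZl.
have := etrans (esym (integral_mv_signed 0 mth ch)) ch0.
have := integrable_fin_num measurableT i1; have := integrable_fin_num measurableT i2.
move: I1 I2; set A := (\int[Leb d.+1]_x (pos x * (thead (mv 1 0 x) * _))%:E)%E.
set B := (\int[Leb d.+1]_x (pos x * (thead (mv (-1) 0 x) * _))%:E)%E.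
case: A => // a I1; case: B => // b I2 _ _ [] ab.
exists (2 * a); last by rewrite I1 I2 -!EFinM; split => //; congr EFin; lra.
have [mF F0 F11] := dF1.
have tF0 x : 0 <= thead x * F1 x.
  have [x0|x0] := leP (thead x) 0; first by rewrite halfd_le0// mulr0.
  by rewrite mulr_ge0// ltW.
have a0 : (0 <= (2 * a)%:E)%E.
  by rewrite EFinM -I1; apply: integral_ge0 => x _; rewrite lee_fin.
rewrite lt_neqAle -lee_fin a0 andbT; apply/eqP => a00.
have mtF : measurable_fun setT (fun x : X => (thead x * F1 x)%:E).
  by apply/measurable_EFinP; apply: measurable_funM => //; exact: measurable_thead.
have ae0 : {ae Leb d.+1, forall x, (thead x * F1 x)%:E = 0%E}.
  apply/(ae_integral0E (Leb d.+1) mtF) => [x|]; first by rewrite lee_fin.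
  by rewrite I1 -EFinM -a00.
have : {ae Leb d.+1, forall x, (F1 x)%:E = 0%E}.
  apply: filterS ae0 => x [] /eqP; rewrite mulf_eq0 => /orP[/eqP x0|/eqP ->//].
  by rewrite halfd_le0// x0.
move=> /(ae_integral0E (Leb d.+1) _ _) h.
have mFE : measurable_fun setT (fun x : X => (F1 x)%:E) by exact/measurable_EFinP.
have FE0 x : (0 <= (F1 x)%:E)%E by rewrite lee_fin.
by have := h mFE FE0; rewrite F11 => -[] /eqP; rewrite oner_eq0.
Qed.

Let ae_F (p th : R) (M : 'M[R]_d) (F G : X -> R) (Ta Za : X -> X) : p = 2^-1 -> 0 < th ->
  {ae Leb d.+1, forall x, 0 < F x -> p * F x = gam (Za x) * Num.sqrt (F x / G (Ta x))} ->
  {ae Leb d.+1, forall x, 0 < thead x -> 0 < F x /\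
      (sqnorm (Za x) = th * thead x ^+ 2 + qform M (tl x) /\ F x / G (Ta x) = th * \det M)} ->
  {ae Leb d.+1, forall x, 0 < thead x -> F x =
     (2 * (Num.sqrt (2 * pi))^-1 ^+ d.+1 * Num.sqrt (\det M)) * Num.sqrt th *
      expR (- (th * thead x ^+ 2 + qform M (tl x)) / 2)}.
Proof.
move=> -> th0 h1 h2; apply: filterS2 h1 h2 => x h1 h2 x0.
have [Fx [zE jE]] := h2 x0; have := h1 Fx.
rewrite jE /gam zE (sqrtrM _ (ltW th0)) => h.
 rewrite -[LHS](mulKf (x := 2^-1)) ?invr_neq0//; rewrite h invrK.
by rewrite -!mulrA; congr (_ * (_ * _)); rewrite mulrC -!mulrA mulrCA.
Qed.

(** By [half_moment], the common moment times [sqrt th1] and times [sqrt th2] is the same number. *)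
Let slopes_eq th1 th2 (M : 'M[R]_d) : 0 < th1 -> 0 < th2 ->
  {ae Leb d.+1, forall x, 0 < thead x -> F1 x =
     (2 * (Num.sqrt (2 * pi))^-1 ^+ d.+1 * Num.sqrt (\det M)) * Num.sqrt th1 *
      expR (- (th1 * thead x ^+ 2 + qform M (tl x)) / 2)} ->
  {ae Leb d.+1, forall x, 0 < thead x -> F2 x =
     (2 * (Num.sqrt (2 * pi))^-1 ^+ d.+1 * Num.sqrt (\det M)) * Num.sqrt th2 *
      expR (- (th2 * thead x ^+ 2 + qform M (tl x)) / 2)} ->
  th1 = th2.
Proof.
move=> t10 t20 e1 e2; have [m m0 [m1 m2]] := moments_eq.
have [mF1 F10 _] := dF1; have [mF2 F20 _] := dF2.
have K0 : 0 <= 2 * (Num.sqrt (2 * pi))^-1 ^+ d.+1 * Num.sqrt (\det M) :> R.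
  by rewrite !mulr_ge0 ?sqrtr_ge0// exprn_ge0// invr_ge0 sqrtr_ge0.
have := half_moment K0 t10 mF1 F10 (fun x h => halfd_le0 1 0 p1 f h) e1.
rewrite -(half_moment K0 t20 mF2 F20 (fun x h => halfd_le0 (-1) 0 p2 f h) e2) m1 m2.
have mn : m != 0 by rewrite gt_eqF.
rewrite -!EFinM => -[] /(mulIf mn) /eqP.
by rewrite eqr_sqrt ?ltW// => /eqP.
Qed.

Lemma glued_linear : exists (M : 'M[R]_d.+1) (b : X), posdef M /\
  {ae Leb d.+1, forall x, [/\ 0 < f x, rv (T x) = rv x *m M + rv b,
     sqnorm (Z x) = qform M x & f x / g (T x) = \det M]}.
Proof.
have [th1 [M1 [b1 [t10 pM1 L1]]]] := lin1.2 p1h.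
have [th2 [M2 [b2 [t20 pM2 L2]]]] := lin2.2 p2h.
have [ME bE] : M1 = M2 /\ b1 = b2.
  apply: (glue_tails t10 t20).
  - by apply: filterS L1 => x h /h[].
  - by apply: filterS L2 => x h /h[].
subst M2 b2.
have h1 := halves_ae_rev p10 HT1 (P := fun x J u => u = gam (Z1 x) * Num.sqrt J).
have h2 := halves_ae_rev p20 HT2 (P := fun x J u => u = gam (Z2 x) * Num.sqrt J).
have tE : th1 = th2.
  apply: (slopes_eq (M := M1) t10 t20).
  - apply: (ae_F p1h t10 (h1 _)); last by apply: filterS L1 => x h /h[].
    apply: filterS (ae_mv 0 s1 H1) => x h x0 fx.
    by have := h x0 fx; rewrite /glT !gl_pos.
  - apply: (ae_F p2h t20 (h2 _)); last by apply: filterS L2 => x h /h[].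
    apply: filterS (ae_mv 0 s2 H1) => x h x0 fx.
    by have := h x0 fx; rewrite /glT !gl_neg.
(* With one slope, one tail map and one offset [c], the maps on the two sides are restrictions of a
   single affine map. *)
subst th2; exists (blk th1 M1), (consp (c, b1)); split; first exact: posdef_blk.
have fin sg p Ta Za (x : X) : (sg == 1) || (sg == -1) -> 0 < p -> 0 < thead x ->
   T (mv sg 0 x) = mv sg c (Ta x) -> Z (mv sg 0 x) = Za x ->
   [/\ 0 < halfd sg 0 p f x, thead (Ta x) = th1 * thead x /\ rv (tl (Ta x)) = rv (tl x) *m M1 + rv b1,
     sqnorm (Za x) = th1 * thead x ^+ 2 + qform M1 (tl x)
     & halfd sg 0 p f x / halfd sg c p g (Ta x) = th1 * \det M1] ->
  [/\ 0 < f (mv sg 0 x), rv (T (mv sg 0 x)) = rv (mv sg 0 x) *m blk th1 M1 + rv (consp (c, b1)),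
     sqnorm (Z (mv sg 0 x)) = qform (blk th1 M1) (mv sg 0 x) &
     f (mv sg 0 x) / g (T (mv sg 0 x)) = \det (blk th1 M1)].
  move=> hs p0 x0 TE ZE [/half_pos/(_ p0)[_ fx] aE zE jE]; rewrite TE ZE; split => //.
  - rewrite (affine_part aE) /mv thead_consp tl_consp /= rv_mul_blk !rv_consp /=.
    rewrite (@add_row_mx _ 1 1 d) -rv_aff -raddfD/=; congr (row_mx (_%:M) _); ring.
  - rewrite qform_blk zE thead_mv /mv tl_consp /= add0r exprMn.
    by have := sg_sq hs; rewrite -expr2 => ->; rewrite mul1r.
  - rewrite det_blk -jE /halfd /pos x0 mul1r (affine_part aE) thead_consp /= pmulr_rgt0// x0 mul1r.
    by rewrite invf_div mulf_div [_ * p]mulrC -mulf_div divff ?mul1r// gt_eqF.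
apply: ae_mv_glue.
  apply: filterS L1 => x h x0; rewrite -[x]mv10.
  by apply: (fin 1 p1 T1 Z1) => //; [rewrite /glT gl_pos|rewrite gl_pos|exact: h].
apply: filterS L2 => x h x0.
by apply: (fin (-1) p2 T2 Z2) => //; [rewrite /glT gl_neg|rewrite gl_neg|exact: h].
Qed.

End glued_linear.

(** * Masses, quantiles and the splitting along the first coordinate *)

Section aligned.
Context {R : realType} (d : nat).
Local Notation Leb := (@Leb R).
Local Notation X := (d.+1.-tuple R).

(** The height [c] is a quantile of the first-coordinate marginal of [g], whose distribution
    function is continuous and hence attains [v]. *)
Lemma quantile (g : X -> R) (v : R) : density g -> 0 < v < 1 ->
  exists c, (\int[Leb d.+1]_x (pos x * g (mv (-1) c x))%:E = v%:E)%E.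
Proof.
move=> [mg g0 g1] v01.
have mgE : measurable_fun setT (fun x => (g x)%:E) by exact/measurable_EFinP.
have g0E x : (0 <= (g x)%:E)%E by rewrite lee_fin.
pose I (s : R) : \bar R := (\int[Leb d]_t (g (consp (s, t)))%:E)%E.
have mI : measurable_fun setT I.
  apply: (measurable_fun_fubini_tonelli_F (m2 := Leb d) (fun z : R * d.-tuple R => (g (consp z))%:E)).
    exact: measurableT_comp mgE (@measurable_consp R d).
  by move=> z; exact: g0E.
have I0 s : (0 <= I s)%E by apply: integral_ge0.
have I1 : (\int[lebR]_s I s = 1)%E by rewrite -g1 (ge0_integral_LebS mgE g0E).
pose h s := fine (I s).
have mh : measurable_fun setT h by apply: measurableT_comp mI; exact: fine_measurable.
have h0 s : 0 <= h s by exact: fine_ge0.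
have aeh : {ae lebR, forall s, (h s)%:E = I s}.
  have i : lebR.-integrable setT I.
    apply/integrableP; split => //.
    by under eq_integral do rewrite gee0_abs//; rewrite I1 ltry.
  by apply: filterS (integrable_ae measurableT i) => s /(_ Logic.I) hs; rewrite /h fineK.
have hI (k : R -> \bar R) : measurable_fun setT k -> (forall s, 0 <= k s)%E ->
    (\int[lebR]_s ((h s)%:E * k s) = \int[lebR]_s (I s * k s))%E.
  move=> mk k0; apply: ge0_ae_eq_integral => //.
  - by apply: emeasurable_funM => //; exact/measurable_EFinP.
  - exact: emeasurable_funM.
  - by move=> s _; rewrite mule_ge0// lee_fin.
  - by move=> s _; rewrite mule_ge0.
  - by apply: filterS aeh => s ->.
have h1 : (\int[lebR]_s (h s)%:E = 1)%E.
  rewrite -I1; transitivity (\int[lebR]_s ((h s)%:E * cst 1%E s))%E.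
    by apply: eq_integral => s _; rewrite mule1.
  by rewrite hI//; apply: eq_integral => s _; rewrite mule1.
have [c hc] := cdfd_onto mh h0 h1 v01; exists c.
have mk : measurable_fun setT (fun s : R => ((s <= c)%R%:R)%:E : \bar R).
  by apply/measurable_EFinP/measurable_natr_bool; exact: measurable_fun_ler.
have hcE : (\int[lebR]_s ((h s)%:E * ((s <= c)%R%:R)%:E) = v%:E)%E.
  rewrite -hc cdfdE//; apply: eq_integral => s _; congr (_ * _%:R%:E)%E; congr nat_of_bool.
  by apply/idP/idP; rewrite inE /= in_itv.
have mkx : measurable_fun setT (fun x : X => ((thead x <= c)%R%:R)%:E : \bar R).
  apply/measurable_EFinP/measurable_natr_bool; apply: measurable_fun_ler => //; exact: measurable_thead.
pose H (x : X) : \bar R := ((g x)%:E * ((thead x <= c)%R%:R)%:E)%E.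
have mH : measurable_fun setT H by exact: emeasurable_funM.
have H0 x : (0 <= H x)%E by rewrite mule_ge0// lee_fin.
transitivity (\int[Leb d.+1]_x H x)%E; last first.
  rewrite (ge0_integral_LebS mH H0) -hcE hI//; apply: eq_integral => s _.
  rewrite /H; under eq_integral do rewrite thead_consp/=.
  rewrite ge0_integralZr//; last exact: (measurable_consp2 mgE).1.
rewrite (ge0_integral_glue (c := c) (K1 := cst 0%E) (K2 := fun x => (g (mv (-1) c x))%:E) mH H0).
- rewrite [X in (X + _)%E]integral0_eq ?add0e; last by move=> x _; rewrite mule0.
  by apply: eq_integral => x _; rewrite EFinM.
- by move=> x x0; rewrite /H thead_mv gerDl mul1r leNgt x0 mule0.
- by move=> x x0; rewrite /H thead_mv gerDl mulN1r oppr_le0 ltW// mule1.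
Qed.

(** Centering gives the two sides equal absolute first moments, and a side has zero mass exactly
    when its moment vanishes. So if one side were empty both would be, against total mass 1. *)
Lemma half_mass (f : X -> R) : density f -> centered_density f ->
  exists p1 p2 : R, [/\ 0 < p1, 0 < p2, p1 + p2 = 1,
    (\int[Leb d.+1]_x (pos x * f (mv 1 0 x))%:E = p1%:E)%E &
    (\int[Leb d.+1]_x (pos x * f (mv (-1) 0 x))%:E = p2%:E)%E].
Proof.
move=> [mf f0 f1] cf.
have mth : measurable_fun setT (fun x : X => thead x) by exact: measurable_thead.
have ma sg : measurable_fun setT (fun x : X => pos x * f (mv sg 0 x)).
  apply: measurable_funM; first exact: measurable_pos.
  exact: measurableT_comp mf (measurable_mv _ _).
have a0 sg x : 0 <= pos x * f (mv sg 0 x) by rewrite mulr_ge0// pos_ge0.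
have ta0 sg x : 0 <= thead x * (pos x * f (mv sg 0 x)).
  have [x0|x0] := leP (thead x) 0; last by rewrite mulr_ge0// ltW.
  by rewrite /pos ltNge x0 mul0r mulr0.
have maE sg : measurable_fun setT (fun x : X => (pos x * f (mv sg 0 x))%:E) by exact/measurable_EFinP.
have mtaE sg : measurable_fun setT (fun x : X => (thead x * (pos x * f (mv sg 0 x)))%:E).
  by apply/measurable_EFinP; exact: measurable_funM.
pose P sg : \bar R := (\int[Leb d.+1]_x (pos x * f (mv sg 0 x))%:E)%E.
pose B sg : \bar R := (\int[Leb d.+1]_x (thead x * (pos x * f (mv sg 0 x)))%:E)%E.
have P0 sg : (0 <= P sg)%E by apply: integral_ge0 => x _; rewrite lee_fin.
have P1 : (P 1%R + P (-1)%R = 1)%E.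
  rewrite -f1 (ge0_integral_mv 0); last 2 first.
  - exact/measurable_EFinP.
  - by move=> x; rewrite lee_fin.
  by congr (_ + _)%E; apply: eq_integral => x _; rewrite EFinM.
have PB sg : P sg = 0%E <-> B sg = 0%E.
  rewrite /P /B -!ae_integral0E//; last 2 first.
  - by move=> x; rewrite lee_fin.
  - by move=> x; rewrite lee_fin.
  split; apply: filterS => x [] e; congr EFin; first by rewrite e mulr0.
  move/eqP: e; rewrite mulf_eq0 => /orP[/eqP x0|/eqP//].
  by rewrite /pos x0 ltxx mul0r.
have BB : B 1 = B (-1).
  have [ch ch0] := cf ord0.
  have mthf : measurable_fun setT (fun x : X => thead x * f x) by exact: measurable_funM.
  have s1 : ((1 : R) == 1) || ((1 : R) == -1) by rewrite eqxx.
  have s2 : ((-1 : R) == 1) || ((-1 : R) == -1) by rewrite eqxx orbT.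
  have i1 := integrable_mv 0 mthf ch s1; have i2 := integrable_mv 0 mthf ch s2.
  have := etrans (esym (integral_mv_signed 0 mthf ch)) ch0.
  have e1 : (fun x => (pos x * (thead (mv 1 0 x) * f (mv 1 0 x)))%:E) =
      (fun x => (thead x * (pos x * f (mv 1 0 x)))%:E).
    by apply/funext => x; rewrite thead_mv; congr EFin; ring.
  have e2 : (fun x => (pos x * (thead (mv (-1) 0 x) * f (mv (-1) 0 x)))%:E) =
      (fun x => ((-1)%:E * (thead x * (pos x * f (mv (-1) 0 x)))%:E)%E).
    by apply/funext => x; rewrite thead_mv -EFinM; congr EFin; ring.
  have := integrable_fin_num measurableT i1; have := integrable_fin_num measurableT i2.
  have i3 : (Leb d.+1).-integrable setT (fun x => (thead x * (pos x * f (mv (-1) 0 x)))%:E).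
    rewrite (_ : (fun x => _) = (fun x => ((-1)%:E * (pos x * (thead (mv (-1) 0 x) * f (mv (-1) 0 x)))%:E)%E)).
      exact: integrableZl.
    by apply/funext => x; rewrite thead_mv -EFinM; congr EFin; ring.
  have -> : (\int[Leb d.+1]_x (pos x * (thead (mv 1 0 x) * f (mv 1 0 x)))%:E)%E = B 1 by rewrite e1.
  have -> : (\int[Leb d.+1]_x (pos x * (thead (mv (-1) 0 x) * f (mv (-1) 0 x)))%:E)%E = ((-1)%:E * B (-1)%R)%E.
    by rewrite e2 integralZl.
  have : B (-1) \is a fin_num by exact: (integrable_fin_num measurableT i3).
  case: (B 1) => // a; case: (B (-1)) => // b _ _ _ [] h; congr EFin; lra.
have Pn sg : P sg != 0%E -> (0 < P sg)%E by rewrite lt_neqAle eq_sym P0 => ->.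
have n1 : P 1 != 0%E.
  apply/eqP => h; have h2 := (PB 1).1 h; rewrite BB in h2.
  by move: P1; rewrite h ((PB (-1)).2 h2) adde0 => -[] /eqP; rewrite eq_sym oner_eq0.
have n2 : P (-1) != 0%E.
  apply/eqP => h; have h2 := (PB (-1)).1 h; rewrite -BB in h2.
  by move: P1; rewrite h ((PB 1).2 h2) adde0 => -[] /eqP; rewrite eq_sym oner_eq0.
have := Pn _ n1; have := Pn _ n2; move: P1.
case e1 : (P 1) => [p1||]; case e2 : (P (-1)) => [p2||] //; rewrite !lte_fin => -[] p12 p20 p10.
by exists p1, p2; split.
Qed.

Lemma halfd_centered (f : X -> R) sg p : 0 < p ->
  (forall k : 'I_d, (Leb d.+1).-integrable setT (fun x => (pos x * (tnth (tl x) k * f (mv sg 0 x)))%:E) /\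
    (\int[Leb d.+1]_x (pos x * (tnth (tl x) k * f (mv sg 0 x)))%:E = 0)%E) ->
  forall k : 'I_d, (Leb d.+1).-integrable setT (fun x => (tnth (tl x) k * halfd sg 0 p f x)%:E) /\
    (\int[Leb d.+1]_x (tnth (tl x) k * halfd sg 0 p f x)%:E = 0)%E.
Proof.
move=> p0 h k; have [i e] := h k.
have E : (fun x => (tnth (tl x) k * halfd sg 0 p f x)%:E) =
    (fun x => ((p^-1)%:E * (pos x * (tnth (tl x) k * f (mv sg 0 x)))%:E)%E).
  by apply/funext => x; rewrite -EFinM; congr EFin; rewrite /halfd; ring.
by split; rewrite E; [exact: integrableZl|rewrite integralZl// e mule0].
Qed.

(** The tail means over the upper half vanish by hypothesis, and then over the lower half because
    [f] is centered. Both pieces can thus be handed to the induction, with [g] cut at the quantile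
    that matches the masses. *)
Lemma aligned_pair (w : R) (f g : X -> R) : 0 < w < 1 -> pair_exists d w ->
  density f -> density g -> centered_density f ->
  (forall k : 'I_d, (\int[Leb d.+1]_x (pos x * (tnth (tl x) k * f x))%:E = 0)%E) ->
  exists T Z DB DZ, transport_pair w f g T Z DB DZ.
Proof.
move=> w01 IH df dg cf ct.
have [p1 [p2 [p10 p20 p12 p1E p2E]]] := half_mass df cf.
have p2v : 0 < p2 < 1 by apply/andP; split => //; lra.
have [c q2] := quantile dg p2v.
have [mg g0 g1] := dg; have [mf f0 f1] := df.
have q1 : (\int[Leb d.+1]_x (pos x * g (mv 1 c x))%:E = p1%:E)%E.
  have : (\int[Leb d.+1]_x (pos x * g (mv 1 c x))%:E + p2%:E = 1%:E)%E.
    rewrite -q2 -g1 [RHS](ge0_integral_mv c); last 2 first.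
    - exact/measurable_EFinP.
    - by move=> x; rewrite lee_fin.
    by congr (_ + _)%E; apply: eq_integral => x _; rewrite EFinM.
  by case: (\int[_]_x _)%E => // a [] h; congr EFin; lra.
have mtk (k : 'I_d) : measurable_fun setT (fun x : X => tnth (tl x) k).
  exact: measurableT_comp (measurable_tnth k) (@measurable_tl R d).
have mk k : measurable_fun setT (fun x : X => tnth (tl x) k * f x) by exact: measurable_funM.
have ik (k : 'I_d) : (Leb d.+1).-integrable setT (fun x => (tnth (tl x) k * f x)%:E).
  have [i _] := cf (lift ord0 k); rewrite (_ : (fun x => _) = (fun x => (tnth x (lift ord0 k) * f x)%:E))//.
  by apply/funext => x; rewrite tnth_tl.
have s1 : ((1 : R) == 1) || ((1 : R) == -1) by rewrite eqxx.
have s2 : ((-1 : R) == 1) || ((-1 : R) == -1) by rewrite eqxx orbT.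
have tlm sg (x : X) : tl (mv sg 0 x) = tl x by rewrite /mv tl_consp.
have c1 k : (\int[Leb d.+1]_x (pos x * (tnth (tl x) k * f (mv 1 0 x)))%:E = 0)%E.
  by rewrite -[RHS](ct k); apply: eq_integral => x _; rewrite mv10.
have c2 k : (\int[Leb d.+1]_x (pos x * (tnth (tl x) k * f (mv (-1) 0 x)))%:E = 0)%E.
  have := integral_mv_signed 0 (mk k) (ik k).
  have -> : (\int[Leb d.+1]_x (tnth (tl x) k * f x)%:E = 0)%E.
    have [_ e] := cf (lift ord0 k); rewrite -[RHS]e.
    by apply: eq_integral => x _; rewrite tnth_tl.
  under eq_integral do rewrite tlm; rewrite c1 add0e => e; rewrite [RHS]e.
  by apply: eq_integral => x _; rewrite tlm.
have F1c := halfd_centered p10 (fun k => conj _ (c1 k)).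
have F2c := halfd_centered p20 (fun k => conj _ (c2 k)).
have dF1 := halfd_density df p10 p1E; have dF2 := halfd_density df p20 p2E.
have dG1 := halfd_density dg p10 q1; have dG2 := halfd_density dg p20 q2.
have [|T1 [Z1 [D1 [E1 HT1]]]] := half_exists w01 IH dF1 dG1 (fun x h => halfd_le0 _ _ _ _ h)
  (fun x h => halfd_le0 _ _ _ _ h).
  apply: F1c => k; rewrite (_ : (fun x => _) = (fun x => (pos x * (tnth (tl (mv 1 0 x)) k * f (mv 1 0 x)))%:E)).
    exact: (integrable_mv 0 (mk k) (ik k) s1).
  by apply/funext => x; rewrite tlm.
have [|T2 [Z2 [D2 [E2 HT2]]]] := half_exists w01 IH dF2 dG2 (fun x h => halfd_le0 _ _ _ _ h)
  (fun x h => halfd_le0 _ _ _ _ h).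
  apply: F2c => k; rewrite (_ : (fun x => _) = (fun x => (pos x * (tnth (tl (mv (-1) 0 x)) k * f (mv (-1) 0 x)))%:E)).
    exact: (integrable_mv 0 (mk k) (ik k) s2).
  by apply/funext => x; rewrite tlm.
exists (glT c T1 T2), (gl Z1 Z2), (gl D1 D2), (gl E1 E2).
apply: (glued_transport df dg cf p10 p20 HT1 HT2) => H1 H2 H3.
exact: (glued_linear df cf p10 p20 p12 p1E p2E HT1 HT2 H1 H2 H3).
Qed.

End aligned.

(** * Linear changes of variables and the choice of the splitting direction *)

Section linear_change.
Context {R : realType}.
Local Notation Leb := (@Leb R).

Definition lin d (M : 'M[R]_d) (x : d.-tuple R) : d.-tuple R := aff M [tuple 0 | k < d] x.
Definition tadd d (c x : d.-tuple R) : d.-tuple R := [tuple tnth c k + tnth x k | k < d].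

Lemma rv0 d : rv [tuple (0 : R) | k < d] = 0.
Proof. by apply/rowP => k; rewrite !mxE tnth_mktuple. Qed.

Lemma rv_lin d (M : 'M[R]_d) x : rv (lin M x) = rv x *m M.
Proof. by rewrite rv_aff rv0 addr0. Qed.

Lemma rv_tadd d (c x : d.-tuple R) : rv (tadd c x) = rv c + rv x.
Proof. by apply/rowP => k; rewrite !mxE tnth_mktuple. Qed.

Lemma rv_tsub d (x y : d.-tuple R) : rv (tsub x y) = rv x - rv y.
Proof. by apply/rowP => k; rewrite !mxE tnth_mktuple. Qed.

Lemma rv_comb d w (x y : d.-tuple R) : rv (comb w x y) = (1 - w) *: rv x + w *: rv y.
Proof. by apply/rowP => k; rewrite !mxE tnth_mktuple. Qed.

Lemma dotE d (x y : d.-tuple R) : dot x y = (rv x *m (rv y)^T) ord0 ord0.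
Proof. by rewrite mxE; apply: eq_bigr => k _; rewrite !mxE. Qed.

Lemma measurable_lin d (M : 'M[R]_d) : measurable_fun setT (lin M).
Proof. exact: (measurable_aff _ _ (@measurable_id _ _ setT)). Qed.

Lemma measurable_tadd d dT (T : measurableType dT) (f g : T -> d.-tuple R) :
  measurable_fun setT f -> measurable_fun setT g ->
  measurable_fun setT (fun x => tadd (f x) (g x)).
Proof.
move=> mf mg; apply: measurable_mktuple => k; apply: measurable_funD.
  exact: measurableT_comp (measurable_tnth _) mf.
exact: measurableT_comp (measurable_tnth _) mg.
Qed.

Lemma tadd_consp d (p q : R * d.-tuple R) :
  tadd (consp p) (consp q) = consp (p.1 + q.1, tadd p.2 q.2).
Proof.
apply: eq_from_tnth => k; rewrite tnth_mktuple.
case: (unliftP ord0 k) => [j|] ->; last by rewrite !tnth_consp0.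
by rewrite !tnth_conspS tnth_mktuple.
Qed.

Lemma ge0_integral_tadd d (c : d.-tuple R) (F : d.-tuple R -> \bar R) :
  measurable_fun setT F -> (forall x, 0 <= F x)%E ->
  (\int[Leb d]_x F (tadd c x) = \int[Leb d]_x F x)%E.
Proof.
have mtc n (c' : n.-tuple R) : measurable_fun setT (tadd c') by exact: measurable_tadd.
elim: d c F => [|d IH] c F mF F0.
  by rewrite !ge0_integral_Leb0//; congr F; apply: eq_from_tnth => -[].
have mFc : measurable_fun setT (fun x => F (tadd c x)) by exact: measurableT_comp mF (mtc _ _).
rewrite (ge0_integral_LebS mFc (fun x => F0 _)) (ge0_integral_LebS mF F0).
pose I s := (\int[Leb d]_t F (consp (s, t)))%E.
have mI : measurable_fun setT I.
  apply: (measurable_fun_fubini_tonelli_F (m2 := Leb d) (fun z : R * d.-tuple R => F (consp z))).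
    exact: measurableT_comp mF (@measurable_consp R d).
  by move=> z; exact: F0.
have I0 s : (0 <= I s)%E by apply: integral_ge0.
rewrite -(ge0_integral_shift (thead c) mI I0); apply: eq_integral => s _.
rewrite /I -[RHS](IH (tl c)); last 2 first.
- exact: (measurable_consp2 mF).1.
- by move=> t.
by apply: eq_integral => t _; rewrite -[in LHS](consp_eta c) tadd_consp.
Qed.

(* Averaging over translates by [gam] reduces linear changes of variables to
   translation invariance, without computing any Jacobian. *)
Lemma ge0_integral_lin d (M : 'M[R]_d) (F : d.-tuple R -> \bar R) : M \in unitmx ->
  measurable_fun setT F -> (forall x, 0 <= F x)%E ->
  (\int[Leb d]_x F (lin M x) =
   (\int[Leb d]_x (gam (lin M x))%:E) * \int[Leb d]_x F x)%E.
Proof.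
move=> uM mF F0; pose X := d.-tuple R.
have mg (T' : measurableType _) (h : T' -> X) : measurable_fun setT h ->
    measurable_fun setT (fun x => (gam (h x))%:E : \bar R).
  by move=> mh; apply/measurable_EFinP; exact: measurable_gam.
have g0 (x : X) : (0 <= (gam x)%:E)%E by rewrite lee_fin ltW// gam_gt0.
have gN (x : X) : gam (tsub [tuple 0 | k < d] x) = gam x.
  by rewrite /gam; congr (_ * expR (- _ / 2)); apply: eq_bigr => k _; rewrite !tnth_mktuple sub0r sqrrN.
have mL := measurable_lin M.
pose G (z : X * X) : \bar R := (F (lin M z.1) * (gam (tsub z.2 (lin M z.1)))%:E)%E.
have mG : measurable_fun setT G.
  apply: emeasurable_funM; first by apply: measurableT_comp mF _; exact: measurableT_comp mL _.
  by apply: mg; apply: measurable_tsub => //; exact: measurableT_comp mL _.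
have G0 z : (0 <= G z)%E by rewrite mule_ge0.
transitivity (\int[Leb d]_y \int[Leb d]_z G (y, z))%E.
  apply: eq_integral => y _.
  have <- : (\int[Leb d]_z (F (lin M y) * (gam z)%:E) = F (lin M y))%E.
    by rewrite ge0_integralZl// ?integral_gam ?mule1//; exact: mg.
  rewrite -(ge0_integral_tadd (lin (- M) y)).
  - apply: eq_integral => z _; rewrite /G /=; congr (_ * (gam _)%:E)%E.
    by apply: rv_inj; rewrite rv_tadd rv_tsub !rv_lin mulmxN addrC.
  - by apply: emeasurable_funM => //; exact: mg.
  - by move=> z; rewrite mule_ge0.
rewrite (@fubini_tonelli _ _ _ _ _ (Leb d) (Leb d) G)//.
(* Translating [y] by the preimage of [z] under [M] frees the Gaussian factor from [z]; the integral
   in [z] is then a plain translation of [F]. *)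
transitivity (\int[Leb d]_z \int[Leb d]_y (F (tadd (lin M y) z) * (gam (lin M y))%:E))%E.
  apply: eq_integral => z _; rewrite -[LHS](ge0_integral_tadd (lin (invmx M) z)).
  - apply: eq_integral => y _; rewrite /G /=.
    have -> : lin M (tadd (lin (invmx M) z) y) = tadd (lin M y) z.
      by apply: rv_inj; rewrite rv_lin !rv_tadd !rv_lin mulmxDl mulmxKV// addrC.
    have -> : tsub z (tadd (lin M y) z) = tsub [tuple 0 | k < d] (lin M y).
      by apply: rv_inj; rewrite !rv_tsub rv_tadd rv0 opprD addrCA subrr addr0 sub0r.
    by rewrite gN.
  - by apply: measurableT_comp mG _.
  - by move=> y; exact: G0.
rewrite (@fubini_tonelli _ _ _ _ _ (Leb d) (Leb d) (fun z => F (tadd (lin M z.2) z.1) * (gam (lin M z.2))%:E)%E)//; last 2 first.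
- apply: emeasurable_funM.
    by apply: measurableT_comp mF _; apply: measurable_tadd => //; exact: measurableT_comp mL _.
  by apply: mg; exact: measurableT_comp mL _.
- by move=> z; rewrite mule_ge0.
rewrite -ge0_integralZr//; [|exact: mg|exact: integral_ge0].
apply: eq_integral => y _ /=; rewrite ge0_integralZr//.
- by rewrite ge0_integral_tadd// muleC.
- by apply: measurableT_comp mF _; exact: measurable_tadd.
Qed.

Lemma ae_lin d (M : 'M[R]_d) (P : d.-tuple R -> Prop) : M \in unitmx ->
  {ae Leb d, forall x, P x} -> {ae Leb d, forall x, P (lin M x)}.
Proof.
move=> uM [N [mN N0 PN]]; exists (lin M @^-1` N).
have mLN : measurable (lin M @^-1` N).
  by rewrite -[X in measurable X]setTI; exact: measurable_lin.
split => //; last by move=> x /= h; exact: PN.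
transitivity (\int[Leb d]_x (\1_N (lin M x))%:E)%E.
  transitivity (\int[Leb d]_x (\1_(lin M @^-1` N) x)%:E)%E; last by [].
  by rewrite integral_indic// setIT.
rewrite (ge0_integral_lin uM (F := fun x => (\1_N x)%:E)).
- have -> : (\int[Leb d]_x (\1_N x)%:E = 0)%E by apply: etrans N0; rewrite integral_indic// setIT.
  by rewrite mule0.
- exact/measurable_EFinP.
- by move=> x; rewrite lee_fin.
Qed.

End linear_change.

Section reflection.
Context {R : realType} (d : nat) (H : 'M[R]_d).
Local Notation Leb := (@Leb R).
Hypotheses (HT : H^T = H) (HH : H *m H = 1%:M).

Lemma lin_invol : involutive (lin H).
Proof. by move=> x; apply: rv_inj; rewrite !rv_lin -mulmxA HH mulmx1. Qed.

Lemma dot_linl x y : dot (lin H x) y = dot x (lin H y).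
Proof. by rewrite !dotE !rv_lin trmx_mul HT mulmxA. Qed.

Lemma dot_lin x y : dot (lin H x) (lin H y) = dot x y.
Proof. by rewrite dot_linl lin_invol. Qed.

Lemma sqnorm_lin x : sqnorm (lin H x) = sqnorm x.
Proof. by rewrite !sqnormE dot_lin. Qed.

Lemma unit_refl : H \in unitmx. Proof. by have [] := mulmx1_unit HH. Qed.

Lemma ge0_integral_refl (F : d.-tuple R -> \bar R) : measurable_fun setT F ->
  (forall x, 0 <= F x)%E -> (\int[Leb d]_x F (lin H x) = \int[Leb d]_x F x)%E.
Proof.
move=> mF F0; rewrite (ge0_integral_lin unit_refl mF F0).
rewrite (_ : (\int[Leb d]_x (gam (lin H x))%:E)%E = 1%E) ?mul1e//.
by rewrite -(@integral_gam R d); apply: eq_integral => x _; rewrite /gam sqnorm_lin.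
Qed.

Lemma integral_refl (F : d.-tuple R -> \bar R) : measurable_fun setT F ->
  (\int[Leb d]_x F (lin H x) = \int[Leb d]_x F x)%E.
Proof.
move=> mF; rewrite [LHS]integralE [RHS]integralE.
congr (_ - _)%E.
  rewrite -(ge0_integral_refl (F := F^\+%E))//; last exact: measurable_funepos.
  by apply: eq_integral => x _; rewrite !funeposE.
rewrite -(ge0_integral_refl (F := F^\-%E))//; last exact: measurable_funeneg.
by apply: eq_integral => x _; rewrite !funenegE.
Qed.

Lemma integrable_refl (F : d.-tuple R -> \bar R) : (Leb d).-integrable setT F ->
  (Leb d).-integrable setT (fun x => F (lin H x)).
Proof.
move=> /integrableP[mF iF]; apply/integrableP; split.
  exact: measurableT_comp mF (measurable_lin H).
rewrite (ge0_integral_refl (F := fun x => `|F x|%E))//.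
exact: measurableT_comp.
Qed.

Lemma density_refl (f : d.-tuple R -> R) : density f -> density (f \o lin H).
Proof.
move=> [mf f0 f1]; split.
- exact: measurableT_comp mf (measurable_lin H).
- by move=> x; exact: f0.
- by rewrite (ge0_integral_refl (F := fun x => (f x)%:E))//; exact/measurable_EFinP.
Qed.

Lemma dot_comb_int (f : d.-tuple R -> R) (v : d.-tuple R) (s : d.-tuple R -> R) :
  (forall k : 'I_d, (Leb d).-integrable setT (fun x => (tnth x k * f x)%:E)) ->
  measurable_fun setT f -> measurable_fun setT s -> (forall x, `|s x| <= 1) ->
  (Leb d).-integrable setT (fun x => (s x * (dot x v * f x))%:E).
Proof.
move=> ik mf ms s1.
have E : (fun x => (s x * (dot x v * f x))%:E) =
  (fun x => \sum_(k < d) ((tnth v k)%:E * (s x * (tnth x k * f x))%:E))%E.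
  apply/funext => x; rewrite sumEFin; congr EFin.
  rewrite /dot mulr_suml mulr_sumr; apply: eq_bigr => k _; ring.
rewrite E; apply: integrable_sum => // k _; apply: integrableZl => //.
apply: le_integrable (ik k) => //.
- apply/measurable_EFinP; apply: measurable_funM => //; apply: measurable_funM => //.
  exact: measurable_tnth.
- by move=> x _; rewrite /= lee_fin normrM -[leRHS]mul1r ler_wpM2r.
Qed.

Lemma centered_refl (f : d.-tuple R -> R) : density f -> centered_density f ->
  centered_density (f \o lin H).
Proof.
move=> [mf f0 f1] cf k.
pose F (x : d.-tuple R) : \bar R := (\sum_(j < d) (H j k)%:E * (tnth x j * f x)%:E)%E.
have iF : (Leb d).-integrable setT F.
  by apply: integrable_sum => // j _; apply: integrableZl => //; exact: (cf j).1.
have E x : (tnth x k * (f \o lin H) x)%:E = F (lin H x).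
  rewrite /F /=; under eq_bigr do rewrite -EFinM mulrA; rewrite sumEFin -mulr_suml; congr (_ * _)%:E.
  rewrite -[in LHS](lin_invol x) [LHS]tnth_aff tnth_mktuple addr0.
  by apply: eq_bigr => j _; rewrite mulrC.
split; first by under eq_fun do rewrite E; exact: integrable_refl.
under eq_integral do rewrite E.
rewrite integral_refl; last by case/integrableP: iF.
rewrite integral_sum//; last by move=> j; apply: integrableZl => //; exact: (cf j).1.
by rewrite big1// => j _; rewrite integralZl//; [rewrite (cf j).2 mule0|exact: (cf j).1].
Qed.

(** Conjugation by [H], which preserves Lebesgue measure, inner products and [gam]. The matrix of
    the equality clause becomes [H *m M *m H], with the same determinant. *)
Lemma transport_pair_refl w (f g : d.-tuple R -> R) T Z DB DZ :
  density f -> density g ->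
  transport_pair w (f \o lin H) (g \o lin H) T Z DB DZ ->
  transport_pair w f g (lin H \o T \o lin H) (Z \o lin H) (DB \o lin H) (DZ \o lin H).
Proof.
move=> [mf f0 _] [mg g0 _] TP; have mH := measurable_lin H.
have aeH := @ae_lin R d H _ unit_refl.
have K := lin_invol.
split.
- by apply: measurableT_comp => //; exact: measurableT_comp (tp_mT TP).
- exact: measurableT_comp (tp_mZ TP) mH.
- exact: measurableT_comp (tp_mDB TP) mH.
- exact: measurableT_comp (tp_mDZ TP) mH.
- by move=> x; exact: tp_DB_ge0 TP _.
- by move=> x; exact: tp_DZ_ge0 TP _.
- move=> phi mphi phi0.
  have mphiH : measurable_fun setT (phi \o lin H) by exact: measurableT_comp.
  rewrite -[RHS]ge0_integral_refl; last 2 first.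
  + by apply: emeasurable_funM => //; exact/measurable_EFinP.
  + by move=> x; rewrite mule_ge0// lee_fin.
  rewrite -[RHS](tp_push TP mphiH (fun x => phi0 _)) -[RHS]ge0_integral_refl.
  + by apply: eq_integral => x _; rewrite /= K.
  + apply: emeasurable_funM; first by apply/measurable_EFinP; exact: measurableT_comp.
    exact: measurableT_comp mphiH (tp_mT TP).
  + by move=> x; rewrite mule_ge0 ?lee_fin/=.
- by apply: filterS (aeH _ (tp_gpos TP)) => x /=; rewrite K.
- by apply: filterS (aeH _ (tp_DB_powR TP)) => x /=; rewrite K.
- by apply: filterS (aeH _ (tp_DB_lb TP)) => x /=; rewrite K.
- by apply: filterS (aeH _ (tp_DZ_sqrt TP)) => x /=; rewrite K.
- move=> phi mphi phi0.
  have mphiH : measurable_fun setT (phi \o lin H) by exact: measurableT_comp.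
  rewrite -[leRHS]ge0_integral_refl//; apply: le_trans (tp_DB_le TP mphiH (fun x => phi0 _)).
  rewrite le_eqVlt; apply/orP; left; apply/eqP; rewrite -[RHS]ge0_integral_refl.
  + apply: eq_integral => x _ /=; congr (_ * phi _)%E; apply: rv_inj.
    by rewrite rv_lin !rv_comb !rv_lin mulmxDl -!scalemxAl -mulmxA HH mulmx1.
  + apply: emeasurable_funM; first by apply/measurable_EFinP; exact: tp_mDB TP.
    by apply: measurableT_comp mphiH _; apply: measurable_comb => //; exact: tp_mT TP.
  + by move=> x; rewrite mule_ge0 ?lee_fin ?(tp_DB_ge0 TP)/=.
- apply: le_trans (tp_DZ_le TP); rewrite le_eqVlt; apply/orP; left; apply/eqP.
  rewrite -[RHS]ge0_integral_refl//.
  + apply/measurable_EFinP; apply: measurable_funM; first exact: tp_mDZ TP.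
    by apply: measurable_gam; exact: tp_mZ TP.
  + by move=> x; rewrite lee_fin mulr_ge0 ?(tp_DZ_ge0 TP)// ltW// gam_gt0.
- have := integrable_refl (tp_dot_integrable TP).
  by under eq_fun do rewrite /= dot_linl K.
- rewrite -[RHS](tp_dot0 TP) -[RHS]integral_refl; last by case/integrableP: (tp_dot_integrable TP).
  by apply: eq_integral => x _; rewrite /= K -dot_linl.
- apply: filterS (aeH _ (tp_rigid TP)) => x /=; rewrite K => h fx e1 e2.
  by have := h fx e1 e2; rewrite sqnorm_lin.
move=> h1 h2 h3.
have [|||M [b [pM hM]]] := tp_linear TP.
- by apply: filterS (aeH _ h1) => x /=; rewrite !K.
- by apply: filterS (aeH _ h2) => x /=; rewrite !K.
- apply: filterS (aeH _ h3) => x hx; apply: filterS (aeH _ hx) => y /= h fx fy.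
  have := h fx fy; rewrite !K.
  have E u v : tsub (lin H u) (lin H v) = lin H (tsub u v).
    by apply: rv_inj; rewrite rv_tsub !rv_lin rv_tsub mulmxBl.
  by rewrite !E dot_lin.
have HMH x : qform (H *m M *m H) x = qform M (lin H x).
  by rewrite /qform rv_lin trmx_mul HT !mulmxA.
exists (H *m M *m H), (lin H b); split.
  case: pM => MT Mp; split; first by rewrite !trmx_mul HT MT mulmxA.
  move=> v v0; have := Mp (v *m H).
  rewrite trmx_mul HT !mulmxA; apply; apply: contra_neq v0 => e.
  by rewrite -[v]mulmx1 -HH mulmxA e mul0mx.
have dH : \det H * \det H = 1 by rewrite -det_mulmx HH det1.
apply: filterS (aeH _ hM) => x /=; rewrite !K => -[fx TE zE jE]; split => //.
- by rewrite !rv_lin TE mulmxDl rv_lin !mulmxA.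
- by rewrite zE HMH.
- by rewrite jE !det_mulmx mulrAC dH mul1r.
Qed.

End reflection.

(** * A direction that maximizes the positive mean *)

Section direction.
Context {R : realType} (n : nat).
Local Notation Leb := (@Leb R).
Local Notation X := (n.-tuple R).
Variable f : X -> R.
Hypotheses (mf : measurable_fun setT f) (f0 : forall x, 0 <= f x).
Hypothesis ik : forall k : 'I_n, (Leb n).-integrable setT (fun x => (tnth x k * f x)%:E).

Definition onpos (e x : X) : R := (0 < dot x e)%R%:R.

Let measurable_onpos e : measurable_fun setT (onpos e).
Proof. by apply: measurable_natr_bool; apply: measurable_fun_ltr => //; exact: measurable_dot. Qed.

Lemma onpos_integrable e v : (Leb n).-integrable setT
  (EFin \o (fun x => onpos e x * (dot x v * f x))).
Proof.
apply: dot_comb_int => // x; rewrite /onpos; case: (0 < dot x e).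
  by rewrite normr1.
by rewrite normr0.
Qed.

(** The mean of the positive part of <X,v>; for centered [f] it is half of E|<X,v>|. *)
Definition posmean (v : X) : R := \int[Leb n]_x (onpos v x * (dot x v * f x)).

Lemma posmean_ge0 v : 0 <= posmean v.
Proof.
apply: Rintegral_ge0 => x _; rewrite /onpos; case: ltP => h; last by rewrite mul0r.
by rewrite mul1r mulr_ge0// ltW.
Qed.

Definition tscale (c : R) (v : X) : X := [tuple c * tnth v k | k < n].

Lemma dot_tscale c x v : dot x (tscale c v) = c * dot x v.
Proof. by rewrite /dot mulr_sumr; apply: eq_bigr => k _; rewrite tnth_mktuple; ring. Qed.

Lemma dot_tadd (x u v : X) : dot x (tadd u v) = dot x u + dot x v.
Proof. by rewrite /dot -big_split; apply: eq_bigr => k _; rewrite tnth_mktuple mulrDr. Qed.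

Lemma dotC (x y : X) : dot x y = dot y x.
Proof. by apply: eq_bigr => k _; rewrite mulrC. Qed.

Lemma posmean_scale c v : 0 < c -> posmean (tscale c v) = c * posmean v.
Proof.
move=> c0; rewrite /posmean -RintegralZl//; last exact: onpos_integrable.
apply: eq_Rintegral => x _; rewrite /onpos dot_tscale pmulr_rgt0//; ring.
Qed.

(** Among all half-spaces, integrating <x,v> over its own positive side gives the largest value.
    With [e] fixed the left side is linear in [v], a supporting functional of [posmean]. *)
Lemma posmean_le e v : \int[Leb n]_x (onpos e x * (dot x v * f x)) <= posmean v.
Proof.
apply: le_Rintegral => //; try exact: onpos_integrable.
move=> x _; rewrite /onpos !mulrA ler_wpM2r//.
case: (ltP 0 (dot x e)); case: (ltP 0 (dot x v)); rewrite ?mul1r ?mul0r//.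
by move=> h _; exact: ltW.
Qed.

Let i1 k : (Leb n).-integrable setT (EFin \o (fun x => `|tnth x k * f x|)).
Proof. exact: integrable_abse (ik k). Qed.

Lemma posmean_lip u v : posmean u <= posmean v +
  \sum_(k < n) `|tnth u k - tnth v k| * \int[Leb n]_x `|tnth x k * f x|.
Proof.
have iE : (Leb n).-integrable setT (EFin \o (fun x => \sum_(k < n) `|tnth u k - tnth v k| * `|tnth x k * f x|)).
  rewrite (_ : EFin \o _ = (fun x => \sum_(k < n) (`|tnth u k - tnth v k|%:E * (`|tnth x k * f x|)%:E))%E).
    by apply: integrable_sum => // k _; apply: integrableZl => //; exact: i1.
  by apply/funext => x; rewrite /= -sumEFin.
have -> : \sum_(k < n) `|tnth u k - tnth v k| * \int[Leb n]_x `|tnth x k * f x| =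
    \int[Leb n]_x \sum_(k < n) `|tnth u k - tnth v k| * `|tnth x k * f x|.
  rewrite /Rintegral; under [in RHS]eq_integral do rewrite -sumEFin.
  under [in RHS]eq_integral do under eq_bigr do rewrite EFinM.
  rewrite integral_sum//; last by move=> k; apply: integrableZl => //; exact: i1.
  rewrite -[LHS]/(fine (_%:E)) -sumEFin; congr fine; apply: eq_bigr => k _.
  rewrite integralZl//; last exact: i1.
  by rewrite EFinM fineK//; exact: (integrable_fin_num measurableT (i1 k)).
rewrite -RintegralD//; last exact: onpos_integrable.
apply: le_Rintegral => //; first exact: onpos_integrable.
  have := integrableD measurableT (onpos_integrable v v) iE.
  by congr (_.-integrable _ _); apply/funext => x.
move=> x _; have -> : \sum_(k < n) `|tnth u k - tnth v k| * `|tnth x k * f x| =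
    (\sum_(k < n) `|(tnth u k - tnth v k) * tnth x k|) * f x.
  by rewrite mulr_suml; apply: eq_bigr => k _; rewrite !normrM (ger0_norm (f0 x)) mulrA.
rewrite !mulrA -mulrDl ler_wpM2r//.
have : `|dot x u - dot x v| <= \sum_(k < n) `|(tnth u k - tnth v k) * tnth x k|.
  rewrite /dot -sumrB; apply: le_trans (ler_norm_sum _ _ _) _.
  by apply: ler_sum => k _; rewrite mulrBl ![_ * tnth x k]mulrC.
set S := \sum_(k < n) _; rewrite ler_norml => /andP[S1 S2].
rewrite /onpos; case: (ltP 0 (dot x u)); case: (ltP 0 (dot x v)); rewrite ?mul1r ?mul0r; lra.
Qed.

Definition tov (v : 'rV[R]_n) : X := [tuple v ord0 k | k < n].

Lemma rv_tov v : rv (tov v) = v.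
Proof. by apply/rowP => k; rewrite mxE tnth_mktuple. Qed.

Lemma posmean_continuous : continuous (posmean \o tov).
Proof.
move=> v; pose L (u : 'rV[R]_n) := \sum_(k < n) `|v ord0 k - u ord0 k| * \int[Leb n]_x `|tnth x k * f x|.
have cL : L u @[u --> v] --> \sum_(k < n) `|v ord0 k - v ord0 k| * \int[Leb n]_x `|tnth x k * f x|.
  apply: (cvg_sum_ord (FF := nbhs_filter v)) => k; apply: cvgM; last exact: cvg_cst.
  apply: cvg_norm; apply: cvgB; first exact: cvg_cst.
  exact: coord_continuous.
have L0 : \sum_(k < n) `|v ord0 k - v ord0 k| * \int[Leb n]_x `|tnth x k * f x| = 0.
  by apply: big1 => k _; rewrite subrr normr0 mul0r.
rewrite L0 in cL; apply/(cvgrPdist_lt (FF := nbhs_filter v)) => e e0.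
move/(cvgrPdist_lt (FF := nbhs_filter v)) : cL => /(_ e e0); apply: filterS => u.
rewrite sub0r normrN => h.
have Lu : posmean (tov v) <= posmean (tov u) + L u.
  by have := posmean_lip (tov v) (tov u); under eq_bigr do rewrite !tnth_mktuple.
have Lv : posmean (tov u) <= posmean (tov v) + L u.
  have := posmean_lip (tov u) (tov v); under eq_bigr do rewrite !tnth_mktuple.
  by under eq_bigr do rewrite distrC.
have := ler_norm (L u) => h2.
rewrite /= ltr_norml; apply/andP; split; lra.
Qed.

Lemma max_direction : (0 < n)%N -> exists e : X, sqnorm e = 1 /\
  forall v : X, sqnorm v = 1 -> posmean v <= posmean e.
Proof.
move=> n0.
pose q (v : 'rV[R]_n) := \sum_(k < n) v ord0 k ^+ 2.
have qE x : q (rv x) = sqnorm x by apply: eq_bigr => k _; rewrite mxE.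
have cq : continuous q.
  move=> v; apply: (cvg_sum_ord (FF := nbhs_filter v)) => k.
  by rewrite expr2; under eq_fun do rewrite expr2; apply: cvgM; exact: coord_continuous.
pose S := [set v : 'rV[R]_n | q v = 1].
have cS : closed S.
  have cl : closed [set x : R | x = 1] by exact: closed_eq.
  exact: ((continuous_closedP q).1 cq _ cl).
have cpt : compact S.
  have cb : compact [set v : 'rV[R]_n | forall i, `[-1, 1]%classic (v ord0 i)].
    by apply: (@rV_compact R n (fun=> `[(-1 : R), 1]%classic)) => i; exact: segment_compact.
  apply: (subclosed_compact cS cb).
  move=> v /= qv i; rewrite in_itv/=.
  have : v ord0 i ^+ 2 <= 1.
    rewrite -qv /q (bigD1 i)//= lerDl; apply: sumr_ge0 => k _; exact: sqr_ge0.
  by move=> h; rewrite -ler_norml -(@expr_le1 _ 2) ?normr_ge0// real_normK ?num_real.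
have [||e eS he] := EVT_max_rV (f := posmean \o tov) _ cpt.
- exists (delta_mx ord0 (Ordinal n0)); rewrite /S /= /q (bigD1 (Ordinal n0))//= mxE !eqxx expr1n.
  by rewrite big1 ?addr0// => k kn; rewrite mxE (negbTE kn) andbF expr0n.
- exact/continuous_subspaceT/posmean_continuous.
exists (tov e); split.
  by rewrite -qE rv_tov; move: eS; rewrite inE.
move=> v v1; have := he (rv v); rewrite /= inE /S /= qE => /(_ v1).
suff -> : tov (rv v) = v by [].
by apply: rv_inj; rewrite rv_tov.
Qed.

(* First-order optimality: the mean over the half-space cut out by a maximizing
   direction is parallel to that direction. *)
Lemma halfspace_mean e : sqnorm e = 1 ->
  (forall v : X, sqnorm v = 1 -> posmean v <= posmean e) ->
  forall v, dot v e = 0 -> \int[Leb n]_x (onpos e x * (dot x v * f x)) = 0.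
Proof.
move=> e1 he.
pose m v := \int[Leb n]_x (onpos e x * (dot x v * f x)).
have m_le0 v : dot v e = 0 -> m v <= 0.
  move=> ve; rewrite leNgt; apply/negP => mv.
  (* Moving from [e] to [e + t v] raises [posmean] by at least [t * m v], while the norm, and with
     it the largest admissible value, grows only to second order in [t]. *)
  have K : forall t, 0 < t -> m v <= t * (sqnorm v * posmean e).
    move=> t t0; set y := tadd e (tscale t v).
    have y2 : sqnorm y = 1 + t ^+ 2 * sqnorm v.
      rewrite !sqnormE /y dot_tadd dot_tscale ![dot (tadd _ _) _]dotC !dot_tadd !dot_tscale.
      by rewrite -!sqnormE e1 [dot e v]dotC ve; ring.
    have s0 : 0 <= t ^+ 2 * sqnorm v by rewrite mulr_ge0 ?sqr_ge0 ?sqnorm_ge0.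
    pose N := Num.sqrt (sqnorm y).
    have N2 : N ^+ 2 = sqnorm y by rewrite sqr_sqrtr// sqnorm_ge0.
    have N0 : 0 < N by rewrite sqrtr_gt0 y2 ltr_pwDl.
    have N1 : N <= N ^+ 2.
      rewrite expr2 ler_peMl ?(ltW N0)// -(ler_sqr (x := 1)) ?nnegrE ?ler01 ?(ltW N0)//.
      by rewrite N2 expr1n y2 lerDl.
    have E : y = tscale N (tscale N^-1 y).
      apply: eq_from_tnth => k; rewrite !tnth_mktuple mulrA divff ?mul1r// gt_eqF//.
    have u1 : sqnorm (tscale N^-1 y) = 1.
      rewrite sqnormE dot_tscale dotC dot_tscale -sqnormE -N2 mulrA -invfM -expr2 mulVf//.
      by rewrite gt_eqF// exprn_gt0.
    have A1 : posmean y <= N ^+ 2 * posmean e.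
      rewrite E posmean_scale//; apply: (@le_trans _ _ (N * posmean e)).
        by rewrite ler_pM2l//; exact: he.
      by rewrite ler_wpM2r// posmean_ge0.
    have A2 : posmean e + t * m v <= posmean y.
      apply: le_trans (posmean_le e y).
      rewrite /m -RintegralZl//; last exact: onpos_integrable.
      rewrite -RintegralD//; last 2 first.
      - exact: onpos_integrable.
      - have := integrableZl measurableT t (onpos_integrable e v).
        by congr (_.-integrable _ _); apply/funext.
      rewrite le_eqVlt; apply/orP; left; apply/eqP; apply: eq_Rintegral => x _.
      by rewrite dot_tadd dot_tscale; ring.
    have : t * m v <= t * (t * (sqnorm v * posmean e)).
      have -> : t * (t * (sqnorm v * posmean e)) = (N ^+ 2 - 1) * posmean e by rewrite N2 y2; ring.
      by rewrite mulrBl mul1r; lra.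
    by rewrite ler_pM2l.
  by have := small_le0 (ltW mv) K => m0; move: mv; rewrite m0 ltxx.
move=> v ve; apply/eqP; rewrite eq_le m_le0//=.
have := m_le0 (tscale (-1) v); rewrite dotC dot_tscale dotC ve mulr0 => /(_ erefl).
rewrite (_ : m (tscale (-1) v) = - m v) ?oppr_le0//.
rewrite -[RHS]mulN1r; have h := RintegralZl (-1) measurableT (onpos_integrable e v); rewrite -[RHS]h.
by apply: eq_Rintegral => x _; rewrite dot_tscale; ring.
Qed.

End direction.

(** Reflection in the hyperplane orthogonal to [e - e1]. When the vectors coincide, [2 / s] is 0 by
    convention and the matrix is the identity. *)
Lemma householder (R : realType) n (e1 e : n.-tuple R) : sqnorm e1 = 1 -> sqnorm e = 1 ->
  exists H : 'M[R]_n, [/\ H^T = H, H *m H = 1%:M & lin H e1 = e].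
Proof.
move=> h1 he; pose u := rv e - rv e1; pose s := sqnorm (tsub e e1).
have uu : u *m u^T = s%:M.
  by rewrite [LHS]mx11_scalar; congr (_%:M); rewrite /s sqnormE dotE rv_tsub.
pose B := (2 / s) *: (u^T *m u).
have s_eq : s = 2 - 2 * dot e e1.
  rewrite /s sqnormE dotE rv_tsub linearB/= mulmxBl !mulmxBr !mxE.
  have E x y : \sum_j rv x ord0 j * (rv y)^T j ord0 = dot x y by rewrite dotE mxE.
  by rewrite !E -!sqnormE h1 he [dot e1 e]dotC; ring.
have u0 : s = 0 -> u = 0.
  move=> /sqnorm_eq0 h; apply/rowP => k; have := h k.
  by rewrite !mxE tnth_mktuple => ->.
have BB : B *m B = 2 *: B.
  rewrite /B -scalemxAl -scalemxAr -mulmxA (mulmxA u) uu mul_scalar_mx -scalemxAr !scalerA.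
  have [->|sn] := eqVneq s 0; first by rewrite invr0 !mulr0 ?mul0r.
  by congr (_ *: _); field.
exists (1%:M - B); split.
- by rewrite linearB/= trmx1 linearZ/= trmx_mul trmxK.
- rewrite mulmxBl mul1mx mulmxBr mulmx1 BB scaler_nat mulr2n opprB addrK.
  by rewrite subrK.
apply: rv_inj; rewrite rv_lin mulmxBr mulmx1 /B -scalemxAr mulmxA.
have -> : rv e1 *m u^T = (- (s / 2))%:M.
  rewrite [LHS]mx11_scalar; congr (_%:M).
  rewrite /u linearB/= mulmxBr !mxE.
  have E x y : \sum_j rv x ord0 j * (rv y)^T j ord0 = dot x y by rewrite dotE mxE.
  by rewrite !E -sqnormE h1 [dot e1 e]dotC s_eq; field.
rewrite mul_scalar_mx scalerA; have [s0|sn] := eqVneq s 0.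
  by rewrite (u0 s0) scaler0 subr0; have := u0 s0; rewrite /u => /eqP; rewrite subr_eq0 => /eqP.
have -> : 2 / s * - (s / 2) = -1 by field.
by rewrite scaleN1r opprK /u addrC subrK.
Qed.

(** A reflection brings the maximizing direction to the first axis; [halfspace_mean] then becomes
    the centering of tails that [aligned_pair] requires. *)
Lemma pair_lemma (R : realType) d (w : R) : 0 < w < 1 -> @pair_exists R d w.
Proof.
move=> w01; elim: d => [|d IH] f g df dg cf.
  by exists id, id, (cst 1), (cst 1); exact: transport_pair0.
have [mf f0 f1] := df.
have ik k : (@Leb R d.+1).-integrable setT (fun x => (tnth x k * f x)%:E) by exact: (cf k).1.
have [e [e1 he]] := max_direction mf f0 ik isT.
pose b k : d.+1.-tuple R := tov (delta_mx ord0 k).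
have bE k x : dot x (b k) = tnth x k.
  rewrite /dot (bigD1 k)//= big1 ?addr0 => [|j jk]; rewrite tnth_mktuple mxE !eqxx/= ?mulr1//.
  by rewrite (negbTE jk) mulr0.
have bn : sqnorm (b ord0) = 1 by rewrite sqnormE bE tnth_mktuple mxE !eqxx.
have [H [HT HH He]] := householder bn e1.
have HK := lin_invol HH.
have [|T [Z [DB [DZ TP]]]] := aligned_pair w01 IH (density_refl HT HH df) (density_refl HT HH dg)
   (centered_refl HT HH df cf).
  move=> k; pose v := lin H (b (lift ord0 k)).
  have ve : dot v e = 0.
    by rewrite -He dot_lin// bE tnth_mktuple mxE andbC.
  have m0 := halfspace_mean mf f0 ik e1 he ve.
  have iv := onpos_integrable mf ik e v.
  transitivity (\int[@Leb R d.+1]_x (onpos e x * (dot x v * f x))%:E)%E; last first.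
    rewrite -[LHS]fineK; first by congr EFin.
    exact: (integrable_fin_num measurableT iv).
  rewrite -[RHS](integral_refl HT HH); last by case/integrableP: iv.
  apply: eq_integral => x _; congr EFin.
  by rewrite /onpos /pos /v dot_lin// dot_linl// -He HK !bE tnth_tl.
exists (lin H \o T \o lin H), (Z \o lin H), (DB \o lin H), (DZ \o lin H).
exact: (transport_pair_refl HT HH df dg TP).
Qed.

Section probability_of_measure.
Context dT (T : measurableType dT) (R : realType).
Variables (m : {measure set T -> \bar R}) (m1 : m setT = 1%E).

Definition mprob (_ : m setT = 1%E) : set T -> \bar R := m.

HB.instance Definition _ := isMeasure.Build _ _ _ (mprob m1) (measure0 m) (measure_ge0 m)
  (@measure_semi_sigma_additive _ _ _ m).
HB.instance Definition _ := Measure_isProbability.Build _ _ _ (mprob m1) m1.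

Lemma measure_probability : exists P : probability T R, forall A, P A = m A.
Proof. by exists (mprob m1). Qed.

End probability_of_measure.

Section signed_sub.
Context dT (T : measurableType dT) (R : realType) (m : {measure set T -> \bar R}).
Local Open Scope ereal_scope.

(** The integral of [P] may be infinite. Writing the difference [f] through [f^+ + N = P + f^-]
    keeps every integrand nonnegative, and [f^- <= N] makes the integral of [f^-] finite. *)
Lemma integral_sub_fin (P : T -> \bar R) (N : T -> R) :
  measurable_fun setT P -> measurable_fun setT N ->
  (forall x, 0 <= P x) -> (forall x, (0 <= N x)%R) -> \int[m]_x (N x)%:E < +oo ->
  \int[m]_x (P x - (N x)%:E) = \int[m]_x P x - \int[m]_x (N x)%:E.
Proof.
move=> mP mN P0 N0 Nfin; pose f x := P x - (N x)%:E.
have mNE : measurable_fun setT (EFin \o N) by exact/measurable_EFinP.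
have mf : measurable_fun setT f by exact: emeasurable_funB.
have mfp := measurable_funepos mf; have mfn := measurable_funeneg mf.
have N0E x : 0 <= (N x)%:E by rewrite lee_fin.
have E x : f^\+ x + (N x)%:E = P x + f^\- x.
  rewrite funeposE funenegE /f; have := P0 x; have := N0 x; case: (P x) => [p||]//= n0 p0.
    rewrite -EFinD -!EFin_max -!EFinD; congr EFin; rewrite lee_fin in p0.
    by rewrite !maxEle; do 2!case: ifPn; rewrite -?ltNge => *; lra.
  have -> : +oo + (- N x)%:E = +oo :> \bar R by [].
  by rewrite maxye /= maxNye.
have fnN : \int[m]_x f^\- x <= \int[m]_x (N x)%:E.
  apply: ge0_le_integral => // x _; rewrite funenegE ge_max N0E andbT.
  by rewrite leeNl /f leeDr.
have fn_fin : \int[m]_x f^\- x \is a fin_num.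
  rewrite ge0_fin_numE; first exact: le_lt_trans Nfin.
  exact: integral_ge0.
have N_fin : \int[m]_x (N x)%:E \is a fin_num.
  by rewrite ge0_fin_numE//; exact: integral_ge0.
have h : \int[m]_x f^\+ x + \int[m]_x (N x)%:E = \int[m]_x P x + \int[m]_x f^\- x.
  by rewrite -!ge0_integralD//; apply: eq_integral => x _; rewrite E.
rewrite [LHS]integralE -/f; move: h; move: fn_fin N_fin.
have : 0 <= \int[m]_x f^\+ x by exact: integral_ge0.
have : 0 <= \int[m]_x P x by exact: integral_ge0.
case: (\int[m]_x f^\+ x) => [a||]//; case: (\int[m]_x P x) => [p||]//;
  case: (\int[m]_x f^\- x) => // u; case: (\int[m]_x (N x)%:E) => // v _ _ _ _ //.
by move=> [] h; rewrite -!EFinB; congr EFin; lra.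
Qed.

End signed_sub.

(** * Densities and relative entropy *)

Section push.
Context {R : realType} (d : nat).
Local Notation Leb := (@Leb R).
Local Notation X := (d.-tuple R).

Definition push_to (f : X -> R) (S : X -> X) (k : X -> R) : Prop :=
  forall phi : X -> \bar R, measurable_fun setT phi -> (forall x, 0 <= phi x)%E ->
    (\int[Leb d]_x ((f x)%:E * phi (S x)) = \int[Leb d]_x ((k x)%:E * phi x))%E.

Lemma mul_funeposneg (u v : X -> R) : (forall x, 0 <= v x) ->
  ((fun x => (v x * u x)%:E)^\+%E = (fun x => (v x)%:E * (Num.max (u x) 0)%:E)%E /\
   (fun x => (v x * u x)%:E)^\-%E = (fun x => (v x)%:E * (Num.max (- u x) 0)%:E)%E).
Proof.
move=> v0; split; apply/funext => x; rewrite ?funeposE ?funenegE -EFinM.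
  by rewrite -EFin_max maxr_pMr// mulr0.
by rewrite -EFinN -EFin_max maxr_pMr// mulr0 mulrN.
Qed.

Section signed.
Variables (f : X -> R) (S : X -> X) (k : X -> R) (h : X -> R).
Hypotheses (mf : measurable_fun setT f) (f0 : forall x, 0 <= f x).
Hypotheses (mk : measurable_fun setT k) (k0 : forall x, 0 <= k x).
Hypotheses (mS : measurable_fun setT S) (mh : measurable_fun setT h).
Hypothesis H : push_to f S k.

Let mpos : measurable_fun setT (fun x => (Num.max (h x) 0)%:E : \bar R).
Proof. by apply/measurable_EFinP; exact: measurable_maxr. Qed.
Let mneg : measurable_fun setT (fun x => (Num.max (- h x) 0)%:E : \bar R).
Proof. by apply/measurable_EFinP; apply: measurable_maxr => //; exact: measurable_funN. Qed.

Lemma push_integral :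
  (\int[Leb d]_x (f x * h (S x))%:E = \int[Leb d]_x (k x * h x)%:E)%E.
Proof.
have [p1 n1] := mul_funeposneg (h \o S) f0; have [p2 n2] := mul_funeposneg h k0.
rewrite [LHS]integralE [RHS]integralE p1 n1 p2 n2; congr (_ - _)%E.
  by apply: (H mpos) => x; rewrite lee_fin le_max lexx orbT.
by apply: (H mneg) => x; rewrite lee_fin le_max lexx orbT.
Qed.

Lemma push_integrable : (Leb d).-integrable setT (fun x => (k x * h x)%:E) <->
  (Leb d).-integrable setT (fun x => (f x * h (S x))%:E).
Proof.
have E : (\int[Leb d]_x `|(f x * h (S x))%:E| = \int[Leb d]_x `|(k x * h x)%:E|)%E.
  transitivity (\int[Leb d]_x ((f x)%:E * `|h (S x)|%:E))%E.
    by apply: eq_integral => x _; rewrite /= normrM (ger0_norm (f0 x)).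
  rewrite (H (phi := fun x => `|h x|%:E)).
  - by apply: eq_integral => x _; rewrite /= normrM (ger0_norm (k0 x)).
  - by apply/measurable_EFinP; exact: measurableT_comp.
  - by move=> x; rewrite lee_fin.
have m1 : measurable_fun setT (fun x => (k x * h x)%:E) by apply/measurable_EFinP; exact: measurable_funM.
have m2 : measurable_fun setT (fun x => (f x * h (S x))%:E).
  by apply/measurable_EFinP; apply: measurable_funM => //; exact: measurableT_comp mh mS.
by split => /integrableP[_ i]; apply/integrableP; split => //; rewrite ?E// -E.
Qed.

End signed.

Lemma push_id f : push_to f id f. Proof. by []. Qed.

Lemma push_comp f S g T k : measurable_fun setT T -> push_to f S g -> push_to g T k ->
  push_to f (T \o S) k.
Proof.
move=> mT h1 h2 phi mphi phi0; rewrite -(h2 phi mphi phi0).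
exact: (h1 (phi \o T) (measurableT_comp mphi mT) (fun x => phi0 _)).
Qed.

Lemma push_ae_pos f S k : density f -> density k -> measurable_fun setT S -> push_to f S k ->
  {ae Leb d, forall x, 0 < f x -> 0 < k (S x)}.
Proof.
move=> [mf f0 _] [mk k0 _] mS H.
have mk0 : measurable_fun setT (fun x : X => (~~ (0 < k x)%R)%:R%:E : \bar R).
  by apply/measurable_EFinP/measurable_natr_bool/measurable_neg; exact: measurable_fun_ltr.
have : (\int[Leb d]_x ((f x)%:E * (~~ (0 < k (S x))%R)%:R%:E) = 0)%E.
  rewrite (H _ mk0); last by move=> x; rewrite lee_fin.
  apply: integral0_eq => x _; have := k0 x; rewrite le_eqVlt => /predU1P[<-|->].
    by rewrite mul0e.
  by rewrite mule0.
move=> /(ae_integral0E (Leb d)) h.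
have {}h : {ae Leb d, forall x, ((f x)%:E * (~~ (0 < k (S x))%R)%:R%:E = 0)%E}.
  apply: h.
  - by apply: emeasurable_funM; [exact/measurable_EFinP|exact: measurableT_comp mk0 mS].
  - by move=> x; rewrite mule_ge0// lee_fin.
apply: filterS h => x h fx; apply: contrapT => /negP kx.
by move: h; rewrite kx mule1 => -[] f00; rewrite f00 ltxx in fx.
Qed.

Lemma density_of_ac (nu : probability X R) :
  (forall A, measurable A -> Leb d A = 0%E -> nu A = 0%E) ->
  exists k, density k /\ forall phi : X -> \bar R, measurable_fun setT phi -> (forall x, 0 <= phi x)%E ->
    (\int[nu]_x phi x = \int[Leb d]_x ((k x)%:E * phi x))%E.
Proof.
move=> ac; have dom : nu `<< Leb d.
  by apply/null_content_dominatesP => A mA; exact: ac.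
pose g := Radon_Nikodym_SigmaFinite.f nu (Leb d).
have g0 x : (0 <= g x)%E by exact: Radon_Nikodym_SigmaFinite.f_ge0.
have gf x : g x \is a fin_num by exact: Radon_Nikodym_SigmaFinite.f_fin_num.
have mg : measurable_fun setT g by have /integrableP[] := Radon_Nikodym_SigmaFinite.f_integrable dom.
pose k x := fine (g x).
have kE x : (k x)%:E = g x by rewrite fineK.
have mk : measurable_fun setT k by apply: measurableT_comp mg; exact: fine_measurable.
have k0 x : 0 <= k x by exact: fine_ge0.
have H (phi : X -> \bar R) : measurable_fun setT phi -> (forall x, 0 <= phi x)%E ->
    (\int[nu]_x phi x = \int[Leb d]_x ((k x)%:E * phi x))%E.
  move=> mphi phi0; rewrite -(Radon_Nikodym_SigmaFinite.change_of_variables dom)//.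
  by apply: eq_integral => x _; rewrite kE muleC.
exists k; split => //; split => //.
transitivity (\int[Leb d]_x ((k x)%:E * cst 1%E x))%E.
  by apply: eq_integral => x _; rewrite mule1.
rewrite -H//.
by rewrite integral_cst// mul1e; exact: probability_setT.
Qed.

Lemma push_exists f S : density f -> measurable_fun setT S ->
  (forall A, measurable A -> Leb d A = 0%E -> (\int[Leb d]_x (f x * \1_A (S x))%:E = 0)%E) ->
  exists k, density k /\ push_to f S k.
Proof.
move=> [mf f0 f1] mS ac.
pose nu := wpush_m (Leb d) mf f0 mS.
have [P PE] : exists P : probability X R, forall A, P A = nu A.
  apply: measure_probability; rewrite -f1; apply: eq_integral => x _.
  by rewrite indicT mulr1.
have [k [dk H]] := @density_of_ac P (fun A mA A0 => etrans (PE A) (ac A mA A0)).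
exists k; split => // phi mphi phi0; rewrite -H//.
transitivity (\int[nu]_x phi x)%E.
  by apply/esym; exact: (ge0_integral_wpush (Leb d) mf f0 mS mphi phi0).
by apply: eq_measure_integral => A mA _; exact/esym/PE.
Qed.

End push.

Section entropy.
Context {R : realType} (d : nat).
Local Notation Leb := (@Leb R).
Local Notation X := (d.-tuple R).

Definition klf (f : X -> R) x : R := f x * ln (f x / gam x).
Definition ent f : \bar R := (\int[Leb d]_x (klf f x)%:E)%E.

Lemma ln_le_sub1 (u : R) : 0 < u -> ln u <= u - 1.
Proof.
move=> u0; have -> : ln u = ln (1 + (u - 1)) by congr ln; ring.
by apply: le_ln1Dx; lra.
Qed.

Lemma ln_sub1_eq (u : R) : 0 < u -> ln u = u - 1 -> u = 1.
Proof.
move=> u0 e; have [h|/expR_gt1Dx] := eqVneq (ln u) 0.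
  by apply: ln_inj; rewrite ?posrE ?ln1.
by rewrite lnK ?posrE// e; lra.
Qed.

(** This is [ln u <= u - 1] at [u = gam x / f x]. The integrable lower bound makes the negative part
    of the entropy finite, and its integral 0 makes the entropy nonnegative. *)
Lemma klf_ge (f : X -> R) (x : X) : 0 <= f x -> f x - gam x <= klf f x.
Proof.
have g0 := gam_gt0 x; rewrite /klf le_eqVlt => /predU1P[<-|f0].
  by rewrite mul0r; lra.
have := ln_le_sub1 (divr_gt0 g0 f0); rewrite -[gam x / f x]invf_div lnV ?posrE ?divr_gt0// => h.
have : f x * (- ln (f x / gam x)) <= f x * ((f x / gam x)^-1 - 1) by rewrite ler_pM2l.
rewrite mulrN mulrBr invf_div mulrCA divff ?gt_eqF// !mulr1; lra.
Qed.

Lemma measurable_klf f : measurable_fun setT f -> measurable_fun setT (klf f).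
Proof.
move=> mf; apply: measurable_funM => //; apply: measurableT_comp; first exact: measurable_ln.
apply: measurable_funM => //; apply: measurable_inv_ge0.
  by apply: measurable_gam.
by move=> x; rewrite ltW// gam_gt0.
Qed.

Let mgam : measurable_fun setT (fun x : X => (gam x)%:E : \bar R).
Proof. by apply/measurable_EFinP; apply: measurable_gam. Qed.

Lemma gam_integrable : (Leb d).-integrable setT (fun x : X => (gam x)%:E).
Proof.
apply/integrableP; split => //.
rewrite (_ : (\int[Leb d]_x `|(gam x)%:E|)%E = 1%E) ?ltry// -(@integral_gam R d).
by apply: eq_integral => x _; rewrite gee0_abs// lee_fin ltW// gam_gt0.
Qed.

Lemma density_integrable f : density f -> (Leb d).-integrable setT (fun x : X => (f x)%:E).
Proof.
move=> [mf f0 f1]; apply/integrableP; split; first exact/measurable_EFinP.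
rewrite (_ : (\int[Leb d]_x `|(f x)%:E|)%E = 1%E) ?ltry// -f1.
by apply: eq_integral => x _; rewrite gee0_abs// lee_fin.
Qed.

Lemma klf_neg_le f x : 0 <= f x -> ((fun x => (klf f x)%:E)^\- x <= (gam x)%:E)%E.
Proof.
move=> f0; rewrite funenegE ge_max !lee_fin (ltW (gam_gt0 x)) andbT.
by have := klf_ge f0; lra.
Qed.

Lemma klf_neg_fin f : density f -> (\int[Leb d]_x (fun x => (klf f x)%:E)^\- x)%E \is a fin_num.
Proof.
move=> [mf f0 f1]; have mk : measurable_fun setT (fun x => (klf f x)%:E).
  by apply/measurable_EFinP; exact: measurable_klf.
rewrite ge0_fin_numE; last exact: integral_ge0.
apply: (@le_lt_trans _ _ (\int[Leb d]_x (gam x)%:E)%E); last by rewrite integral_gam ltry.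
apply: ge0_le_integral => //; first exact: measurable_funeneg.
by move=> x _; exact: klf_neg_le.
Qed.

Lemma ent_integrable f : density f -> (ent f < +oo)%E ->
  (Leb d).-integrable setT (fun x => (klf f x)%:E).
Proof.
move=> df; have [mf f0 f1] := df; have mk : measurable_fun setT (fun x => (klf f x)%:E).
  by apply/measurable_EFinP; exact: measurable_klf.
rewrite /ent integralE => h; apply/integrableP; split => //.
rewrite (_ : (\int[Leb d]_x `|(klf f x)%:E|)%E = (\int[Leb d]_x (fun x => (klf f x)%:E)^\+ x +
    \int[Leb d]_x (fun x => (klf f x)%:E)^\- x)%E).
  have := klf_neg_fin df; move: h; case: (\int[_]_x _^\- x)%E => // n.
  case: (\int[_]_x _)%E => // p _ _; exact: ltry.
rewrite -ge0_integralD//; last 2 first.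
- exact: measurable_funepos.
- exact: measurable_funeneg.
by apply: eq_integral => x _; rewrite -[RHS]/((_ \+ _)%E x) -fune_abse.
Qed.

Lemma ent_ge0 f : density f -> (0 <= ent f)%E.
Proof.
move=> df; have [mf f0 f1] := df.
have := ltry 0; case: (ltP (ent f) +oo%E) => [h _|]; last by rewrite leye_eq => /eqP ->.
have i := ent_integrable df h.
have ifg := integrableB measurableT (density_integrable df) gam_integrable.
have e : (\int[Leb d]_x ((f x)%:E - (gam x)%:E) = 0)%E.
  rewrite integralB//; [|exact: density_integrable|exact: gam_integrable].
  by rewrite f1 integral_gam subee.
rewrite -e /ent; apply: le_integral => // x _ /=.
by rewrite -EFinB lee_fin; exact: klf_ge.
Qed.

End entropy.

Section leb_int_signed.
Context {R : realType}.
Local Notation Leb := (@Leb R).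

Lemma integral_lebR (f : R -> \bar R) : measurable_fun setT f ->
  (\int[@lebesgue_measure R]_x f x = \int[lebR]_x f x)%E.
Proof.
move=> mf; rewrite [LHS]integralE [RHS]integralE.
congr (_ - _)%E; apply/esym; apply: ge0_integral_lebR => //.
- exact: measurable_funepos.
- exact: measurable_funeneg.
Qed.

Let mgK d (K : R) : measurable_fun setT (fun x : d.-tuple R => K * gam x).
Proof. by apply: measurable_funM => //; apply: measurable_gam. Qed.

Let intgK d (K : R) : 0 <= K -> (\int[Leb d]_x (K * gam x)%:E = K%:E)%E.
Proof.
move=> K0; under eq_integral do rewrite EFinM.
rewrite ge0_integralZl// ?integral_gam ?mule1//.
- by apply/measurable_EFinP; apply: measurable_gam.
- by move=> x _; rewrite lee_fin ltW// gam_gt0.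
Qed.

(* [leb_int] iterates the signed integral, hence a lower bound is needed to
   identify it with the integral against the product measure. *)
Lemma leb_int_integral d (F : d.-tuple R -> R) (K : R) : measurable_fun setT F -> 0 <= K ->
  (forall x, - (K * gam x) <= F x) ->
  leb_int (EFin \o F) = (\int[Leb d]_x (F x)%:E)%E.
Proof.
elim: d F K => [|d IH] F K mF K0 lb.
  pose P x := F x + K * gam x.
  have P0 x : (0 <= (P x)%:E)%E by rewrite lee_fin /P; have := lb x; lra.
  have N0 (x : 0.-tuple R) : 0 <= K * gam x by rewrite mulr_ge0// ltW// gam_gt0.
  transitivity (\int[Leb 0]_x ((P x)%:E - (K * gam x)%:E))%E; last first.
    by apply: eq_integral => x _; rewrite -EFinB /P addrK.
  rewrite integral_sub_fin//.
  - rewrite !ge0_integral_Leb0//.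
    by rewrite -EFinB /P addrK.
  - by apply/measurable_EFinP; apply: measurable_funD => //; exact: mgK.
  - exact: mgK.
  - by rewrite intgK// ltry.
pose P x := F x + K * gam x.
have mP : measurable_fun setT (fun x => (P x)%:E : \bar R).
  by apply/measurable_EFinP; apply: measurable_funD => //; exact: mgK.
have P0 x : (0 <= (P x)%:E)%E by rewrite lee_fin /P; have := lb x; lra.
have N0 d' K' (x : d'.-tuple R) : 0 <= K' -> 0 <= K' * gam x.
  by move=> K'0; rewrite mulr_ge0// ltW// gam_gt0.
have g0 s : 0 <= K * gam1 s by rewrite mulr_ge0// ltW// gam1_gt0.
have mFs s : measurable_fun setT (fun t : d.-tuple R => F (consp (s, t))).
  apply/measurable_EFinP; apply: (measurable_consp2 (F := EFin \o F) _).1.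
  exact/measurable_EFinP.
have lbs s (t : d.-tuple R) : - (K * gam1 s * gam t) <= F (consp (s, t)).
  by have := lb (consp (s, t)); rewrite gam_consp mulrA.
pose IP s := (\int[Leb d]_t (P (consp (s, t)))%:E)%E.
have mIP : measurable_fun setT IP.
  apply: (measurable_fun_fubini_tonelli_F (m2 := Leb d) (fun z : R * d.-tuple R => (P (consp z))%:E)).
    exact: measurableT_comp mP (@measurable_consp R d).
  by move=> z; exact: P0.
have IP0 s : (0 <= IP s)%E by apply: integral_ge0.
have E s : leb_int (fun t : d.-tuple R => (F (consp (s, t)))%:E) = (IP s - (K * gam1 s)%:E)%E.
  rewrite (IH _ _ (mFs s) (g0 s) (lbs s)).
  rewrite -[X in (_ - X)%E](intgK d (g0 s)) /IP -integral_sub_fin//.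
  - apply: eq_integral => t _; rewrite -EFinB /P gam_consp /=; congr EFin; ring.
  - exact: (measurable_consp2 mP).1.
  - exact: mgK.
  - by move=> t; exact: N0.
  - by rewrite intgK// ltry.
have mg1 : measurable_fun setT (fun s => K * gam1 s).
  by apply: measurable_funM => //; exact: measurable_gam1.
have ig1 : (\int[lebR]_s (K * gam1 s)%:E = K%:E)%E.
  under eq_integral do rewrite EFinM.
  rewrite ge0_integralZl// ?integral_gam1 ?mule1//.
  - by apply/measurable_EFinP; exact: measurable_gam1.
  - by move=> s _; rewrite lee_fin ltW// gam1_gt0.
transitivity (\int[lebR]_s (IP s - (K * gam1 s)%:E))%E.
  rewrite -integral_lebR; last by apply: emeasurable_funB => //; exact/measurable_EFinP.
  by apply: eq_integral => s _; rewrite -E.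
rewrite integral_sub_fin//; last by rewrite ig1 ltry.
rewrite ig1 /IP -(ge0_integral_LebS mP P0).
rewrite -[X in (_ - X)%E](@intgK d.+1 K K0) -integral_sub_fin//.
- by apply: eq_integral => x _; rewrite -EFinB /P addrK.
- exact: mgK.
- by move=> x; exact: N0.
- by rewrite intgK// ltry.
Qed.

Lemma sqrtrXn (a : R) n : 0 <= a -> Num.sqrt (a ^+ n) = Num.sqrt a ^+ n.
Proof.
move=> a0; elim: n => [|n IH]; first by rewrite !expr0 sqrtr1.
by rewrite !exprS sqrtrM// IH.
Qed.

Lemma gauss_densityE d (C : 'M[R]_d) (x : d.-tuple R) : gauss_density C x =
  (Num.sqrt (2 * pi))^-1 ^+ d * (Num.sqrt (\det C))^-1 * expR (- qform (invmx C) x / 2).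
Proof.
rewrite /gauss_density /qform sqrtrM ?sqrtrXn ?invfM ?exprVn//.
- by rewrite mulr_ge0 ?pi_ge0.
- by rewrite exprn_ge0// mulr_ge0 ?pi_ge0.
Qed.

Lemma qform1 d (x : d.-tuple R) : qform 1%:M x = sqnorm x.
Proof. by rewrite /qform mulmx1 -dotE sqnormE. Qed.

Lemma gauss_density1 d (x : d.-tuple R) : gauss_density 1%:M x = gam x.
Proof. by rewrite gauss_densityE det1 sqrtr1 invr1 mulr1 invmx1 qform1. Qed.

Lemma leb_int_klf d (f : d.-tuple R -> R) : measurable_fun setT f -> (forall x, 0 <= f x) ->
  leb_int (fun x => (f x * ln (f x / gauss_density 1%:M x))%:E) = ent f.
Proof.
move=> mf f0.
have -> : (fun x => (f x * ln (f x / gauss_density 1%:M x))%:E) = EFin \o klf f.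
  by apply/funext => x; rewrite /= gauss_density1.
apply: (@leb_int_integral _ _ 1); rewrite ?ler01//; first exact: measurable_klf.
by move=> x; rewrite mul1r; have := klf_ge (f0 x); have := f0 x; lra.
Qed.

End leb_int_signed.

(** * Pointwise inequalities behind the entropy estimates *)

Section ae_ineq.
Context dT (T : measurableType dT) (R : realType) (m : {measure set T -> \bar R}).

Lemma ae_le_Rintegral (A B : T -> R) : m.-integrable setT (EFin \o A) ->
  m.-integrable setT (EFin \o B) -> {ae m, forall x, A x <= B x} ->
  \int[m]_x A x <= \int[m]_x B x /\
  (\int[m]_x B x <= \int[m]_x A x -> {ae m, forall x, A x = B x}).
Proof.
move=> iA iB AB; pose C x := Num.max (B x - A x) 0.
have mA : measurable_fun setT A by case/integrableP: iA => /measurable_EFinP.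
have mB : measurable_fun setT B by case/integrableP: iB => /measurable_EFinP.
have mC : measurable_fun setT (fun x => (C x)%:E : \bar R).
  by apply/measurable_EFinP; apply: measurable_maxr => //; exact: measurable_funB.
have C0 x : (0 <= (C x)%:E)%E by rewrite lee_fin le_max lexx orbT.
have aeC : {ae m, forall x, C x = B x - A x}.
  by apply: filterS AB => x h; rewrite /C max_l// subr_ge0.
have E : (\int[m]_x (C x)%:E = (\int[m]_x B x - \int[m]_x A x)%:E)%E.
  rewrite -RintegralB// fineK; last first.
    apply: integrable_fin_num => //.
    by have := integrableB measurableT iB iA; congr (_.-integrable _ _); apply/funext.
  apply: ae_eq_integral => //.
  - by apply/measurable_EFinP; exact: measurable_funB.
  - by apply: filterS aeC => x -> _.
split; first by rewrite -subr_ge0 -lee_fin -E; exact: integral_ge0.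
move=> h; have C00 : (\int[m]_x (C x)%:E = 0)%E.
  apply/eqP; rewrite eq_le; apply/andP; split; last exact: integral_ge0.
  by rewrite E lee_fin subr_le0.
have := (ae_integral0E m mC C0).2 C00.
apply: filterS2 aeC => x e; rewrite e => -[] /eqP; rewrite subr_eq0 => /eqP.
exact: esym.
Qed.

Lemma integrableZ (c : R) (A : T -> R) : m.-integrable setT (EFin \o A) ->
  m.-integrable setT (EFin \o (fun x => c * A x)).
Proof. by move=> i; have := integrableZl measurableT c i; congr (_.-integrable _ _); apply/funext. Qed.

Lemma integrableDR (A B : T -> R) : m.-integrable setT (EFin \o A) ->
  m.-integrable setT (EFin \o B) -> m.-integrable setT (EFin \o (fun x => A x + B x)).
Proof. by move=> i j; have := integrableD measurableT i j; congr (_.-integrable _ _); apply/funext. Qed.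

Lemma ge0_Rintegral (A : T -> R) : (forall x, 0 <= A x) -> m.-integrable setT (EFin \o A) ->
  (\int[m]_x (A x)%:E = (\int[m]_x A x)%:E)%E.
Proof. by move=> A0 i; rewrite fineK//; exact: integrable_fin_num. Qed.

End ae_ineq.

(** The defect is [z * (jz - sqrt (a / b)) + a * (u - 1 - ln u)]: the Jacobian bound plus Jensen in
    tangent-line form. In the application [a], [b], [z] are [f x], [g (T x)], [gam (Z x)], and [c0]
    is the logarithm of the Gaussian constant. Equality forces [u = 1]. *)
Lemma talagrand_pointwise (R : realType) (a b z x2 t2 xt jz : R) : 0 < a -> 0 < b -> 0 < z -> Num.sqrt (a / b) <= jz ->
  let u := z / Num.sqrt (a * b) in
  let lhs := 4^-1 * (a * (x2 + t2 - 2 * xt)) in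
  let c := ln z in
  forall c0 z2, c = c0 - z2 / 2 ->
  let rhs := (((2^-1 * ((z2 - xt) * a) + 2^-1 * (a * (ln a - (c0 - x2 / 2)))) +
     2^-1 * (a * (ln b - (c0 - t2 / 2)))) + jz * z) + -1 * a in
  lhs <= rhs /\ (lhs = rhs -> a = z * Num.sqrt (a / b) /\ Num.sqrt (a / b) = jz).
Proof.
move=> a0 b0 z0 jle u lhs c c0 z2 cE rhs.
have s0 : 0 < Num.sqrt (a * b) by rewrite sqrtr_gt0 mulr_gt0.
have sab : a * u = z * Num.sqrt (a / b).
  have sa : 0 < Num.sqrt a by rewrite sqrtr_gt0.
  have sb : 0 < Num.sqrt b by rewrite sqrtr_gt0.
  rewrite /u !(sqrtrM _ (ltW a0)) (sqrtrV (ltW b0)) -{1}(sqr_sqrtr (ltW a0)).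
  by field; rewrite !gt_eqF.
have u0 : 0 < u by exact: divr_gt0.
have lnu : ln u = ln z - 2^-1 * (ln a + ln b).
  have ls : ln (Num.sqrt (a * b)) = 2^-1 * (ln a + ln b).
    rewrite -lnM ?posrE// -{2}(sqr_sqrtr (ltW (mulr_gt0 a0 b0))) lnXn//.
    by field.
  by rewrite /u lnM ?posrE ?invr_gt0// lnV ?posrE// ls.
have E : rhs - lhs = z * (jz - Num.sqrt (a / b)) + a * (u - 1 - ln u).
  have cz : c0 = ln z + z2 / 2 by rewrite -/c cE subrK.
  by rewrite /rhs /lhs lnu [z * (_ - _)]mulrBr -sab cz; field.
have e1 : 0 <= z * (jz - Num.sqrt (a / b)) by rewrite mulr_ge0 ?subr_ge0// ltW.
have e2 : 0 <= a * (u - 1 - ln u) by rewrite mulr_ge0 ?subr_ge0 ?ln_le_sub1// ltW.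
have le : lhs <= rhs by rewrite -subr_ge0 E addr_ge0.
split=> // e; move: E; rewrite e subrr => E.
have e3 : a * (u - 1 - ln u) = 0 by lra.
have e4 : z * (jz - Num.sqrt (a / b)) = 0 by lra.
move/eqP: e4; rewrite mulf_eq0 gt_eqF//= subr_eq0 => /eqP ->.
move/eqP: e3; rewrite mulf_eq0 gt_eqF//= subr_eq0 => /eqP e3.
by rewrite -sab (ln_sub1_eq u0 (esym e3)) mulr1.
Qed.

Lemma interp_pointwise (R : realType) (w a b z x2 t2 xt jb c0 : R) : 0 < a -> 0 < b -> 0 < z -> (a / b) `^ w <= jb ->
  let lhs := a * (ln z - (c0 - ((1 - w) * x2 + w * t2 - w * (1 - w) * xt) / 2)) in
  let rhs := ((((1 - w) * (a * (ln a - (c0 - x2 / 2))) + w * (a * (ln b - (c0 - t2 / 2)))) +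
    - (2^-1 * (w * (1 - w))) * (a * xt)) + jb * z) + -1 * a in
  lhs <= rhs /\ (lhs = rhs -> (a / b) `^ w = jb).
Proof.
move=> a0 b0 z0 jle lhs rhs.
pose u := z * ((a / b) `^ w) / a.
have ab0 : 0 < a / b by exact: divr_gt0.
have p0 : 0 < (a / b) `^ w by exact: powR_gt0.
have u0 : 0 < u by rewrite divr_gt0// mulr_gt0.
have au : a * u = z * ((a / b) `^ w) by rewrite /u mulrC divfK// gt_eqF.
have lnu : ln u = ln z + w * (ln a - ln b) - ln a.
  by rewrite /u lnM ?posrE ?invr_gt0 ?mulr_gt0// lnV ?posrE// lnM ?posrE// ln_powR lnM ?posrE ?invr_gt0// lnV ?posrE.
have E : rhs - lhs = z * (jb - (a / b) `^ w) + a * (u - 1 - ln u).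
  by rewrite /rhs /lhs lnu !mulrBr -au; field.
have e1 : 0 <= z * (jb - (a / b) `^ w) by rewrite mulr_ge0 ?subr_ge0// ltW.
have e2 : 0 <= a * (u - 1 - ln u) by rewrite mulr_ge0 ?subr_ge0 ?ln_le_sub1// ltW.
have le : lhs <= rhs by rewrite -subr_ge0 E addr_ge0.
split=> // e; move: E; rewrite e subrr => E; have : z * (jb - (a / b) `^ w) = 0 by lra.
by move/eqP; rewrite mulf_eq0 gt_eqF//= subr_eq0 => /eqP ->.
Qed.

Lemma sub_fin_lt_pinfty (R : realDomainType) (a b : \bar R) : (a < +oo -> b \is a fin_num -> a - b < +oo)%E.
Proof. by case: a => [a||] //; case: b => // b _ _; rewrite ?ltry ?ltNyr. Qed.

(** * The two-marginal entropy inequalities *)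

Section entropy_ineq.
Context {R : realType} (d : nat).
Local Notation Leb := (@Leb R).
Local Notation X := (d.-tuple R).
Local Notation IL h := (\int[Leb d]_x h x).
Local Notation integ h := ((Leb d).-integrable setT (EFin \o h)).

Definition fin2 (f : X -> R) := integ (fun x => f x * sqnorm x).

Definition logr (f : X -> R) y := ln (f y / gam y).

Lemma klfE f x : klf f x = f x * logr f x. Proof. by []. Qed.

Lemma measurable_logr f : measurable_fun setT f -> measurable_fun setT (logr f).
Proof.
move=> mf; apply: measurableT_comp; first exact: measurable_ln.
apply: measurable_funM => //; apply: measurable_inv_ge0.
  by apply: measurable_gam.
by move=> x; rewrite ltW// gam_gt0.
Qed.

Lemma logrE f (y : X) : 0 < f y -> logr f y = ln (f y) - ln (gam y).
Proof. by move=> fy; rewrite /logr lnM ?posrE ?invr_gt0 ?gam_gt0// lnV ?posrE ?gam_gt0. Qed.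

Lemma ln_gam (y : X) : ln (gam y) = ln ((Num.sqrt (2 * pi))^-1 ^+ d) - sqnorm y / 2.
Proof.
rewrite /gam lnM ?posrE ?expR_gt0 ?exprn_gt0 ?invr_gt0 ?sqrt2pi_gt0// expRK.
by congr (_ + _); rewrite mulNr.
Qed.

Lemma sqnorm_tsub (x y : X) : sqnorm (tsub x y) = sqnorm x + sqnorm y - 2 * dot x y.
Proof.
rewrite !sqnormE /dot mulr_sumr -big_split -sumrB/=; apply: eq_bigr => k _.
by rewrite tnth_mktuple; ring.
Qed.

Lemma sqnorm_comb w (x y : X) : sqnorm (comb w x y) =
  (1 - w) * sqnorm x + w * sqnorm y - w * (1 - w) * sqnorm (tsub x y).
Proof.
rewrite sqnorm_tsub !sqnormE /dot !mulr_sumr -!big_split -sumrB mulr_sumr -sumrB/=.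
by apply: eq_bigr => k _; rewrite tnth_mktuple; ring.
Qed.

Section fixed.
Variables (w : R) (f g : X -> R).
Hypothesis w01 : 0 < w < 1.
Hypotheses (df : density f) (dg : density g) (f2 : fin2 f) (g2 : fin2 g).
Hypotheses (ef : (ent f < +oo)%E) (eg : (ent g < +oo)%E).
Variables (T Z : X -> X) (DB DZ : X -> R).
Hypothesis TP : transport_pair w f g T Z DB DZ.

Let mf : measurable_fun setT f. Proof. by have [] := df. Qed.
Let f0 x : 0 <= f x. Proof. by have [] := df. Qed.
Let mg : measurable_fun setT g. Proof. by have [] := dg. Qed.
Let g0 x : 0 <= g x. Proof. by have [] := dg. Qed.
Let mT := tp_mT TP.
Let pushT : push_to f T g. Proof. exact: tp_push TP. Qed.

Let J x := f x / g (T x).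
Let W x := f x * sqnorm (tsub x (T x)).
Let C x := f x * logr g (T x).

Lemma cost_integrable : integ W.
Proof.
have iT : integ (fun x => f x * sqnorm (T x)).
  have m : measurable_fun setT (fun x : X => sqnorm x) by exact: measurable_sqnorm.
  exact: ((push_integrable mf f0 mg g0 mT m pushT).1 g2).
have := integrableDR (integrableZ 2 f2) (integrableZ 2 iT).
apply: le_integrable => //.
  apply/measurable_EFinP; apply: measurable_funM => //; apply: measurable_sqnorm.
  exact: measurable_tsub.
move=> x _; rewrite /= lee_fin /W !ger0_norm ?addr_ge0 ?mulr_ge0 ?sqnorm_ge0//.
rewrite -mulrCA -[2 * _]mulrCA -mulrDr ler_wpM2l//.
(* Nonnegativity of the squared norm of the midpoint is the bound of |x - y|^2 by 2|x|^2 +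
   2|y|^2. *)
have : 0 <= sqnorm (comb (1 / 2) x (T x)) by exact: sqnorm_ge0.
by rewrite sqnorm_comb; lra.
Qed.

Let iC : integ C.
Proof.
exact: ((push_integrable mf f0 mg g0 mT (measurable_logr mg) pushT).1 (ent_integrable dg eg)).
Qed.

Let IC : IL C = IL (klf g).
Proof.
have h := push_integral f0 g0 (measurable_logr mg) pushT.
by rewrite /Rintegral; apply: (congr1 fine); apply: etrans h _.
Qed.

Let iKf : integ (klf f). Proof. exact: ent_integrable df ef. Qed.
Let if' : integ f. Proof. exact: density_integrable df. Qed.
Let I1 : IL f = 1. Proof. by rewrite /Rintegral; have [_ _ ->] := df. Qed.

Let P x := DZ x * gam (Z x).

Let P0 x : 0 <= P x.
Proof. apply: mulr_ge0; [exact: (tp_DZ_ge0 TP x)|exact/ltW/gam_gt0]. Qed.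

Let iP : integ P.
Proof.
apply/integrableP; split.
  apply/measurable_EFinP; apply: measurable_funM; first exact: tp_mDZ TP.
  by apply: measurable_gam; exact: tp_mZ TP.
apply: le_lt_trans (ltry 1); apply: le_trans (tp_DZ_le TP).
rewrite le_eqVlt; apply/orP; left; apply/eqP; apply: eq_integral => x _.
by rewrite /= (ger0_norm (P0 x)).
Qed.

Let IP : IL P <= 1.
Proof. by rewrite -lee_fin -(ge0_Rintegral P0 iP); exact: tp_DZ_le TP. Qed.

Let V x := (sqnorm (Z x) - dot x (T x)) * f x.
Let iV : integ V. Proof. exact: tp_dot_integrable TP. Qed.
Let IV : IL V = 0. Proof. by rewrite /Rintegral (tp_dot0 TP). Qed.

(** The upper bound of [talagrand_pointwise]. On integration [V] gives 0, the entropy terms one half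
    each, and [P] together with [-1 * f x] at most 0. *)
Let rhsa x := (((2^-1 * V x + 2^-1 * klf f x) + 2^-1 * C x) + P x) + -1 * f x.

Let pw_a : {ae Leb d, forall x, 4^-1 * W x <= rhsa x /\
  (4^-1 * W x = rhsa x -> 0 < f x -> f x = gam (Z x) * Num.sqrt (f x / g (T x)) /\
    Num.sqrt (f x / g (T x)) = DZ x)}.
Proof.
apply: filterS2 (tp_gpos TP) (tp_DZ_sqrt TP) => x h1 h2.
have := f0 x; rewrite le_eqVlt => /predU1P[fx|fx].
  split; last by move=> _; rewrite -fx ltxx.
  by rewrite /rhsa /W /V /klf /C -fx !mul0r !mulr0 !add0r addr0.
have gx := h1 fx; have := talagrand_pointwise (sqnorm x) (sqnorm (T x)) (dot x (T x)) fx gx (gam_gt0 (Z x)) (h2 fx) (ln_gam (Z x)).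
have -> : rhsa x = (((2^-1 * ((sqnorm (Z x) - dot x (T x)) * f x) +
    2^-1 * (f x * (ln (f x) - (ln ((Num.sqrt (2 * pi))^-1 ^+ d) - sqnorm x / 2)))) +
    2^-1 * (f x * (ln (g (T x)) - (ln ((Num.sqrt (2 * pi))^-1 ^+ d) - sqnorm (T x) / 2)))) +
    DZ x * gam (Z x)) + -1 * f x.
  by rewrite /rhsa /C klfE (logrE fx) (logrE gx) !ln_gam.
have -> : 4^-1 * W x = 4^-1 * (f x * (sqnorm x + sqnorm (T x) - 2 * dot x (T x))).
  by rewrite /W sqnorm_tsub.
by move=> [H1 H2]; split=> [|e _]; [exact: H1|exact: H2].
Qed.

Let irhsa : integ rhsa.
Proof.
exact: (integrableDR (integrableDR (integrableDR (integrableDR (integrableZ _ iV) (integrableZ _ iKf))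
  (integrableZ _ iC)) iP) (integrableZ _ if')).
Qed.

Let Irhsa : IL rhsa <= 2^-1 * (IL (klf f) + IL (klf g)).
Proof.
have i1 := integrableZ 2^-1 iV; have i2 := integrableZ 2^-1 iKf; have i3 := integrableZ 2^-1 iC.
have i5 := integrableZ (-1) if'; have i12 := integrableDR i1 i2.
have i123 := integrableDR i12 i3; have i1234 := integrableDR i123 iP.
have -> := RintegralD measurableT i1234 i5; have -> := RintegralD measurableT i123 iP.
have -> := RintegralD measurableT i12 i3; have -> := RintegralD measurableT i1 i2.
have -> := RintegralZl 2^-1 measurableT iV; have -> := RintegralZl 2^-1 measurableT iKf.
have -> := RintegralZl 2^-1 measurableT iC; have -> := RintegralZl (-1) measurableT if'.
rewrite IV IC I1; have := IP; lra.
Qed.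

Lemma talagrand_pair : 2^-1 * IL W <= IL (klf f) + IL (klf g) /\
  (2^-1 * IL W = IL (klf f) + IL (klf g) ->
   {ae Leb d, forall x, 0 < f x -> f x = gam (Z x) * Num.sqrt (f x / g (T x)) /\
    Num.sqrt (f x / g (T x)) = DZ x}).
Proof.
have iW4 := integrableZ 4^-1 cost_integrable.
have pa : {ae Leb d, forall x, 4^-1 * W x <= rhsa x} by apply: filterS pw_a => x [].
have [h1 h2] := ae_le_Rintegral iW4 irhsa pa.
have z := RintegralZl 4^-1 measurableT cost_integrable; rewrite z in h1 h2.
have := Irhsa => h3; split; first lra.
move=> e; have {}h2 := h2 ltac:(lra).
by apply: filterS2 h2 pw_a => x e' [_ h]; exact: h.
Qed.

Let B x := comb w x (T x).
Variable k : X -> R.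
Hypotheses (dk : density k) (pushB : push_to f B k).
Let mk : measurable_fun setT k. Proof. by have [] := dk. Qed.
Let k0 x : 0 <= k x. Proof. by have [] := dk. Qed.
Let mB : measurable_fun setT B. Proof. exact: measurable_comb. Qed.

Let Q x := DB x * k (B x).
Let Q0 x : 0 <= Q x. Proof. apply: mulr_ge0; [exact: (tp_DB_ge0 TP x)|exact: k0]. Qed.

Let Qle : (\int[Leb d]_x (Q x)%:E <= 1)%E.
Proof.
have [_ _ <-] := dk.
have := tp_DB_le TP (phi := fun x => (k x)%:E); apply.
- exact/measurable_EFinP.
- by move=> x; rewrite lee_fin.
Qed.

Let iQ : integ Q.
Proof.
apply/integrableP; split.
  apply/measurable_EFinP; apply: measurable_funM; first exact: tp_mDB TP.
  exact: measurableT_comp mk mB.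
apply: le_lt_trans (ltry 1); apply: le_trans Qle.
rewrite le_eqVlt; apply/orP; left; apply/eqP; apply: eq_integral => x _.
by rewrite /= (ger0_norm (Q0 x)).
Qed.

Let IQ : IL Q <= 1.
Proof. by rewrite -lee_fin -(ge0_Rintegral Q0 iQ); exact: Qle. Qed.

Let A x := f x * logr k (B x).
(** The upper bound of [interp_pointwise]; [Q] together with [-1 * f x] integrates to at most 0. *)
Let rhsb x := ((((1 - w) * klf f x + w * C x) + - (2^-1 * (w * (1 - w))) * W x) + Q x) + -1 * f x.

Let pw_b : {ae Leb d, forall x, A x <= rhsb x /\
  (A x = rhsb x -> 0 < f x -> (f x / g (T x)) `^ w = DB x)}.
Proof.
apply: filterS3 (tp_gpos TP) (tp_DB_powR TP) (push_ae_pos df dk mB pushB) => x h1 h2 h3.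
have := f0 x; rewrite le_eqVlt => /predU1P[fx|fx].
  split; last by move=> _; rewrite -fx ltxx.
  by rewrite /rhsb /W /A /klf /C -fx !mul0r !mulr0 !add0r addr0.
have gx := h1 fx; have kx := h3 fx.
have := interp_pointwise (sqnorm x) (sqnorm (T x)) (sqnorm (tsub x (T x))) (ln ((Num.sqrt (2 * pi))^-1 ^+ d)) fx gx kx (h2 fx).
have -> : rhsb x = ((((1 - w) * (f x * (ln (f x) - (ln ((Num.sqrt (2 * pi))^-1 ^+ d) - sqnorm x / 2))) +
    w * (f x * (ln (g (T x)) - (ln ((Num.sqrt (2 * pi))^-1 ^+ d) - sqnorm (T x) / 2)))) +
    - (2^-1 * (w * (1 - w))) * (f x * sqnorm (tsub x (T x)))) + DB x * k (B x)) + -1 * f x.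
  by rewrite /rhsb /C klfE (logrE fx) (logrE gx) !ln_gam.
have -> : A x = f x * (ln (k (B x)) - (ln ((Num.sqrt (2 * pi))^-1 ^+ d) -
    ((1 - w) * sqnorm x + w * sqnorm (T x) - w * (1 - w) * sqnorm (tsub x (T x))) / 2)).
  by rewrite /A (logrE kx) ln_gam /B sqnorm_comb.
by move=> [H1 H2]; split=> [|e _]; [exact: H1|exact: H2].
Qed.

Let irhsb : integ rhsb.
Proof.
exact: (integrableDR (integrableDR (integrableDR (integrableDR (integrableZ _ iKf) (integrableZ _ iC))
  (integrableZ _ cost_integrable)) iQ) (integrableZ _ if')).
Qed.

Let Irhsb : IL rhsb <= (1 - w) * IL (klf f) + w * IL (klf g) - 2^-1 * (w * (1 - w)) * IL W.
Proof.
have iW := cost_integrable.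
have i1 := integrableZ (1 - w) iKf; have i2 := integrableZ w iC.
have i3 := integrableZ (- (2^-1 * (w * (1 - w)))) iW.
have i5 := integrableZ (-1) if'; have i12 := integrableDR i1 i2.
have i123 := integrableDR i12 i3; have i1234 := integrableDR i123 iQ.
have -> := RintegralD measurableT i1234 i5; have -> := RintegralD measurableT i123 iQ.
have -> := RintegralD measurableT i12 i3; have -> := RintegralD measurableT i1 i2.
have -> := RintegralZl (1 - w) measurableT iKf; have -> := RintegralZl w measurableT iC.
have -> := RintegralZl (- (2^-1 * (w * (1 - w)))) measurableT iW.
have -> := RintegralZl (-1) measurableT if'.
rewrite IC I1; have := IQ; lra.
Qed.

(** Pulled back through [B], the positive part of the entropy integrand is at most the absolute
    value of the integrable function [rhsb]; the negative part is always finite. *)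
Lemma interp_ent_fin : (ent k < +oo)%E.
Proof.
have mL : measurable_fun setT (fun x => Num.max (logr k x) 0).
  by apply: measurable_maxr; [exact: measurable_logr|exact: measurable_cst].
have E : (fun x => (klf k x)%:E)^\+%E = (fun x => ((k x)%:E * (Num.max (logr k x) 0)%:E)%E).
  by apply/funext => x; rewrite funeposE -EFinM -EFin_max (maxr_pMr _ _ (k0 x)) mulr0.
have pfin : (\int[Leb d]_x (fun x => (klf k x)%:E)^\+ x < +oo)%E.
  have mLE : measurable_fun setT (fun x => (Num.max (logr k x) 0)%:E : \bar R) by exact/measurable_EFinP.
  have L0 x : (0 <= (Num.max (logr k x) 0)%:E)%E by rewrite lee_fin le_max lexx orbT.
  rewrite E -(pushB mLE L0).
  case/integrableP: irhsb => mr; apply: le_lt_trans.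
  have mBL : measurable_fun setT (fun x => (Num.max (logr k (B x)) 0)%:E : \bar R).
    by apply/measurable_EFinP; exact: measurableT_comp mL mB.
  apply: ae_ge0_le_integral.
  - exact: measurableT.
  - by move=> x _; apply: mule_ge0; rewrite lee_fin; [exact: f0|rewrite le_max lexx orbT].
  - by apply: emeasurable_funM; [exact/measurable_EFinP|exact: mBL].
  - by move=> x _; exact: abse_ge0.
  - exact: measurableT_comp mr.
  apply: filterS pw_b => x [h _] _; rewrite /= -EFinM lee_fin (maxr_pMr _ _ (f0 x)) mulr0 ge_max normr_ge0 andbT.
  exact: le_trans h (ler_norm _).
rewrite /ent integralE; exact: sub_fin_lt_pinfty pfin (klf_neg_fin dk).
Qed.

Lemma entropy_interp : IL (klf k) <= (1 - w) * IL (klf f) + w * IL (klf g) - 2^-1 * (w * (1 - w)) * IL W /\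
  (IL (klf k) = (1 - w) * IL (klf f) + w * IL (klf g) - 2^-1 * (w * (1 - w)) * IL W ->
   {ae Leb d, forall x, 0 < f x -> (f x / g (T x)) `^ w = DB x}).
Proof.
have iA : integ A.
  exact: ((push_integrable mf f0 mk k0 mB (measurable_logr mk) pushB).1 (ent_integrable dk interp_ent_fin)).
have IA : IL A = IL (klf k).
  have h := push_integral f0 k0 (measurable_logr mk) pushB.
  by rewrite /Rintegral; apply: (congr1 fine); apply: etrans h _.
have pb : {ae Leb d, forall x, A x <= rhsb x} by apply: filterS pw_b => x [].
have [h1 h2] := ae_le_Rintegral iA irhsb pb.
rewrite IA in h1 h2; split; first exact: le_trans h1 Irhsb.
move=> e; have {}h2 : {ae Leb d, forall x, A x = rhsb x} by apply: h2; rewrite e; exact: Irhsb.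
by apply: filterS2 h2 pw_b => x e' [_ h]; exact: h.
Qed.

End fixed.

Lemma eq_density_ae (f g : X -> R) : density f -> density g ->
  {ae Leb d, forall x, 0 < f x -> f x = g x} -> {ae Leb d, forall x, f x = g x}.
Proof.
move=> [mf f0 f1] [mg g0 g1] h.
apply: (integral_saturated_ae mf mg f0 g0) => //.
- apply: filterS h => x; have := f0 x; rewrite le_eqVlt => /predU1P[<- _ //|fx ->//].
- by rewrite f1 ltry.
- by rewrite f1 g1.
Qed.

Lemma density_gam : density (@gam R d).
Proof.
split; first by apply: measurable_gam.
- by move=> x; rewrite ltW// gam_gt0.
- exact: integral_gam.
Qed.

(** The barycenter density [k] takes the place of [f] in the next step, so everything the next step
    consumes is delivered here. In the rigid case the Jacobian ratio is 1 and [Z] preserves norms,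
    which turns the equality [f x = gam (Z x)] into [f x = gam x]. *)
Lemma pair_step w (f g : X -> R) : 0 < w < 1 ->
  density f -> density g -> centered_density f -> fin2 f -> fin2 g ->
  (ent f < +oo)%E -> (ent g < +oo)%E ->
  exists (T : X -> X) (k : X -> R), [/\ measurable_fun setT T, push_to f T g,
    density k /\ push_to f (fun x => comb w x (T x)) k, (ent k < +oo)%E &
    [/\ 2^-1 * IL (fun x => f x * sqnorm (tsub x (T x))) <= IL (klf f) + IL (klf g),
      IL (klf k) <= (1 - w) * IL (klf f) + w * IL (klf g) -
        2^-1 * (w * (1 - w)) * IL (fun x => f x * sqnorm (tsub x (T x))) &
      2^-1 * IL (fun x => f x * sqnorm (tsub x (T x))) = IL (klf f) + IL (klf g) ->
      IL (klf k) = (1 - w) * IL (klf f) + w * IL (klf g) -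
        2^-1 * (w * (1 - w)) * IL (fun x => f x * sqnorm (tsub x (T x))) ->
      {ae Leb d, forall x, f x = gam x}]].
Proof.
move=> w01 df dg cf f2 g2 ef eg.
have [T [Z [DB [DZ TP]]]] := pair_lemma w01 df dg cf.
have mT := tp_mT TP; have [mf f0 _] := df.
have mB : measurable_fun setT (fun x => comb w x (T x)) by exact: measurable_comb.
(* The interpolated law has a density: [DB] is at least [(1 - w) ^+ d], which is positive, on the
   support of [f], so the image bound for [DB] excludes mass on null sets. *)
have [k [dk pk]] : exists k, density k /\ push_to f (fun x => comb w x (T x)) k.
  apply: push_exists => // A mA A0.
  have mE : measurable_fun setT (fun x => (\1_A (comb w x (T x)))%:E : \bar R).
    have mI : measurable_fun setT (\1_A : X -> R) by exact: measurable_indic.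
    by apply/measurable_EFinP; exact: measurableT_comp mI mB.
  have z : (\int[Leb d]_x ((DB x)%:E * (\1_A (comb w x (T x)))%:E) = 0)%E.
    apply/eqP; rewrite eq_le; apply/andP; split; last first.
      by apply: integral_ge0 => x _; rewrite mule_ge0 ?lee_fin ?(tp_DB_ge0 TP).
    apply: le_trans (tp_DB_le TP (phi := fun x => (\1_A x)%:E) _ _) _.
    - exact/measurable_EFinP.
    - by move=> x; rewrite lee_fin.
    have -> : (\int[Leb d]_x (\1_A x)%:E = 0)%E by apply: etrans A0; rewrite integral_indic// setIT.
    by [].
  have z0 : {ae Leb d, forall x, ((DB x)%:E * (\1_A (comb w x (T x)))%:E = 0)%E}.
    apply/(ae_integral0E (Leb d)) => //.
    - by apply: emeasurable_funM => //; apply/measurable_EFinP; exact: tp_mDB TP.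
    - by move=> x; rewrite mule_ge0 ?lee_fin ?(tp_DB_ge0 TP).
  apply/(ae_integral0E (Leb d)).
  - by apply/measurable_EFinP; apply: measurable_funM => //; exact/measurable_EFinP.
  - by move=> x; rewrite lee_fin mulr_ge0.
  apply: filterS2 z0 (tp_DB_lb TP) => x [] /eqP; rewrite mulf_eq0 => /orP[/eqP db|/eqP -> _]; last first.
    by rewrite mulr0.
  move=> h; have := f0 x; rewrite le_eqVlt => /predU1P[<-|fx]; first by rewrite mul0r.
  have := h fx; rewrite db => /(lt_le_trans _) => /(_ 0).
  by rewrite ltxx exprn_gt0 => [/(_ isT)//|]; rewrite subr_gt0; case/andP: w01.
have [a1 a2] := talagrand_pair df dg f2 g2 ef eg TP.
have [b1 b2] := entropy_interp df dg f2 g2 ef eg TP dk pk.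
exists T, k; split => //.
- exact: tp_push TP.
- exact: (interp_ent_fin df dg f2 g2 ef eg TP dk pk).
split => // /a2 h1 /b2 h2.
apply: eq_density_ae => //; first exact: density_gam.
apply: filterS3 h1 h2 (tp_rigid TP) => x h1 h2 h3 fx.
have [e1 e2] := h1 fx; have [J1 z] := h3 fx (h2 fx) e2.
by rewrite e1 J1 sqrtr1 mulr1 /gam z.
Qed.

End entropy_ineq.

Section interp_moments.
Context {R : realType} (d : nat).
Local Notation Leb := (@Leb R).
Local Notation X := (d.-tuple R).
Local Notation IL h := (\int[Leb d]_x h x).
Local Notation integ h := ((Leb d).-integrable setT (EFin \o h)).

Lemma push_fin2 (f k : X -> R) S : density f -> density k -> measurable_fun setT S ->
  push_to f S k -> fin2 k <-> integ (fun x => f x * sqnorm (S x)).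
Proof.
move=> [mf f0 _] [mk k0 _] mS H.
have m : measurable_fun setT (fun x : X => sqnorm x) by exact: measurable_sqnorm.
exact: (push_integrable mf f0 mk k0 mS m H).
Qed.

Lemma fin2_comb w (f g k : X -> R) (T : X -> X) : 0 < w < 1 ->
  density f -> density g -> density k -> measurable_fun setT T -> push_to f T g ->
  push_to f (fun x => comb w x (T x)) k -> fin2 f -> fin2 g -> fin2 k.
Proof.
move=> /andP[w0 w1] df dg dk mT H1 H2 f2 g2.
have mB : measurable_fun setT (fun x => comb w x (T x)) by exact: measurable_comb.
apply/(push_fin2 df dk mB H2).
have iT := (push_fin2 df dg mT H1).1 g2.
have [mf f0 _] := df.
apply: le_integrable (integrableDR (integrableZ (1 - w) f2) (integrableZ w iT)) => //.
  by apply/measurable_EFinP; apply: measurable_funM => //; exact: measurable_sqnorm.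
move=> x _; rewrite /= lee_fin !ger0_norm; last 2 first.
- apply: addr_ge0; apply: mulr_ge0; rewrite ?(ltW w0) ?subr_ge0 ?(ltW w1)//;
    by apply: mulr_ge0; rewrite ?f0 ?sqnorm_ge0.
- by rewrite mulr_ge0 ?sqnorm_ge0.
rewrite sqnorm_comb ![_ * (f x * _)]mulrCA -mulrDr ler_wpM2l// gerBl.
by rewrite !mulr_ge0 ?sqnorm_ge0 ?subr_ge0 ?ltW.
Qed.

Lemma centered_comb w (f g k : X -> R) (T : X -> X) :
  density f -> density g -> density k -> measurable_fun setT T -> push_to f T g ->
  push_to f (fun x => comb w x (T x)) k -> centered_density f -> centered_density g ->
  centered_density k.
Proof.
move=> [mf f0 _] [mg g0 _] [mk k0 _] mT H1 H2 cf cg c.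
have mB : measurable_fun setT (fun x => comb w x (T x)) by exact: measurable_comb.
have mc : measurable_fun setT (fun x : X => tnth x c) by exact: measurable_tnth.
have comm (h : X -> R) : (fun x : X => (h x * tnth x c)%:E : \bar R) = (fun x => (tnth x c * h x)%:E).
  by apply/funext => x; rewrite mulrC.
have [if' If] := cf c; have [ig Ig] := cg c.
have iT : integ (fun x => f x * tnth (T x) c).
  by apply: (push_integrable mf f0 mg g0 mT mc H1).1; rewrite comm.
have IT : (\int[Leb d]_x (f x * tnth (T x) c)%:E = 0)%E.
  by rewrite (push_integral f0 g0 mc H1) comm.
have ifc : integ (fun x => f x * tnth x c) by have := if'; rewrite -comm.
have E : (fun x => f x * tnth (comb w x (T x)) c) =
    (fun x => (1 - w) * (f x * tnth x c) + w * (f x * tnth (T x) c)).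
  by apply/funext => x; rewrite tnth_mktuple; ring.
rewrite -comm; split.
  apply: (push_integrable mf f0 mk k0 mB mc H2).2.
  by have := integrableDR (integrableZ (1 - w) ifc) (integrableZ w iT); rewrite -E.
rewrite -(push_integral f0 k0 mc H2).
transitivity (\int[Leb d]_x ((1 - w)%:E * (f x * tnth x c)%:E + w%:E * (f x * tnth (T x) c)%:E))%E.
  by apply: eq_integral => x _; rewrite -!EFinM -EFinD; congr EFin; rewrite -(congr1 (@^~ x) E).
rewrite integralD//; last 2 first.
- exact: integrableZl.
- exact: integrableZl.
by rewrite !integralZl// IT comm If !mule0 adde0.
Qed.

End interp_moments.

(* The defects in the two inequalities for [b |: A] are nonnegative
   combinations of those for [A] and of those in the two-marginal step. *)
Lemma chain_arith (R : realFieldType) (q L l S D' W2 Dk Dk' R1 : R) : 0 < L -> 0 < l ->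
  q <= R1 -> L * Dk <= S - q / L -> W2 <= Dk + D' ->
  Dk' <= (1 - l / (l + L)) * Dk + l / (l + L) * D' - l / (l + L) * (1 - l / (l + L)) * W2 ->
  let q' := (l + L) / L * q + l * L * W2 in
  let R1' := R1 + l * S + l * L * D' in
  [/\ q' <= R1', (l + L) * Dk' <= (S + l * D') - q' / (l + L),
    (q' = R1' -> [/\ q = R1, L * Dk = S - q / L & W2 = Dk + D']) &
    ((l + L) * Dk' = (S + l * D') - q' / (l + L) ->
     Dk' = (1 - l / (l + L)) * Dk + l / (l + L) * D' - l / (l + L) * (1 - l / (l + L)) * W2)].
Proof.
move=> L0 l0 h1 h2 h3 h4 q' R1'; have s0 : 0 < l + L by rewrite addr_gt0.
set U := (1 - _) * Dk + _ - _ in h4 *.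
have E1 : R1' - q' = (R1 - q) + l * ((S - q / L) - L * Dk) + l * L * (Dk + D' - W2).
  by rewrite /R1' /q'; field; rewrite gt_eqF.
have E2 : (S + l * D') - q' / (l + L) - (l + L) * Dk' =
    ((S - q / L) - L * Dk) + (l + L) * (U - Dk').
  by rewrite /q' /U; field; rewrite !gt_eqF.
have a1 : 0 <= R1 - q by rewrite subr_ge0.
have a2 : 0 <= (S - q / L) - L * Dk by rewrite subr_ge0.
have a3 : 0 <= Dk + D' - W2 by rewrite subr_ge0.
have a4 : 0 <= U - Dk' by rewrite subr_ge0.
have b2 : 0 <= l * ((S - q / L) - L * Dk) by rewrite mulr_ge0// ltW.
have b3 : 0 <= l * L * (Dk + D' - W2) by rewrite !mulr_ge0// ltW.
have b4 : 0 <= (l + L) * (U - Dk') by rewrite mulr_ge0// ltW.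
split.
- by rewrite -subr_ge0 E1; exact: addr_ge0 (addr_ge0 a1 b2) b3.
- by rewrite -subr_ge0 E2; exact: addr_ge0 a2 b4.
- move=> e; rewrite e subrr in E1.
  have c1 : R1 - q = 0 by lra.
  have c2 : l * ((S - q / L) - L * Dk) = 0 by lra.
  have c3 : l * L * (Dk + D' - W2) = 0 by lra.
  move/eqP: c2; rewrite mulf_eq0 gt_eqF//= subr_eq0 => /eqP c2.
  move/eqP: c3; rewrite mulf_eq0 gt_eqF ?mulr_gt0//= subr_eq0 => /eqP c3.
  by split=> //; lra.
- move=> e; rewrite e subrr in E2.
  have c : (l + L) * (U - Dk') = 0 by lra.
  by move/eqP: c; rewrite mulf_eq0 gt_eqF//= subr_eq0 => /eqP.
Qed.

(** * Several marginals *)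

Section marginals.
Context {R : realType} (d n : nat).
Local Notation Leb := (@Leb R).
Local Notation X := (d.-tuple R).
Local Notation IL h := (\int[Leb d]_x h x).
Local Notation integ h := ((Leb d).-integrable setT (EFin \o h)).
Variables (f : 'I_n -> X -> R) (lam : 'I_n -> R).
Hypotheses (df : forall i, density (f i)) (cf : forall i, centered_density (f i))
  (f2 : forall i, fin2 (f i)) (ef : forall i, (ent (f i) < +oo)%E) (lam0 : forall i, 0 < lam i).
Variable i0 : 'I_n.

Definition wsum (A : {set 'I_n}) : R := \sum_(i in A) lam i.
Definition bary (A : {set 'I_n}) (Y : 'I_n -> X) : X :=
  [tuple (wsum A)^-1 * \sum_(i in A) lam i * tnth (Y i) k | k < d].
(** By the weighted parallel axis identity this is the sum of [lam i * lam j] times the squared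
    distances over unordered pairs in [A]. In this form a new index interacts with the old ones only
    through their barycenter. *)
Definition wcost (A : {set 'I_n}) (Y : 'I_n -> X) : R :=
  wsum A * (\sum_(i in A) lam i * sqnorm (Y i)) - wsum A ^+ 2 * sqnorm (bary A Y).
Let D i := IL (klf (f i)).

Lemma wsum_gt0 (A : {set 'I_n}) i : i \in A -> 0 < wsum A.
Proof.
move=> iA; rewrite /wsum (big_setD1 i)//= ltr_pwDl//; apply: sumr_ge0 => j _; exact: ltW.
Qed.

Lemma wsumU1 (A : {set 'I_n}) b : b \notin A -> wsum (b |: A) = lam b + wsum A.
Proof. by move=> bA; rewrite /wsum big_setU1. Qed.

Let upd b (y : X) (Y : 'I_n -> X) i := if i == b then y else Y i.

Let upd_sum (A : {set 'I_n}) b y Y (V : zmodType) (h : 'I_n -> X -> V) : b \notin A ->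
  \sum_(i in A) h i (upd b y Y i) = \sum_(i in A) h i (Y i).
Proof.
move=> bA; apply: eq_bigr => i iA; rewrite /upd; case: eqP => // ib.
by move: bA; rewrite -ib iA.
Qed.

Lemma bary_upd (A : {set 'I_n}) b y Y : b \notin A -> 0 < wsum A ->
  bary (b |: A) (upd b y Y) = comb (lam b / (lam b + wsum A)) (bary A Y) y.
Proof.
move=> bA A0; apply: eq_from_tnth => k; rewrite !tnth_mktuple wsumU1// big_setU1//=.
rewrite (upd_sum y Y (fun i z => lam i * tnth z k) bA) /upd eqxx.
have l0 := lam0 b; have := addr_gt0 l0 A0 => s0.
by field; rewrite !gt_eqF.
Qed.

Lemma wcost_upd (A : {set 'I_n}) b y Y : b \notin A -> 0 < wsum A ->
  wcost (b |: A) (upd b y Y) = (lam b + wsum A) / wsum A * wcost A Y +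
    lam b * wsum A * sqnorm (tsub (bary A Y) y).
Proof.
move=> bA A0; rewrite /wcost bary_upd// sqnorm_comb wsumU1// big_setU1//=.
rewrite (upd_sum y Y (fun i z => lam i * sqnorm z) bA) /upd eqxx.
have l0 := lam0 b; have := addr_gt0 l0 A0 => s0.
by field; rewrite !gt_eqF.
Qed.

Lemma measurable_bary (A : {set 'I_n}) (Y : 'I_n -> X -> X) : (forall i, measurable_fun setT (Y i)) ->
  measurable_fun setT (fun x => bary A (fun i => Y i x)).
Proof.
move=> mY; apply: measurable_mktuple => k; apply: measurable_funM => //.
under eq_fun do rewrite big_mkcond.
apply: measurable_sum => i; case: (i \in A) => //; apply: measurable_funM => //.
exact: measurableT_comp (measurable_tnth _) (mY i).
Qed.

(** [Y] couples the marginals in [A] from the single source [i0], and [k] is the law of the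
    barycenter. With two marginals rigidity needs equality in both the cost and the entropy bound.
    With three, equality in the cost alone forces both at the preceding stage. [ch_one] identifies
    [k] with the source when that stage is the first. *)
Record chain (A : {set 'I_n}) (Y : 'I_n -> X -> X) (k : X -> R) : Prop := Chain {
  ch_mY : forall i, measurable_fun setT (Y i);
  ch_push : forall i, i \in A -> push_to (f i0) (Y i) (f i);
  ch_dk : density k;
  ch_ck : centered_density k;
  ch_k2 : fin2 k;
  ch_ek : (ent k < +oo)%E;
  ch_bary : push_to (f i0) (fun x => bary A (fun i => Y i x)) k;
  ch_int : integ (fun x => f i0 x * wcost A (fun i => Y i x));
  ch_cost : 2^-1 * IL (fun x => f i0 x * wcost A (fun i => Y i x)) <=
    \sum_(i in A) lam i * (wsum A - lam i) * D i;
  ch_ent : wsum A * IL (klf k) <= \sum_(i in A) lam i * D i -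
    2^-1 * IL (fun x => f i0 x * wcost A (fun i => Y i x)) / wsum A;
  ch_one : (#|A| <= 1)%N -> k = f i0;
  ch_rigid2 : (1 < #|A|)%N ->
    2^-1 * IL (fun x => f i0 x * wcost A (fun i => Y i x)) =
      \sum_(i in A) lam i * (wsum A - lam i) * D i ->
    wsum A * IL (klf k) = \sum_(i in A) lam i * D i -
      2^-1 * IL (fun x => f i0 x * wcost A (fun i => Y i x)) / wsum A ->
    {ae Leb d, forall x, f i0 x = gam x};
  ch_rigid3 : (2 < #|A|)%N ->
    2^-1 * IL (fun x => f i0 x * wcost A (fun i => Y i x)) =
      \sum_(i in A) lam i * (wsum A - lam i) * D i ->
    {ae Leb d, forall x, f i0 x = gam x} }.

Lemma chain_base : exists Y k, chain [set i0] Y k.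
Proof.
exists (fun _ => id), (f i0).
have l0 := lam0 i0; have w1 : wsum [set i0] = lam i0 by rewrite /wsum big_set1.
have bE x : bary [set i0] (fun=> x) = x.
  apply: eq_from_tnth => k; rewrite tnth_mktuple w1 big_set1 mulrA mulVf ?mul1r//.
  by rewrite gt_eqF.
have bE' : (fun x => bary [set i0] (fun=> id x)) = id by apply/funext => x; exact: bE.
have cE x : wcost [set i0] (fun=> x) = 0.
  by rewrite /wcost bE w1 big_set1; ring.
have cE' : (fun x => f i0 x * wcost [set i0] (fun=> id x)) = cst 0.
  by apply/funext => x; rewrite /= cE mulr0.
have I0 : IL (fun x => f i0 x * wcost [set i0] (fun=> id x)) = 0.
  by rewrite cE' /Rintegral integral0.
split=> //; rewrite ?cards1 ?I0 ?w1 ?big_set1 ?bE' ?cE'//.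
- by move=> i; rewrite inE => /eqP ->; exact: push_id.
- exact: integrable0.
- by rewrite subrr !mulr0 mul0r.
- by rewrite !(mulr0, mul0r) subr0.
Qed.

Lemma chain_step (A : {set 'I_n}) b Y k : i0 \in A -> b \notin A -> chain A Y k ->
  exists Y' k', chain (b |: A) Y' k'.
Proof.
move=> iA bA C; have L0 := wsum_gt0 iA; have l0 := lam0 b.
case: C => mY pY dk ck k2 ek pB ic hc he h1 r2 r3.
(* The share of the new weight, for which interpolating between the old barycenter and the new point
   gives the new barycenter. *)
set w := lam b / (lam b + wsum A).
have s0 : 0 < lam b + wsum A by rewrite addr_gt0.
have w01 : 0 < w < 1 by rewrite divr_gt0//= ltr_pdivrMr// mul1r ltrDl.
have [T [k' [mT pT [dk' pk'] ek' [a1 b1 rig]]]] := pair_step w01 dk (df b) ck k2 (f2 b) ek (ef b).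
have mB := measurable_bary A mY.
set B := (fun x => bary A (fun i => Y i x)) in mB pB.
pose Y' i := if i == b then T \o B else Y i.
have YE x : (fun i => Y' i x) = upd b (T (B x)) (fun i => Y i x).
  by apply/funext => i; rewrite /Y' /upd; case: eqP.
have [mfi fi0 _] := df i0; have [mk k0 _] := dk; have [mfb fb0 _] := df b.
have mW : measurable_fun setT (fun y : X => sqnorm (tsub y (T y))).
  by apply: measurable_sqnorm; exact: measurable_tsub.
have iW : integ (fun y => k y * sqnorm (tsub y (T y))).
  have iT := (push_fin2 dk (df b) mT pT).1 (f2 b).
  apply: le_integrable (integrableDR (integrableZ 2 k2) (integrableZ 2 iT)) => //.
    by apply/measurable_EFinP; exact: measurable_funM.
  move=> x _; rewrite /= lee_fin !ger0_norm; last 2 first.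
  - by apply: addr_ge0; apply: mulr_ge0 => //; apply: mulr_ge0; rewrite ?k0 ?sqnorm_ge0.
  - by apply: mulr_ge0; rewrite ?k0 ?sqnorm_ge0.
  rewrite ![_ * (k x * _)]mulrCA -mulrDr; apply: ler_wpM2l; first exact: k0.
  have := sqnorm_ge0 (comb (1 / 2) x (T x)); rewrite sqnorm_comb; lra.
have iWB := (push_integrable mfi fi0 mk k0 mB mW pB).1 iW.
set W := IL (fun y => k y * sqnorm (tsub y (T y))) in a1 b1 rig.
have WE : IL (fun x => f i0 x * sqnorm (tsub (B x) (T (B x)))) = W.
  have h := push_integral fi0 k0 mW pB.
  by rewrite /W /Rintegral; apply: (congr1 fine); apply: etrans h _.
have cE : (fun x => f i0 x * wcost (b |: A) (fun i => Y' i x)) =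
    (fun x => (lam b + wsum A) / wsum A * (f i0 x * wcost A (fun i => Y i x)) +
      lam b * wsum A * (f i0 x * sqnorm (tsub (B x) (T (B x))))).
  by apply/funext => x; rewrite YE wcost_upd// -/(B x); ring.
have ic' : integ (fun x => f i0 x * wcost (b |: A) (fun i => Y' i x)).
  by rewrite cE; exact: integrableDR (integrableZ _ ic) (integrableZ _ iWB).
set q := IL (fun x => f i0 x * wcost A (fun i => Y i x)) in hc he r2 r3.
have qE : 2^-1 * IL (fun x => f i0 x * wcost (b |: A) (fun i => Y' i x)) =
    (lam b + wsum A) / wsum A * (2^-1 * q) + lam b * wsum A * (2^-1 * W).
  rewrite cE (RintegralD measurableT (integrableZ _ ic) (integrableZ _ iWB)).
  by rewrite (RintegralZl _ measurableT ic) (RintegralZl _ measurableT iWB) WE -/q; ring.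
have RE : \sum_(i in b |: A) lam i * (wsum (b |: A) - lam i) * D i =
    \sum_(i in A) lam i * (wsum A - lam i) * D i + lam b * (\sum_(i in A) lam i * D i) +
    lam b * wsum A * D b.
  rewrite big_setU1//= wsumU1// addrC; congr (_ + _); last by ring.
  by rewrite mulr_sumr -big_split/=; apply: eq_bigr => i _; ring.
have SE : \sum_(i in b |: A) lam i * D i = \sum_(i in A) lam i * D i + lam b * D b.
  by rewrite big_setU1//= addrC.
have b1' : IL (klf k') <= (1 - w) * IL (klf k) + w * D b - w * (1 - w) * (2^-1 * W).
  by apply: le_trans b1 _; rewrite le_eqVlt; apply/orP; left; apply/eqP; rewrite /D; ring.
have [c1 c2 c3 c4] := chain_arith L0 l0 hc he a1 b1'.
have rig' : 2^-1 * W = IL (klf k) + D b ->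
    IL (klf k') = (1 - w) * IL (klf k) + w * D b - w * (1 - w) * (2^-1 * W) ->
    {ae Leb d, forall x, k x = gam x}.
  by move=> e1 e2; apply: rig => //; rewrite e2 /D; ring.
have A1 : (1 <= #|A|)%N by apply/card_gt0P; exists i0.
have cA : #|b |: A| = #|A|.+1 by rewrite cardsU1 bA.
exists Y', k'; split.
- by move=> i; rewrite /Y'; case: eqP => // _; exact: measurableT_comp.
- move=> i; rewrite in_setU1 => /predU1P; rewrite /Y'; case: eqP => [-> _|ib [//|iA']].
    exact: (push_comp mT pB pT).
  exact: pY.
- exact: dk'.
- exact: (centered_comb dk (df b) dk' mT pT pk' ck (cf b)).
- exact: (fin2_comb w01 dk (df b) dk' mT pT pk' k2 (f2 b)).
- exact: ek'.
- under eq_fun do rewrite YE bary_upd//.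
  have mC : measurable_fun setT (fun x => comb w x (T x)) by exact: measurable_comb.
  exact: (push_comp mC pB pk').
- exact: ic'.
- by rewrite qE RE.
- by rewrite qE SE wsumU1.
- by rewrite cA ltnS leqNgt A1.
(* Either [A] is a singleton and rigidity of the present step already concerns the source, or
   equality is passed back to the chain for [A]. *)
- rewrite qE RE SE wsumU1// => _ /c3 [e1 e2 e3] /c4 e4.
  have := rig' e3 e4; case: (leqP #|A| 1) => hA.
    by rewrite h1.
  by move=> _; exact: r2.
(* The cost defect for [b |: A] contains both defects for [A] with positive coefficients, so its
   vanishing gives the two equalities needed for [A]. *)
- rewrite cA qE RE => hA /c3 [e1 e2 _]; exact: r2.
Qed.

Lemma chain_exists (A : {set 'I_n}) : i0 \in A -> exists Y k, chain A Y k.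
Proof.
move: {2}#|A|.-1 (erefl #|A|.-1) => m; elim: m A => [|m IH] A cA iA.
  have A1 : (0 < #|A|)%N by apply/card_gt0P; exists i0.
  have /eqP/cards1P[a aE] : #|A| = 1%N by rewrite -(prednK A1) cA.
  by move: iA; rewrite aE inE => /eqP <-; exact: chain_base.
have [b] : exists b, b \in A :\ i0.
  by apply/card_gt0P; move: cA; rewrite (cardsD1 i0) iA add1n /= => ->.
rewrite !inE => /andP[bi bA].
have iA' : i0 \in A :\ b by rewrite !inE eq_sym bi.
have [|Y [k C]] := IH (A :\ b) _ iA'.
  by move: cA; rewrite (cardsD1 b) bA add1n /= => ->.
by rewrite -(finset.setD1K bA); apply: chain_step C => //; rewrite !inE eqxx.
Qed.

End marginals.

(** * From densities to laws and couplings *)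

Section law.
Context {R : realType} (d : nat).
Local Notation Leb := (@Leb R).
Local Notation X := (d.-tuple R).
Local Notation integ h := ((Leb d).-integrable setT (EFin \o h)).

Definition has_density (mu : probability X R) (f : X -> R) : Prop :=
  density f /\ forall phi : X -> \bar R, measurable_fun setT phi -> (forall x, 0 <= phi x)%E ->
    (\int[mu]_x phi x = \int[Leb d]_x ((f x)%:E * phi x))%E.

Let mind (A : set X) : measurable A -> measurable_fun setT (fun x => (\1_A x)%:E : \bar R).
Proof. by move=> mA; apply/measurable_EFinP; exact: measurable_indic. Qed.

Lemma leb_int_density (f : X -> R) (A : set X) : measurable_fun setT f -> (forall x, 0 <= f x) ->
  measurable A -> leb_int (fun x => (\1_A x * f x)%:E) = (\int[Leb d]_x ((f x)%:E * (\1_A x)%:E))%E.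
Proof.
move=> mf f0 mA; rewrite leb_intE.
- by apply: eq_integral => x _; rewrite -EFinM mulrC.
- by apply/measurable_EFinP; apply: measurable_funM => //; exact: measurable_indic.
- by move=> x; rewrite lee_fin mulr_ge0.
Qed.

Lemma integral_prob_indic (mu : probability X R) (A : set X) : measurable A ->
  (\int[mu]_x (\1_A x)%:E)%E = mu A.
Proof. by move=> mA; rewrite integral_indic// setIT. Qed.

Lemma is_density_has (mu : probability X R) f : is_density mu f -> has_density mu f.
Proof.
move=> [mf [f0 H]].
have H' A : measurable A -> mu A = (\int[Leb d]_x ((f x)%:E * (\1_A x)%:E))%E.
  by move=> mA; rewrite H// leb_int_density.
have f1 : (\int[Leb d]_x (f x)%:E = 1)%E.
  transitivity (\int[Leb d]_x ((f x)%:E * (\1_(@setT X) x)%:E))%E.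
    by apply: eq_integral => x _; rewrite indicT mule1.
  by rewrite -H'//; exact: probability_setT.
split=> // phi mphi phi0.
apply/esym; apply: (ge0_eq_integral_wpush (m := Leb d) mf f0 (@measurable_id _ _ setT) (n := mu)) => //.
by move=> A mA; apply: etrans (esym (H' A mA)); apply: eq_integral => x _; rewrite EFinM.
Qed.

(** The definition of [relent] selects some density by choice; that very density is returned, so no
    comparison between densities arises. Absolute continuity rules out the infinite branch. *)
Lemma relent_ent (mu : probability X R) : abs_cont_leb mu ->
  exists2 f, has_density mu f & relent mu = ent f.
Proof.
move=> ac.
have [k [[mk k0 k1] H]] : exists k, density k /\ forall phi : X -> \bar R, measurable_fun setT phi -> (forall x, 0 <= phi x)%E ->
    (\int[mu]_x phi x = \int[Leb d]_x ((k x)%:E * phi x))%E.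
  apply: density_of_ac => A mA A0; apply: ac => //.
  by rewrite -A0; exact: LebE.
rewrite /relent; case: pselect => [h|nh]; last first.
  exfalso; apply: nh; exists k; split=> //; split=> // A mA.
  by rewrite leb_int_density// -H ?integral_prob_indic//; exact: mind.
case: (cid h) => f hf /=; exists f; first exact: is_density_has.
by case: hf => mf [f0 _]; rewrite leb_int_klf.
Qed.

Lemma measurable_gauss C : measurable_fun setT (@gauss_density R d C).
Proof.
rewrite (_ : gauss_density C = (fun x => (Num.sqrt (2 * pi))^-1 ^+ d * (Num.sqrt (\det C))^-1 *
  expR (- qform (invmx C) x / 2))); last by apply/funext => x; exact: gauss_densityE.
apply: measurable_funM => //; apply: measurableT_comp; first exact: measurable_expR.
by apply: measurable_funM => //; apply: measurable_funN; exact: measurable_qform.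
Qed.

Lemma gauss_ge0 C x : 0 <= @gauss_density R d C x.
Proof. by rewrite gauss_densityE !mulr_ge0 ?expR_ge0 ?exprn_ge0 ?invr_ge0 ?sqrtr_ge0. Qed.

Section with_density.
Variables (mu : probability X R) (f : X -> R).
Hypothesis H : has_density mu f.
Let mf : measurable_fun setT f. Proof. by have [[]] := H. Qed.
Let f0 x : 0 <= f x. Proof. by have [[]] := H. Qed.

Lemma has_density_prob A : measurable A -> mu A = (\int[Leb d]_x ((f x)%:E * (\1_A x)%:E))%E.
Proof.
move=> mA; rewrite -integral_prob_indic//; apply: H.2; first exact: mind.
by move=> x; rewrite lee_fin.
Qed.

Lemma has_density_integral (h : X -> R) : measurable_fun setT h ->
  (\int[mu]_x (h x)%:E = \int[Leb d]_x (f x * h x)%:E)%E.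
Proof.
move=> mh; have [p n] := mul_funeposneg h f0.
rewrite [LHS]integralE [RHS]integralE p n; congr (_ - _)%E.
  rewrite -H.2.
  - by apply: eq_integral => x _; rewrite funeposE EFin_max.
  - by apply/measurable_EFinP; exact: measurable_maxr.
  - by move=> x; rewrite lee_fin le_max lexx orbT.
rewrite -H.2.
- by apply: eq_integral => x _; rewrite funenegE EFin_max.
- by apply/measurable_EFinP; apply: measurable_maxr => //; exact: measurable_funN.
- by move=> x; rewrite lee_fin le_max lexx orbT.
Qed.

Lemma has_density_fin2 : finite_second_moment mu -> fin2 f.
Proof.
rewrite /finite_second_moment; have m : measurable_fun setT (fun x : X => sqnorm x) by exact: measurable_sqnorm.
rewrite has_density_integral// => h; apply/integrableP; split.
  by apply/measurable_EFinP; exact: measurable_funM.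
apply: le_lt_trans h; rewrite le_eqVlt; apply/orP; left; apply/eqP; apply: eq_integral => x _.
by rewrite gee0_abs// lee_fin mulr_ge0 ?sqnorm_ge0.
Qed.

Lemma has_density_centered : fin2 f -> centered mu -> centered_density f.
Proof.
move=> f2 c k; have mk : measurable_fun setT (fun x : X => tnth x k) by exact: measurable_tnth.
have E : (fun x => (tnth x k * f x)%:E) = (fun x => (f x * tnth x k)%:E) :> (X -> \bar R).
  by apply/funext => x; rewrite mulrC.
rewrite E; split; last by rewrite -has_density_integral//; exact: c.
apply: le_integrable (integrableDR (density_integrable H.1) f2) => //.
  by apply/measurable_EFinP; exact: measurable_funM.
move=> x _; rewrite /= lee_fin normrM (ger0_norm (f0 x)) [leRHS]ger0_norm; last first.
  by rewrite addr_ge0// mulr_ge0 ?sqnorm_ge0.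
rewrite -[X in X + _]mulr1 -mulrDr ler_wpM2l//.
have : tnth x k ^+ 2 <= sqnorm x.
  rewrite /sqnorm (bigD1 k)//= lerDl; apply: sumr_ge0 => j _; exact: sqr_ge0.
have := sqr_ge0 (`|tnth x k| - 1); rewrite sqrrB1 real_normK ?num_real//.
have : 0 <= sqnorm x by exact: sqnorm_ge0.
have := normr_ge0 (tnth x k); lra.
Qed.

Lemma is_gaussian_ae C : {ae Leb d, forall x, f x = gauss_density C x} -> is_gaussian mu C.
Proof.
move=> h A mA; have mG := measurable_gauss C; have G0 := gauss_ge0 C.
rewrite has_density_prob// leb_int_density//; apply: ge0_ae_eq_integral => //.
- by apply: emeasurable_funM; [exact/measurable_EFinP|exact: mind].
- by apply: emeasurable_funM; [exact/measurable_EFinP|exact: mind].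
- by move=> x _; rewrite mule_ge0// lee_fin.
- by move=> x _; rewrite mule_ge0// lee_fin.
- by apply: filterS h => x ->.
Qed.

Lemma gaussian_ae C : is_gaussian mu C ->
  density (gauss_density C) /\ {ae Leb d, forall x, f x = gauss_density C x}.
Proof.
move=> h; have mG := measurable_gauss C; have G0 := gauss_ge0 C.
have [dG H'] : has_density mu (gauss_density C) by apply: is_density_has.
split=> //.
have RE (u : X -> R) A : (\int[Leb d]_(x in A) (u x)%:E = \int[Leb d]_x ((u x)%:E * (\1_A x)%:E))%E.
  rewrite integral_mkcond; apply: eq_integral => x _; rewrite patchE indicE.
  by case: (x \in A); rewrite ?mule1 ?mule0.
have E : forall A, A `<=` setT -> measurable A ->
    (\int[Leb d]_(x in A) (f x)%:E = \int[Leb d]_(x in A) (gauss_density C x)%:E)%E.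
  move=> A _ mA; apply: etrans (RE f A) _; apply: etrans (esym (RE _ A)).
  apply: etrans (esym (has_density_prob mA)) _; apply: etrans (h A mA) _.
  exact: (leb_int_density mG G0 mA).
have mGE : measurable_fun setT (fun x => (gauss_density C x)%:E : \bar R) by exact/measurable_EFinP.
have := integral_ae_eq measurableT (density_integrable H.1) mGE E.
by apply: filterS => x /(_ I) [].
Qed.

End with_density.

Lemma integrable_qform (f : X -> R) (M : 'M[R]_d) : measurable_fun setT f -> (forall x, 0 <= f x) ->
  fin2 f -> integ (fun x => f x * qform M x).
Proof.
move=> mf f0 f2.
have mt (k : 'I_d) : measurable_fun setT (fun x : X => tnth x k) by exact: measurable_tnth.
have ijk (j k : 'I_d) : integ (fun x => f x * (tnth x j * tnth x k)).
  apply: le_integrable f2 => //.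
    by apply/measurable_EFinP; apply: measurable_funM => //; exact: measurable_funM.
  move=> x _; rewrite /= lee_fin !normrM (ger0_norm (f0 x)) (ger0_norm (sqnorm_ge0 x)) ler_wpM2l//.
  have le2 (k' : 'I_d) : `|tnth x k'| ^+ 2 <= sqnorm x.
    rewrite real_normK ?num_real// /sqnorm (bigD1 k')//= lerDl.
    by apply: sumr_ge0 => l _; exact: sqr_ge0.
  have := sqr_ge0 (`|tnth x j| - `|tnth x k|); rewrite sqrrB.
  have := le2 j; have := le2 k; rewrite -mulr_natr; lra.
have -> : (fun x => f x * qform M x) = (fun x => \sum_j \sum_k M k j * (f x * (tnth x k * tnth x j))).
  apply/funext => x; rewrite /qform mxE mulr_sumr; apply: eq_bigr => j _.
  by rewrite !mxE mulr_suml mulr_sumr; apply: eq_bigr => k _; rewrite !mxE; ring.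
rewrite (_ : EFin \o _ = (fun x => \sum_j \sum_k (M k j * (f x * (tnth x k * tnth x j)))%:E)%E).
  apply: integrable_sum => // j _; apply: integrable_sum => // k _.
  exact: (integrableZ (M k j) (ijk k j)).
by apply/funext => x; rewrite /= -sumEFin; apply: eq_bigr => j _; rewrite sumEFin.
Qed.

(** For a nonpositive determinant the square root and its inverse are 0 by convention, so the
    formula would be the zero function, which does not integrate to 1. *)
Lemma density_gauss_det C : density (@gauss_density R d C) -> 0 < \det C.
Proof.
move=> [_ _ g1]; rewrite ltNge; apply/negP => dC.
have : (\int[Leb d]_x (gauss_density C x)%:E = 0)%E.
  by apply: integral0_eq => x _; rewrite gauss_densityE (ler0_sqrtr dC) invr0 mulr0 mul0r.
by rewrite g1 => -[] /eqP; rewrite oner_eq0.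
Qed.

Lemma klf_gauss (f : X -> R) C x : 0 < \det C -> f x = gauss_density C x ->
  klf f x = f x * (ln ((Num.sqrt (\det C))^-1)) + (2^-1 * (f x * sqnorm x) +
    - 2^-1 * (f x * qform (invmx C) x)).
Proof.
move=> dC fE; have cd : 0 < (Num.sqrt (\det C))^-1 by rewrite invr_gt0 sqrtr_gt0.
have c0 : 0 < (Num.sqrt (2 * pi))^-1 ^+ d :> R by rewrite exprn_gt0// invr_gt0 sqrt2pi_gt0.
have fx : 0 < f x by rewrite fE gauss_densityE !mulr_gt0// expR_gt0.
rewrite klfE logrE// ln_gam {2}fE gauss_densityE lnM ?posrE ?mulr_gt0 ?expR_gt0// lnM ?posrE// expRK.
by field.
Qed.

(** The quadratic moments are left unevaluated: they will cancel against the integrated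
    Fenchel-Young inequality, so no Gaussian covariance has to be computed. *)
Lemma gauss_klf_integral (f : X -> R) C : density f -> fin2 f -> 0 < \det C ->
  {ae Leb d, forall x, f x = gauss_density C x} ->
  (ent f < +oo)%E /\ \int[Leb d]_x klf f x = ln ((Num.sqrt (\det C))^-1) +
    2^-1 * \int[Leb d]_x (f x * sqnorm x) - 2^-1 * \int[Leb d]_x (f x * qform (invmx C) x).
Proof.
move=> df f2 dC fE; have [mf f0 f1] := df; have i0 := density_integrable df.
have iq := integrable_qform (invmx C) mf f0 f2.
set c := ln _.
have i1 := integrableZ c i0; have i2 := integrableZ 2^-1 f2; have i3 := integrableZ (- 2^-1) iq.
have i23 := integrableDR i2 i3; have i123 := integrableDR i1 i23.
have kE : {ae Leb d, forall x, klf f x = c * f x + (2^-1 * (f x * sqnorm x) + - 2^-1 * (f x * qform (invmx C) x))}.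
  by apply: filterS fE => x e; rewrite (klf_gauss dC e) [f x * ln _]mulrC.
have mk : measurable_fun setT (fun x => (klf f x)%:E : \bar R).
  by apply/measurable_EFinP; exact: measurable_klf.
have E : (\int[Leb d]_x (klf f x)%:E = \int[Leb d]_x (c * f x + (2^-1 * (f x * sqnorm x) +
    - 2^-1 * (f x * qform (invmx C) x)))%:E)%E.
  apply: ae_eq_integral => //; first by case/integrableP: i123.
  by apply: filterS kE => x ->.
split; first by rewrite /ent E; case/fin_numPlt: (integrable_fin_num measurableT i123) => /andP[].
have -> : \int[Leb d]_x klf f x = \int[Leb d]_x (c * f x + (2^-1 * (f x * sqnorm x) +
    - 2^-1 * (f x * qform (invmx C) x))) by rewrite /Rintegral E.
have -> := RintegralD measurableT i1 i23; have -> := RintegralD measurableT i2 i3.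
have -> := RintegralZl c measurableT i0; have -> := RintegralZl 2^-1 measurableT f2.
have -> := RintegralZl (- 2^-1) measurableT iq.
by rewrite [X in c * X]/Rintegral f1 /= mulr1 addrA mulNr.
Qed.

Lemma ent_gam (f : X -> R) : density f -> {ae Leb d, forall x, f x = gam x} -> ent f = 0%E.
Proof.
move=> [mf f0 f1] h; rewrite /ent.
transitivity (\int[Leb d]_x (cst 0 x : \bar R))%E; last by rewrite integral0.
apply: ae_eq_integral => //.
- by apply/measurable_EFinP; exact: measurable_klf.
- by apply: filterS h => x e _; rewrite /klf e divff ?ln1 ?mulr0// gt_eqF// gam_gt0.
Qed.

End law.

Section coupling.
Context {R : realType} (d n : nat).
Local Notation Leb := (@Leb R).
Local Notation X := (d.-tuple R).

Lemma measurable_tuple_maps dT (T : measurableType dT) (Y : 'I_n -> T -> X) :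
  (forall i, measurable_fun setT (Y i)) ->
  measurable_fun setT (fun x => [tuple Y i x | i < n] : n.-tuple X).
Proof.
move=> mY; apply/measurable_fun_tnthP => i.
rewrite (_ : _ \o _ = Y i); first exact: mY.
by apply/funext => x /=; rewrite tnth_mktuple.
Qed.

Lemma coupling_of_maps dT (T : measurableType dT) (nu : probability T R)
    (mu : 'I_n -> probability X R) (Y : 'I_n -> T -> X) :
  (forall i, measurable_fun setT (Y i)) ->
  (forall i A, measurable A -> (\int[nu]_x (\1_A (Y i x))%:E = mu i A)%E) ->
  exists P : probability (n.-tuple X) R, is_coupling mu P /\
    forall c : n.-tuple X -> R, measurable_fun setT c -> (forall x, 0 <= c x) ->
      (\int[P]_x (c x)%:E = \int[nu]_x (c [tuple Y i x | i < n])%:E)%E.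
Proof.
move=> mY H; have mt := measurable_tuple_maps mY.
have m1 : measurable_fun setT (cst 1 : T -> R) by exact: measurable_cst.
have p1 (x : T) : 0 <= (cst 1 : T -> R) x by exact: ler01.
pose W := wpush_m nu m1 p1 mt.
have [P PE] : exists P : probability (n.-tuple X) R, forall A, P A = W A.
  apply: measure_probability; transitivity (\int[nu]_x (1%:E))%E.
    by apply: eq_integral => x _; rewrite indicT mulr1.
  by rewrite integral_cst// mul1e; exact: probability_setT.
exists P; split.
  move=> i A mA; rewrite PE -H//; apply: eq_integral => x _; rewrite mul1r.
  congr (_ %:R%:E); congr nat_of_bool; apply/idP/idP; rewrite !inE /= tnth_mktuple//.
move=> c mc c0; transitivity (\int[W]_x (c x)%:E)%E.
  by apply: eq_measure_integral => A mA _; exact: PE.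
rewrite (ge0_integral_wpush nu m1 p1 mt (F := fun x => (c x)%:E)).
- by apply: eq_integral => x _; rewrite mul1e.
- exact/measurable_EFinP.
- by move=> x; rewrite lee_fin.
Qed.

Lemma sqdistE (x y : X) : sqdist x y = sqnorm (tsub x y).
Proof. by apply: eq_bigr => k _; rewrite tnth_mktuple. Qed.

Lemma mm_cost_ge0 (lam : 'I_n -> R) (x : n.-tuple X) : (forall i, 0 < lam i) -> 0 <= mm_cost lam x.
Proof.
move=> l0; apply: sumr_ge0 => i _; apply: sumr_ge0 => j _.
by rewrite sqdistE; exact: mulr_ge0 (mulr_ge0 (ltW (l0 i)) (ltW (l0 j))) (sqnorm_ge0 _).
Qed.

Lemma measurable_mm_cost (lam : 'I_n -> R) : measurable_fun setT (mm_cost lam : n.-tuple X -> R).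
Proof.
apply: measurable_sum => i; under eq_fun do rewrite big_mkcond.
apply: measurable_sum => j; case: (_ < _)%N => //; apply: measurable_funM => //.
under eq_fun do rewrite sqdistE.
by apply: measurable_sqnorm; apply: measurable_tsub; exact: measurable_tnth.
Qed.

Lemma mm_cost_wcost (lam : 'I_n -> R) (Y : 'I_n -> X) : \sum_i lam i = 1 ->
  mm_cost lam [tuple Y i | i < n] = wcost lam [set: 'I_n] Y.
Proof.
move=> s1.
pose G i j := lam i * lam j * sqnorm (tsub (Y i) (Y j)).
have GC i j : G i j = G j i.
  by rewrite /G mulrC [sqnorm _](_ : _ = sqnorm (tsub (Y j) (Y i))); [ring|apply: eq_bigr => k _; rewrite !tnth_mktuple; ring].
have G0 i : G i i = 0.
  by rewrite /G [sqnorm _](_ : _ = 0) ?mulr0//; apply: big1 => k _; rewrite tnth_mktuple subrr expr0n.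
have mE : mm_cost lam [tuple Y i | i < n] = \sum_(i < n) \sum_(j < n | (i < j)%N) G i j.
  by apply: eq_bigr => i _; apply: eq_bigr => j _; rewrite sqdistE !tnth_mktuple.
(* The expansion of the squared barycenter runs over all ordered pairs, so the sum over [i < j] is
   first symmetrized; diagonal terms vanish. *)
have dbl : \sum_(i < n) \sum_(j < n) G i j = 2 * mm_cost lam [tuple Y i | i < n].
  rewrite mE mulr_natl mulr2n.
  have -> : \sum_(i < n) \sum_(j < n) G i j = \sum_(i < n) \sum_(j < n | (i < j)%N) G i j +
      \sum_(i < n) \sum_(j < n | (j < i)%N) G i j.
    rewrite -big_split/=; apply: eq_bigr => i _.
    rewrite [LHS](bigID (fun j : 'I_n => (i < j)%N))/=; congr (_ + _).
    rewrite [LHS](bigID (fun j : 'I_n => (j < i)%N))/= [X in _ + X]big1 ?addr0 => [|j].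
      by apply: eq_bigl => j; rewrite -leqNgt; case: ltngtP.
    rewrite -!leqNgt -eqn_leq => /eqP e; have -> : j = i by apply/val_inj.
    exact: G0.
  congr (_ + _); rewrite (exchange_big_dep xpredT)//=; apply: eq_bigr => i _.
  by apply: eq_bigr => j _; exact: GC.
have wT : wsum lam [set: 'I_n] = 1.
  by rewrite /wsum -s1; apply: eq_bigl => i; rewrite inE.
have bE : sqnorm (bary lam [set: 'I_n] Y) = \sum_(i < n) \sum_(j < n) lam i * lam j * dot (Y i) (Y j).
  rewrite sqnormE /dot; under [RHS]eq_bigr do under eq_bigr do rewrite mulr_sumr.
  under [RHS]eq_bigr do rewrite exchange_big; rewrite [RHS]exchange_big/=; apply: eq_bigr => k _.
  rewrite !tnth_mktuple wT invr1 mul1r.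
  have -> : \sum_(i in [set: 'I_n]%SET) lam i * tnth (Y i) k = \sum_(i < n) lam i * tnth (Y i) k.
    by apply: eq_bigl => i; rewrite inE.
  rewrite mulr_suml; apply: eq_bigr => i _; rewrite mulr_sumr; apply: eq_bigr => j _; ring.
rewrite /wcost wT expr1n !mul1r bE.
have -> : \sum_(i in [set: 'I_n]%SET) lam i * sqnorm (Y i) = \sum_(i < n) lam i * sqnorm (Y i).
  by apply: eq_bigl => i; rewrite inE.
suff : \sum_(i < n) \sum_(j < n) G i j = 2 * (\sum_(i < n) lam i * sqnorm (Y i) -
    \sum_(i < n) \sum_(j < n) lam i * lam j * dot (Y i) (Y j)).
  have n2 : (2 : R) != 0 by rewrite pnatr_eq0.
  by rewrite dbl => /(mulfI n2).
have r1 : \sum_(i < n) lam i * sqnorm (Y i) = \sum_(i < n) \sum_(j < n) lam i * lam j * sqnorm (Y i).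
  apply: eq_bigr => i _; rewrite -mulr_suml -mulr_sumr s1 mulr1//.
have r2 : \sum_(i < n) lam i * sqnorm (Y i) = \sum_(i < n) \sum_(j < n) lam i * lam j * sqnorm (Y j).
  rewrite r1 exchange_big/=; apply: eq_bigr => i _; apply: eq_bigr => j _; ring.
rewrite mulrBr {1}mulr_natl mulr2n {1}r1 {1}r2 -big_split/= mulr_sumr -sumrB; apply: eq_bigr => i _.
rewrite -big_split/= mulr_sumr -sumrB; apply: eq_bigr => j _.
by rewrite /G sqnorm_tsub; ring.
Qed.

End coupling.

(** * Monotonicity of an optimal map, and the equality cases *)

Section swap.
Context {R : realType} (d : nat).
Local Notation Leb := (@Leb R).
Local Notation X := (d.-tuple R).
Variables (nu : probability X R) (f : X -> R) (T : X -> X).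
Hypotheses (Hf : has_density nu f) (mT : measurable_fun setT T).
Local Notation m2 := (nu \x nu)%E.

Let mX1 : measurable_fun setT (fun z : X * X => z.1). Proof. exact: measurable_fst. Qed.
Let mX2 : measurable_fun setT (fun z : X * X => z.2). Proof. exact: measurable_snd. Qed.
Let mT1 : measurable_fun setT (fun z : X * X => T z.1). Proof. exact: measurableT_comp mT mX1. Qed.
Let mT2 : measurable_fun setT (fun z : X * X => T z.2). Proof. exact: measurableT_comp mT mX2. Qed.

Lemma integral_swap (H : X * X -> \bar R) : measurable_fun setT H -> (forall z, 0 <= H z)%E ->
  (\int[m2]_z H (z.2, z.1) = \int[m2]_z H z)%E.
Proof.
move=> mH H0; rewrite [RHS]fubini_tonelli2// [LHS]fubini_tonelli1//.
by apply: measurableT_comp mH _; exact: measurable_fun_pair.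
Qed.

Lemma integral_fst (H : X -> \bar R) : measurable_fun setT H -> (forall x, 0 <= H x)%E ->
  (\int[m2]_z H z.1 = \int[nu]_x H x)%E.
Proof.
move=> mH H0; rewrite fubini_tonelli1//; last by exact: measurableT_comp mH mX1.
apply: eq_integral => x _; rewrite /fubini_F.
transitivity (\int[nu]_y (cst (H x) y))%E; first by [].
rewrite integral_cst//.
by rewrite [X in (_ * X)%E](_ : _ = 1%E) ?mule1//; exact: probability_setT.
Qed.

Definition bad (z : X * X) : bool := dot (tsub z.1 z.2) (tsub (T z.1) (T z.2)) < 0.
Definition swapped (z : X * X) : X := if bad z then T z.2 else T z.1.
Let bd z : R := (bad z)%:R.

Let badC z : bad (z.2, z.1) = bad z.
Proof.
rewrite /bad; congr (_ < 0); rewrite /dot; apply: eq_bigr => k _.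
by rewrite !tnth_mktuple; ring.
Qed.

Let mbad : measurable_fun setT bad.
Proof. by apply: measurable_fun_ltr => //; apply: measurable_dot; exact: measurable_tsub. Qed.
Let mbd : measurable_fun setT bd. Proof. exact: measurable_natr_bool. Qed.
Let bd0 z : 0 <= bd z. Proof. exact: ler0n. Qed.

Lemma measurable_swapped : measurable_fun setT swapped.
Proof. by apply: measurable_fun_ifT. Qed.

(* Both [bad] and the product law are invariant under exchanging the two
   coordinates. *)
Lemma swapped_law (A : set X) : measurable A ->
  (\int[m2]_z (\1_A (swapped z))%:E = \int[nu]_x (\1_A (T x))%:E)%E.
Proof.
move=> mA; have mI : measurable_fun setT (fun x => (\1_A (T x))%:E : \bar R).
  have mi : measurable_fun setT (\1_A : X -> R) by exact: measurable_indic.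
  by apply/measurable_EFinP; exact: measurableT_comp mi mT.
have mi1 : measurable_fun setT (fun z : X * X => (bd z * \1_A (T z.1))%:E : \bar R).
  apply/measurable_EFinP; apply: measurable_funM => //.
  by apply/measurable_EFinP; exact: measurableT_comp mI mX1.
have mi2 : measurable_fun setT (fun z : X * X => (bd z * \1_A (T z.2))%:E : \bar R).
  apply/measurable_EFinP; apply: measurable_funM => //.
  by apply/measurable_EFinP; exact: measurableT_comp mI mX2.
have mi3 : measurable_fun setT (fun z : X * X => ((1 - bd z) * \1_A (T z.1))%:E : \bar R).
  apply/measurable_EFinP; apply: measurable_funM; first exact: measurable_funB.
  by apply/measurable_EFinP; exact: measurableT_comp mI mX1.
have nb z : 0 <= 1 - bd z by rewrite /bd; case: (bad z); rewrite ?subrr ?subr0.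
have I0 x : 0 <= \1_A x :> R by [].
transitivity (\int[m2]_z ((bd z * \1_A (T z.2))%:E + ((1 - bd z) * \1_A (T z.1))%:E))%E.
  apply: eq_integral => z _; rewrite -EFinD; congr EFin; rewrite /swapped /bd.
  by case: (bad z); rewrite ?subrr ?subr0 ?mul1r ?mul0r ?addr0 ?add0r.
rewrite ge0_integralD//; last 2 first.
- by move=> z _; rewrite lee_fin mulr_ge0.
- by move=> z _; rewrite lee_fin mulr_ge0.
rewrite -(integral_swap mi2); last by move=> z; rewrite lee_fin mulr_ge0.
transitivity (\int[m2]_z ((bd z * \1_A (T z.1))%:E + ((1 - bd z) * \1_A (T z.1))%:E))%E.
  rewrite ge0_integralD//; last 2 first.
  - by move=> z _; rewrite lee_fin mulr_ge0.
  - by move=> z _; rewrite lee_fin mulr_ge0.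
  by congr (_ + _)%E; apply: eq_integral => z _; rewrite /bd badC.
rewrite -(integral_fst mI); last by move=> x; rewrite lee_fin.
by apply: eq_integral => z _; rewrite -EFinD; congr EFin; ring.
Qed.

Let cost (x y : X) : R := sqnorm (tsub x y).
Let cost0 x y : 0 <= cost x y. Proof. exact: sqnorm_ge0. Qed.
Let mcost (a b : X * X -> X) : measurable_fun setT a -> measurable_fun setT b ->
  measurable_fun setT (fun z => cost (a z) (b z)).
Proof. by move=> ma mb; apply: measurable_sqnorm; exact: measurable_tsub. Qed.

Hypothesis fin : (\int[nu]_x (cost x (T x))%:E < +oo)%E.
Hypothesis opt : (\int[nu]_x (cost x (T x))%:E <= \int[m2]_z (cost z.1 (swapped z))%:E)%E.

(** The cost is divided according to [bad]: [a] is the exchanged cost on bad pairs, [c] the original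
    one there, and [b] the part common to both couplings. *)
Let a z := bd z * cost z.1 (T z.2).
Let b z := (1 - bd z) * cost z.1 (T z.1).
Let c z := bd z * cost z.1 (T z.1).
Let nb z : 0 <= 1 - bd z. Proof. by rewrite /bd; case: (bad z); rewrite ?subrr ?subr0. Qed.
Let a0 z : 0 <= a z. Proof. exact: mulr_ge0. Qed.
Let b0 z : 0 <= b z. Proof. exact: mulr_ge0. Qed.
Let c0 z : 0 <= c z. Proof. exact: mulr_ge0. Qed.
Let ma : measurable_fun setT a. Proof. by apply: measurable_funM => //; exact: mcost. Qed.
Let mc : measurable_fun setT c. Proof. by apply: measurable_funM => //; exact: mcost. Qed.
Let mb : measurable_fun setT b.
Proof. by apply: measurable_funM; [exact: measurable_funB|exact: mcost]. Qed.
Let maE : measurable_fun setT (EFin \o a). Proof. exact/measurable_EFinP. Qed.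
Let mbE : measurable_fun setT (EFin \o b). Proof. exact/measurable_EFinP. Qed.
Let mcE : measurable_fun setT (EFin \o c). Proof. exact/measurable_EFinP. Qed.
Let IE (h : X * X -> R) := (\int[m2]_z (h z)%:E)%E.

Let Ibc : (IE b + IE c = \int[nu]_x (cost x (T x))%:E)%E.
Proof.
rewrite /IE -ge0_integralD//; last 2 first.
- by move=> z _; rewrite lee_fin.
- by move=> z _; rewrite lee_fin.
rewrite -(integral_fst (H := fun x => (cost x (T x))%:E)).
- by apply: eq_integral => z _; rewrite -EFinD; congr EFin; rewrite /b /c; ring.
- by apply/measurable_EFinP; apply: measurable_sqnorm; exact: measurable_tsub.
- by move=> x; rewrite lee_fin.
Qed.

Let Iab : (IE a + IE b = \int[m2]_z (cost z.1 (swapped z))%:E)%E.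
Proof.
rewrite /IE -ge0_integralD//; last 2 first.
- by move=> z _; rewrite lee_fin.
- by move=> z _; rewrite lee_fin.
apply: eq_integral => z _; rewrite -EFinD; congr EFin; rewrite /a /b /swapped /bd.
by case: (bad z); rewrite ?subrr ?subr0 ?mul1r ?mul0r ?addr0 ?add0r.
Qed.

Let IEge0 h : (forall z, 0 <= h z) -> (0 <= IE h)%E.
Proof. by move=> h0; apply: integral_ge0 => z _; rewrite lee_fin. Qed.

Let b_fin : IE b \is a fin_num.
Proof.
rewrite ge0_fin_numE ?IEge0//; apply: le_lt_trans fin; rewrite -Ibc.
by rewrite leeDl// IEge0.
Qed.

Let c_fin : (IE c < +oo)%E.
Proof. by apply: le_lt_trans fin; rewrite -Ibc leeDr// IEge0. Qed.

(** Optimality after cancelling the common part, which is allowed because [b] has a finite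
    integral. *)
Let ca : (IE c <= IE a)%E.
Proof.
have := opt; rewrite -Ibc -Iab [leRHS]addeC => h.
by move: h; rewrite leeD2lE.
Qed.

(** An exchange lowers the cost of a pair only when the contributions of [z] and of its mirror image
    are added; hence the symmetrization. Then [u <= v] pointwise, strictly on bad pairs, while
    optimality gives the reverse inequality for integrals. *)
Let u z := a z + a (z.2, z.1).
Let v z := c z + c (z.2, z.1).

Let sw_int h : measurable_fun setT (EFin \o h) -> (forall z, 0 <= h z) ->
  (IE (fun z => (h z + h (z.2, z.1))%R) = IE h + IE h)%E.
Proof.
move=> mh h0; rewrite -[X in _ = (_ + X)%E](integral_swap mh); last by move=> z; rewrite lee_fin.
rewrite /IE -ge0_integralD//.
- by move=> z _; rewrite lee_fin.
- by move=> z _; rewrite lee_fin.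
- by apply: measurableT_comp mh _; exact: measurable_fun_pair.
Qed.

Let vu z : v z - u z = - 2 * (bd z * dot (tsub z.1 z.2) (tsub (T z.1) (T z.2))).
Proof.
rewrite /u /v /a /c /bd badC /= /cost !sqnorm_tsub.
have -> : dot (tsub z.1 z.2) (tsub (T z.1) (T z.2)) =
    dot z.1 (T z.1) + dot z.2 (T z.2) - dot z.1 (T z.2) - dot z.2 (T z.1).
  rewrite /dot -!big_split -!sumrB/=; apply: eq_bigr => k _; rewrite !tnth_mktuple; ring.
by ring.
Qed.

Let ae_good2 : {ae m2, forall z, ~~ bad z}.
Proof.
have uv z : u z <= v z.
  rewrite -subr_ge0 vu /bd; case: (boolP (bad z)) => [bz|_]; last by rewrite mul0r mulr0.
  by rewrite mul1r mulNr oppr_ge0 pmulr_rle0// ltW.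
have msw (h : X * X -> R) : measurable_fun setT h -> measurable_fun setT (fun z : X * X => h (z.2, z.1)).
  by move=> mh; apply: measurableT_comp mh _; exact: measurable_fun_pair.
have mu' : measurable_fun setT u by apply: measurable_funD => //; exact: msw.
have mv' : measurable_fun setT v by apply: measurable_funD => //; exact: msw.
have u0 z : 0 <= u z by rewrite addr_ge0.
have v0 z : 0 <= v z by rewrite addr_ge0.
have Iu : IE u = (IE a + IE a)%E by exact: sw_int.
have Iv : IE v = (IE c + IE c)%E by exact: sw_int.
have vfin : (IE v < +oo)%E by rewrite Iv lte_add_pinfty.
have vu' : (IE v <= IE u)%E by rewrite Iu Iv; exact: leeD.
have uv' : (IE u <= IE v)%E.
  apply: ge0_le_integral => //.
  - by move=> z _; rewrite lee_fin.
  - exact/measurable_EFinP.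
  - exact/measurable_EFinP.
  - by move=> z _; rewrite lee_fin.
have ufin : (IE u < +oo)%E by exact: le_lt_trans uv' vfin.
have := integral_saturated_ae mu' mv' u0 v0 (aeW _ uv) ufin vu'.
apply: filterS => z e; apply/negP => bz.
have := vu z; rewrite e subrr /bd bz mul1r => /esym/eqP; rewrite mulf_eq0 oppr_eq0 pnatr_eq0/= => /eqP z0.
by move: bz; rewrite /bad z0 ltxx.
Qed.

Lemma optimal_monotone : {ae Leb d, forall x, {ae Leb d, forall y, 0 < f x -> 0 < f y ->
  0 <= dot (tsub x y) (tsub (T x) (T y))}}.
Proof.
have [[mf f0 _] H] := Hf.
have mB : measurable_fun setT (fun z : X * X => (bd z)%:E : \bar R) by exact/measurable_EFinP.
have B0 z : (0 <= (bd z)%:E)%E by rewrite lee_fin.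
have I0 : (\int[m2]_z (bd z)%:E = 0)%E.
  apply/(ae_integral0E m2 mB B0); apply: filterS ae_good2 => z h.
  by rewrite /bd (negbTE h).
have mBx x : measurable_fun setT (fun y => (bd (x, y))%:E : \bar R).
  by apply: measurableT_comp mB _.
have mF : measurable_fun setT (fun x => \int[nu]_y (bd (x, y))%:E)%E.
  exact: (measurable_fun_fubini_tonelli_F (m2 := nu) (fun z => (bd z)%:E)).
have F0 x : (0 <= \int[nu]_y (bd (x, y))%:E)%E by apply: integral_ge0.
move: I0; rewrite fubini_tonelli1// /fubini_F (H _ mF F0).
have mfF : measurable_fun setT (fun x => (f x)%:E * \int[nu]_y (bd (x, y))%:E)%E.
  by apply: emeasurable_funM => //; exact/measurable_EFinP.
have fF0 x : (0 <= (f x)%:E * \int[nu]_y (bd (x, y))%:E)%E by rewrite mule_ge0 ?lee_fin.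
move=> /(ae_integral0E (Leb d) mfF fF0); apply: filterS => x /eqP.
rewrite mule_eq0 => /orP[/eqP[] fx|/eqP].
  by apply: aeW => y; rewrite fx ltxx.
rewrite (H _ (mBx x) (fun y => B0 _)).
have mfB : measurable_fun setT (fun y => (f y)%:E * (bd (x, y))%:E)%E.
  by apply: emeasurable_funM => //; exact/measurable_EFinP.
have fB0 y : (0 <= (f y)%:E * (bd (x, y))%:E)%E by rewrite mule_ge0 ?lee_fin.
move=> /(ae_integral0E (Leb d) mfB fB0); apply: filterS => y e _ fy.
rewrite leNgt; apply/negP => h; move: e; rewrite /bd /bad /= h mule1 => -[] fy0.
by move: fy; rewrite fy0 ltxx.
Qed.

End swap.

(** * Positive definite forms and the Gaussian pair *)

Section posdef.
Context {R : realType} (d : nat).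
Implicit Types (C : 'M[R]_d) (x y : d.-tuple R).

Lemma posdef_unit C : posdef C -> C \in unitmx.
Proof.
move=> [_ Cp]; rewrite -row_free_unit -kermx_eq0; apply: contraT => /rowV0Pn[v].
move=> /sub_kermxP vC v0; have := Cp v v0.
by rewrite vC mul0mx mxE ltxx.
Qed.

Lemma qform_inv_lin C x : posdef C -> qform (invmx C) (lin C x) = qform C x.
Proof.
move=> Cp; rewrite /qform rv_lin trmx_mul Cp.1 mulmxK ?posdef_unit//.
by rewrite mulmxA.
Qed.

Lemma qform_ge0 C x : posdef C -> 0 <= qform C x.
Proof.
move=> Cp; have [x0|x0] := eqVneq (rv x) 0; first by rewrite /qform x0 !mul0mx mxE.
by rewrite ltW//; exact: Cp.2.
Qed.

Lemma posdef_inv C : posdef C -> posdef (invmx C).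
Proof.
move=> Cp; have uC := posdef_unit Cp; split; first by rewrite trmx_inv Cp.1.
move=> v v0; have := Cp.2 (v *m invmx C); rewrite trmx_mul trmx_inv Cp.1 mulmxKV// mulmxA.
by apply; apply: contra_neq v0 => e; rewrite -(mulmxKV uC v) e mul0mx.
Qed.

(** Expansion of the nonnegative form of [C] at [invmx C x - y]. *)
Lemma fenchel_young C x y : posdef C -> 2 * dot x y <= qform (invmx C) x + qform C y.
Proof.
move=> Cp; have uC := posdef_unit Cp.
have := qform_ge0 (tsub (lin (invmx C) x) y) Cp.
rewrite /qform rv_tsub rv_lin linearB/= trmx_mul trmx_inv Cp.1 mulmxBl mulmxKV// mulmxBl !mulmxBr mulmxA.
have -> : rv y *m C *m (invmx C *m (rv x)^T) = rv y *m (rv x)^T by rewrite mulmxA mulmxK.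
rewrite [X in 0 <= X]mxE [X in 0 <= _ + X]mxE [X in 0 <= X + _]mxE [X in 0 <= _ + X + _]mxE [X in 0 <= _ - X]mxE.
rewrite [X in 0 <= _ - (_ + X)]mxE -!dotE (dotC y x); lra.
Qed.

End posdef.

Section gaussian_pair.
Context {R : realType} (d : nat).
Local Notation Leb := (@Leb R).
Local Notation X := (d.-tuple R).
Variables (f g : X -> R) (T Z : X -> X) (M : 'M[R]_d) (b : X).
Hypotheses (df : density f) (dg : density g) (cf : centered_density f) (cg : centered_density g).
Hypotheses (mT : measurable_fun setT T) (TP : push_to f T g) (gpos : {ae Leb d, forall x, 0 < f x -> 0 < g (T x)}).
Hypotheses (Mp : posdef M) (HM : {ae Leb d, forall x, [/\ 0 < f x, rv (T x) = rv x *m M + rv b,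
        sqnorm (Z x) = qform M x & f x / g (T x) = \det M]}).
Hypothesis HZ : {ae Leb d, forall x, 0 < f x -> f x = gam (Z x) * Num.sqrt (f x / g (T x))}.

Let ae_ex (P : X -> Prop) : {ae Leb d, forall x, P x} -> exists x, P x.
Proof.
move=> h; apply: contrapT => nP; have [_ _ f1] := df.
have : (\int[Leb d]_x (f x)%:E = 0)%E.
  transitivity (\int[Leb d]_x (cst 0 x : \bar R))%E; last by rewrite integral0.
  apply: ae_eq_integral => //; first by case: df => mf _ _; exact/measurable_EFinP.
  by apply: filterS h => x Px; exfalso; apply: nP; exists x.
by rewrite f1 => -[] /eqP; rewrite oner_eq0.
Qed.

Let detM : 0 < \det M.
Proof.
have [x [[fx _ _ <-] gx]] := ae_ex (filterI HM gpos).
by rewrite divr_gt0// gx.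
Qed.

(** The mean of the image law is the image of the mean of [f] plus [b], and both laws are
    centered. *)
Let b0 : rv b = 0.
Proof.
apply/rowP => k; rewrite !mxE.
have [mf f0 f1] := df; have [mg g0 _] := dg.
have mt : measurable_fun setT (fun x : X => tnth x k) by exact: measurable_tnth.
have := push_integral f0 g0 mt TP.
have -> : (\int[Leb d]_x (g x * tnth x k)%:E = 0)%E.
  by rewrite -[RHS](cg k).2; apply: eq_integral => x _; rewrite mulrC.
have ic j : (Leb d).-integrable setT (fun x : X => (f x * (tnth x j * M j k))%:E).
  have := integrableZ (M j k) (cf j).1; congr (_.-integrable _ _).
  by apply/funext => x /=; congr EFin; ring.
have ib : (Leb d).-integrable setT (fun x : X => (tnth b k * f x)%:E).
  exact: (integrableZ (tnth b k) (density_integrable df)).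
have is' : (Leb d).-integrable setT (fun x : X => (\sum_j (f x * (tnth x j * M j k))%:E)%E).
  by apply: integrable_sum => // j _; exact: ic.
have -> : (\int[Leb d]_x (f x * tnth (T x) k)%:E =
    \int[Leb d]_x ((\sum_j (f x * (tnth x j * M j k))%:E) + (tnth b k * f x)%:E))%E.
  apply: ae_eq_integral => //.
  - apply/measurable_EFinP; apply: measurable_funM => //; exact: measurableT_comp mt mT.
  - by apply: emeasurable_funD; [case/integrableP: is'|case/integrableP: ib].
  - apply: filterS HM => x [_ e _ _] _; have := congr1 (fun v : 'rV[R]_d => v ord0 k) e.
    rewrite !mxE => ->; rewrite sumEFin -EFinD; congr EFin.
    by rewrite mulrDr mulr_sumr [tnth b k * _]mulrC; congr (_ + _); apply: eq_bigr => j _; rewrite !mxE.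
have -> := integralD measurableT is' ib.
rewrite integral_sum//.
have -> : (\sum_j \int[Leb d]_x (f x * (tnth x j * M j k))%:E = 0)%E.
  apply: big1 => j _; transitivity ((M j k)%:E * \int[Leb d]_x (tnth x j * f x)%:E)%E.
    rewrite -integralZl//; last exact: (cf j).1.
    by apply: eq_integral => x _; rewrite -EFinM; congr EFin; ring.
  by rewrite (cf j).2 mule0.
rewrite add0e; transitivity (fine (\int[Leb d]_x (tnth b k * f x)%:E)%E); last by rewrite H.
transitivity (fine ((tnth b k)%:E * \int[Leb d]_x (f x)%:E)%E).
  by rewrite f1 mule1.
by rewrite -(integralZl measurableT (density_integrable df)).
Qed.

(** The equality clause gives [f] explicitly, since |Z|^2 is the form of [M] and the Jacobian ratio
    is its determinant. The same ratio then gives [g] along the image, and invertibility of [M]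
    reaches almost every point. *)
Lemma gaussian_pair : {ae Leb d, forall x, f x = gauss_density (invmx M) x} /\
  {ae Leb d, forall x, g x = gauss_density M x}.
Proof.
have uM := posdef_unit Mp; have sM : 0 < Num.sqrt (\det M) by rewrite sqrtr_gt0.
pose c : R := (Num.sqrt (2 * pi))^-1 ^+ d.
have fE : {ae Leb d, forall x, f x = c * expR (- qform M x / 2) * Num.sqrt (\det M)}.
  apply: filterS (filterI HM HZ) => x [[fx _ zx e] /(_ fx)].
  by rewrite e => {1}->; rewrite /gam zx.
have gE : {ae Leb d, forall x, g (lin M x) = gauss_density M (lin M x)}.
  apply: filterS (filterI fE (filterI HM gpos)) => x [fx [[fx0 Tx _ e] /(_ fx0) gx]].
  have TE : T x = lin M x by apply: rv_inj; rewrite Tx rv_lin b0 addr0.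
  rewrite TE in e gx; rewrite gauss_densityE qform_inv_lin// -/c.
  have -> : g (lin M x) = f x / \det M by rewrite -e; field; rewrite !gt_eqF.
  rewrite fx -{2}(sqr_sqrtr (ltW detM)); field; rewrite gt_eqF//.
split.
  apply: filterS fE => x ->; rewrite gauss_densityE invmxK det_inv sqrtrV ?ltW// invrK -/c; ring.
have uM' : invmx M \in unitmx by rewrite unitmx_inv.
apply: filterS (ae_lin uM' gE) => x; have -> : lin M (lin (invmx M) x) = x.
  by apply: rv_inj; rewrite !rv_lin mulmxKV.
by [].
Qed.

End gaussian_pair.

(** * Bounds on the optimal cost *)

Section coupling_bounds.
Context {R : realType} (d n : nat).
Local Notation Leb := (@Leb R).
Local Notation X := (d.-tuple R).
Local Notation IL h := (\int[Leb d]_x h x).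
Local Notation integ h := ((Leb d).-integrable setT (EFin \o h)).
Variables (mu : 'I_n -> probability X R) (lam : 'I_n -> R).
Hypotheses (lam0 : forall i, 0 < lam i) (lam1 : \sum_i lam i = 1).

Lemma opt_cost_ge0 : (0 <= opt_cost mu lam)%E.
Proof.
apply: le_ereal_inf_tmp => _ [P [_ ->]]; apply: integral_ge0 => x _.
by rewrite lee_fin mm_cost_ge0.
Qed.

Lemma opt_cost_le_maps dT (T : measurableType dT) (nu : probability T R) (Y : 'I_n -> T -> X) :
  (forall i, measurable_fun setT (Y i)) ->
  (forall i A, measurable A -> (\int[nu]_x (\1_A (Y i x))%:E = mu i A)%E) ->
  (opt_cost mu lam <= \int[nu]_x (mm_cost lam [tuple Y i x | i < n])%:E)%E.
Proof.
move=> mY H; have [P [cP PE]] := coupling_of_maps mY H.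
apply: ereal_inf_lbound; exists P; split=> //; rewrite PE//; first exact: measurable_mm_cost.
by move=> x; exact: mm_cost_ge0.
Qed.

Lemma coupling_marginal P (i : 'I_n) (phi : X -> \bar R) : is_coupling mu P ->
  measurable_fun setT phi -> (forall x, 0 <= phi x)%E ->
  (\int[P]_x phi (tnth x i) = \int[mu i]_x phi x)%E.
Proof.
move=> cP mphi phi0; have mt : measurable_fun setT (fun x : n.-tuple X => tnth x i) by exact: measurable_tnth.
transitivity (\int[pushforward P (fun x : n.-tuple X => tnth x i)]_x phi x)%E.
  by rewrite (ge0_integral_pushforward mt).
by apply: eq_measure_integral => A mA _; exact: cP.
Qed.

Variable f : 'I_n -> X -> R.
Hypothesis Hf : forall i, has_density (mu i) (f i).

Lemma push_law i0 i (Y : X -> X) (A : set X) : measurable_fun setT Y -> push_to (f i0) Y (f i) ->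
  measurable A -> (\int[mu i0]_x (\1_A (Y x))%:E = mu i A)%E.
Proof.
move=> mY pY mA; have mi : measurable_fun setT (\1_A : X -> R) by exact: measurable_indic.
have mI : measurable_fun setT (fun x => (\1_A x)%:E : \bar R) by exact/measurable_EFinP.
have I0 x : (0 <= (\1_A x : R)%:E)%E by rewrite lee_fin.
rewrite (has_density_prob (Hf i) mA) -(pY _ mI I0).
by apply: (Hf i0).2 => [|x]; [apply/measurable_EFinP; exact: measurableT_comp mi mY|exact: I0].
Qed.

Lemma opt_cost_le_push i0 (Y : 'I_n -> X -> X) : (forall i, measurable_fun setT (Y i)) ->
  (forall i, push_to (f i0) (Y i) (f i)) ->
  (opt_cost mu lam <= \int[Leb d]_x (f i0 x * wcost lam [set: 'I_n]%SET (Y^~ x))%:E)%E.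
Proof.
move=> mY pY; apply: le_trans (opt_cost_le_maps mY _) _.
  by move=> i A mA; exact: push_law (pY i) mA.
have mm : measurable_fun setT (fun x => mm_cost lam [tuple Y i x | i < n]).
  by apply: measurableT_comp; [exact: measurable_mm_cost|exact: measurable_tuple_maps].
rewrite (has_density_integral (Hf i0) mm).
by under eq_integral do rewrite (mm_cost_wcost (Y^~ _) lam1).
Qed.

Hypotheses (f2 : forall i, fin2 (f i)) (cf : forall i, centered_density (f i)).

(** Transporting one marginal to all others gives a coupling with finite cost, from second moments
    alone. As the left side is then always finite, equality will exclude infinite relative
    entropies. *)
Lemma opt_cost_lty (i0 : 'I_n) : (opt_cost mu lam < +oo)%E.
Proof.
have df i : density (f i) := (Hf i).1.
have w12 : 0 < (2^-1 : R) < 1 by apply/andP; split; [rewrite invr_gt0|rewrite invf_lt1 ?ltr1n].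
have /choice[Y HY] : forall i, exists Y : X -> X, measurable_fun setT Y /\ push_to (f i0) Y (f i).
  move=> i; have [T [Z [DB [DZ TP]]]] := pair_lemma w12 (df i0) (df i) (cf i0).
  by exists T; split; [exact: tp_mT TP|exact: tp_push TP].
have mY i := (HY i).1; have pY i := (HY i).2.
apply: le_lt_trans (opt_cost_le_push mY pY) _.
have [m0 f0 _] := df i0.
have iY i : integ (fun x => f i0 x * sqnorm (Y i x)).
  exact: ((push_fin2 (df i0) (df i) (mY i) (pY i)).1 (f2 i)).
have iS : (Leb d).-integrable setT (fun x => (\sum_i (lam i * (f i0 x * sqnorm (Y i x)))%:E)%E).
  by apply: integrable_sum => // i _; exact: (integrableZ (lam i) (iY i)).
have wT : wsum lam [set: 'I_n]%SET = 1 by rewrite /wsum -lam1; apply: eq_bigl => i; rewrite inE.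
have wle x : wcost lam [set: 'I_n]%SET (Y^~ x) <= \sum_i lam i * sqnorm (Y i x).
  rewrite /wcost wT expr1n !mul1r lerBlDr; apply: (@le_trans _ _ (\sum_i lam i * sqnorm (Y i x))).
    by rewrite le_eqVlt; apply/orP; left; apply/eqP; apply: eq_bigl => i; rewrite inE.
  by rewrite lerDl sqnorm_ge0.
have w0 x : 0 <= wcost lam [set: 'I_n]%SET (Y^~ x).
  by rewrite -mm_cost_wcost//; exact: mm_cost_ge0.
have mw : measurable_fun setT (fun x => wcost lam [set: 'I_n]%SET (Y^~ x)).
  have -> : (fun x => wcost lam [set: 'I_n]%SET (Y^~ x)) = (fun x => mm_cost lam [tuple Y i x | i < n]).
    by apply/funext => x; rewrite mm_cost_wcost.
  by apply: measurableT_comp; [exact: measurable_mm_cost|exact: measurable_tuple_maps].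
apply: (@le_lt_trans _ _ (\int[Leb d]_x (\sum_i (lam i * (f i0 x * sqnorm (Y i x)))%:E))%E).
  apply: ge0_le_integral => //.
  - by move=> x _; rewrite lee_fin mulr_ge0.
  - by apply/measurable_EFinP; exact: measurable_funM.
  - by case/integrableP: iS.
  - move=> x _; rewrite sumEFin lee_fin; apply: le_trans (ler_wpM2l (f0 x) (wle x)) _.
    rewrite mulr_sumr le_eqVlt; apply/orP; left; apply/eqP.
    by apply: eq_bigr => i _; ring.
by case/fin_numPlt: (integrable_fin_num measurableT iS) => /andP[].
Qed.

(** The source [i0] of the chain is arbitrary, so although rigidity is stated for the source only,
    it can be applied to every marginal in turn. *)
Lemma finite_entropy_bound (i0 : 'I_n) : (forall i, ent (f i) < +oo)%E ->
  exists c : R, [/\ (opt_cost mu lam <= c%:E)%E,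
    2^-1 * c <= \sum_i lam i * (1 - lam i) * IL (klf (f i)) &
    (2 < n)%N -> 2^-1 * c = \sum_i lam i * (1 - lam i) * IL (klf (f i)) ->
    {ae Leb d, forall x, f i0 x = gam x}].
Proof.
move=> ef; have df i : density (f i) := (Hf i).1.
have i0T : i0 \in [set: 'I_n]%SET by rewrite inE.
have [Y [k C]] := chain_exists df cf f2 ef lam0 i0T.
have wT : wsum lam [set: 'I_n]%SET = 1 by rewrite /wsum -lam1; apply: eq_bigl => i; rewrite inE.
have SE : \sum_(i in [set: 'I_n]%SET) lam i * (wsum lam [set: 'I_n]%SET - lam i) * IL (klf (f i)) =
    \sum_i lam i * (1 - lam i) * IL (klf (f i)).
  by rewrite wT; apply: eq_bigl => i; rewrite inE.
exists (IL (fun x => f i0 x * wcost lam [set: 'I_n]%SET (Y^~ x))); split.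
- apply: le_trans (opt_cost_le_push (ch_mY C) _) _.
    by move=> i; apply: ch_push C _ _; rewrite inE.
  rewrite ge0_Rintegral//; last exact: ch_int C.
  have [_ f0 _] := df i0; move=> x; rewrite mulr_ge0//.
  by rewrite -mm_cost_wcost//; exact: mm_cost_ge0.
- by rewrite -SE; exact: ch_cost C.
- rewrite -SE => n2; apply: ch_rigid3 C _; by rewrite cardsT card_ord.
Qed.

End coupling_bounds.

Lemma ord2P (i : 'I_2) : i = ord0 \/ i = ord_max.
Proof. by case: i => [[|[|//]]] hi; [left|right]; apply: val_inj. Qed.

Lemma sum_ord2 (V : nmodType) (F : 'I_2 -> V) : \sum_(i < 2) F i = F ord0 + F ord_max.
Proof. by rewrite big_ord_recl big_ord1; congr (_ + F _); exact: val_inj. Qed.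

Section two_marginals.
Context {R : realType} (d : nat).
Local Notation Leb := (@Leb R).
Local Notation X := (d.-tuple R).
Local Notation IL h := (\int[Leb d]_x h x).
Local Notation integ h := ((Leb d).-integrable setT (EFin \o h)).
Variables (mu : 'I_2 -> probability X R) (lam : 'I_2 -> R) (f : 'I_2 -> X -> R).
Hypotheses (lam0 : forall i, 0 < lam i) (lam1 : \sum_i lam i = 1).
Hypotheses (Hf : forall i, has_density (mu i) (f i)) (f2 : forall i, fin2 (f i))
  (cf : forall i, centered_density (f i)).
Let df i : density (f i) := (Hf i).1.
Let l := lam ord0 * lam ord_max.
Let l0 : 0 < l. Proof. exact: mulr_gt0. Qed.
Let D i := IL (klf (f i)).

Lemma mm_cost2 (x : 2.-tuple X) :
  mm_cost lam x = l * sqnorm (tsub (tnth x ord0) (tnth x ord_max)).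
Proof.
rewrite /mm_cost sum_ord2 [X in _ + X]big_pred0 ?addr0; last first.
  by move=> j; have [->|->] := ord2P j.
by rewrite big_mkcond sum_ord2/= add0r sqdistE.
Qed.

Lemma rhs2E : \sum_i lam i * (1 - lam i) * D i = l * (D ord0 + D ord_max).
Proof.
move: lam1; rewrite !sum_ord2 => e; rewrite /l.
have -> : 1 - lam ord0 = lam ord_max by rewrite -e; ring.
have -> : 1 - lam ord_max = lam ord0 by rewrite -e; ring.
by ring.
Qed.

Lemma opt_cost2_le dT (T : measurableType dT) (nu : probability T R) (Y0 Y1 : T -> X) :
  measurable_fun setT Y0 -> measurable_fun setT Y1 ->
  (forall A, measurable A -> (\int[nu]_x (\1_A (Y0 x))%:E = mu ord0 A)%E) ->
  (forall A, measurable A -> (\int[nu]_x (\1_A (Y1 x))%:E = mu ord_max A)%E) ->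
  (opt_cost mu lam <= l%:E * \int[nu]_x (sqnorm (tsub (Y0 x) (Y1 x)))%:E)%E.
Proof.
move=> m0 m1 h0 h1; pose Y (i : 'I_2) := if i == ord0 then Y0 else Y1.
have mY i : measurable_fun setT (Y i) by have [->|->] := ord2P i.
have HY i A : measurable A -> (\int[nu]_x (\1_A (Y i x))%:E = mu i A)%E.
  by have [->|->] := ord2P i; [exact: h0|exact: h1].
apply: le_trans (opt_cost_le_maps lam0 mY HY) _.
rewrite -ge0_integralZl//.
- rewrite le_eqVlt; apply/orP; left; apply/eqP; apply: eq_integral => x _.
  by rewrite mm_cost2 !tnth_mktuple -EFinM.
- by apply/measurable_EFinP; apply: measurable_sqnorm; exact: measurable_tsub.
- by move=> x _; rewrite lee_fin sqnorm_ge0.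
- by rewrite lee_fin ltW.
Qed.

(** Equality squeezes the cost of the constructed map between the optimal cost and the entropies.
    The map is thus optimal, hence monotone, and the equality clause of the transport pair
    applies. *)
Lemma gaussian_of_equality : (forall i, ent (f i) < +oo)%E ->
  ((2^-1)%:E * opt_cost mu lam = (l * (D ord0 + D ord_max))%:E)%E ->
  exists M : 'M[R]_d, [/\ posdef M,
    {ae Leb d, forall x, f ord0 x = gauss_density (invmx M) x} &
    {ae Leb d, forall x, f ord_max x = gauss_density M x}].
Proof.
move=> ef eqD; have w12 : 0 < (2^-1 : R) < 1 by apply/andP; split; [rewrite invr_gt0|rewrite invf_lt1 ?ltr1n].
have [T [Z [DB [DZ TP]]]] := pair_lemma w12 (df ord0) (df ord_max) (cf ord0).
have mT := tp_mT TP; have pT : push_to (f ord0) T (f ord_max) := tp_push TP.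
have [t1 t2] := talagrand_pair (df ord0) (df ord_max) (f2 ord0) (f2 ord_max) (ef ord0) (ef ord_max) TP.
have iW := cost_integrable (df ord0) (df ord_max) (f2 ord0) (f2 ord_max) TP.
set W := IL (fun x => f ord0 x * sqnorm (tsub x (T x))) in t1 t2.
have [m0 f0 _] := df ord0.
have mW : measurable_fun setT (fun x => sqnorm (tsub x (T x))).
  by apply: measurable_sqnorm; exact: measurable_tsub.
have WE : (\int[mu ord0]_x (sqnorm (tsub x (T x)))%:E = W%:E)%E.
  rewrite (has_density_integral (Hf ord0) mW) ge0_Rintegral//.
  by move=> x; rewrite mulr_ge0// sqnorm_ge0.
have oW : (opt_cost mu lam <= (l * W)%:E)%E.
  rewrite EFinM -WE; apply: (opt_cost2_le (Y0 := id)) => //.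
    by move=> A mA; exact: integral_prob_indic.
  by move=> A mA; exact: (push_law Hf mT pT mA).
have oE : opt_cost mu lam = (l * (2 * (D ord0 + D ord_max)))%:E.
  have -> : l * (2 * (D ord0 + D ord_max)) = 2 * (l * (D ord0 + D ord_max)) by ring.
  by rewrite EFinM -eqD muleA -EFinM divff ?pnatr_eq0// mul1e.
have WD : 2^-1 * W = D ord0 + D ord_max.
  move: oW; rewrite oE lee_fin ler_pM2l// /D => oW.
  move: t1 oW; set D0 := IL _; set D1 := IL _; lra.
have H12 := t2 WD.
(* The exchanged map on the product of two copies of the first law is again a coupling of the two
   marginals, so its cost is at least the optimal one. *)
have H3 : {ae Leb d, forall x, {ae Leb d, forall y, 0 < f ord0 x -> 0 < f ord0 y ->
  0 <= dot (tsub x y) (tsub (T x) (T y))}}.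
  apply: (optimal_monotone (Hf ord0) mT); rewrite WE ?ltry//.
  have sl : forall A, measurable A -> (\int[(mu ord0 \x mu ord0)%E]_z (\1_A (swapped T z))%:E = mu ord_max A)%E.
    by move=> A mA; rewrite (swapped_law _ mT mA); exact: (push_law Hf mT pT mA).
  have fl : forall A, measurable A -> (\int[(mu ord0 \x mu ord0)%E]_z (\1_A z.1)%:E = mu ord0 A)%E.
    move=> A mA; rewrite (integral_fst (mu ord0) (H := fun x => (\1_A x)%:E)).
    + exact: integral_prob_indic.
    + by apply/measurable_EFinP; exact: measurable_indic.
    + by move=> x; rewrite lee_fin.
  have := opt_cost2_le measurable_fst (measurable_swapped mT) fl sl.
  rewrite oE EFinM lee_pmul2l ?lte_fin//; apply: le_trans.
  by rewrite lee_fin -WD; lra.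
have H1 : {ae Leb d, forall x, 0 < f ord0 x -> f ord0 x = gam (Z x) * Num.sqrt (f ord0 x / f ord_max (T x))}.
  by apply: filterS H12 => x h fx; have [] := h fx.
have H2 : {ae Leb d, forall x, 0 < f ord0 x -> Num.sqrt (f ord0 x / f ord_max (T x)) = DZ x}.
  by apply: filterS H12 => x h fx; have [] := h fx.
have [M [b [Mp HM]]] := tp_linear TP H1 H2 H3.
have [] := gaussian_pair (df ord0) (df ord_max) (cf ord0) (cf ord_max) mT pT (tp_gpos TP) Mp HM H1.
by exists M.
Qed.

(** Only the lower bound on the optimal cost is at stake: Fenchel-Young for [C], integrated over an
    arbitrary coupling, involves nothing but moments of the marginals. *)
Lemma equality_of_gaussian (C : 'M[R]_d) : posdef C ->
  is_gaussian (mu ord0) C -> is_gaussian (mu ord_max) (invmx C) ->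
  (forall i, ent (f i) < +oo)%E /\
  ((l * (D ord0 + D ord_max))%:E <= (2^-1)%:E * opt_cost mu lam)%E.
Proof.
move=> Cp g0 g1; have [dG0 e0] := gaussian_ae (Hf ord0) g0; have [dG1 e1] := gaussian_ae (Hf ord_max) g1.
have d0 := density_gauss_det dG0; have d1 := density_gauss_det dG1.
have [E0 K0] := gauss_klf_integral (df ord0) (f2 ord0) d0 e0.
have [E1 K1] := gauss_klf_integral (df ord_max) (f2 ord_max) d1 e1.
split; first by move=> i; have [->|->] := ord2P i.
have [m0 p0 _] := df ord0; have [m1 p1 _] := df ord_max.
have s0 : 0 < Num.sqrt (\det C) by rewrite sqrtr_gt0.
rewrite invmxK det_inv sqrtrV ?ltW// invrK in K1; rewrite lnV ?posrE// in K0.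
have iq0 := integrable_qform (invmx C) m0 p0 (f2 ord0).
have iq1 := integrable_qform C m1 p1 (f2 ord_max).
set a0 := IL (fun x => f ord0 x * sqnorm x) in K0.
set q0 := IL (fun x => f ord0 x * qform (invmx C) x) in K0.
set a1 := IL (fun x => f ord_max x * sqnorm x) in K1.
set q1 := IL (fun x => f ord_max x * qform C x) in K1.
(* The logarithms of the determinants of [C] and its inverse cancel in the sum. *)
have K : 2 * (D ord0 + D ord_max) = a0 + a1 - q0 - q1.
  by rewrite /D K0 K1; set s := ln _; field.
rewrite (_ : l * _ = 2^-1 * (l * (a0 + a1 - q0 - q1))); last by rewrite -K; field.
rewrite EFinM lee_pmul2l//; apply: le_ereal_inf_tmp => _ [P [cP ->]].
have mt (i : 'I_2) : measurable_fun setT (fun x : 2.-tuple X => tnth x i) by exact: measurable_tnth.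
have Cp' := posdef_inv Cp.
have ms : measurable_fun setT (fun x : X => sqnorm x) by exact: measurable_sqnorm.
have marg (i : 'I_2) (h : X -> R) : measurable_fun setT h -> (forall x, 0 <= h x) ->
    integ (fun x => f i x * h x) -> (\int[P]_x (h (tnth x i))%:E = (IL (fun x => f i x * h x))%:E)%E.
  move=> mh h0 ih; have [_ fi _] := df i.
  rewrite (coupling_marginal i (phi := fun x => (h x)%:E) cP); last by move=> x; rewrite lee_fin.
    by rewrite (has_density_integral (Hf i) mh) ge0_Rintegral// => x; rewrite mulr_ge0.
  exact/measurable_EFinP.
have A0 := marg ord0 _ ms (@sqnorm_ge0 _ _) (f2 ord0).
have A1 := marg ord_max _ ms (@sqnorm_ge0 _ _) (f2 ord_max).
have mq M : measurable_fun setT (fun x : X => qform M x) by exact: measurable_qform.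
have Q0 := marg ord0 _ (mq (invmx C)) (fun x => qform_ge0 x Cp') iq0.
have Q1 := marg ord_max _ (mq C) (fun x => qform_ge0 x Cp) iq1.
pose I := (\int[P]_x (sqnorm (tsub (tnth x ord0) (tnth x ord_max)))%:E)%E.
have mI : measurable_fun setT (fun x : 2.-tuple X => (sqnorm (tsub (tnth x ord0) (tnth x ord_max)))%:E : \bar R).
  by apply/measurable_EFinP; apply: measurable_sqnorm; exact: measurable_tsub.
have I0 (x : 2.-tuple X) : (0 <= (sqnorm (tsub (tnth x ord0) (tnth x ord_max)))%:E :> \bar R)%E by rewrite lee_fin sqnorm_ge0.
have mh (h : X -> R) i : measurable_fun setT h -> measurable_fun setT (fun x : 2.-tuple X => (h (tnth x i))%:E : \bar R).
  by move=> mh; apply/measurable_EFinP; exact: measurableT_comp mh (mt i).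
have -> : (\int[P]_x (mm_cost lam x)%:E = l%:E * I)%E.
  rewrite /I -ge0_integralZl//; last by rewrite lee_fin ltW.
  by apply: eq_integral => x _; rewrite mm_cost2 EFinM.
rewrite EFinM lee_pmul2l ?lte_fin//.
(* Written without subtraction because [I] is not known to be finite. *)
suff : ((a0 + a1)%:E <= I + (q0 + q1)%:E)%E.
  by case: I => [r||] //; rewrite ?leey// -EFinD !lee_fin; lra.
rewrite !EFinD -A0 -A1 -Q0 -Q1 /I.
rewrite -!ge0_integralD//; first last.
all: try by move=> x _; rewrite ?adde_ge0 ?lee_fin ?sqnorm_ge0 ?qform_ge0.
all: try by exact: mh.
  by apply: emeasurable_funD; exact: mh.
apply: ge0_le_integral => //.
- by move=> x _; rewrite adde_ge0 ?lee_fin ?sqnorm_ge0.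
- by apply: emeasurable_funD; exact: mh.
- by apply: emeasurable_funD => //; apply: emeasurable_funD; exact: mh.
- move=> x _; rewrite -!EFinD lee_fin sqnorm_tsub.
  have := fenchel_young (tnth x ord0) (tnth x ord_max) Cp; lra.
Qed.

End two_marginals.

Theorem theorem4 (R : realType) (n d : nat) (hn : (2 <= n)%N)
  (mu : 'I_n -> probability (d.-tuple R) R) (lam : 'I_n -> R)
  (hP : forall i, in_P (mu i)) (hc : forall i, centered (mu i))
  (hlam : forall i, 0 < lam i) (hsum : \sum_(i < n) lam i = 1) :
  let lhs := ((2^-1)%:E * opt_cost mu lam)%E in
  let rhs := (\sum_(i < n) (lam i * (1 - lam i))%:E * relent (mu i))%E in
  (lhs <= rhs)%E /\
  (lhs = rhs <->
    if n == 2%N then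
      exists C : 'M[R]_d, posdef C /\
        forall i : 'I_n, is_gaussian (mu i) (if val i == 0%N then C else invmx C)
    else forall i : 'I_n, is_gaussian (mu i) 1%:M).
Proof.
move=> lhs rhs.
have /choice[f Hfr] : forall i, exists g, has_density (mu i) g /\ relent (mu i) = ent g.
  by move=> i; have [g Hg rg] := relent_ent (hP i).1; exists g.
have Hf i := (Hfr i).1; have rE i := (Hfr i).2.
have df i : density (f i) := (Hf i).1.
have f2 i : fin2 (f i) by exact: has_density_fin2 (Hf i) (hP i).2.
have cf i : centered_density (f i) by exact: has_density_centered (Hf i) (f2 i) (hc i).
have i0 : 'I_n by exact: Ordinal (ltnW hn).
have h2 : (0 < (2^-1)%:E :> \bar R)%E by rewrite lte_fin invr_gt0.
have lhs0 : (0 <= lhs)%E by apply: mule_ge0; [exact: ltW|exact: opt_cost_ge0].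
have lhsoo : (lhs < +oo)%E.
  have := opt_cost_lty hlam hsum Hf f2 cf i0; have := opt_cost_ge0 mu hlam; rewrite /lhs.
  by case: opt_cost => // r _ _; rewrite -EFinM ltry.
have lam_lt1 i : lam i < 1.
  have [j ji] : exists j : 'I_n, j != i.
    have : (0 < #|[set~ i]%SET|)%N by rewrite cardsC1 card_ord; case: (n) hn => [|[]].
    by move=> /card_gt0P[j]; rewrite !inE => ji; exists j.
  rewrite -hsum (bigD1 i)//= (bigD1 j)//= ltrDl ltr_pwDl//.
  by apply: sumr_ge0 => k _; exact: ltW.
have cpos i : 0 < lam i * (1 - lam i) by rewrite mulr_gt0 ?subr_gt0.
have term0 i : (0 <= (lam i * (1 - lam i))%:E * relent (mu i))%E.
  by rewrite rE mule_ge0 ?ent_ge0// lee_fin ltW.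
have rhs_fin : (forall i, ent (f i) < +oo)%E ->
    rhs = (\sum_i lam i * (1 - lam i) * \int[Leb d]_x klf (f i) x)%:E.
  move=> ef; rewrite -sumEFin; apply: eq_bigr => i _; rewrite rE [RHS]EFinM; congr (_ * _)%E.
  by rewrite fineK//; apply: integrable_fin_num => //; exact: ent_integrable.
(* All terms are nonnegative with positive coefficients, so a single infinite relative entropy makes
   the sum infinite. *)
have rhs_oo : rhs = +oo%E \/ forall i, (ent (f i) < +oo)%E.
  have [|/existsNP[i /negP]] := pselect (forall i, (ent (f i) < +oo)%E); first by right.
  rewrite -leNgt leye_eq => /eqP ei; left; rewrite /rhs (bigD1 i)//= rE ei gt0_muley ?lte_fin//.
  by rewrite addye// gt_eqF// (lt_le_trans ltNy0)// sume_ge0.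
(* The constant [c] lies between the two sides, so equality of the sides saturates the chain built
   from the source [i]. *)
have bound (ef : forall i, (ent (f i) < +oo)%E) i : exists2 c : R, (lhs <= c%:E <= rhs)%E &
    (2 < n)%N -> c%:E = rhs -> {ae Leb d, forall x, f i x = gam x}.
  have [c [oc cS rig]] := finite_entropy_bound hlam hsum Hf f2 cf i ef.
  exists (2^-1 * c); first by rewrite (rhs_fin ef) EFinM lee_pmul2l// oc lee_fin.
  by rewrite (rhs_fin ef) => n2 [] e; exact: rig.
have ent_of_eq : lhs = rhs -> forall i, (ent (f i) < +oo)%E.
  by move=> e; case: rhs_oo => // roo; move: lhsoo; rewrite e roo ltxx.
have le : (lhs <= rhs)%E.
  case: rhs_oo => [->|ef]; first exact: leey.
  by have [c /andP[h1 h2'] _] := bound ef i0; exact: le_trans h1 h2'.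
split=> //; case: eqVneq => [n2|n2]; last first.
  have n3 : (2 < n)%N by rewrite ltn_neqAle eq_sym n2.
  split=> [e i|g].
    have ef := ent_of_eq e; have [c /andP[c1 c2] rig] := bound ef i.
    apply: (is_gaussian_ae (Hf i)).
    have ce : c%:E = rhs by apply/eqP; rewrite eq_le c2 -e c1.
    by apply: filterS (rig n3 ce) => x ->; rewrite gauss_density1.
  apply/eqP; rewrite eq_le le /= /rhs big1// => i _.
  have [_ gi] := gaussian_ae (Hf i) (g i).
  rewrite rE (ent_gam (df i)) ?mule0//.
  by apply: filterS gi => x ->; rewrite gauss_density1.
clear i0; subst n.
split=> [e|[C [Cp gC]]].
  have ef := ent_of_eq e.
  have [|M [Mp e0 e1]] := gaussian_of_equality hlam Hf f2 cf ef.
    by rewrite -(rhs2E f hsum) -(rhs_fin ef).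
  (* [M] is the matrix of the map and the covariance of the second law, whereas the statement uses
     the covariance of the first. *)
  exists (invmx M); split; first exact: posdef_inv.
  move=> i; have [->|->] := ord2P i; rewrite /= ?invmxK.
    exact: (is_gaussian_ae (Hf _)).
  exact: (is_gaussian_ae (Hf _)).
have [ef le'] := equality_of_gaussian hlam Hf f2 Cp (gC ord0) (gC ord_max).
by apply/eqP; rewrite eq_le le /= (rhs_fin ef) (rhs2E f hsum).
Qed.
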